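(* (i) For $0\le p<1/2$ and $r=r_c(p)$, the DaC model is critical. (ii) For $p=1/2$ and every $r\in(0,1)$, the DaC model is critical. (iii) For $1/2<p\le 1$, the model is not critical: $\Theta(p,r)>0$ for all $r>0$.
   Context: DaC model on the square lattice: let $\mathbb{Z}^2$ have edge set $\mathcal{E}^2$ of nearest-neighbour pairs. Let $Y\in\{0,1\}^{\mathcal{E}^2}$ be i.i.d. Bernoulli($p$) edge states (1 = open), with law $\nu_p$. The $p$-clusters are the connected components of the graph on $\mathbb{Z}^2$ with only the open edges. Independently for each $p$-cluster, colour all its vertices black with probability $r$ and white with probability $1-r$; $\mathbb{P}_{p,r}$ is the joint law of edges and colours. Black clusters are maximal sets of black vertices connected by nearest-neighbour black paths. $\Theta(p,r)$ is the $\mathbb{P}_{p,r}$-probability that the origin lies in an infinite black cluster and $r_c(p)=\sup\{r:\Theta(p,r)=0\}$. For fixed $p,r$ the model is called critical if $\Theta(p,r)=0$ and $\mathbb{E}_{p,r}|C_0^r|=\infty$, where $C_0^r$ is the black cluster of the origin (empty if the origin is white) and $|\cdot|$ is cardinality. *)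

(* Defs.v *)
From HB Require Import structures.
From mathcomp Require Import all_boot all_order all_algebra.
From mathcomp Require Import all_classical all_reals all_analysis.
Set Implicit Arguments. Unset Strict Implicit. Unset Printing Implicit Defensive.
Import Order.TTheory GRing.Theory Num.Theory.
Local Open Scope classical_set_scope.
Local Open Scope ring_scope.

Definition vertex := (int * int)%type.
Definition origin : vertex := (0, 0).

(* Nearest-neighbour edges of Z^2: the edge (x, false) joins x and x + e1,
   the edge (x, true) joins x and x + e2.  This is a bijective encoding of E^2. *)
Definition edge := (vertex * bool)%type.
Definition edge_src (e : edge) : vertex := e.1.
Definition edge_dst (e : edge) : vertex :=
  if e.2 then (e.1.1, e.1.2 + 1) else (e.1.1 + 1, e.1.2).
Definition edge_joins (e : edge) (u v : vertex) : Prop :=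
  (edge_src e = u /\ edge_dst e = v) \/ (edge_src e = v /\ edge_dst e = u).

Definition nn_adj (u v : vertex) : Prop := exists e : edge, edge_joins e u v.

Inductive path_conn (adj : vertex -> vertex -> Prop) (u : vertex) : vertex -> Prop :=
| path_refl : path_conn adj u u
| path_step v w : path_conn adj u v -> adj v w -> path_conn adj u w.

Section DaC.
Context {R : realType} {d : measure_display} {Omega : measurableType d}.

Definition rindex := (edge + vertex)%type.

(* W (inl e) drives the state of edge e, W (inr v) drives the colour choice
   attached to vertex v.  Edge e is p-open iff W (inl e) w < p, so edge states
   are i.i.d. Bernoulli(p) when the W's are i.i.d. uniform on [0,1]. *)
Variable W : rindex -> Omega -> R.

Definition open_edge (p : R) (w : Omega) (e : edge) : Prop := W (inl e) w < p.

Definition open_adj (p : R) (w : Omega) (u v : vertex) : Prop :=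
  exists e : edge, edge_joins e u v /\ open_edge p w e.

Definition same_pcluster (p : R) (w : Omega) (u v : vertex) : Prop :=
  path_conn (open_adj p w) u v.

(* Each p-cluster is coloured using the uniform variable of its representative,
   the vertex of the cluster with least index in the fixed enumeration [pickle]
   of Z^2; distinct clusters have distinct representatives, so clusters are
   coloured independently, black with probability r. *)
Definition cluster_rep (p : R) (w : Omega) (v rep : vertex) : Prop :=
  same_pcluster p w v rep /\
  forall u, same_pcluster p w v u -> (pickle rep <= pickle u)%N.

Definition black (p r : R) (w : Omega) (v : vertex) : Prop :=
  exists rep, cluster_rep p w v rep /\ W (inr rep) w < r.

Definition black_adj (p r : R) (w : Omega) (u v : vertex) : Prop :=
  nn_adj u v /\ black p r w u /\ black p r w v.

Definition black_cluster0 (p r : R) (w : Omega) : set vertex :=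
  [set x | black p r w origin /\ path_conn (black_adj p r w) origin x].

Definition card0 (p r : R) (w : Omega) : \bar R :=
  (\esum_(x in black_cluster0 p r w) (1%:E : \bar R))%E.

Variable P : probability Omega R.

Definition Theta (p r : R) : \bar R :=
  P [set w | ~ finite_set (black_cluster0 p r w)].

Definition r_c (p : R) : R :=
  sup [set r : R | 0 <= r <= 1 /\ Theta p r = 0%E].

Definition critical (p r : R) : Prop :=
  Theta p r = 0%E /\ (\int[P]_w card0 p r w)%E = +oo%E.

End DaC.

Definition iid_uniform {R : realType} {d : measure_display} {Omega : measurableType d}
  (P : probability Omega R) (W : rindex -> Omega -> R) : Prop :=
  (forall i, measurable_fun setT (W i)) /\
  (forall i (t : R), P [set w | W i w <= t] = (Num.max 0 (Num.min t 1))%:E) /\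
  (forall (s : seq rindex) (B : rindex -> set R), uniq s ->
     (forall i, measurable (B i)) ->
     P (\bigcap_(i in [set` s]) (W i @^-1` B i)) =
       (\prod_(i <- s) P (W i @^-1` B i))%E).

(* Main.v *)
(** The colouring of the open clusters is positively associated: reveal, at every stage, the
    state of an edge or the colour at the smallest vertex whose cluster is not yet known; being
    the representative of its cluster, this vertex makes the colouring monotone in the revealed
    bit.

    For [p < 1/2] open clusters have exponential tails (through the functional [phi_p(S)] of
    Duminil-Copin and Tassion), so the colouring is also mixing and invariant under the
    symmetries of the lattice.  For such colourings percolation of black forces black circuits
    in annuli of infinitely many scales with probability close to 1.  On the other hand, if
    white (resp. black) crossings of an annulus at one scale are unlikely enough, then
    renormalization makes black percolate (resp. not percolate).  The hypothesis of this
    criterion is an open condition on [r].  Hence [Theta(p, r) > 0] persists for slightly smaller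
    [r], which gives [Theta(p, r_c) = 0]; and a finite mean cluster size at [r_c] would give
    [Theta = 0] slightly above [r_c].

    For [p = 1/2] neither the open edges nor their duals percolate, so the origin is surrounded
    by [k] distinct open clusters with high probability; a long black path from the origin makes
    all of them black, at cost [r ^ k].  The mean is infinite because the black cluster contains
    the open cluster of the origin, which has radius at least [n] with probability at least
    [1 / (2 (n + 1))].  For [p > 1/2] the same inclusion and percolation of open edges give
    [Theta > 0]. *)

Require Import Defs.
From HB Require Import structures.
From mathcomp Require Import all_boot all_order all_algebra.
From mathcomp Require Import all_classical all_reals all_analysis.
From mathcomp Require Import measurable_realfun zify ring lra.
Import Order.TTheory GRing.Theory Num.Theory.
Local Open Scope classical_set_scope.
Local Open Scope ring_scope.
Set Implicit Arguments. Unset Strict Implicit. Unset Printing Implicit Defensive.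

(** Percolation yields likely arms from a fixed box; the square root trick directs them to chosen
    parts of the sides of larger boxes. With boxes in ratio 7/4, paths in two larger boxes hook into
    a central one from both sides, and together they cross a rectangle that is longer than high. The
    arms must lie in one cluster, which a gluing event ensures. In a first pass this event is a
    fully black box, of small positive probability, so circuits have some positive probability at
    arbitrarily large scales. Mixing then produces one of them with probability close to 1, and
    since a circuit glues all arms through it, a second pass gives circuits of probability close to
    1. The argument is stated for an abstract [law] because it is used twice: for the colouring when
    p < 1/2, and for bond percolation at 1/2 drawn as a colouring of a refined lattice, where
    duality turns it into absence of percolation. The latter feeds both directions of the sharpness
    argument. *)

(** * Adjacency, and connection inside a set of vertices *)

Definition nn (u v : vertex) : Prop :=
  (u.1 = v.1 /\ (v.2 = u.2 + 1 \/ u.2 = v.2 + 1)) \/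
  (u.2 = v.2 /\ (v.1 = u.1 + 1 \/ u.1 = v.1 + 1)).

(* Reflexive: [star u u] holds. *)
Definition star (u v : vertex) : Prop :=
  (u.1 <= v.1 + 1 /\ v.1 <= u.1 + 1) /\ (u.2 <= v.2 + 1 /\ v.2 <= u.2 + 1).

Definition con (adj : vertex -> vertex -> Prop) (S : vertex -> Prop) u v :=
  S u /\ path_conn (fun a b => adj a b /\ S b) u v.

Lemma vtx_eq (u v : vertex) : u.1 = v.1 -> u.2 = v.2 -> u = v.
Proof. by case: u v => a b [c e] /= -> ->. Qed.

Lemma nn_sym u v : nn u v -> nn v u.
Proof. rewrite /nn; lia. Qed.

Lemma star_sym u v : star u v -> star v u.
Proof. rewrite /star; lia. Qed.

Lemma nn_star u v : nn u v -> star u v.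
Proof. rewrite /nn /star; lia. Qed.

Lemma nn_adjP u v : nn_adj u v <-> nn u v.
Proof.
split.
  by case=> -[[x y] b]; rewrite /edge_joins /edge_src /edge_dst /nn;
     case: b => /=; case=> -[<- <-] /=; lia.
rewrite /nn; case: u v => a b [c d] /=.
case=> -[<-] [->|->].
- by exists ((a, b), true); left.
- by exists ((a, d), true); right.
- by exists ((a, b), false); left.
- by exists ((c, b), false); right.
Qed.

Section Con.
Variables (adj : vertex -> vertex -> Prop) (S : vertex -> Prop).

Lemma con_refl u : S u -> con adj S u u.
Proof. by move=> Su; split=> //; exact: path_refl. Qed.

Lemma con_step u v w : con adj S u v -> adj v w -> S w -> con adj S u w.
Proof. by move=> [Su p] a Sw; split=> //; exact: (path_step p). Qed.

Lemma con_l u v : con adj S u v -> S u.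
Proof. by case. Qed.

Lemma con_r u v : con adj S u v -> S v.
Proof. by case=> Su; case=> // a b _ []. Qed.

Lemma con_ind u (Q : vertex -> Prop) : Q u ->
  (forall v w, con adj S u v -> Q v -> adj v w -> S w -> Q w) ->
  forall v, con adj S u v -> Q v.
Proof.
move=> Qu IH v [Su p]; elim: p => // a b p Qa [ab Sb].
by apply: (IH a) => //; split.
Qed.

Lemma con_trans u v w : con adj S u v -> con adj S v w -> con adj S u w.
Proof.
move=> uv; apply: con_ind => // a b _ ua ab Sb; exact: con_step ua ab Sb.
Qed.

Lemma con_cons u v w : S u -> adj u v -> con adj S v w -> con adj S u w.
Proof.
move=> Su uv vw; have Sv := con_l vw.
by apply: con_trans vw; apply: con_step uv Sv; exact: con_refl.
Qed.

Lemma con_sym : (forall a b, adj a b -> adj b a) ->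
  forall u v, con adj S u v -> con adj S v u.
Proof.
move=> sy u v uv; have Su := con_l uv; move: v uv.
apply: con_ind; first exact: con_refl.
by move=> v w uv vu vw Sw; apply: (con_cons Sw (sy _ _ vw)).
Qed.

End Con.

Lemma con_sub adj (S S' : vertex -> Prop) u v :
  (forall x, S x -> S' x) -> con adj S u v -> con adj S' u v.
Proof.
move=> sub uv; have Su := con_l uv; move: v uv.
apply: con_ind; first exact/con_refl/sub.
by move=> v w _ c vw /sub Sw; exact: con_step c vw Sw.
Qed.

Lemma con_adj (adj adj' : vertex -> vertex -> Prop) S u v :
  (forall x y, adj x y -> adj' x y) -> con adj S u v -> con adj' S u v.
Proof.
move=> sub uv; have Su := con_l uv; move: v uv.
apply: con_ind; first exact/con_refl.
by move=> v w _ c /sub vw Sw; exact: con_step c vw Sw.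
Qed.

Lemma con_self adj S a z : con adj S a z -> con adj (con adj S a) a z.
Proof.
move=> az; have Sa := con_l az; move: z az.
apply: con_ind; first exact/con_refl/con_refl.
by move=> v w av c vw Sw; apply: (con_step c vw); exact: con_step av vw Sw.
Qed.

Lemma con_comp adj S a u v : (forall a b, adj a b -> adj b a) ->
  con adj S a u -> con adj S a v -> con adj (con adj S a) u v.
Proof.
by move=> sy /con_self/(con_sym sy) ua /con_self av; exact: con_trans ua av.
Qed.

(** Discrete intermediate value: keep the part of the path after its last visit to level a, and stop
    it at the next visit to level b. Since [phi] changes by at most one per step, both levels are
    hit exactly. *)
Lemma con_trunc adj S (phi : vertex -> int) (a b : int) u v :
  (forall x y, adj x y -> phi x <= phi y + 1 /\ phi y <= phi x + 1) ->
  a <= b -> con adj S u v -> phi u <= a -> b <= phi v ->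
  exists u' v', [/\ phi u' = a, phi v' = b, con adj S u u' &
    con adj (fun x => S x /\ a <= phi x <= b) u' v'].
Proof.
move=> lip ab uv ua bv.
have [u' [pu' uu' u'v]] : exists u', [/\ phi u' = a, con adj S u u' &
    con adj (fun x => S x /\ a <= phi x) u' v].
  have Su := con_l uv.
  suff H : forall v, con adj S u v -> a <= phi v -> exists u', [/\ phi u' = a,
    con adj S u u' & con adj (fun x => S x /\ a <= phi x) u' v].
    by apply: H => //; lia.
  apply: con_ind.
    move=> au; exists u; split; [lia|exact: con_refl|exact: con_refl].
  move=> {bv uv}v w uv IH vw Sw aw.
  have [av|va] := leP a (phi v).
    have [u' [h1 h2 h3]] := IH av; exists u'; split=> //.
    exact: (con_step h3 vw).
  exists w; have := lip _ _ vw; split; [lia|exact: con_step uv vw Sw|exact: con_refl].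
exists u'.
suff [[vb c]|[v' [h1 h2]]] : (phi v <= b /\
   con adj (fun x => S x /\ a <= phi x <= b) u' v) \/
   (exists v', phi v' = b /\ con adj (fun x => S x /\ a <= phi x <= b) u' v').
- by exists v; split=> //; lia.
- by exists v'.
have [Su' _] := con_l u'v.
move: v u'v {uv bv}; apply: con_ind.
  left; split; first lia.
  by apply: con_refl; split=> //; lia.
move=> v w u'v [[vb c]|?] vw [Sw aw]; last by right.
have := lip _ _ vw => lvw.
have [e|ne] := eqVneq (phi v) b; first by right; exists v.
left; have wb : phi w <= b by lia.
by split=> //; apply: (con_step c vw); split=> //; lia.
Qed.

Lemma con_row (S : vertex -> Prop) (a b y : int) :
  a <= b -> (forall x, a <= x <= b -> S (x, y)) -> con nn S (a, y) (b, y).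
Proof.
move=> ab H.
have K : forall k : nat, a + k%:Z <= b -> con nn S (a, y) (a + k%:Z, y).
  elim=> [|k IH] kb; first by rewrite addr0; apply/con_refl/H; lia.
  apply: (con_step (IH _)); [lia| |by apply: H; lia].
  by right=> /=; split=> //; lia.
by have := K `|b - a|%N; rewrite (_ : a + _ = b) ?lexx; [exact|lia].
Qed.

Lemma con_col (S : vertex -> Prop) (a b x : int) :
  a <= b -> (forall y, a <= y <= b -> S (x, y)) -> con nn S (x, a) (x, b).
Proof.
move=> ab H.
have K : forall k : nat, a + k%:Z <= b -> con nn S (x, a) (x, a + k%:Z).
  elim=> [|k IH] kb; first by rewrite addr0; apply/con_refl/H; lia.
  apply: (con_step (IH _)); [lia| |by apply: H; lia].
  by left=> /=; split=> //; lia.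
by have := K `|b - a|%N; rewrite (_ : a + _ = b) ?lexx; [exact|lia].
Qed.

(** * Crossing paths meet *)

Ltac split_bool := repeat (match goal with
  | |- context [@eq_op _ ?a ?b] => case: (a =P b) => ? /=; try (exfalso; lia)
  | |- context [(?a < ?b)%O] => case: (ltP a b) => ? /=; try (exfalso; lia)
  | |- context [(?a <= ?b)%O] => case: (leP a b) => ? /=; try (exfalso; lia)
  end); try done.

Definition step_below (a b z : vertex) : bool :=
  [&& a.2 == b.2, (a.1 == z.1) && (b.1 == z.1 + 1) ||
                  (b.1 == z.1) && (a.1 == z.1 + 1) & a.2 < z.2].

Definition column_below (z z' w : vertex) : bool :=
  if z'.1 == z.1 + 1 then (w.1 == z'.1) && (w.2 < z'.2)
  else if z.1 == z'.1 + 1 then (w.1 == z.1) && (w.2 < z.2) else false.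

(* [N z] is the parity of the number of horizontal steps of the path passing
   below [z] and to its right; off the path it only changes at the endpoints. *)
Lemma path_parity (S : vertex -> Prop) u v : con nn S u v ->
  exists N : vertex -> bool, [/\
   forall z z', star z z' -> ~ S z -> ~ S z' ->
     N z (+) N z' = column_below z z' u (+) column_below z z' v,
   forall z : vertex, (forall s, S s -> z.2 <= s.2) -> N z = false &
   forall z : vertex, (forall s, S s -> s.2 <= z.2) -> ~ S z ->
     N z = (u.1 <= z.1) (+) (v.1 <= z.1)].
Proof.
move=> uv; have Su := con_l uv; move: v uv; apply: con_ind.
  by exists (fun=> false); split=> //= *; rewrite addbb.
move=> v w uv [N [H1 H2 H3]] vw Sw; have Sv := con_r uv.
exists (fun z => N z (+) step_below v w z); split.
- move=> z z' zz Sz Sz'; have := H1 _ _ zz Sz Sz'.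
  have d1 : z.1 <> v.1 \/ z.2 <> v.2.
    by apply: contrapT => /not_orP[/contrapT e /contrapT f]; apply: Sz; rewrite (vtx_eq e f).
  have d2 : z.1 <> w.1 \/ z.2 <> w.2.
    by apply: contrapT => /not_orP[/contrapT e /contrapT f]; apply: Sz; rewrite (vtx_eq e f).
  have d3 : z'.1 <> v.1 \/ z'.2 <> v.2.
    by apply: contrapT => /not_orP[/contrapT e /contrapT f]; apply: Sz'; rewrite (vtx_eq e f).
  have d4 : z'.1 <> w.1 \/ z'.2 <> w.2.
    by apply: contrapT => /not_orP[/contrapT e /contrapT f]; apply: Sz'; rewrite (vtx_eq e f).
  suff E : step_below v w z (+) step_below v w z' = column_below z z' v (+) column_below z z' w.
    move=> e; rewrite addbACA e E.
    by case: (column_below z z' u); case: (column_below z z' v); case: (column_below z z' w).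
  move: zz vw; rewrite /step_below /column_below /star /nn.
  clear -d1 d2 d3 d4 => -[[s1 s2] [s3 s4]].
  by case: (z'.1 =P z.1 + 1) => ?; case: (z.1 =P z'.1 + 1) => ? /=;
     case=> -[e [f|f]]; split_bool.
- move=> z Hz; rewrite H2 //= /step_below; have := Hz _ Sv; lia.
- move=> z Hz Sz; rewrite H3 // /step_below; have := Hz _ Sv; have := Hz _ Sw.
  have d1 : z.1 <> v.1 \/ z.2 <> v.2.
    by apply: contrapT => /not_orP[/contrapT e /contrapT f]; apply: Sz; rewrite (vtx_eq e f).
  have d2 : z.1 <> w.1 \/ z.2 <> w.2.
    by apply: contrapT => /not_orP[/contrapT e /contrapT f]; apply: Sz; rewrite (vtx_eq e f).
  clear -d1 d2 vw => h1 h2; case: vw => -[e [f|f]]; split_bool.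
Qed.

(** A path in T that avoids S keeps the parity of [path_parity] constant, up to a correction at v,
    but this parity differs between a point below the whole S-path and one above it. *)
Lemma crossing (S T : vertex -> Prop) u v z0 z1 :
  con nn S u v -> con star T z0 z1 ->
  (forall t, T t -> u.1 <= t.1 <= v.1) ->
  (forall s, S s -> z0.2 <= s.2 <= z1.2) -> exists s, S s /\ T s.
Proof.
move=> uv zz HT HS; apply: contrapT => no.
have dis t : T t -> ~ S t by move=> Tt St; apply: no; exists t.
have [N [H1 H2 H3]] := path_parity uv.
(* In the strip between the columns of u and v, the parity jumps along T only at steps entering or
   leaving the column of v above v; the extra bit cancels these jumps. *)
pose M z := N z (+) ((z.1 == v.1) && (v.2 < z.2)).
have Sv := con_r uv.
have E : M z0 = M z1.
  have Tz0 := con_l zz; have Tz1 := con_r zz; move: z1 zz Tz1 {HS H2 H3}.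
  apply: con_ind => // a b z0a IH ab Tb _.
  have Ta := con_r z0a; rewrite IH //.
  have := H1 _ _ ab (dis _ Ta) (dis _ Tb).
  have d1 : a.1 <> v.1 \/ a.2 <> v.2.
    by apply: contrapT => /not_orP[/contrapT e /contrapT f]; apply: (dis _ Ta); rewrite (vtx_eq e f).
  have d2 : b.1 <> v.1 \/ b.2 <> v.2.
    by apply: contrapT => /not_orP[/contrapT e /contrapT f]; apply: (dis _ Tb); rewrite (vtx_eq e f).
  have := HT _ Ta; have := HT _ Tb; rewrite /M; move: ab; rewrite /star /column_below.
  clear -d1 d2 => s1 h1 h2.
  case: (N a) => /=; case: (N b) => /=; split_bool.
move: E; rewrite /M H2 ?H3.
- have := HT _ (con_l zz); have := HT _ (con_r zz); have := HS _ Sv.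
  have d1 : z1.1 <> v.1 \/ z1.2 <> v.2.
    by apply: contrapT => /not_orP[/contrapT e /contrapT f];
       apply: (dis _ (con_r zz)); rewrite (vtx_eq e f).
  clear -d1 => h1 h2 h3; split_bool.
- by move=> s /HS; lia.
- exact/dis/(con_r zz).
- by move=> s /HS; lia.
Qed.

(** * Connectedness of boundaries *)

Lemma int_prim (a : int -> bool) :
  exists G : int -> bool, G 0 = false /\ forall k, G (k + 1) = G k (+) a k.
Proof.
pose P := fix P (n : nat) := if n is m.+1 then P m (+) a (Posz m) else false.
pose Q := fix Q (n : nat) := if n is m.+1 then Q m (+) a (Negz m) else false.
exists (fun k => match k with Posz n => P n | Negz n => Q n.+1 end); split=> //.
case=> [n|[|n]].
- by rewrite (_ : Posz n + 1 = Posz n.+1); [|lia].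
- by rewrite (_ : Negz 0 + 1 = Posz 0) //=; case: (a _).
- rewrite (_ : Negz n.+1 + 1 = Negz n); last by lia.
  by rewrite /= -addbA addbb addbF.
Qed.

Lemma int_ind_iff (Q : int -> Prop) : Q 0 -> (forall k, Q k <-> Q (k + 1)) -> forall k, Q k.
Proof.
move=> Q0 H; case=> n.
  elim: n => // n /(H _).1; by rewrite (_ : Posz n + 1 = Posz n.+1); [|lia].
elim: n => [|n IH]; first by apply/H; rewrite (_ : Negz 0 + 1 = 0).
by apply/H; rewrite (_ : Negz n.+1 + 1 = Negz n); [|lia].
Qed.

(** Discrete Poincare lemma modulo 2: an edge function whose sum around every unit square vanishes
    is a gradient. The potential is the integral along row 0, then along columns. *)
Lemma closed_exact (f : vertex -> vertex -> bool) : (forall u v, f u v = f v u) ->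
  (forall x y, f (x, y) (x + 1, y) (+) f (x + 1, y) (x + 1, y + 1)
     = f (x, y) (x, y + 1) (+) f (x, y + 1) (x + 1, y + 1)) ->
  exists g : vertex -> bool, forall u v, nn u v -> g v = g u (+) f u v.
Proof.
move=> fs cl.
have [G0 [_ HG0]] := int_prim (fun x => f (x, 0) (x + 1, 0)).
have [G1 HG1] := choice (fun x => int_prim (fun y => f (x, y) (x, y + 1))).
pose g (z : vertex) := G0 z.1 (+) G1 z.1 z.2.
have gv x y : g (x, y + 1) = g (x, y) (+) f (x, y) (x, y + 1).
  by rewrite /g /= (HG1 x).2 addbA.
have gh x y : g (x + 1, y) = g (x, y) (+) f (x, y) (x + 1, y).
  move: y; apply: int_ind_iff; first by rewrite /g /= !(HG1 _).1 HG0 !addbF.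
  move=> y; rewrite !gv; have := cl x y.
  by case: (g (x, y)); case: (g (x + 1, y)); case: (f (x, y) (x + 1, y));
     case: (f (x + 1, y) (x + 1, y + 1)); case: (f (x, y) (x, y + 1));
     case: (f (x, y + 1) (x + 1, y + 1)).
have K a b : a (+) b (+) b = a by case: a; case: b.
exists g => -[a b] [c d]; rewrite /nn /=.
by case=> -[<-] [->|->]; rewrite ?gv ?gh // fs K.
Qed.

(** Closedness, on one unit square with corners p, q, r, s, of the edge function used in
    [boundary_nn]; the letters t, e, a stand for membership in T, in D and in the component A. *)
Lemma square_parity (tp tq tr ts ep eq er es ap aq ar as_ : bool) :
  (ts -> ~~ es) -> (tr -> ~~ er) -> (tq -> ~~ eq) -> (tp -> ~~ ep) ->
  (er -> ~~ ts -> es) -> (es -> ~~ tp -> ep) ->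
  (er -> ~~ tq -> eq) -> (eq -> ~~ tp -> ep) ->
  (es -> ~~ tr -> er) -> (ep -> ~~ ts -> es) ->
  (eq -> ~~ tr -> er) -> (ep -> ~~ tq -> eq) ->
  (tp || tq || tr || ts -> es -> er -> as_ = ar) ->
  (tp || tq || tr || ts -> ep -> es -> ap = as_) ->
  (tp || tq || tr || ts -> eq -> er -> aq = ar) ->
  (tp || tq || tr || ts -> ep -> eq -> ap = aq) ->
  tp && eq && aq || tq && ep && ap (+) (tq && er && ar || tr && eq && aq) =
  tp && es && as_ || ts && ep && ap (+) (ts && er && ar || tr && es && as_).
Proof.
have imp (a b : bool) : (a -> b) -> a ==> b by case: a => // ->.
have imp2 (a b c : bool) : (a -> b -> c) -> a && b ==> c by case: a; case: b => // ->.
have imp3 (a b c : bool) (x y : bool) : (a -> b -> c -> x = y) -> [&& a, b & c] ==> (x == y).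
  by case: a; case: b; case: c => // H; rewrite (H isT isT isT) eqxx.
move=> /imp + /imp + /imp + /imp + /imp2 + /imp2 + /imp2 + /imp2 + /imp2 + /imp2 + /imp2 +
  /imp2 + /imp3 + /imp3 + /imp3 + /imp3.
case: tp; case: tq; case: tr; case: ts; case: ep; case: eq => //=; case: er => //=;
 case: es => //=; case: ap => //=; case: aq => //=; case: ar => //=; case: as_ => //=.
Qed.

Section Boundary.
Variables (D : vertex -> Prop).
Hypothesis Dcon : forall d d', D d -> D d' -> con nn D d d'.

(** Let A be the star-component of d0 in the boundary and let f mark the edges between C and D whose
    end in D lies in A. On a unit square the boundary sites are pairwise star-adjacent, hence all in
    A or all outside, and the edges between C and D are even in number; so f is a gradient. Its
    potential is constant on C and on D, so f agrees on the two given edges. *)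
Lemma boundary_star (C : vertex -> Prop) c0 d0 c1 d1 :
  (forall c c', C c -> C c' -> con nn C c c') ->
  (forall d z, D d -> nn d z -> ~ C z -> D z) -> (forall z, C z -> ~ D z) ->
  C c0 -> D d0 -> nn c0 d0 -> C c1 -> D d1 -> nn c1 d1 ->
  con star (fun d => D d /\ exists c, C c /\ nn c d) d0 d1.
Proof.
move=> Ccon Dcl dis C0 D0 n0 C1 D1 n1; pose Bd d := D d /\ exists c, C c /\ nn c d.
pose A := con star Bd d0.
pose f u v := `[< (C u /\ D v /\ A v) \/ (C v /\ D u /\ A u) >].
have fs u v : f u v = f v u by apply/asboolP/asboolP; tauto.
have [g Hg] : exists g : vertex -> bool, forall u v, nn u v -> g v = g u (+) f u v.
  apply: closed_exact => // x y.
  pose sq (z : vertex) := (x <= z.1 <= x + 1) && (y <= z.2 <= y + 1).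
  pose al := `[< exists d, sq d /\ Bd d /\ A d >].
  have E a b : sq a -> sq b -> nn a b -> f a b = al && (`[< D a >] (+) `[< D b >]).
    have E1 a' b' : sq a' -> sq b' -> nn a' b' -> C a' -> D b' ->
       f a' b' = al && (`[< D a' >] (+) `[< D b' >]).
      move=> sa sb ab Ca Db; rewrite (asboolF (dis _ Ca)) (asboolT Db) addFb andbT.
      have Bb : Bd b' by split=> //; exists a'.
      apply/asboolP/asboolP.
        case=> [[_ [_ Ab]]|[Cb _]]; last by case: (dis _ Cb).
        by exists b'.
      case=> d [sd [_ Ad]]; left; split=> //; split=> //.
      apply: (con_step Ad) => //; move: sd sb; rewrite /sq /star; lia.
    move=> sa sb ab.
    have [Da|nDa] := pselect (D a); have [Db|nDb] := pselect (D b).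
    - rewrite (asboolT Da) (asboolT Db) andbF; apply/asboolP; case.
        by case=> /dis.
      by case=> /dis.
    - have Cb : C b by apply: contrapT => nCb; apply/nDb/(Dcl a).
      by rewrite fs addbC; apply: E1 => //; exact: nn_sym.
    - have Ca : C a by apply: contrapT => nCa; apply/nDa/(Dcl b) => //; exact: nn_sym.
      exact: E1.
    - rewrite (asboolF nDa) (asboolF nDb) andbF; apply/asboolP; tauto.
  rewrite !E; try by rewrite /sq /nn /=; lia.
have gC c c' : C c -> C c' -> g c = g c'.
  move=> Cc Cc'; have := Ccon _ _ Cc Cc'; move: c' {Cc'}; apply: con_ind => // a b ca IH ab Cb.
  have f0 : f a b = false.
    apply: asboolF; move=> [[_ [Db _]]|[_ [Da _]]]; first exact: dis Cb Db.
    exact: dis (con_r ca) Da.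
  by rewrite (Hg _ _ ab) IH f0 addbF.
have gD d d' : D d -> D d' -> g d = g d'.
  move=> Dd Dd'; have := Dcon Dd Dd'; move: d' {Dd'}; apply: con_ind => // a b ca IH ab Db.
  have f0 : f a b = false.
    apply: asboolF; move=> [[Ca _]|[Cb _]]; last exact: dis Cb Db.
    exact: dis Ca (con_r ca).
  by rewrite (Hg _ _ ab) IH f0 addbF.
have : f c1 d1 = f c0 d0.
  by have := Hg _ _ n0; have := Hg _ _ n1; rewrite (gC _ _ C1 C0) (gD _ _ D1 D0) => -> /addbI.
rewrite [RHS]asboolT; last first.
  left; split=> //; split=> //; apply: con_refl; split=> //; by exists c0.
by move/asboolP => [[_ [_ //]]|[/dis]].
Qed.

(** Same cohomological argument with the two adjacencies exchanged. A diagonal step inside T does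
    not change the potential, because both of its ends see a common neighbour through the same value
    of f. *)
Lemma boundary_nn (T : vertex -> Prop) t0 d0 t1 d1 :
  (forall t t', T t -> T t' -> con star T t t') ->
  (forall d z, D d -> nn d z -> ~ T z -> D z) -> (forall z, T z -> ~ D z) ->
  T t0 -> D d0 -> nn t0 d0 -> T t1 -> D d1 -> nn t1 d1 ->
  con nn (fun d => D d /\ exists t, T t /\ star t d) d0 d1.
Proof.
move=> Tcon Dcl dis T0 D0 n0 T1 D1 n1; pose Bd d := D d /\ exists t, T t /\ star t d.
pose A := con nn Bd d0.
pose t z := `[< T z >]. pose e z := `[< D z >]. pose a z := `[< A z >].
pose f u v := (t u && e v && a v) || (t v && e u && a u).
have fs u v : f u v = f v u by rewrite /f orbC.
have dse z : t z -> ~~ e z by move=> /asboolP/dis ?; apply/asboolPn.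
have cle u v : nn u v -> e u -> ~~ t v -> e v.
  by move=> uv /asboolP Du /asboolPn Tv; apply/asboolP/(Dcl u).
have aE u v s : nn u v -> star s u -> star s v -> t s -> e u -> e v -> a u = a v.
  move=> uv su sv /asboolP Ts /asboolP Du /asboolP Dv.
  have Bu : Bd u by split=> //; exists s.
  have Bv : Bd v by split=> //; exists s.
  apply/asboolP/asboolP => K; [exact: con_step K uv Bv|].
  exact: con_step K (nn_sym uv) Bu.
have [g Hg] : exists g : vertex -> bool, forall u v, nn u v -> g v = g u (+) f u v.
  apply: closed_exact => // x y.
  set p := (x, y); set q := (x + 1, y); set r := (x + 1, y + 1); set s := (x, y + 1).
  have pq : nn p q by right => /=; lia.
  have qr : nn q r by left => /=; lia.
  have ps : nn p s by left => /=; lia.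
  have sr : nn s r by right => /=; lia.
  have st1 u v : u \in [:: p; q; r; s] -> v \in [:: p; q; r; s] -> star u v.
    by rewrite !inE => /or4P[]/eqP-> /or4P[]/eqP->; rewrite /star /=; lia.
  have aEs u v : u \in [:: p; q; r; s] -> v \in [:: p; q; r; s] -> nn u v ->
     t p || t q || t r || t s -> e u -> e v -> a u = a v.
    move=> iu iv uv; case/orP => [/orP[/orP[]|]|] tt; apply: aE tt => //;
      by apply: st1 => //; rewrite !inE eqxx ?orbT.
  have ip : p \in [:: p; q; r; s] by rewrite !in_cons eqxx.
  have iq : q \in [:: p; q; r; s] by rewrite !in_cons eqxx !orbT.
  have ir : r \in [:: p; q; r; s] by rewrite !in_cons eqxx !orbT.
  have is_ : s \in [:: p; q; r; s] by rewrite !in_cons eqxx !orbT.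
  have := aEs _ _ ip iq pq; have := aEs _ _ iq ir qr.
  have := aEs _ _ ip is_ ps; have := aEs _ _ is_ ir sr.
  have := cle _ _ pq; have := cle _ _ qr; have := cle _ _ ps; have := cle _ _ sr.
  have := cle _ _ (nn_sym pq); have := cle _ _ (nn_sym qr).
  have := cle _ _ (nn_sym ps); have := cle _ _ (nn_sym sr).
  have := dse p; have := dse q; have := dse r; have := dse s.
  exact: square_parity.
have gT c c' : T c -> T c' -> g c = g c'.
  move=> Cc Cc'; have := Tcon _ _ Cc Cc'; move: c' {Cc'}; apply: con_ind => // u v ca IH uv Tv.
  have Tu := con_r ca; rewrite IH.
  have tu : t u by apply/asboolP. have tv : t v by apply/asboolP.
  have f0 : f u v = false by rewrite /f (negbTE (dse _ tu)) (negbTE (dse _ tv)) !andbF.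
  have [[e1 e2]|[Nuv|[w [wu wv]]]] : (u.1 = v.1 /\ u.2 = v.2) \/ (nn u v \/ exists w, nn u w /\ nn v w).
  - have [e1|e1] := eqVneq u.1 v.1; have [e2|e2] := eqVneq u.2 v.2; first by left.
    + by right; left; move: uv; rewrite /star /nn; lia.
    + by right; left; move: uv; rewrite /star /nn; lia.
    + right; right; exists (u.1, v.2); move: uv; rewrite /star /nn /=; lia.
  - by rewrite (vtx_eq e1 e2).
  - by rewrite (Hg _ _ Nuv) f0 addbF.
  - have := Hg _ _ wu; rewrite (Hg _ _ wv) /f tu tv (negbTE (dse _ tu)) (negbTE (dse _ tv)) /= !andbF !orbF.
    by move/addIb.
have gD d d' : D d -> D d' -> g d = g d'.
  move=> Dd Dd'; have := Dcon Dd Dd'; move: d' {Dd'}; apply: con_ind => // u v ca IH uv Db.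
  rewrite (Hg _ _ uv) IH /f.
  have /asboolF tu : ~ T u by move/dis; apply; exact: con_r ca.
  have /asboolF tv : ~ T v by move/dis; apply.
  by rewrite /t tu tv addbF.
have : f t1 d1 = f t0 d0.
  by have := Hg _ _ n0; have := Hg _ _ n1; rewrite (gT _ _ T1 T0) (gD _ _ D1 D0) => -> /addbI.
have -> : f t0 d0 = true.
  have Ad0 : A d0 by apply: con_refl; split=> //; exists t0; split=> //; exact: nn_star.
  by rewrite /f /t /e /a (asboolT T0) (asboolT D0) (asboolT Ad0).
rewrite /f (negbTE (dse t1 _)) ?andbF ?orbF; last exact/asboolP.
by move=> /andP[_ /asboolP].
Qed.

End Boundary.

Definition in_rect (x0 x1 y0 y1 : int) (z : vertex) : bool :=
  (x0 <= z.1 <= x1) && (y0 <= z.2 <= y1).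

Definition hcross adj (S : vertex -> Prop) x0 x1 y0 y1 : Prop := exists u v,
  [/\ u.1 = x0, v.1 = x1 & con adj (fun z => S z /\ in_rect x0 x1 y0 y1 z) u v].

Definition vcross adj (S : vertex -> Prop) x0 x1 y0 y1 : Prop := exists u v,
  [/\ u.2 = y0, v.2 = y1 & con adj (fun z => S z /\ in_rect x0 x1 y0 y1 z) u v].

Lemma nn_lip1 x y : nn x y -> x.1 <= y.1 + 1 /\ y.1 <= x.1 + 1.
Proof. rewrite /nn; lia. Qed.
Lemma star_lip1 x y : star x y -> x.1 <= y.1 + 1 /\ y.1 <= x.1 + 1.
Proof. rewrite /star; lia. Qed.
Lemma star_lip2 x y : star x y -> x.2 <= y.2 + 1 /\ y.2 <= x.2 + 1.
Proof. rewrite /star; lia. Qed.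

(** C is the cluster of the left half-plane through S, and D the component of its complement on the
    right. If C misses the right side, the part of D next to C is star-connected, and within the
    rows of the rectangle it consists of sites of the rectangle outside S. *)
Lemma hex (S : vertex -> Prop) (x0 x1 y0 y1 : int) : x0 <= x1 -> y0 <= y1 ->
  hcross nn S x0 x1 y0 y1 \/ vcross star (fun z => ~ S z) x0 x1 y0 y1.
Proof.
move=> lx ly.
pose bl (z : vertex) := z.1 < x0 \/ (in_rect x0 x1 y0 y1 z /\ S z).
pose C := con nn bl (x0 - 1, y0).
have [[z [Cz zx]]|noC] := pselect (exists z, C z /\ z.1 = x1).
  left; have [] := con_trunc (phi := fun z : vertex => z.1) nn_lip1 lx Cz.
  - by rewrite /=; lia.
  - by rewrite zx.
  move=> u' [v' [e1 e2 _ c]]; exists u', v'; split=> //; apply: con_sub c.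
  by move=> w [[h|[rw Sw]] hx] //; lia.
right.
have Clt z : C z -> z.1 < x1.
  move=> Cz; rewrite ltNge; apply/negP => x1z; apply: noC.
  have [] := con_trunc (phi := fun z : vertex => z.1) (a := x1) (b := x1) nn_lip1 _ Cz; rewrite /=.
  - by rewrite lexx.
  - by lia.
  - by [].
  by move=> u' [v' [e1 _ c _]]; exists u'.
pose D := con nn (fun z => ~ C z) (x1, y0).
have Cleft (z : vertex) : z.1 < x0 -> C z.
  move=> zx; apply: (@con_trans _ _ _ (x0 - 1, z.2)).
    have [h|h] := leP z.2 y0.
      by apply: con_sym; [exact: nn_sym|apply: con_col => // y ?; left => /=; lia].
    by apply: con_col; [lia|move=> y ?; left => /=; lia].
  apply: con_sym; first exact: nn_sym.
  case: z zx => a b /= zx; apply: con_row; [lia|move=> x ?; left => /=; lia].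
have nright z : x1 <= z.1 -> ~ C z by move=> h /Clt; rewrite ltNge h.
have nC (z : vertex) : x0 <= z.1 -> ~~ (y0 <= z.2 <= y1) -> ~ C z.
  move=> h1 h2 /con_r [|[]]; first by lia.
  by rewrite /in_rect; lia.
have Dr z : x1 <= z.1 -> z.1 = x1 -> D z.
  move=> _; case: z => a b /= ->.
  have [h|h] := leP y0 b.
    by apply: con_col => // y ?; apply: nright => /=.
  apply: con_sym; first exact: nn_sym.
  by apply: con_col; [lia|move=> y ?; apply: nright => /=].
have Drow y : ~~ (y0 <= y <= y1) -> D (x0, y).
  move=> hy; apply: con_trans (Dr (x1, y) _ _) _ => //=.
  apply: con_sym; first exact: nn_sym.
  apply: con_row => // x hx; apply: nC => //=; lia.
(* The two boundary pairs lie in the rows just below and just above the rectangle, so the boundary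
   path spans its full height. *)
have := @boundary_star D _ C (x0 - 1, y0 - 1) (x0, y0 - 1) (x0 - 1, y1 + 1) (x0, y1 + 1).
case.
- by move=> d d' Dd Dd'; exact: con_comp nn_sym Dd Dd'.
- by move=> d d' Dd Dd'; exact: con_comp nn_sym Dd Dd'.
- by move=> d z Dd dz Cz; apply: con_step Dd dz Cz.
- by move=> z Cz /con_r.
- by apply: Cleft => /=; lia.
- by apply: Drow; lia.
- by right => /=; lia.
- by apply: Cleft => /=; lia.
- by apply: Drow; lia.
- by right => /=; lia.
move=> Bd0 pth; have {}pth := conj Bd0 pth.
have [] := con_trunc (phi := fun z : vertex => z.2) star_lip2 ly pth.
- by rewrite /=; lia.
- by rewrite /=; lia.
move=> u [v [e1 e2 _ c]]; exists u, v; split=> //; apply: con_sub c.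
move=> w [[Dw [c [Cc cw]]] wy]; have nCw := con_r Dw.
have nb : ~ bl w by move=> bw; apply/nCw/(con_step Cc cw bw).
have w0 : x0 <= w.1 by rewrite leNgt; apply/negP => h; apply: nb; left.
have rw : in_rect x0 x1 y0 y1 w.
  have := Clt _ Cc; move: cw; rewrite /nn /in_rect; lia.
by split=> // Sw; apply: nb; right.
Qed.

(** * Boxes, annuli and circuits *)

Definition nrm (z : vertex) : int := Num.max `|z.1| `|z.2|.
Definition box (n : int) (z : vertex) : bool := nrm z <= n.

Lemma boxE n z : box n z = in_rect (- n) n (- n) n z.
Proof. rewrite /box /nrm /in_rect; lia. Qed.

Lemma star_nrm x y : star x y -> nrm x <= nrm y + 1 /\ nrm y <= nrm x + 1.
Proof. rewrite /star /nrm; lia. Qed.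

Lemma con_map adj (S : vertex -> Prop) (f : vertex -> vertex) u v :
  (forall a b, adj a b -> adj (f a) (f b)) ->
  con adj (fun z => S (f z)) u v -> con adj S (f u) (f v).
Proof.
move=> fa uv; have Su := con_l uv; move: v uv; apply: con_ind; first exact: con_refl.
by move=> a b _ c ab Sb; apply: con_step c (fa _ _ ab) Sb.
Qed.

Definition swap (z : vertex) : vertex := (z.2, z.1).
Definition flipy (z : vertex) : vertex := (z.1, - z.2).
Definition shift (c z : vertex) : vertex := (c.1 + z.1, c.2 + z.2).

Lemma swapK : involutive swap. Proof. by case. Qed.
Lemma flipyK : involutive flipy. Proof. by case=> a b; rewrite /flipy /= opprK. Qed.
Lemma swap_nn a b : nn a b -> nn (swap a) (swap b). Proof. rewrite /nn /=; lia. Qed.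
Lemma flipy_nn a b : nn a b -> nn (flipy a) (flipy b). Proof. rewrite /nn /=; lia. Qed.
Lemma shift_nn c a b : nn a b -> nn (shift c a) (shift c b). Proof. rewrite /nn /=; lia. Qed.
Lemma swap_star a b : star a b -> star (swap a) (swap b). Proof. rewrite /star /=; lia. Qed.
Lemma con_swap adj (S : vertex -> Prop) u v : (forall a b, adj a b -> adj (swap a) (swap b)) ->
  con adj S u v -> con adj (fun z => S (swap z)) (swap u) (swap v).
Proof.
by move=> h c; apply: (con_map (f := swap)) => //; apply: con_sub c => z; rewrite swapK.
Qed.

Lemma crossing_v (S T : vertex -> Prop) u v z0 z1 :
  con nn S u v -> con star T z0 z1 ->
  (forall t, T t -> u.2 <= t.2 <= v.2) ->
  (forall s, S s -> z0.1 <= s.1 <= z1.1) -> exists s, S s /\ T s.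
Proof.
move=> /(con_swap swap_nn) c /(con_swap swap_star) d hT hS.
have [] := crossing c d; first by move=> t /hT.
  by move=> s /hS.
by move=> s [? ?]; exists (swap s).
Qed.

Section Cross.
Variables (adj : vertex -> vertex -> Prop).
Hypothesis adj_star : forall a b, adj a b -> star a b.
Variable S : vertex -> Prop.

Lemma adj_lip1 x y : adj x y -> x.1 <= y.1 + 1 /\ y.1 <= x.1 + 1.
Proof. by move/adj_star/star_lip1. Qed.
Lemma adj_lip2 x y : adj x y -> x.2 <= y.2 + 1 /\ y.2 <= x.2 + 1.
Proof. by move/adj_star/star_lip2. Qed.

Lemma hcross_sub x0 x1 y0 y1 a b c d : x0 <= a -> a <= b -> b <= x1 -> c <= y0 -> y1 <= d ->
  hcross adj S x0 x1 y0 y1 -> hcross adj S a b c d.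
Proof.
move=> xa ab bx cy yd [u [v [ux vx uv]]].
have [] := con_trunc (phi := fun z : vertex => z.1) adj_lip1 ab uv.
- by rewrite ux.
- by rewrite vx.
move=> u' [v' [e1 e2 _ k]]; exists u', v'; split=> //; apply: con_sub k => z.
by move=> [[Sz rz] h]; split=> //; move: rz; rewrite /in_rect; lia.
Qed.

Lemma vcross_sub x0 x1 y0 y1 a b c d : a <= x0 -> x1 <= b -> y0 <= c -> c <= d -> d <= y1 ->
  vcross adj S x0 x1 y0 y1 -> vcross adj S a b c d.
Proof.
move=> xa bx cy yd dy [u [v [ux vx uv]]].
have [] := con_trunc (phi := fun z : vertex => z.2) adj_lip2 yd uv.
- by rewrite ux.
- by rewrite vx.
move=> u' [v' [e1 e2 _ k]]; exists u', v'; split=> //; apply: con_sub k => z.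
by move=> [[Sz rz] h]; split=> //; move: rz; rewrite /in_rect; lia.
Qed.

(** After truncation the path stays between norms n and m; the side of the large box on which it
    ends tells which of the four rectangles of the annulus it traverses from its inner to its outer
    side. *)
Lemma leave_annulus (n m : int) u v : 0 <= n -> n <= m -> con adj S u v -> box n u -> m <= nrm v ->
  exists u' v', [/\ con adj S u u',
    con adj (fun z => S z /\ box m z) u' v' &
   [\/ con adj (fun z => S z /\ in_rect (- m) m n m z) u' v' /\ u'.2 = n /\ v'.2 = m,
       con adj (fun z => S z /\ in_rect (- m) m (- m) (- n) z) u' v' /\ u'.2 = - n /\ v'.2 = - m,
       con adj (fun z => S z /\ in_rect n m (- m) m z) u' v' /\ u'.1 = n /\ v'.1 = m |
       con adj (fun z => S z /\ in_rect (- m) (- n) (- m) m z) u' v' /\ u'.1 = - n /\ v'.1 = - m]].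
Proof.
move=> n0 nm uv un mv.
have lip x y : adj x y -> nrm x <= nrm y + 1 /\ nrm y <= nrm x + 1 by move/adj_star/star_nrm.
have [p [q [e1 e2 up pq]]] := con_trunc lip nm uv un mv.
suff H (phi : vertex -> int) (Q : vertex -> bool) :
   (forall x y, adj x y -> phi x <= phi y + 1 /\ phi y <= phi x + 1) ->
   (forall z, phi z <= nrm z) -> (forall z, nrm z <= m -> n <= phi z <= m -> Q z) ->
   phi q = m -> exists u' v', [/\ con adj S u u', con adj (fun z => S z /\ box m z) u' v' &
     con adj (fun z => S z /\ Q z) u' v' /\ phi u' = n /\ phi v' = m].
  have [h|[h|[h|h]]] : q.2 = m \/ - q.2 = m \/ q.1 = m \/ - q.1 = m by move: e2; rewrite /nrm; lia.
  - have [||||u' [v' [h1 h2 [h3 h4]]]] := H (fun z : vertex => z.2) (in_rect (- m) m n m).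
    + exact: adj_lip2.
    + by move=> z; rewrite /nrm; lia.
    + by move=> z; rewrite /nrm /in_rect; lia.
    + by [].
    by exists u', v'; split=> //; apply: Or41.
  - have [||||u' [v' [h1 h2 [h3 h4]]]] := H (fun z : vertex => - z.2) (in_rect (- m) m (- m) (- n)).
    + by move=> x y /adj_lip2; lia.
    + by move=> z; rewrite /nrm; lia.
    + by move=> z; rewrite /nrm /in_rect; lia.
    + by [].
    by exists u', v'; split=> //; apply: Or42; split=> //; lia.
  - have [||||u' [v' [h1 h2 [h3 h4]]]] := H (fun z : vertex => z.1) (in_rect n m (- m) m).
    + exact: adj_lip1.
    + by move=> z; rewrite /nrm; lia.
    + by move=> z; rewrite /nrm /in_rect; lia.
    + by [].
    by exists u', v'; split=> //; apply: Or43.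
  - have [||||u' [v' [h1 h2 [h3 h4]]]] := H (fun z : vertex => - z.1) (in_rect (- m) (- n) (- m) m).
    + by move=> x y /adj_lip1; lia.
    + by move=> z; rewrite /nrm; lia.
    + by move=> z; rewrite /nrm /in_rect; lia.
    + by [].
    by exists u', v'; split=> //; apply: Or44; split=> //; lia.
move=> plip pn pQ pq'.
have [||u' [v' [h1 h2 h3 h4]]] := con_trunc plip nm pq; first by rewrite -e1 pn.
  by rewrite pq'.
exists u', v'; split.
- by apply: con_trans up _; apply: con_sub h3 => z [].
- by apply: con_sub h4 => z [[Sz hz] _]; split=> //; rewrite /box; lia.
- split=> //; apply: con_sub h4 => z [[Sz hz] k]; split=> //; apply: pQ => //; lia.
Qed.

End Cross.

(** Lengthwise crossings of the four overlapping rectangles of the annulus between n and 3n.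
    Neighbouring crossings meet in the corners, so this encodes a circuit without defining closed
    paths. *)
Definition circ (n : int) (S : vertex -> Prop) : Prop :=
  (hcross nn S (- (3 * n)) (3 * n) n (3 * n) /\ hcross nn S (- (3 * n)) (3 * n) (- (3 * n)) (- n)) /\
  (vcross nn S n (3 * n) (- (3 * n)) (3 * n) /\ vcross nn S (- (3 * n)) (- n) (- (3 * n)) (3 * n)).

Lemma hv_meet (A B : vertex -> Prop) u v w w' :
  con nn A u v -> con nn B w w' -> (forall t, B t -> u.1 <= t.1 <= v.1) ->
  (forall s, A s -> w.2 <= s.2 <= w'.2) -> exists s, con nn A u s /\ con nn B w s.
Proof.
move=> /con_self cA /con_self cB hB hA.
have [|||s [h1 h2]] := @crossing (con nn A u) (con nn B w) u v w w' cA.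
- by apply: con_adj cB; exact: nn_star.
- by move=> t /con_r/hB.
- by move=> s /con_r/hA.
by exists s.
Qed.

Lemma circ_blocks (n : int) (S T : vertex -> Prop) u v : 0 <= n -> circ n S -> con star T u v ->
  box n u -> 3 * n <= nrm v -> exists s, S s /\ T s.
Proof.
move=> n0 [[[a [a' [ea ea' ca]]] [b [b' [eb eb' cb]]]] [[c [c' [ec ec' cc]]] [d [d' [ed ed' cd]]]]] uv un mv.
have nm : n <= 3 * n by lia.
have [u' [v' [_ _]]] := leave_annulus (fun _ _ h => h) n0 nm uv un mv.
case=> -[k [e1 e2]].
- have [||s [[? _] [? _]]] := crossing ca k; last by exists s.
    by move=> t []; rewrite /in_rect; lia.
  by move=> t []; rewrite /in_rect; lia.
- have [||s [[? _] [? _]]] := crossing cb (con_sym star_sym k); last by exists s.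
    by move=> t []; rewrite /in_rect; lia.
  by move=> t []; rewrite /in_rect; lia.
- have [||s [[? _] [? _]]] := crossing_v cc k; last by exists s.
    by move=> t []; rewrite /in_rect; lia.
  by move=> t []; rewrite /in_rect; lia.
- have [||s [[? _] [? _]]] := crossing_v cd (con_sym star_sym k); last by exists s.
    by move=> t []; rewrite /in_rect; lia.
  by move=> t []; rewrite /in_rect; lia.
Qed.

(** Every path through the annulus meets one of the four crossings, and these are joined to each
    other; the hub is the left end of the top crossing, independent of the path and of the region
    Q. *)
Lemma circ_hub (n : int) (S : vertex -> Prop) : 0 <= n -> circ n S ->
  exists p, forall (Q : vertex -> Prop) u v, (forall z, box (3 * n) z -> Q z) ->
    con nn (fun z => S z /\ Q z) u v -> box n u -> 3 * n <= nrm v ->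
    con nn (fun z => S z /\ Q z) p v.
Proof.
move=> n0 [[[a [a' [ea ea' ca]]] [b [b' [eb eb' cb]]]] [[c [c' [ec ec' cc]]] [d [d' [ed ed' cd]]]]].
exists a => Q u v bQ uv un mv.
have nm : n <= 3 * n by lia.
pose SQ z := S z /\ Q z.
have inc (x0 x1 y0 y1 : int) p q : - (3 * n) <= x0 -> x1 <= 3 * n -> - (3 * n) <= y0 -> y1 <= 3 * n ->
  con nn (fun z => S z /\ in_rect x0 x1 y0 y1 z) p q -> con nn SQ p q.
  move=> ? ? ? ?; apply: con_sub => z [Sz rz]; split=> //; apply: bQ; move: rz.
  by rewrite boxE /in_rect; lia.
have ac : con nn SQ a c.
  have [||s [h1 h2]] := hv_meet ca cc.
  - by move=> t []; rewrite /in_rect; lia.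
  - by move=> t []; rewrite /in_rect; lia.
  apply: con_trans (_ : con nn SQ a s) _; first by apply: inc h1; lia.
  by apply: con_sym; [exact: nn_sym|apply: inc h2; lia].
have ad : con nn SQ a d.
  have [||s [h1 h2]] := hv_meet ca cd.
  - by move=> t []; rewrite /in_rect; lia.
  - by move=> t []; rewrite /in_rect; lia.
  apply: con_trans (_ : con nn SQ a s) _; first by apply: inc h1; lia.
  by apply: con_sym; [exact: nn_sym|apply: inc h2; lia].
have bc : con nn SQ b c.
  have [||s [h1 h2]] := hv_meet cb cc.
  - by move=> t []; rewrite /in_rect; lia.
  - by move=> t []; rewrite /in_rect; lia.
  apply: con_trans (_ : con nn SQ b s) _; first by apply: inc h1; lia.
  by apply: con_sym; [exact: nn_sym|apply: inc h2; lia].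
have [u' [v' [uu' _ alt]]] := leave_annulus nn_star n0 nm uv un mv.
suff au' : con nn SQ a u'.
  exact: con_trans (con_trans au' (con_sym nn_sym uu')) uv.
have sub x0 x1 y0 y1 p q : con nn (fun z => (S z /\ Q z) /\ in_rect x0 x1 y0 y1 z) p q ->
   con nn SQ p q by apply: con_sub => z [].
have fin x0 x1 y0 y1 p s : con nn SQ a p ->
   con nn SQ p s -> con nn (fun z => (S z /\ Q z) /\ in_rect x0 x1 y0 y1 z) u' s -> con nn SQ a u'.
  move=> ap ps u's; apply: con_trans ap _; apply: con_trans ps _; apply: con_sym; first exact: nn_sym.
  exact: sub u's.
have aa : con nn SQ a a by apply: con_refl; exact: con_l ac.
case: alt => -[k [e1 e2]].
- have [||s [h1 h2]] := hv_meet ca k.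
  + by move=> t []; rewrite /in_rect; lia.
  + by move=> t []; rewrite /in_rect; lia.
  by apply: (fin _ _ _ _ _ _ aa _ h2); apply: inc h1; lia.
- have [||s [h1 h2]] := hv_meet cb (con_sym nn_sym k).
  + by move=> t []; rewrite /in_rect; lia.
  + by move=> t []; rewrite /in_rect; lia.
  have ab : con nn SQ a b by apply: con_trans ac (con_sym nn_sym bc).
  have h3 := con_trans k h2.
  by apply: (fin _ _ _ _ _ _ ab _ h3); apply: inc h1; lia.
- have [||s [h1 h2]] := hv_meet k cc.
  + by move=> t []; rewrite /in_rect; lia.
  + by move=> t []; rewrite /in_rect; lia.
  by apply: (fin _ _ _ _ _ _ ac _ h1); apply: inc h2; lia.
- have [||s [h1 h2]] := hv_meet (con_sym nn_sym k) cd.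
  + by move=> t []; rewrite /in_rect; lia.
  + by move=> t []; rewrite /in_rect; lia.
  have h3 := con_trans k h1.
  by apply: (fin _ _ _ _ _ _ ad _ h3); apply: inc h2; lia.
Qed.

(** A is continued by one step to column X + 1, and B from its two ends along that column up to Y
    and down to -Y, so that [crossing] applies. The extensions can meet only if t is t1 or t2, and
    then (X, t) is already a common point. *)
Lemma hook (A B : vertex -> Prop) (X Y t t1 t2 : int) l :
  con nn A l (X, t) -> con nn B (X, t1) (X, t2) -> t2 <= t <= t1 ->
  (forall z, A z -> z.1 <= X) -> (forall z, B z -> l.1 <= z.1 <= X) ->
  (forall z, A z -> - Y <= z.2 <= Y) -> (forall z, B z -> - Y <= z.2 <= Y) ->
  exists s, con nn A l s /\ con nn B (X, t1) s.
Proof.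
move=> cA cB tt hA hB yA yB; have yA1 := yA _ (con_r cA); have yB1 := yB _ (con_l cB).
have yB2 := yB _ (con_r cB); rewrite /= in yA1 yB1 yB2.
pose A' z := con nn A l z \/ z = (X + 1, t).
pose B' z := con nn B (X, t1) z \/ (z.1 = X + 1 /\ (t1 <= z.2 <= Y \/ - Y <= z.2 <= t2)).
have cA' : con nn A' l (X + 1, t).
  apply: (@con_step _ _ _ (X, t)); last by right.
    by apply: (con_sub (S := con nn A l)); [move=> z; left|exact: con_self].
  by right => /=; lia.
have cB' : con nn B' (X + 1, - Y) (X + 1, Y).
  apply: (@con_trans _ _ _ (X + 1, t2)).
    by apply: con_col; [lia|move=> y hy; right => /=; split=> //; right].
  apply: (@con_cons _ _ _ (X, t2)).
  - by right=> /=; split=> //; right; lia.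
  - by right => /=; lia.
  apply: (@con_trans _ _ _ (X, t1)).
    apply: con_sym; first exact: nn_sym.
    by apply: (con_sub (S := con nn B (X, t1))); [move=> z; left|exact: con_self].
  apply: (@con_cons _ _ _ (X + 1, t1)).
  - by left; apply: con_refl; exact: con_l cB.
  - by right => /=; lia.
  by apply: con_col; [lia|move=> y hy; right => /=; split=> //; left].
have [||s [[h1|h1] [h2|h2]]] := @crossing A' B' _ _ _ _ cA' (con_adj nn_star cB').
- move=> z [/con_r/hB|[zx _]]; first by rewrite /=; lia.
  by have := hA _ (con_l cA); rewrite /=; lia.
- by move=> z [/con_r/yA|->] /=; lia.
- by exists s.
- by have := hA _ (con_r h1); lia.
- by have := hB _ (con_r h2); rewrite h1 /=; lia.
- have e : t = t1 \/ t = t2 by move: h2; rewrite h1 /=; lia.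
  exists (X, t); split=> //; case: e => [->|->//]; apply: con_refl; exact: con_l cB.
Qed.

(** * Positively associated symmetric colourings *)

Definition event := (vertex -> Prop) -> Prop.

Definition on_set (F : vertex -> Prop) (A : event) :=
  forall S S', (forall z, F z -> (S z <-> S' z)) -> A S -> A S'.
Definition loc (A : event) := exists n : int, on_set (fun z => box n z) A.
Definition inc (A : event) :=
  forall S S' : vertex -> Prop, (forall z, S z -> S' z) -> A S -> A S'.

Definition arm (H Q T : vertex -> Prop) : event := fun S =>
  exists u v, [/\ H u, T v & con nn (fun z => S z /\ Q z) u v].

Lemma on_set_sub (F F' : vertex -> Prop) A : (forall z, F z -> F' z) -> on_set F A -> on_set F' A.
Proof. by move=> FF h S S' e; apply: h => z /FF; exact: e. Qed.

Lemma loc_box A (n : int) : loc A -> exists2 m : int, n <= m & on_set (fun z => box m z) A.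
Proof.
case=> m h; exists (Num.max n m); first by rewrite le_max lexx.
by apply: on_set_sub h => z; rewrite /box; lia.
Qed.

Lemma on_set_not F A : on_set F A -> on_set F (fun S => ~ A S).
Proof. by move=> h S S' e nA AS'; apply: nA; apply: h AS' => z /e; tauto. Qed.
Lemma on_set_and F A B : on_set F A -> on_set F B -> on_set F (fun S => A S /\ B S).
Proof. by move=> h k S S' e [? ?]; split; [apply: h|apply: k]; eassumption. Qed.
Lemma on_set_or F A B : on_set F A -> on_set F B -> on_set F (fun S => A S \/ B S).
Proof. by move=> h k S S' e [?|?]; [left; apply: h|right; apply: k]; eassumption. Qed.

Lemma loc_not A : loc A -> loc (fun S => ~ A S).
Proof. by case=> n h; exists n; exact: on_set_not. Qed.
Lemma loc_and A B : loc A -> loc B -> loc (fun S => A S /\ B S).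
Proof.
case=> n hA /(loc_box n)[m nm hB]; exists m; apply: on_set_and hB.
by apply: on_set_sub hA => z; rewrite /box; lia.
Qed.
Lemma loc_or A B : loc A -> loc B -> loc (fun S => A S \/ B S).
Proof.
case=> n hA /(loc_box n)[m nm hB]; exists m; apply: on_set_or hB.
by apply: on_set_sub hA => z; rewrite /box; lia.
Qed.
Lemma inc_and A B : inc A -> inc B -> inc (fun S => A S /\ B S).
Proof. by move=> h k S S' e [? ?]; split; [apply: h|apply: k]; eassumption. Qed.
Lemma arm_on H Q T : on_set Q (arm H Q T).
Proof.
move=> S S' e [u [v [Hu Tv c]]]; exists u, v; split=> //; apply: con_sub c => z [Sz Qz].
by split=> //; apply/e.
Qed.
Lemma arm_inc H Q T : inc (arm H Q T).
Proof.
move=> S S' e [u [v [Hu Tv c]]]; exists u, v; split=> //; apply: con_sub c => z [Sz Qz].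
by split=> //; apply/e.
Qed.
Lemma arm_loc H (Q : vertex -> Prop) T (n : int) : (forall z, Q z -> box n z) -> loc (arm H Q T).
Proof. by move=> h; exists n; apply: on_set_sub (@arm_on H Q T). Qed.

Lemma hcross_on x0 x1 y0 y1 :
  on_set (fun z => in_rect x0 x1 y0 y1 z) (fun S => hcross nn S x0 x1 y0 y1).
Proof.
move=> S S' e [u [v [Hu Tv c]]]; exists u, v; split=> //; apply: con_sub c => z [Sz Qz].
by split=> //; apply/e.
Qed.
Lemma vcross_on x0 x1 y0 y1 :
  on_set (fun z => in_rect x0 x1 y0 y1 z) (fun S => vcross nn S x0 x1 y0 y1).
Proof.
move=> S S' e [u [v [Hu Tv c]]]; exists u, v; split=> //; apply: con_sub c => z [Sz Qz].
by split=> //; apply/e.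
Qed.
Lemma rect_box (x0 x1 y0 y1 : int) : exists n : int, forall z, in_rect x0 x1 y0 y1 z -> box n z.
Proof.
exists (Num.max (Num.max `|x0| `|x1|) (Num.max `|y0| `|y1|)) => z; rewrite /in_rect /box /nrm; lia.
Qed.
Lemma hcross_loc x0 x1 y0 y1 : loc (fun S => hcross nn S x0 x1 y0 y1).
Proof. by have [n h] := rect_box x0 x1 y0 y1; exists n; apply: on_set_sub (@hcross_on _ _ _ _). Qed.
Lemma vcross_loc x0 x1 y0 y1 : loc (fun S => vcross nn S x0 x1 y0 y1).
Proof. by have [n h] := rect_box x0 x1 y0 y1; exists n; apply: on_set_sub (@vcross_on _ _ _ _). Qed.
Lemma hcross_inc x0 x1 y0 y1 : inc (fun S => hcross nn S x0 x1 y0 y1).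
Proof.
move=> S S' e [u [v [Hu Tv c]]]; exists u, v; split=> //; apply: con_sub c => z [Sz Qz].
by split=> //; apply/e.
Qed.
Lemma vcross_inc x0 x1 y0 y1 : inc (fun S => vcross nn S x0 x1 y0 y1).
Proof.
move=> S S' e [u [v [Hu Tv c]]]; exists u, v; split=> //; apply: con_sub c => z [Sz Qz].
by split=> //; apply/e.
Qed.
Lemma circ_inc n : inc (circ n).
Proof.
by apply: inc_and; apply: inc_and; first [exact: hcross_inc|exact: vcross_inc].
Qed.
Lemma circ_out (m n : int) : m < n -> on_set (fun z => ~~ box m z) (circ n).
Proof.
move=> mn; apply: on_set_and; apply: on_set_and;
  first [apply: on_set_sub (@hcross_on _ _ _ _)|apply: on_set_sub (@vcross_on _ _ _ _)];
  by move=> z; rewrite /in_rect /box /nrm; lia.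
Qed.

Definition dbl (c : vertex) : vertex := (2 * c.1, 2 * c.2).

(** Axioms shared by the divide-and-colour law and the refined picture of bond percolation. Only
    even translations are required, because the refined lattice distinguishes sites by the parity of
    their coordinates. Mixing is uniform over all events A on the box n and all B far away. *)
Record law (R : realType) (pr : event -> R) : Prop := Law {
  law_ge0 : forall A, loc A -> 0 <= pr A;
  law_mono : forall A B : event, loc A -> loc B -> (forall S, A S -> B S) -> pr A <= pr B;
  law_not : forall A, loc A -> pr (fun S => ~ A S) = 1 - pr A;
  law_or : forall A B, loc A -> loc B ->
    pr (fun S => A S \/ B S) + pr (fun S => A S /\ B S) = pr A + pr B;
  law_fkg : forall A B, loc A -> loc B -> inc A -> inc B ->
    pr A * pr B <= pr (fun S => A S /\ B S);
  law_swap : forall A, loc A -> pr (fun S => A (fun z => S (swap z))) = pr A;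
  law_flip : forall A, loc A -> pr (fun S => A (fun z => S (flipy z))) = pr A;
  law_shift : forall c A, loc A -> pr (fun S => A (fun z => S (shift (dbl c) z))) = pr A;
  law_mix : forall (n : int) (e : R), 0 < e -> exists m : int, forall A B,
    on_set (fun z => box n z) A -> loc B -> on_set (fun z => ~~ box m z) B ->
    pr (fun S => A S /\ B S) <= pr A * pr B + e }.

(** * Circuits from arms: a crossing argument without self-duality *)

Section Hub.
Context {R : realType} (pr : event -> R) (Hpr : law pr).

Lemma law_le1 A : loc A -> pr A <= 1.
Proof.
by move=> lA; have := law_ge0 Hpr (loc_not lA); rewrite (law_not Hpr lA) subr_ge0.
Qed.

Definition good (A : event) (a : R) := [/\ loc A, inc A & a <= pr A].

Lemma good_and A B a b : 0 <= a -> 0 <= b -> good A a -> good B b ->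
  good (fun S => A S /\ B S) (a * b).
Proof.
move=> a0 b0 [lA iA hA] [lB iB hB]; split; [exact: loc_and|exact: inc_and|].
by apply: le_trans (law_fkg Hpr lA lB iA iB); apply: ler_pM.
Qed.

Lemma good_sub (A B : event) a : good A a -> loc B -> inc B -> (forall S, A S -> B S) -> good B a.
Proof. by move=> [lA iA hA] lB iB AB; split=> //; apply: le_trans hA (law_mono Hpr _ _ AB). Qed.

Definition isym (s : vertex -> vertex) := [/\ (forall a b, nn a b -> nn (s a) (s b)),
  (forall n : int, exists m : int, forall z, box n z -> box m (s z)) &
  forall A, loc A -> pr (fun S => A (fun z => S (s z))) = pr A].

Lemma loc_sym s A : isym s -> loc A -> loc (fun S => A (fun z => S (s z))).
Proof.
move=> [_ bs _] [n h]; have [m bm] := bs n; exists m => S S' e; apply: h => z /bm; exact: e.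
Qed.

Lemma inc_sym s A : inc A -> inc (fun S => A (fun z => S (s z))).
Proof. by move=> iA S S' e; apply: iA => z; exact: e. Qed.

Lemma good_sym s A a : isym s -> good A a -> good (fun S => A (fun z => S (s z))) a.
Proof.
move=> hs [lA iA hA]; split; [exact: loc_sym|exact: inc_sym|].
by case: hs => _ _ ->.
Qed.

Lemma isym_comp s t : isym s -> isym t -> isym (s \o t).
Proof.
move=> hs ht; have [ns bs ps] := hs; have [nt bt pt] := ht; split.
- by move=> a b /nt/ns.
- move=> n; have [m h] := bt n; have [k h'] := bs m; exists k => z /h /h'; exact.
- move=> A lA; rewrite -[RHS](pt A) // -(ps (fun S => A (fun z => S (t z)))) //.
  exact: loc_sym ht lA.
Qed.

Lemma isym_swap : isym swap.
Proof.
split; [exact: swap_nn| |exact: law_swap].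
by move=> n; exists n => z; rewrite /box /nrm /swap /=; lia.
Qed.
Lemma isym_flip : isym flipy.
Proof.
split; [exact: flipy_nn| |exact: law_flip].
by move=> n; exists n => z; rewrite /box /nrm /=; lia.
Qed.
Lemma isym_shift c : isym (shift (dbl c)).
Proof.
split; [exact: shift_nn| |exact: law_shift].
by move=> n; exists (n + nrm (dbl c)) => z; rewrite /box /nrm /=; lia.
Qed.

Definition flipx (z : vertex) : vertex := (- z.1, z.2).
Lemma isym_flipx : isym flipx.
Proof.
have <- : swap \o (flipy \o swap) = flipx by apply/funext => -[].
by apply: isym_comp isym_swap (isym_comp isym_flip isym_swap).
Qed.

Lemma good_arm s (H Q T H' Q' T' : vertex -> Prop) (n : int) a : isym s -> good (arm H Q T) a ->
  (forall z, H z -> H' (s z)) -> (forall z, Q z -> Q' (s z)) -> (forall z, Q z -> T z -> T' (s z)) ->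
  (forall z, Q' z -> box n z) -> good (arm H' Q' T') a.
Proof.
move=> hs g hH hQ hT bQ; have [ns _ _] := hs; apply: good_sub (good_sym hs g) _ _ _.
- exact: arm_loc bQ.
- exact: arm_inc.
- move=> S [u [v [Hu Tv c]]]; exists (s u), (s v); split; first exact: hH.
    by apply: hT => //; case: (con_r c).
  apply: con_map => //; apply: con_sub c => z [? ?]; split=> //; exact: hQ.
Qed.

Lemma isym_id : isym id.
Proof. by split=> // n; exists n. Qed.

(* The square root trick. *)
Lemma good_half (H Q T T' : vertex -> Prop) (n : int) (e : R) :
  0 <= e <= 1 -> (forall z, Q z -> box n z) ->
  good (arm H Q (fun v => T v \/ T' v)) (1 - e ^+ 2) ->
  good (arm H Q T) (1 - e) \/ good (arm H Q T') (1 - e).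
Proof.
move=> /andP[e0 e1] bQ [_ _ h].
have lA := @arm_loc H Q T n bQ; have lB := @arm_loc H Q T' n bQ.
have iA := @arm_inc H Q T; have iB := @arm_inc H Q T'.
have [g|g] := leP (1 - e) (pr (arm H Q T)); first by left.
have [g'|g'] := leP (1 - e) (pr (arm H Q T')); first by right.
exfalso; have f := law_fkg Hpr lA lB iA iB; have o := law_or Hpr lA lB.
have k : 1 - e ^+ 2 <= pr (fun S => arm H Q T S \/ arm H Q T' S).
  apply: le_trans h (law_mono Hpr _ _ _); [exact: arm_loc bQ|exact: loc_or|].
  by move=> S [u [v [Hu [Tv|Tv] c]]]; [left|right]; exists u, v.
have a1 := law_le1 lA; have b1 := law_le1 lB.
move: f o k g g' a1 b1; set a := pr (arm H Q T); set b := pr (arm H Q T').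
set x := pr (fun S => _ /\ _); set y := pr (fun S => _ \/ _) => f o k g g' a1 b1.
have : (1 - a) * (1 - b) > e * e by rewrite ltr_pM //; lra.
rewrite expr2 in k; nra.
Qed.

Definition side (X a b : int) (v : vertex) : Prop := v.1 = X /\ a <= v.2 <= b.

(** Phrased as certainty of arms from large boxes rather than positive probability at the origin;
    under mixing, [no_perc] shows that its failure makes arms from any fixed box unlikely. *)
Definition percolates := forall e : R, 0 < e -> exists m : int, 0 <= m /\ forall N, m <= N ->
  good (arm (fun z => box m z) (fun z => box N z) (fun v => nrm v = N)) (1 - e).

Lemma half_side (e : R) : percolates -> 0 < e <= 1 -> exists m : int, 0 <= m /\ forall N, m <= N ->
  good (arm (fun z => box m z) (fun z => box N z) (side N 0 N)) (1 - e).
Proof.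
(* The target is halved three times (pair of sides, one side, half a side), and each use of the
   square root trick halves the exponent: 8, 4, 2, 1. *)
move=> P /andP[e0 e1]; have [m [m0 h]] := P (e ^+ 8) (exprn_gt0 _ e0); exists m; split=> // N mN.
have pw k : 0 <= e ^+ k <= 1 by rewrite exprn_ge0 ?exprn_ile1 // ltW.
pose H z : Prop := box m z. pose Q z : Prop := box N z.
have bQ z : Q z -> box N z by [].
have g1 : good (arm H Q (fun v => (v.1 = N \/ v.1 = - N) \/ (v.2 = N \/ v.2 = - N))) (1 - (e ^+ 4) ^+ 2).
  rewrite -exprM; apply: good_arm isym_id (h N mN) _ _ _ bQ => // z _; rewrite /nrm /=; lia.
have g2 : good (arm H Q (fun v => v.1 = N \/ v.1 = - N)) (1 - e ^+ 4).
  case: (good_half (pw 4%N) bQ g1) => // g.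
  by apply: good_arm isym_swap g _ _ _ bQ => z; rewrite /H /Q /box /nrm /=; lia.
have g3 : good (arm H Q (side N 0 N)) (1 - e) \/ good (arm H Q (side N (- N) 0)) (1 - e).
  apply: (good_half _ bQ); first by rewrite (ltW e0).
  have g2' : good (arm H Q (fun v => v.1 = N \/ v.1 = - N)) (1 - (e ^+ 2) ^+ 2) by rewrite -exprM.
  have /= := good_half (pw 2%N) bQ g2'.
  case=> g.
    by apply: good_arm isym_id g _ _ _ bQ => // z; rewrite /Q /box /nrm /side /=; lia.
  by apply: good_arm isym_flipx g _ _ _ bQ => // z; rewrite /H /Q /box /nrm /side /=; lia.
case: g3 => // g.
by apply: good_arm isym_flip g _ _ _ bQ => // z; rewrite /H /Q /box /nrm /side /=; lia.
Qed.

(** Take the largest k for which arms to the part of the right side above 2k are likely. By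
    maximality and the square root trick, arms to the part below 2k + 2 are likely too. Heights are
    even to match the even translations. *)
Lemma split_side (e : R) : percolates -> 0 < e <= 1 -> exists m : int, 0 <= m /\
  forall n : nat, m <= 2 * n%:Z -> exists k : nat, (1 <= k <= n)%N /\
   good (arm (fun z => box m z) (fun z => box (2 * n%:Z) z) (side (2 * n%:Z) (2 * k%:Z) (2 * n%:Z))) (1 - e) /\
   good (arm (fun z => box m z) (fun z => box (2 * n%:Z) z) (side (2 * n%:Z) 0 (2 * k%:Z + 2))) (1 - e).
Proof.
move=> P /andP[e0 e1].
have ee : 0 < e ^+ 2 <= 1 by rewrite exprn_gt0 //= exprn_ile1 // ltW.
have [m [m0 h]] := half_side P ee; exists (m + 2); split; first by lia.
move=> n mn; pose N := 2 * n%:Z; pose H z : Prop := box (m + 2) z; pose Q z : Prop := box N z.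
have bQ z : Q z -> box N z by [].
(* Translating by (2, 2) raises the target above height 2, which makes k = 1 admissible. *)
have g2 : good (arm H Q (side N 2 N)) (1 - e ^+ 2).
  have mN : m <= N - 2 by rewrite /N; lia.
  apply: good_arm (isym_shift (1, 1)) (h _ mN) _ _ _ bQ => z; rewrite /H /Q /box /nrm /side /=; lia.
have e2 : e ^+ 2 <= e by rewrite expr2 ler_piMl // ltW.
have g1 : good (arm H Q (side N 2 N)) (1 - e).
  by case: g2 => ? ? g2; split=> //; apply: le_trans g2; rewrite lerB.
pose p k := `[< good (arm H Q (side N (2 * Posz k) N)) (1 - e) >] && (k <= n)%N.
have n1 : (1 <= n)%N by lia.
have ex : exists k, p k by exists 1%N; rewrite /p n1 andbT; apply/asboolP.
have ub k : p k -> (k <= n)%N by case/andP.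
have [k /andP[/asboolP gk kn] mx] := ex_maxnP ex ub.
have k1 : (1 <= k)%N by apply: mx; rewrite /p n1 andbT; apply/asboolP.
exists k; split; first by rewrite k1.
split=> //.
have [kn1|kn1] := leqP k.+1 n; last first.
  by apply: good_arm isym_id g1 _ _ _ bQ => // z; rewrite /Q /box /nrm /side /N /=; lia.
have no : ~ good (arm H Q (side N (2 * Posz k.+1) N)) (1 - e).
  by move=> g; have := mx k.+1; rewrite /p kn1 andbT; move/(_ (asboolT g)); rewrite ltnn.
have e01 : 0 <= e <= 1 by rewrite (ltW e0).
have gg : good (arm H Q (fun v => side N (2 * Posz k.+1) N v \/ side N 0 (2 * Posz k + 2) v)) (1 - e ^+ 2).
  by apply: good_arm isym_id g2 _ _ _ bQ => // z; rewrite /side /=; lia.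
by case: (good_half e01 bQ gg).
Qed.

(** If k doubled each time n is multiplied by 7/4, it would outgrow its bound n. The ratio has to be
    below 2 here and above 3/2 in [hub_circuits], where the crossed rectangle must be longer than
    high. *)
Lemma scale_exists (k : nat -> nat) (n0 : nat) :
  (forall n, (n0 <= n)%N -> (1 <= k n <= n)%N) -> (2 <= n0)%N ->
  exists2 n, (n0 <= n)%N & (k ((7 * n) %/ 4) < 2 * k n)%N.
Proof.
move=> hk n2; apply: contrapT => no.
pose f := fun j => iter j (fun n => (7 * n) %/ 4)%N n0.
have fge j : (n0 <= f j)%N by elim: j => //= j IH; apply: leq_trans IH _; lia.
have grow j : (2 ^ j <= k (f j))%N.
  elim: j => [|j IH]; first by have /andP[] := hk _ (fge 0%N).
  rewrite expnS /=; have [h|h] := leqP (2 * k (f j)) (k (f j.+1)).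
    by apply: leq_trans h; rewrite leq_mul2l IH.
  by exfalso; apply: no; exists (f j).
have fle j : (4 ^ j * f j <= 7 ^ j * n0)%N.
  elim: j => // j IH; rewrite !expnS /=.
  have : (4 * ((7 * f j) %/ 4) <= 7 * f j)%N by rewrite mulnC leq_trunc_div.
  nia.
have e8 j : (7 ^ j * (7 + j) <= 7 * 8 ^ j)%N.
  by elim: j => // j IH; rewrite !expnS; nia.
(* After j = 7 n0 steps, the Bernoulli bound gives (8/7)^j >= 1 + n0, so that 2^j exceeds (7/4)^j
   n0. *)
have := fle (7 * n0)%N; have := grow (7 * n0)%N; have /andP[_ hh] := hk _ (fge (7 * n0)%N).
have := e8 (7 * n0)%N; rewrite (_ : 8 = 4 * 2)%N // expnMn.
set a := (4 ^ _)%N; set b := (2 ^ _)%N; set c := (7 ^ _)%N; set F := f _.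
have a0 : (0 < a)%N by rewrite expn_gt0. have c0 : (0 < c)%N by rewrite expn_gt0.
move=> h1 h2 h3.
have h4 : (a * b <= c * n0)%N by apply: leq_trans h3; rewrite leq_mul2l (leq_trans h2 hh) orbT.
nia.
Qed.

(** Substitute for uniqueness of the infinite cluster: on Z, all arms from the box M0 beyond M1 lie
    in one cluster, within any region that contains the box M1. *)
Definition glues (M0 M1 : int) (Z : event) := forall S, Z S ->
  forall (Q : vertex -> Prop) u u' v v', (forall z, box M1 z -> Q z) ->
    con nn (fun z => S z /\ Q z) u v -> con nn (fun z => S z /\ Q z) u' v' ->
    box M0 u -> box M0 u' -> M1 < nrm v -> M1 < nrm v' ->
    con nn (fun z => S z /\ Q z) v v'.

Definition bar (N b : int) : event := fun S => exists l t,
  [/\ l.1 = - N, 0 <= t <= b & con nn (fun z => S z /\ box N z) l (N, t)].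

(** What remains of four glued arms ending on the left and right sides of the box n, above height a
    and below -a. *)
Definition xshape (n a : int) : event := fun S => exists t1 t2 t3 t4,
  [/\ [/\ a <= t1, a <= t2, a <= t3 & a <= t4],
    con nn (fun z => S z /\ box n z) (n, t1) (n, - t2),
    con nn (fun z => S z /\ box n z) (- n, t3) (- n, - t4) &
    con nn (fun z => S z /\ box n z) (n, t1) (- n, t3)].

(** The translation puts the right side of the bar on the line x = n, with its end at a height in
    [-a, b - a]. Since b <= 2a, this lies between -t2 and t1, so [hook] applies. *)
Lemma bar_side (S : vertex -> Prop) (n N a b t1 t2 : int) : 0 <= n -> n <= N -> 0 <= a -> b <= 2 * a ->
  a <= t1 -> a <= t2 ->
  con nn (fun z => S z /\ box n z) (n, t1) (n, - t2) ->
  bar N b (fun z => S (shift (n - N, - a) z)) ->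
  exists2 l, l.1 = n - 2 * N &
    con nn (fun z => S z /\ in_rect (n - 2 * N) n (- a - N) N z) l (n, t1).
Proof.
move=> n0 nN a0 ba at1 at2 cB [l [t [el ht cA]]].
pose A z := S z /\ in_rect (n - 2 * N) n (- a - N) (N - a) z.
have cA' : con nn A (shift (n - N, - a) l) (n, t - a).
  have -> : (n, t - a) = shift (n - N, - a) (N, t) by rewrite /shift /=; congr pair; lia.
  apply: con_map; first exact: shift_nn.
  apply: con_sub cA => z [Sz bz]; split=> //; move: bz.
  by rewrite /box /nrm /in_rect /shift /=; lia.
have [|||||s [h1 h2]] := @hook A _ n (2 * N + n + a) (t - a) t1 (- t2) _ cA' cB.
- by lia.
- by move=> z []; rewrite /in_rect; lia.
- by move=> z []; rewrite /box /nrm /shift /= el; lia.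
- by move=> z []; rewrite /in_rect; lia.
- by move=> z []; rewrite /box /nrm; lia.
exists (shift (n - N, - a) l); first by rewrite /shift /= el; lia.
apply: (@con_trans _ _ _ s).
  by apply: con_sub h1 => z [Sz rz]; split=> //; move: rz; rewrite /in_rect; lia.
apply: con_sym; first exact: nn_sym.
by apply: con_sub h2 => z [Sz rz]; split=> //; move: rz; rewrite /box /nrm /in_rect; lia.
Qed.

(** A bar hooks into the central shape from each side, the second one by reflection. The rectangle
    has width 4N - 2n and height 2N + n, hence is longer than high once N > 3n/2. *)
Lemma xshape_cross (S : vertex -> Prop) (n N a b : int) : 0 <= n -> n <= N -> 0 <= a <= n -> b <= 2 * a ->
  xshape n a S -> bar N b (fun z => S (shift (n - N, - a) z)) ->
  bar N b (fun z => S (flipx (shift (n - N, - a) z))) ->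
  hcross nn S (n - 2 * N) (2 * N - n) (- n - N) N.
Proof.
move=> n0 nN /andP[a0 an] ba [t1 [t2 [t3 [t4 [[h1 h2 h3 h4] c1 c2 c3]]]]] b1 b2.
have [l1 e1 k1] := bar_side n0 nN a0 ba h1 h2 c1 b1.
have c2' : con nn (fun z => S (flipx z) /\ box n z) (n, t3) (n, - t4).
  have -> : (n, t3) = flipx (- n, t3) by rewrite /flipx /= opprK.
  have -> : (n, - t4) = flipx (- n, - t4) by rewrite /flipx /= opprK.
  apply: con_map; first by rewrite /nn /=; lia.
  apply: con_sub c2 => -[x y] [Sz bz]; rewrite /flipx /= opprK; split=> //; move: bz.
  by rewrite /box /nrm /=; lia.
have [l2 e2 k2] := @bar_side (fun z => S (flipx z)) _ _ _ _ _ _ n0 nN a0 ba h3 h4 c2' b2.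
have k2' : con nn (fun z => S z /\ in_rect (n - 2 * N) (2 * N - n) (- n - N) N z) (flipx l2) (- n, t3).
  have -> : (- n, t3) = flipx (n, t3) by [].
  apply: con_map; first by rewrite /nn /=; lia.
  apply: con_sub k2 => -[x y] [Sz bz]; split=> //; move: bz; rewrite /in_rect /=; lia.
exists l1, (flipx l2); split=> //; first by rewrite /flipx /= e2; lia.
apply: (@con_trans _ _ _ (n, t1)).
  by apply: con_sub k1 => z [Sz rz]; split=> //; move: rz; rewrite /in_rect; lia.
apply: (@con_trans _ _ _ (- n, t3)); last exact: (con_sym nn_sym k2').
by apply: con_sub c3 => z [Sz rz]; split=> //; move: rz; rewrite /box /nrm /in_rect; lia.
Qed.

Lemma good_bar (M0 M1 N b : int) Z (k e : R) : 0 <= k -> 0 <= e <= 1 -> M0 <= M1 -> M1 < N ->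
  good Z k -> glues M0 M1 Z ->
  good (arm (fun z => box M0 z) (fun z => box N z) (side N 0 b)) (1 - e) ->
  good (arm (fun z => box M0 z) (fun z => box N z) (side N 0 N)) (1 - e) ->
  good (bar N b) (k * ((1 - e) * (1 - e))).
Proof.
move=> k0 /andP[e0 e1] M01 M1N gZ glu g1 g2.
have g3 : good (arm (fun z => box M0 z) (fun z => box N z) (fun v => v.1 = - N)) (1 - e).
  by apply: good_arm isym_flipx g2 _ _ _ (fun _ h => h) => z; rewrite /box /nrm /side /=; lia.
have ge : 0 <= 1 - e by rewrite subr_ge0.
have g := good_and k0 (mulr_ge0 ge ge) gZ (good_and ge ge g1 g3).
apply: good_sub g _ _ _.
- exists N => S S' e' [l [t [h1 h2 h3]]]; exists l, t; split=> //; apply: con_sub h3 => z [Sz bz].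
  by split=> //; apply/e'.
- move=> S S' e' [l [t [h1 h2 h3]]]; exists l, t; split=> //; apply: con_sub h3 => z [Sz bz].
  by split=> //; apply/e'.
move=> S [ZS [[u [[x y] [hu [/= -> hy] c]]] [u' [v' [hu' hv' c']]]]].
exists v', y; split=> //.
have [_ b1] := con_r c; have [_ b2] := con_r c'.
apply: (glu S ZS (fun z => box N z) u' u) => //.
- by move=> z; rewrite /box; lia.
- by move: b2 M1N; rewrite /box /nrm hv'; lia.
- by move: M1N; rewrite /nrm /=; lia.
Qed.

Lemma good_xshape (M0 M1 n a : int) Z (k e : R) : 0 <= k -> 0 <= e <= 1 -> M0 <= M1 -> M1 < n ->
  good Z k -> glues M0 M1 Z ->
  good (arm (fun z => box M0 z) (fun z => box n z) (side n a n)) (1 - e) ->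
  good (xshape n a) (k * (((1 - e) * (1 - e)) * ((1 - e) * (1 - e)))).
Proof.
move=> k0 /andP[e0 e1] M01 M1n gZ glu g1.
have g2 : good (arm (fun z => box M0 z) (fun z => box n z) (side n (- n) (- a))) (1 - e).
  by apply: good_arm isym_flip g1 _ _ _ (fun _ h => h) => z; rewrite /box /nrm /side /=; lia.
have g3 : good (arm (fun z => box M0 z) (fun z => box n z) (side (- n) a n)) (1 - e).
  by apply: good_arm isym_flipx g1 _ _ _ (fun _ h => h) => z; rewrite /box /nrm /side /=; lia.
have g4 : good (arm (fun z => box M0 z) (fun z => box n z) (side (- n) (- n) (- a))) (1 - e).
  by apply: good_arm isym_flip g3 _ _ _ (fun _ h => h) => z; rewrite /box /nrm /side /=; lia.
have ge : 0 <= 1 - e by rewrite subr_ge0.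
have gg := mulr_ge0 ge ge.
have g := good_and k0 (mulr_ge0 gg gg) gZ (good_and gg gg (good_and ge ge g1 g2) (good_and ge ge g3 g4)).
apply: good_sub g _ _ _.
- exists n => S S' e' [t1 [t2 [t3 [t4 [h c1 c2 c3]]]]]; exists t1, t2, t3, t4.
  by split=> //; [apply: con_sub c1|apply: con_sub c2|apply: con_sub c3] => z [Sz bz]; split=> //; apply/e'.
- move=> S S' e' [t1 [t2 [t3 [t4 [h c1 c2 c3]]]]]; exists t1, t2, t3, t4.
  by split=> //; [apply: con_sub c1|apply: con_sub c2|apply: con_sub c3] => z [Sz bz]; split=> //; apply/e'.
move=> S [ZS [[[u1 [[x1 t1] [m1 [/= -> h1] c1]]] [u2 [[x2 t2] [m2 [/= -> h2] c2]]]]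
  [[u3 [[x3 t3] [m3 [/= -> h3] c3]]] [u4 [[x4 t4] [m4 [/= -> h4] c4]]]]]].
have sub z : box M1 z -> box n z by rewrite /box; lia.
have far (t x : int) : x = n \/ x = - n -> M1 < nrm (x, t) by move: M1n; rewrite /nrm /=; lia.
exists t1, (- t2), t3, (- t4); rewrite !opprK; split.
- by clear -h1 h2 h3 h4; split; lia.
- by apply: (glu S ZS (fun z => box n z) u1 u2) => //; apply: far; auto.
- by apply: (glu S ZS (fun z => box n z) u3 u4) => //; apply: far; auto.
- by apply: (glu S ZS (fun z => box n z) u1 u3) => //; apply: far; auto.
Qed.

Lemma hcross_shift c (S : vertex -> Prop) x0 x1 y0 y1 :
  hcross nn (fun z => S (shift c z)) x0 x1 y0 y1 ->
  hcross nn S (c.1 + x0) (c.1 + x1) (c.2 + y0) (c.2 + y1).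
Proof.
move=> [u [v [e1 e2 k]]]; exists (shift c u), (shift c v); split.
- by rewrite /= e1.
- by rewrite /= e2.
apply: con_map; first exact: shift_nn.
by apply: con_sub k => z [Sz rz]; split=> //; move: rz; rewrite /in_rect /=; lia.
Qed.

Lemma hcross_swap (S : vertex -> Prop) x0 x1 y0 y1 :
  hcross nn (fun z => S (swap z)) x0 x1 y0 y1 -> vcross nn S y0 y1 x0 x1.
Proof.
move=> [u [v [e1 e2 k]]]; exists (swap u), (swap v); split=> //.
apply: con_map; first exact: swap_nn.
by apply: con_sub k => z [Sz rz]; split=> //; move: rz; rewrite /in_rect /=; lia.
Qed.

Lemma good_hshift (c : vertex) x0 x1 y0 y1 x0' x1' y0' y1' q :
  good (fun S => hcross nn S x0 x1 y0 y1) q ->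
  x0' = 2 * c.1 + x0 -> x1' = 2 * c.1 + x1 -> y0' = 2 * c.2 + y0 -> y1' = 2 * c.2 + y1 ->
  good (fun S => hcross nn S x0' x1' y0' y1') q.
Proof.
move=> g -> -> -> ->; apply: good_sub (good_sym (isym_shift c) g) _ _ _.
- exact: hcross_loc.
- exact: hcross_inc.
- by move=> S /hcross_shift.
Qed.

Lemma good_hswap x0 x1 y0 y1 q : good (fun S => hcross nn S x0 x1 y0 y1) q ->
  good (fun S => vcross nn S y0 y1 x0 x1) q.
Proof.
move=> g; apply: good_sub (good_sym isym_swap g) _ _ _.
- exact: vcross_loc.
- exact: vcross_inc.
- by move=> S /hcross_swap.
Qed.

(** Two translates of the crossing overlap in a square of side 2h; a vertical crossing of this
    square, cut out of a reflected long crossing, joins them. Three crossings in all give the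
    cube. *)
Lemma good_extend (w h q : int) (a : R) : 0 <= a -> 0 <= h -> h <= w ->
  good (fun S => hcross nn S 0 (2 * w) 0 (2 * h)) a ->
  good (fun S => hcross nn S 0 (2 * (2 * w - h)) 0 (2 * h)) (a ^+ 3).
Proof.
move=> a0 h0 hw g.
have g2 : good (fun S => hcross nn S (2 * (w - h)) (2 * (2 * w - h)) 0 (2 * h)) a.
  by apply: (good_hshift (c := (w - h, 0))) g _ _ _ _ => /=; lia.
have g3 : good (fun S => vcross nn S (2 * (w - h)) (2 * w) 0 (2 * w)) a.
  apply: good_hswap; apply: (good_hshift (c := (0, w - h))) g _ _ _ _ => /=; lia.
have := good_and a0 (mulr_ge0 a0 a0) g (good_and a0 a0 g2 g3).
have -> : a * (a * a) = a ^+ 3 by ring.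
move/good_sub; apply; [exact: hcross_loc|exact: hcross_inc|].
move=> S [[u [v [eu ev c1]]] [[u' [v' [eu' ev' c2]]] /(vcross_sub nn_star) V]].
have [||||| z0 [z1 [ez0 ez1 c3]]] := V (2 * (w - h)) (2 * w) 0 (2 * h); try by lia.
exists u, v'; split=> //.
have [||s [h1 h2]] := hv_meet c1 c3.
- by move=> t []; rewrite /in_rect; lia.
- by move=> t []; rewrite /in_rect; lia.
have [||s' [h1' h2']] := hv_meet c2 c3.
- by move=> t []; rewrite /in_rect; lia.
- by move=> t []; rewrite /in_rect; lia.
pose D z := S z /\ in_rect 0 (2 * (2 * w - h)) 0 (2 * h) z.
have us : con nn D u s by apply: con_sub h1 => t [St]; rewrite /D /in_rect; split=> //; lia.
have zs : con nn D z0 s by apply: con_sub h2 => t [St]; rewrite /D /in_rect; split=> //; lia.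
have us' : con nn D u' s' by apply: con_sub h1' => t [St]; rewrite /D /in_rect; split=> //; lia.
have zs' : con nn D z0 s' by apply: con_sub h2' => t [St]; rewrite /D /in_rect; split=> //; lia.
have uv' : con nn D u' v' by apply: con_sub c2 => t [St]; rewrite /D /in_rect; split=> //; lia.
exact: (con_trans us (con_trans (con_sym nn_sym zs) (con_trans zs' (con_trans (con_sym nn_sym us') uv')))).
Qed.

Lemma good_extend_iter (d h : int) (a : R) j : 0 <= a -> 0 <= h -> 0 <= d ->
  good (fun S => hcross nn S 0 (2 * (h + d)) 0 (2 * h)) a ->
  good (fun S => hcross nn S 0 (2 * (h + (2 ^ j)%N%:Z * d)) 0 (2 * h)) (a ^+ (3 ^ j)).
Proof.
move=> a0 h0 d0 g; elim: j => [|j IH]; first by rewrite expn0 mul1r expr1.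
have dj : 0 <= (2 ^ j)%N%:Z * d by rewrite mulr_ge0.
have := good_extend 0 (exprn_ge0 _ a0) h0 _ IH.
rewrite -exprM -expnSr (_ : 2 * _ - h = h + (2 ^ j.+1)%N%:Z * d); last first.
  by rewrite expnS PoszM; ring.
by apply; rewrite lerDl.
Qed.

(** Six applications of [good_extend] multiply the surplus d by 64, so the length 2 (h + 64 d) is at
    least 12 h, the side of the outer box. The exponent 2916 is 4 * 3^6: four sides, six cubings. *)
Lemma good_circ (d h : int) (a : R) : 0 <= a -> 0 <= h -> 5 * h <= 64 * d ->
  good (fun S => hcross nn S 0 (2 * (h + d)) 0 (2 * h)) a -> good (circ (2 * h)) (a ^+ 2916).
Proof.
move=> a0 h0 hd g; have d0 : 0 <= d by lia.
have := good_extend_iter 6 a0 h0 d0 g; set b := a ^+ _; set w := 2 * (h + _) => g6.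
have b0 : 0 <= b by exact: exprn_ge0.
have wh : 12 * h <= w by rewrite /w; lia.
have red x1 y1 x0' x1' y0' y1' : 0 <= x0' -> x0' <= x1' -> x1' <= x1 -> y0' <= 0 -> y1 <= y1' ->
  good (fun S => hcross nn S 0 x1 0 y1) b -> good (fun S => hcross nn S x0' x1' y0' y1') b.
  move=> ? ? ? ? ? gg; apply: good_sub gg _ _ _; [exact: hcross_loc|exact: hcross_inc|].
  move=> S; apply: hcross_sub => //; exact: nn_star.
have g7 : good (fun S => hcross nn S 0 (12 * h) 0 (4 * h)) b by apply: red g6; lia.
have top : good (fun S => hcross nn S (- (3 * (2 * h))) (3 * (2 * h)) (2 * h) (3 * (2 * h))) b.
  by apply: (good_hshift (c := (- (3 * h), h))) g7 _ _ _ _ => /=; lia.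
have bot : good (fun S => hcross nn S (- (3 * (2 * h))) (3 * (2 * h)) (- (3 * (2 * h))) (- (2 * h))) b.
  by apply: (good_hshift (c := (- (3 * h), - (3 * h)))) g7 _ _ _ _ => /=; lia.
have := good_and (mulr_ge0 b0 b0) (mulr_ge0 b0 b0) (good_and b0 b0 top bot)
  (good_and b0 b0 (good_hswap top) (good_hswap bot)).
have -> // : b * b * (b * b) = a ^+ 2916.
by rewrite /b -!exprD.
Qed.

(** The exponents count gluing events and arms: the central shape uses one gluing event and four
    arms, each of the two bars one gluing event and two arms. *)
Theorem hub_circuits (e : R) : percolates -> 0 < e <= 1 -> exists M0 : int, 0 <= M0 /\
  forall (M1 : int) Z (k : R), 0 <= k -> M0 <= M1 -> good Z k -> glues M0 M1 Z ->
  forall n0 : int, exists2 n : int, n0 <= n &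
    good (circ n) ((k ^+ 3 * (1 - e) ^+ 8) ^+ 2916).
Proof.
move=> P e01; have /andP[e0 e1] := e01; have [M0 [M00 h]] := split_side P e01.
exists M0; split=> // M1 Z k k0 M01 gZ glu n0.
have {}e01 : 0 <= e <= 1 by rewrite (ltW e0).
have ge : 0 <= 1 - e by rewrite subr_ge0.
pose m0 := (`|M1| + `|n0| + 40)%N.
have hk (n : nat) : exists k : nat, (m0 <= n)%N -> (1 <= k <= n)%N /\
   good (arm (fun z => box M0 z) (fun z => box (2 * n%:Z) z) (side (2 * n%:Z) (2 * k%:Z) (2 * n%:Z))) (1 - e) /\
   good (arm (fun z => box M0 z) (fun z => box (2 * n%:Z) z) (side (2 * n%:Z) 0 (2 * k%:Z + 2))) (1 - e).
  have [mn|] := leqP m0 n; last by exists 0%N.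
  have [|j hj] := h n; first by move: mn; rewrite /m0; lia.
  by exists j.
have {hk}[kf hk] := choice hk.
have [||n mn kn] := @scale_exists kf m0.
- by move=> n /hk[].
- by rewrite /m0; lia.
pose N := ((7 * n) %/ 4)%N.
have Nn : (n <= N)%N by rewrite /N; lia.
have mN : (m0 <= N)%N by exact: leq_trans mn Nn.
have [kn1 [gn _]] := hk _ mn; have [kN1 [gN gN']] := hk _ mN.
have M1n : M1 < 2 * n%:Z by move: mn; rewrite /m0; lia.
have M1N : M1 < 2 * N%:Z by lia.
have gN0 : good (arm (fun z => box M0 z) (fun z => box (2 * N%:Z) z) (side (2 * N%:Z) 0 (2 * N%:Z))) (1 - e).
  by apply: good_arm isym_id gN _ _ _ (fun _ h => h) => // z _; rewrite /side /=; lia.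
have gX := good_xshape k0 e01 M01 M1n gZ glu gn.
have gB := good_bar k0 e01 M01 M1N gZ glu gN' gN0.
set a : int := 2 * (kf n)%:Z in gX; set b : int := 2 * (kf N)%:Z + 2 in gB.
have sh : shift (dbl (n%:Z - N%:Z, - (kf n)%:Z)) = shift (2 * n%:Z - 2 * N%:Z, - a).
  by apply/funext => z; rewrite /shift /dbl /=; congr pair; rewrite /a; lia.
have gB1 := good_sym (isym_shift (n%:Z - N%:Z, - (kf n)%:Z)) gB.
have gB2 := good_sym isym_flipx gB1.
have gB2' := good_sym (isym_comp isym_flipx (isym_shift (n%:Z - N%:Z, - (kf n)%:Z))) gB.
rewrite sh in gB1 gB2'.
have gg := mulr_ge0 ge ge.
have g := good_and (mulr_ge0 k0 (mulr_ge0 gg gg)) (mulr_ge0 (mulr_ge0 k0 gg) (mulr_ge0 k0 gg))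
   gX (good_and (mulr_ge0 k0 gg) (mulr_ge0 k0 gg) gB1 gB2').
have {g}g : good (fun S => hcross nn S (2 * n%:Z - 2 * (2 * N%:Z)) (2 * (2 * N%:Z) - 2 * n%:Z)
     (- (2 * n%:Z) - 2 * N%:Z) (2 * N%:Z)) (k ^+ 3 * (1 - e) ^+ 8).
  have -> : k ^+ 3 * (1 - e) ^+ 8 = k * ((1 - e) * (1 - e) * ((1 - e) * (1 - e))) *
     (k * ((1 - e) * (1 - e)) * (k * ((1 - e) * (1 - e)))) by ring.
  apply: good_sub g _ _ _; [exact: hcross_loc|exact: hcross_inc|].
  move=> S [hX [h1 h2]]; apply: (@xshape_cross S _ _ a b) => //; rewrite /a /b; try lia.
  by move: kn; rewrite -/N; lia.
(* The crossed rectangle has height 2 hh and width 2 (hh + d); d is positive because N / n is close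
   to 7/4, above 3/2. *)
pose hh := 2 * N%:Z + n%:Z; pose d := 2 * N%:Z - 3 * n%:Z.
exists (2 * hh); first by move: mn; rewrite /hh /m0; lia.
apply: (@good_circ d).
- by rewrite mulr_ge0 ?exprn_ge0.
- by rewrite /hh; lia.
- by move: mn; rewrite /hh /d /N /m0; lia.
apply: (good_hshift (c := (2 * N%:Z - n%:Z, N%:Z + n%:Z))) g _ _ _ _ => /=; rewrite /hh /d; lia.
Qed.

Lemma pow_small (c e : R) : 0 < c <= 1 -> 0 < e -> exists j, (1 - c) ^+ j <= e.
Proof.
move=> /andP[c0 c1] e0.
have H j : (1 - c) ^+ j * (1 + j%:R * c) <= 1.
  elim: j => [|j IH]; first by rewrite mul0r addr0 mulr1.
  apply: le_trans IH; rewrite exprS -mulrA mulrCA ler_wpM2l ?exprn_ge0 ?subr_ge0 //.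
  rewrite -natr1; have : 0 <= j%:R * c ^+ 2 by rewrite mulr_ge0 ?sqr_ge0.
  have := sqr_ge0 c; nra.
have ce : 0 < c * e by exact: mulr_gt0.
pose j := Num.bound (c * e)^-1.
have hj : (c * e)^-1 < j%:R by apply: archi_boundP; rewrite invr_ge0 ltW.
exists j; have := H j; have p0 : 0 <= (1 - c) ^+ j by rewrite exprn_ge0 ?subr_ge0.
have : 1 < j%:R * c * e by rewrite -mulrA -(ltr_pdivrMr _ _ ce) div1r.
set x := (1 - c) ^+ j in p0 *; set y := j%:R * c => h1 h2.
have y0 : 0 < y by have : 0 < y * e; [exact: lt_trans ltr01 h1|rewrite pmulr_lgt0].
have h3 : x * y <= 1 by apply: le_trans h2; rewrite ler_wpM2l // lerDr.
rewrite leNgt; apply/negP => ex.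
have : y * e < y * x by rewrite ltr_pM2l.
rewrite [y * x]mulrC => h4; move: (lt_le_trans (lt_trans h1 h4) h3); by rewrite ltxx.
Qed.

Lemma none_loc (l : seq event) : (forall D, List.In D l -> loc D) ->
  loc (fun S => forall D, List.In D l -> ~ D S).
Proof.
elim: l => [|D l IH] h; first by exists 0.
have [n hn] := loc_and (loc_not (h D (or_introl erefl))) (IH (fun D' i => h D' (or_intror i))).
exists n => S S' e a.
have [h1 h2] : ~ D S' /\ (forall D', List.In D' l -> ~ D' S').
  apply: hn e _; split; first by apply: a; left.
  by move=> D' iD; apply: a; right.
by move=> D' [<-|/h2].
Qed.

(** Events are added one at a time, each so far out that mixing makes it nearly independent of the
    previous ones. *)
Lemma mix_none (K : event -> Prop) (c : R) : 0 < c <= 1 ->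
  (forall m : int, exists D, [/\ K D, loc D, on_set (fun z => ~~ box m z) D & c <= pr D]) ->
  forall e : R, 0 < e -> exists l : seq event, (forall D, List.In D l -> K D /\ loc D) /\
    pr (fun S => forall D, List.In D l -> ~ D S) <= e.
Proof.
move=> c01 H e e0; have /andP[c0 c1] := c01.
have e2 : 0 < e / 2 by rewrite divr_gt0.
have [j hj] := pow_small c01 e2.
suff [l [hl pl]] : exists l : seq event, (forall D, List.In D l -> K D /\ loc D) /\
    pr (fun S => forall D, List.In D l -> ~ D S) <= (1 - c) ^+ j + e / 2.
  by exists l; split=> //; apply: le_trans pl _; lra.
elim: j {hj} => [|j [l [hl pl]]].
  exists [::]; split=> //; rewrite expr0; apply: le_trans (law_le1 _) _; first by exists 0.
  by rewrite lerDl ltW.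
have [n hn] := none_loc (fun D i => (hl D i).2).
(* The mixing error c e / 2 preserves the bound: (1 - c) (w + e / 2) + c e / 2 = (1 - c) w + e /
   2. *)
have [m hm] := law_mix Hpr n (mulr_gt0 c0 e2).
have [D [KD lD oD pD]] := H m.
exists (D :: l); split; first by move=> D' [<-//|/hl].
have lN : loc (fun S => forall D, List.In D l -> ~ D S) by exists n.
have := hm _ _ hn (loc_not lD) (on_set_not oD); rewrite (law_not Hpr lD).
have := law_ge0 Hpr lN.
have : pr (fun S => forall D', List.In D' (D :: l) -> ~ D' S) <=
       pr (fun S => (forall D, List.In D l -> ~ D S) /\ ~ D S).
  apply: law_mono => //.
  - by apply: none_loc => D' [<-//|/hl[]].
  - by apply: loc_and => //; exact: loc_not.
  by move=> S h; split=> [D' i|]; apply: h; [right|left].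
move: pl; set x := pr (fun S => forall D, List.In D l -> ~ D S).
set y := pr _; set z := pr _; rewrite exprS; set w := (1 - c) ^+ j => h1 h2 h3 h4.
have h5 : x * (1 - pr D) <= (w + e / 2) * (1 - c) by apply: ler_pM => //; have := law_le1 lD; lra.
apply: le_trans h2 (le_trans h4 (le_trans (lerD h5 (lexx _)) _)).
by rewrite le_eqVlt; apply/orP; left; apply/eqP; ring.
Qed.

(** Circuits at widely separated scales are nearly independent, so a uniform lower bound c makes one
    of finitely many occur with high probability. *)
Lemma circ_whp (c : R) : 0 < c -> (forall n0 : int, exists2 n : int, n0 <= n & good (circ n) c) ->
  forall (e : R) (m : int), 0 < e -> exists (M : int) Z, [/\ m <= M, good Z (1 - e) &
   forall S, Z S -> exists n : int, [/\ m <= n, 3 * n <= M & circ n S]].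
Proof.
move=> c0 H e m e0.
have c1 : c <= 1 by have [n _ [lC _ h]] := H 0; apply: le_trans h (law_le1 lC).
pose K D := exists n : int, m <= n /\ D = circ n.
have c01 : 0 < c <= 1 by rewrite c0.
have [|l [hl pl]] := mix_none (K := K) c01 _ e0.
  move=> m'; have [n hn [h1 h2 h3]] := H (Num.max m (m' + 1)); exists (circ n); split=> //.
    by exists n; split=> //; lia.
  by apply: circ_out; lia.
have [M [mM hM]] : exists M : int, m <= M /\ forall D, List.In D l ->
   exists n : int, [/\ m <= n, 3 * n <= M & D = circ n].
  elim: l hl {pl} => [|D l IH] hl; first by exists m.
  have [M [mM hM]] := IH (fun D' i => hl D' (or_intror i)).
  have [[n [mn ->]] _] := hl D (or_introl erefl).
  exists (Num.max M (3 * n)); split; first by lia.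
  move=> D' [<-|/hM[n' [h1 h2 h3]]]; [exists n|exists n']; split=> //; lia.
have lN := none_loc (fun D i => (hl D i).2).
exists M, (fun S => ~ forall D, List.In D l -> ~ D S); split=> //.
  split; first exact: loc_not.
    move=> S S' e' h h'; apply: h => D iD DS; apply: (h' D iD).
    have [n [_ _ eD]] := hM D iD; rewrite eD in DS *; exact: circ_inc DS.
  by rewrite (law_not Hpr lN) lerB.
move=> S /existsNP[D /not_implyP[/hM[n [h1 h2 ->]] /contrapT h3]]; by exists n.
Qed.

(** First pass: the gluing event may be very unlikely, which still gives circuits a probability that
    does not depend on the scale. *)
Theorem circuits_io : percolates ->
  (forall m : int, 0 <= m -> exists (M : int) Z (k : R), [/\ m <= M, 0 < k, good Z k & glues m M Z]) ->
  exists2 c : R, 0 < c & forall n0 : int, exists2 n : int, n0 <= n & good (circ n) c.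
Proof.
move=> P G; have h2 : 0 < (2^-1 : R) <= 1 by lra.
have [M0 [M00 H]] := hub_circuits P h2; have [M [Z [k [M01 k0 gZ gl]]]] := G _ M00.
exists ((k ^+ 3 * (1 - 2^-1) ^+ 8) ^+ 2916); last exact: (H _ _ _ (ltW k0) M01 gZ gl).
by rewrite exprn_gt0 // mulr_gt0 // exprn_gt0 //; lra.
Qed.

Lemma bernoulli (e : R) n : 0 <= e <= 1 -> 1 - n%:R * e <= (1 - e) ^+ n.
Proof.
move=> /andP[e0 e1]; elim: n => [|n IH]; first by rewrite mul0r subr0.
rewrite exprS; apply: le_trans (_ : (1 - e) * (1 - n%:R * e) <= _); last first.
  by rewrite ler_wpM2l // subr_ge0.
rewrite -natr1; have : 0 <= n%:R * e * e by rewrite !mulr_ge0.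
nra.
Qed.

Lemma circ_glues (M0 M : int) (Z : event) : 0 <= M0 ->
  (forall S, Z S -> exists n : int, [/\ M0 <= n, 3 * n <= M & circ n S]) -> glues M0 M Z.
Proof.
move=> M00 hZ S /hZ[n [h1 h2 h3]] Q u u' v v' bQ c1 c2 bu bu' mv mv'.
have [|p hp] := @circ_hub n _ _ h3; first by lia.
have bQ' z : box (3 * n) z -> Q z by move=> bz; apply: bQ; move: bz; rewrite /box; lia.
have k1 : con nn (fun z => S z /\ Q z) p v by apply: hp c1 _ _ => //; move: bu mv; rewrite /box; lia.
have k2 : con nn (fun z => S z /\ Q z) p v' by apply: hp c2 _ _ => //; move: bu' mv'; rewrite /box; lia.
exact: (con_trans (con_sym nn_sym k1) k2).
Qed.

(** Second pass: a circuit at one of finitely many scales is a gluing event by [circ_glues], and is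
    likely by [circ_whp], so k can be taken to be 1 - e. *)
Theorem circuits_high : percolates ->
  (forall m : int, 0 <= m -> exists (M : int) Z (k : R), [/\ m <= M, 0 < k, good Z k & glues m M Z]) ->
  forall (d : R) (n0 : int), 0 < d -> exists2 n : int, n0 <= n & good (circ n) (1 - d).
Proof.
move=> P G d n0 d0; have [c c0 io] := circuits_io P G.
(* With k = 1 - e, the bound of [hub_circuits] is 1 - e to the power (3 + 8) * 2916. *)
pose N := (11 * 2916)%N; have N0 : 0 < (N%:R : R) by rewrite ltr0n.
pose e := Num.min 1 (d / N%:R).
have e0 : 0 < e by rewrite lt_min ltr01 divr_gt0.
have e01 : 0 < e <= 1 by rewrite e0 ge_min lexx.
have [M0 [M00 H]] := hub_circuits P e01.
have [M [Z [M01 gZ hZ]]] := circ_whp c0 io M0 e0.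
have ge : 0 <= 1 - e by rewrite subr_ge0; case/andP: e01.
have gl := circ_glues M00 hZ.
have [n hn [h1 h2 h3]] := H _ _ _ ge M01 gZ gl n0; exists n => //; split=> //.
apply: le_trans h3; rewrite -exprD -exprM; apply: le_trans (bernoulli _ _).
  rewrite lerB // -/N; have : e <= d / N%:R by rewrite /e ge_min lexx orbT.
  by rewrite ler_pdivlMr // mulrC.
by rewrite (ltW e0); case/andP: e01.
Qed.

End Hub.

(** * Expectations over finitely many independent bits *)

Section Indicator.
Variable R : realType.

Definition ind (Q : Prop) : R := (`[< Q >])%:R.

Lemma ind_ge0 Q : 0 <= ind Q. Proof. exact: ler0n. Qed.
Lemma ind_le1 Q : ind Q <= 1. Proof. by rewrite /ind; case: `[< Q >]; rewrite ?ler01. Qed.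
Lemma indT (Q : Prop) : Q -> ind Q = 1. Proof. by move=> q; rewrite /ind asboolT. Qed.
Lemma indF (Q : Prop) : ~ Q -> ind Q = 0. Proof. by move=> q; rewrite /ind asboolF. Qed.

Lemma ind_mono (Q Q' : Prop) : (Q -> Q') -> ind Q <= ind Q'.
Proof.
move=> QQ; have [q|q] := pselect Q; last by rewrite (indF q) ind_ge0.
by rewrite !indT //; exact: QQ.
Qed.

Lemma ind_iff (Q Q' : Prop) : (Q <-> Q') -> ind Q = ind Q'.
Proof. by move=> [? ?]; apply/eqP; rewrite eq_le !ind_mono. Qed.

Lemma ind_and (Q Q' : Prop) : ind (Q /\ Q') = ind Q * ind Q'.
Proof.
have [q|q] := pselect Q; last by rewrite (indF q) mul0r indF //; tauto.
by rewrite (indT q) mul1r; apply: ind_iff; tauto.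
Qed.

Lemma ind_or (Q Q' : Prop) : ind (Q \/ Q') <= ind Q + ind Q'.
Proof.
have [q|q] := pselect Q; first by rewrite (indT q) (le_trans (ind_le1 _)) // lerDl ind_ge0.
by rewrite (indF q) add0r; apply: ind_mono; tauto.
Qed.

Lemma ind_ex_seq (T : eqType) (r : seq T) (Q : T -> Prop) :
  ind (exists2 i, i \in r & Q i) <= \sum_(i <- r) ind (Q i).
Proof.
elim: r => [|a r IH]; first by rewrite big_nil indF //; case.
rewrite big_cons (le_trans _ (lerD (lexx _) IH)) // (le_trans _ (ind_or _ _)) //.
apply: ind_mono => -[i]; rewrite in_cons => /orP[/eqP->|ir] Qi; [by left|right].
by exists i.
Qed.

End Indicator.
Arguments ind {R}.

Section Bits.
Context {R : realType} {I : eqType}.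
Implicit Types (x y : I -> bool) (q : I -> R) (s t : seq I) (F G : (I -> bool) -> R).

Definition upd x (i : I) (b : bool) : I -> bool := fun j => if j == i then b else x j.

(** Expectation over independent bits at the indices in s, the other bits being frozen as in x; thus
    also a conditional expectation given the bits outside s. *)
Fixpoint Ex q s F x : R :=
  if s is i :: s' then
    q i * Ex q s' F (upd x i true) + (1 - q i) * Ex q s' F (upd x i false)
  else F x.

Definition dep (A : I -> Prop) (T : Type) (F : (I -> bool) -> T) :=
  forall x y, (forall i, A i -> x i = y i) -> F x = F y.

Lemma updE x i b : upd x i b i = b. Proof. by rewrite /upd eqxx. Qed.
Lemma updN x i j b : j != i -> upd x i b j = x j.
Proof. by move=> /negbTE ji; rewrite /upd ji. Qed.
Lemma updC x i j a b : i != j -> upd (upd x i a) j b = upd (upd x j b) i a.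
Proof.
move=> ij; apply/funext => k; rewrite /upd.
by case: (eqVneq k j) => // ->; rewrite eq_sym (negbTE ij).
Qed.
Lemma upd_id x i : upd x i (x i) = x.
Proof. by apply/funext => k; rewrite /upd; case: eqVneq => // ->. Qed.
Lemma upd_upd x i a b : upd (upd x i a) i b = upd x i b.
Proof. by apply/funext => k; rewrite /upd; case: eqVneq. Qed.

Lemma Ex_ext q s F G x : (forall y, F y = G y) -> Ex q s F x = Ex q s G x.
Proof. by move=> /funext->. Qed.

Lemma ExD q s F G x : Ex q s (fun y => F y + G y) x = Ex q s F x + Ex q s G x.
Proof. elim: s x => //= i s IH x; rewrite !IH; ring. Qed.

Lemma ExZ q s c F x : Ex q s (fun y => c * F y) x = c * Ex q s F x.
Proof. elim: s x => //= i s IH x; rewrite !IH; ring. Qed.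

Lemma Ex_cst q s c x : Ex q s (fun=> c) x = c.
Proof. elim: s x => //= i s IH x; rewrite !IH; ring. Qed.

Lemma ExB q s F G x : Ex q s (fun y => F y - G y) x = Ex q s F x - Ex q s G x.
Proof.
rewrite -mulN1r -ExZ -ExD; apply: Ex_ext => y; by rewrite mulN1r.
Qed.

Lemma Ex_sum q s (T : Type) (r : seq T) (F : T -> (I -> bool) -> R) x :
  Ex q s (fun y => \sum_(k <- r) F k y) x = \sum_(k <- r) Ex q s (F k) x.
Proof.
elim: r => [|k r IH].
  rewrite big_nil -[RHS](Ex_cst q s 0 x); apply: Ex_ext => y; by rewrite big_nil.
rewrite big_cons -IH -ExD; apply: Ex_ext => y; by rewrite big_cons.
Qed.

Definition probs q := forall i, 0 <= q i <= 1.

Lemma Ex_le q s F G x : probs q ->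
  (forall y, (forall j, j \notin s -> y j = x j) -> F y <= G y) ->
  Ex q s F x <= Ex q s G x.
Proof.
move=> hq; elim: s x => [|i s IH] x H /=; first by apply: H.
have /andP[q0 q1] := hq i.
apply: lerD; apply: ler_wpM2l; rewrite ?subr_ge0 //; apply: IH => y Hy; apply: H => j;
  by rewrite in_cons negb_or => /andP[ji js]; rewrite Hy // updN.
Qed.

Lemma Ex_ge0 q s F x : probs q -> (forall y, 0 <= F y) -> 0 <= Ex q s F x.
Proof. by move=> hq F0; rewrite -(Ex_cst q s 0 x); apply: Ex_le. Qed.

Lemma Ex_le1 q s F x : probs q -> (forall y, F y <= 1) -> Ex q s F x <= 1.
Proof. by move=> hq F0; rewrite -(Ex_cst q s 1 x); apply: Ex_le. Qed.

Lemma Ex_pull q s F x i : uniq s -> i \in s -> Ex q s F x =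
  q i * Ex q (rem i s) F (upd x i true) + (1 - q i) * Ex q (rem i s) F (upd x i false).
Proof.
elim: s x => //= j s IH x /andP[js us]; rewrite in_cons eq_sym.
have [->//|ji] /= := eqVneq j i => is_.
by rewrite !IH // !(updC _ _ _ ji) /=; ring.
Qed.

Lemma Ex_perm q s t F x : uniq s -> perm_eq s t -> Ex q s F x = Ex q t F x.
Proof.
elim: s t x => [|i s IH] t x us st; first by move: (perm_size st); case: t {st}.
have it : i \in t by rewrite -(perm_mem st) mem_head.
have ut : uniq t by rewrite -(perm_uniq st).
have st' : perm_eq s (rem i t).
  by rewrite -(perm_cons i); apply: perm_trans st (perm_to_rem it).
by rewrite (Ex_pull _ _ _ ut it) /= -!(IH (rem i t)) //; case/andP: us.
Qed.

Lemma Ex_base q s A F x y : dep A F -> (forall i, A i -> i \notin s -> x i = y i) ->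
  Ex q s F x = Ex q s F y.
Proof.
move=> dF; elim: s x y => [|i s IH] x y H /=; first by apply: dF => i Ai; apply: H.
by congr (_ * _ + _ * _); apply: IH => j Aj js; rewrite /upd; case: (eqVneq j i) => // ji;
   apply: H => //; rewrite in_cons negb_or ji.
Qed.

Lemma Ex_drop q s A F x i : dep A F -> ~ A i -> Ex q (i :: s) F x = Ex q s F x.
Proof.
move=> dF nA /=.
rewrite !(@Ex_base q s A F (upd x i _) x) //; first by ring.
all: by move=> j Aj _; rewrite updN //; apply: contra_notN nA => /eqP<-.
Qed.

Lemma Ex_filter q s A F x (a : pred I) : dep A F -> (forall i, i \in s -> ~~ a i -> ~ A i) ->
  Ex q s F x = Ex q (seq.filter a s) F x.
Proof.
move=> dF; elim: s x => //= i s IH x H.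
have IH' y : Ex q s F y = Ex q (seq.filter a s) F y.
  by apply: IH => j js; apply: H; rewrite in_cons js orbT.
case: ifP => ai /=; first by rewrite !IH'.
rewrite -IH' -[LHS]/(Ex q (i :: s) F x); apply: Ex_drop dF _.
by apply: H; rewrite ?mem_head ?ai.
Qed.

Lemma Ex_supp q s t F x : dep (fun i => i \in t) F -> uniq s -> uniq t ->
  {subset t <= s} -> Ex q s F x = Ex q t F x.
Proof.
move=> dF us ut ts; rewrite (Ex_filter q x (a := mem t) dF); last by move=> i _ /= /negP.
apply: Ex_perm; first exact: filter_uniq.
apply: uniq_perm => //; first exact: filter_uniq.
by move=> i; rewrite mem_filter /=; case: (boolP (i \in t)) => //= /ts.
Qed.

Lemma Ex_mul q s A B F G x : dep A F -> dep B G -> (forall i, i \in s -> A i -> ~ B i) ->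
  Ex q s (fun y => F y * G y) x = Ex q s F x * Ex q s G x.
Proof.
move=> dF dG; elim: s x => //= i s IH x dis.
have IH' y : Ex q s (fun z => F z * G z) y = Ex q s F y * Ex q s G y.
  by apply: IH => j js; apply: dis; rewrite in_cons js orbT.
rewrite !IH'.
have [Ai|nA] := pselect (A i).
  have nB : ~ B i by apply: dis; rewrite ?mem_head.
  have K b : Ex q s G (upd x i b) = Ex q s G x.
    by apply: Ex_base dG _ => j Bj _; rewrite updN //; apply: contra_notN nB => /eqP<-.
  by rewrite !K; ring.
have K b : Ex q s F (upd x i b) = Ex q s F x.
  by apply: Ex_base dF _ => j Bj _; rewrite updN //; apply: contra_notN nA => /eqP<-.
by rewrite !K; ring.
Qed.

(** Chebyshev's association inequality on a two-point space: the gap is at least p (1 - p) (a1 - a0)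
    (b1 - b0). *)
Lemma correlation_step (p a0 a1 b0 b1 c0 c1 : R) : 0 <= p <= 1 ->
  (a0 <= a1 /\ b0 <= b1) \/ (a1 <= a0 /\ b1 <= b0) -> a1 * b1 <= c1 -> a0 * b0 <= c0 ->
  (p * a1 + (1 - p) * a0) * (p * b1 + (1 - p) * b0) <= p * c1 + (1 - p) * c0.
Proof.
move=> /andP[p0 p1] mon h1 h0.
have m : 0 <= (a1 - a0) * (b1 - b0).
  case: mon => -[? ?]; first by rewrite mulr_ge0 ?subr_ge0.
  by rewrite -mulrNN mulr_ge0 // opprB subr_ge0.
have k : 0 <= p * (1 - p) * ((a1 - a0) * (b1 - b0)) by rewrite mulr_ge0 // mulr_ge0 ?subr_ge0.
have k1 : p * (a1 * b1) <= p * c1 by rewrite ler_wpM2l.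
have k0 : (1 - p) * (a0 * b0) <= (1 - p) * c0 by rewrite ler_wpM2l ?subr_ge0.
apply: le_trans (lerD k1 k0); rewrite -subr_ge0; apply: le_trans k _.
by rewrite le_eqVlt; apply/orP; left; apply/eqP; ring.
Qed.

Lemma Ex_upd q s F x i b : i \notin s ->
  Ex q s F (upd x i b) = Ex q s (fun y => F (upd y i b)) x.
Proof.
elim: s x => //= k s IH x; rewrite in_cons negb_or => /andP[ik ir].
by rewrite !(updC x _ _ ik) !IH.
Qed.

(* Harris' inequality along a decision tree: it suffices that at every stage some
   unrevealed bit acts monotonically, in the same direction, on both functions. *)
Lemma Ex_fkg_tree q F G : probs q ->
  (forall s x, uniq s -> s != [::] -> exists2 i, i \in s &
     (forall y, (forall j, j \notin s -> y j = x j) ->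
        F (upd y i false) <= F (upd y i true) /\ G (upd y i false) <= G (upd y i true)) \/
     (forall y, (forall j, j \notin s -> y j = x j) ->
        F (upd y i true) <= F (upd y i false) /\ G (upd y i true) <= G (upd y i false))) ->
  forall s x, uniq s -> Ex q s F x * Ex q s G x <= Ex q s (fun y => F y * G y) x.
Proof.
move=> hq tree s; have [n] := ubnP (size s); elim: n s => // n IH s sn x us.
have [->//=|s0] := eqVneq s [::]; have [i is_ mon] := tree s x us s0.
rewrite !(Ex_pull _ _ _ us is_).
have sz : (size (rem i s) < n)%N.
  by rewrite size_rem //; case: (s) s0 sn => //= a r _; rewrite ltnS.
apply: correlation_step => //; try by apply: IH => //; exact: rem_uniq.
have K (H : (I -> bool) -> R) (b c : bool) :
  (forall y, (forall j, j \notin s -> y j = x j) -> H (upd y i b) <= H (upd y i c)) ->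
  Ex q (rem i s) H (upd x i b) <= Ex q (rem i s) H (upd x i c).
  move=> HH; pose H' b y := H (upd y i b).
  have E d : Ex q (rem i s) H (upd x i d) = Ex q (rem i s) (H' d) x.
    by apply: Ex_upd; rewrite mem_rem_uniqF.
  rewrite !E; apply: Ex_le => // y Hy; apply: HH => j js; apply: Hy.
  by apply: contra js; exact: mem_rem.
by case: mon => mon; [left|right]; split; apply: K => y /mon[].
Qed.

Definition incr F := forall x y, (forall i, x i -> y i) -> F x <= F y.

Lemma incr_upd F x i : incr F -> F (upd x i false) <= F (upd x i true).
Proof. by move=> mF; apply: mF => j; rewrite /upd; case: eqP. Qed.

Lemma Ex_fkg q s F G x : probs q -> incr F -> incr G -> uniq s ->
  Ex q s F x * Ex q s G x <= Ex q s (fun y => F y * G y) x.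
Proof.
move=> hq mF mG; apply: Ex_fkg_tree => // -[//|i {}s] {}x us _.
exists i; first exact: mem_head.
by left=> y _; split; exact: incr_upd.
Qed.

Lemma Ex_incr q s F x y : probs q -> incr F -> (forall i, x i -> y i) ->
  Ex q s F x <= Ex q s F y.
Proof.
move=> hq mF; elim: s x y => [|i s IH] x y xy /=; first exact: mF.
have /andP[q0 q1] := hq i.
apply: lerD; apply: ler_wpM2l; rewrite ?subr_ge0 //; apply: IH => j;
  by rewrite /upd; case: eqP => // _; exact: xy.
Qed.

Lemma Ex_mono_q q q' s F x : probs q -> probs q' -> (forall i, q i <= q' i) -> incr F ->
  Ex q s F x <= Ex q' s F x.
Proof.
move=> hq hq' qq mF; elim: s x => //= i s IH x.
have /andP[q0 q1] := hq i; have /andP[q'0 q'1] := hq' i.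
have h1 := IH (upd x i true); have h0 := IH (upd x i false).
have h : Ex q s F (upd x i false) <= Ex q s F (upd x i true).
  by apply: Ex_incr => // j; rewrite /upd; case: eqP.
have h' := qq i.
have k1 : q' i * Ex q s F (upd x i true) <= q' i * Ex q' s F (upd x i true) by rewrite ler_wpM2l.
have k0 : (1 - q' i) * Ex q s F (upd x i false) <= (1 - q' i) * Ex q' s F (upd x i false).
  by rewrite ler_wpM2l ?subr_ge0.
have k : 0 <= (q' i - q i) * (Ex q s F (upd x i true) - Ex q s F (upd x i false)).
  by rewrite mulr_ge0 ?subr_ge0.
apply: le_trans (lerD k1 k0); rewrite -subr_ge0; apply: le_trans k _.
by rewrite le_eqVlt; apply/orP; left; apply/eqP; ring.
Qed.

(** The parameters are changed one bit at a time, and each change costs at most e because F takes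
    values in [0, 1]. *)
Lemma Ex_lip q q' s F x (e : R) : probs q -> probs q' ->
  (forall y, 0 <= F y <= 1) -> (forall i, i \in s -> `|q i - q' i| <= e) ->
  Ex q s F x <= Ex q' s F x + (size s)%:R * e.
Proof.
move=> hq hq' F01; elim: s x => [|i s IH] x He /=; first by rewrite mul0r addr0.
have /andP[q0 q1] := hq i; have /andP[q'0 q'1] := hq' i.
have H1 y : Ex q s F y <= Ex q' s F y + (size s)%:R * e.
  by apply: IH => j js; apply: He; rewrite in_cons js orbT.
have := H1 (upd x i true); have := H1 (upd x i false).
have b1 y : 0 <= Ex q s F y <= 1.
  by rewrite Ex_ge0 ?Ex_le1 // => z; case/andP: (F01 z).
have /andP[u0 u1] := b1 (upd x i true); have /andP[v0 v1] := b1 (upd x i false).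
have := He i (mem_head _ _); rewrite ler_norml => /andP[e1 e2].
have -> : (size s).+1%:R * e = (size s)%:R * e + e by rewrite -natr1 mulrDl mul1r.
move: u0 u1 v0 v1; set A := Ex q s F (upd x i true); set B := Ex q s F (upd x i false).
set A' := Ex q' s F (upd x i true); set B' := Ex q' s F (upd x i false).
set n := (size s)%:R * e => u0 u1 v0 v1 k0 k1.
have m1 : q' i * A <= q' i * (A' + n) by rewrite ler_wpM2l.
have m0 : (1 - q' i) * B <= (1 - q' i) * (B' + n) by rewrite ler_wpM2l ?subr_ge0.
have m2 : (q i - q' i) * (A - B) <= e.
  apply: le_trans (ler_norm _) _; rewrite normrM -[leRHS]mulr1; apply: ler_pM => //.
    by rewrite ler_norml e1 e2.
  by rewrite ler_norml; apply/andP; split; lra.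
have -> : q i * A + (1 - q i) * B = q' i * A + (1 - q' i) * B + (q i - q' i) * (A - B) by ring.
have := lerD (lerD m1 m0) m2; set z := _ + _ + e; suff -> : z = q' i * A' + (1 - q' i) * B' + (n + e) by [].
by rewrite /z; ring.
Qed.

End Bits.
Arguments probs {R I} q.
Arguments incr {R I} F.

Lemma Ex_map (R : realType) (I J : eqType) (q : I -> R) (h : J -> I) (A : J -> Prop)
  (F : (J -> bool) -> R) s x y : dep A F ->
  (forall i j, A i -> A j -> h i = h j -> i = j) -> (forall i, i \in s -> A i) ->
  (forall i, A i -> y i = x (h i)) ->
  Ex q (map h s) (fun x => F (x \o h)) x = Ex (q \o h) s F y.
Proof.
move=> dF inj; elim: s x y => [|i s IH] x y sA xy /=.
  by apply: dF => i Ai /=; rewrite xy.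
have As j : j \in s -> A j by move=> js; apply: sA; rewrite in_cons js orbT.
have Ai : A i by apply: sA; rewrite mem_head.
have K b j : A j -> upd y i b j = upd x (h i) b (h j).
  move=> Aj; rewrite /upd; case: (eqVneq j i) => [->|ji]; first by rewrite eqxx.
  rewrite ifF ?xy //; apply: contra_neqF ji => /eqP; exact: inj.
by rewrite (IH _ (upd y i true)) ?(IH _ (upd y i false)) //; exact: K.
Qed.

Lemma Ex_flip (R : realType) (I : eqType) (q : I -> R) (F : (I -> bool) -> R) s x :
  Ex q s (fun x => F (fun i => ~~ x i)) x = Ex (fun i => 1 - q i) s F (fun i => ~~ x i).
Proof.
elim: s x => //= i s IH x; rewrite !IH.
have E b : (fun j => ~~ upd x i b j) = upd (fun j => ~~ x j) i (~~ b).
  by apply/funext => j; rewrite /upd; case: eqP.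
by rewrite !E /=; ring.
Qed.

(** * Colouring the open clusters of a region *)

Notation conf := (rindex -> bool).

Definition oadj (x : conf) (u v : vertex) : Prop := exists e, edge_joins e u v /\ x (inl e).

Lemma edge_joins_sym e u v : edge_joins e u v -> edge_joins e v u.
Proof. by case; [right|left]. Qed.

Lemma edge_joins_nn e u v : edge_joins e u v -> nn u v.
Proof. by move=> h; apply/nn_adjP; exists e. Qed.

Lemma oadj_nn x u v : oadj x u v -> nn u v.
Proof. by case=> e [/edge_joins_nn]. Qed.

Lemma oadj_sym x u v : oadj x u v -> oadj x v u.
Proof. by case=> e [/edge_joins_sym h xe]; exists e. Qed.

Lemma edge_unique e e' u v : edge_joins e u v -> edge_joins e' u v -> e = e'.
Proof.
case: e e' => -[a b] c [[a' b'] c']; rewrite /edge_joins /edge_src /edge_dst /=.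
by case: c; case: c' => /=; case=> -[<- <-] [] [] h1 h2;
  (try (by move: h1 h2 => [? ?] [? ?]; exfalso; lia)); move: h1 h2 => [? ?] [? ?]; congr (_, _, _); lia.
Qed.

Definition gbit (G : vertex -> Prop) (i : rindex) : Prop :=
  match i with inl e => G (edge_src e) /\ G (edge_dst e) | inr v => G v end.

Section Colour.
Variable key : vertex -> nat.

(** The order [key] that selects representatives is a parameter, because a lattice symmetry
    transforms it into another one; [black_order] shows that the law of the colouring does not
    depend on it. *)
Definition blackG (G : vertex -> Prop) (x : conf) (v : vertex) : Prop :=
  exists rep, [/\ con (oadj x) G v rep,
    forall u, con (oadj x) G v u -> (key rep <= key u)%N & x (inr rep)].

Hypothesis key_inj : injective key.

Lemma rep_exists G x v : G v -> exists rep, con (oadj x) G v rep /\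
  forall u, con (oadj x) G v u -> (key rep <= key u)%N.
Proof.
move=> Gv; pose p n := `[< exists u, con (oadj x) G v u /\ key u = n >].
have ex : exists n, p n by exists (key v); apply/asboolP; exists v; split=> //; exact: con_refl.
have [n /asboolP[u [cu <-]] mn] := ex_minnP ex.
by exists u; split=> // u' cu'; apply: mn; apply/asboolP; exists u'.
Qed.

Lemma rep_unique G x v r r' : con (oadj x) G v r -> con (oadj x) G v r' ->
  (forall u, con (oadj x) G v u -> (key r <= key u)%N) ->
  (forall u, con (oadj x) G v u -> (key r' <= key u)%N) -> r = r'.
Proof.
by move=> c c' h h'; apply: key_inj; apply/eqP; rewrite eqn_leq h // h'.
Qed.

Lemma con_dep G x y u v : (forall i, gbit G i -> x i = y i) ->
  con (oadj x) G u v -> con (oadj y) G u v.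
Proof.
move=> e c; have Gu := con_l c; move: v c; apply: con_ind; first exact: con_refl.
move=> v w uv c [f [fj xf]] Gw; apply: (con_step c _ Gw); exists f; split=> //.
by rewrite -e //=; have := con_r uv; case: fj => -[-> ->].
Qed.

Lemma blackG_dep G x y v : (forall i, gbit G i -> x i = y i) -> blackG G x v -> blackG G y v.
Proof.
move=> e [r [c m xr]].
have e' i : gbit G i -> y i = x i by move=> /e.
exists r; split; first exact: con_dep c.
  by move=> u /(con_dep e') /m.
by rewrite -e //=; exact: con_r c.
Qed.

Lemma blackG_local (G G' : vertex -> Prop) x v : (forall z, G' z -> G z) ->
  (forall u, con (oadj x) G v u -> G' u) -> (blackG G x v <-> blackG G' x v).
Proof.
move=> sub cl.
have E u : con (oadj x) G v u <-> con (oadj x) G' v u.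
  split; last exact: con_sub.
  move=> c; apply: con_sub (con_self c) => z; exact: cl.
split=> -[r [c m xr]]; exists r; split=> //; try exact/E.
  by move=> u /E/m.
by move=> u /E/m.
Qed.

Lemma blackG_sub G x v : blackG G x v -> G v.
Proof. by case=> r [/con_l]. Qed.

Lemma blackG_con G x u v : con (oadj x) G u v -> blackG G x u -> blackG G x v.
Proof.
move=> uv [r [c m xr]]; have vu := con_sym (@oadj_sym x) uv.
exists r; split=> //; first exact: con_trans vu c.
by move=> z vz; apply: m; exact: con_trans uv vz.
Qed.

(** The representative is already found inside the box L. Being a minimum over natural numbers, it
    exists even in an infinite cluster, so this holds for large L at every p and finite-volume
    approximation requires no decay of clusters. *)
Definition stable (L : int) (x : conf) (v : vertex) : Prop :=
  exists rep, con (oadj x) (fun z => box L z) v rep /\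
    forall u, con (oadj x) (fun=> True) v u -> (key rep <= key u)%N.

Lemma con_box adj (S : vertex -> Prop) u v : con adj S u v ->
  exists L : nat, con adj (fun z => S z /\ box L%:Z z) u v.
Proof.
move=> c; have Su := con_l c; move: v c; apply: con_ind.
  by exists `|nrm u|%N; apply: con_refl; split=> //; rewrite /box; lia.
move=> v w _ [L c] vw Sw; exists (maxn L `|nrm w|%N).
apply: (@con_step _ _ _ v) => //; last by split=> //; rewrite /box; lia.
by apply: con_sub c => z [Sz bz]; split=> //; move: bz; rewrite /box; lia.
Qed.

Lemma stable_mono L L' x v : L <= L' -> stable L x v -> stable L' x v.
Proof.
move=> LL [r [c m]]; exists r; split=> //; apply: con_sub c => z; rewrite /box; lia.
Qed.

Lemma stable_ex x v : exists L : nat, stable L%:Z x v.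
Proof.
have [r [c m]] := @rep_exists (fun=> True) x v I.
have [L cL] := con_box c; exists L, r; split=> //; by apply: con_sub cL => z [].
Qed.

Lemma stable_black (L : int) (G : vertex -> Prop) x v : stable L x v -> (forall z, box L z -> G z) ->
  (blackG G x v <-> blackG (fun=> True) x v).
Proof.
move=> [r [c m]] sub.
have cG : con (oadj x) G v r by apply: con_sub c.
have cT : con (oadj x) (fun=> True) v r by apply: con_sub c.
have toT u : con (oadj x) G v u -> con (oadj x) (fun=> True) v u by apply: con_sub.
split=> -[r' [c' m' xr]].
  have e : r = r' by apply: (rep_unique cG c') => // u /toT /m.
  by rewrite -e in xr; exists r.
have e : r = r' by exact: rep_unique cT c' m m'.
by rewrite -e in xr; exists r; split=> // u /toT /m.
Qed.

Lemma con_avoid G (x y : conf) e a b z u : (forall i, i != inl e -> x i = y i) ->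
  edge_joins e a b -> ~ con (oadj x) G z a -> ~ con (oadj x) G z b ->
  con (oadj x) G z u -> con (oadj y) G z u.
Proof.
move=> exy eab na nb c; have Gz := con_l c; move: u c; apply: con_ind; first exact: con_refl.
move=> v w zv c [f [fj xf]] Gw; apply: (con_step c _ Gw); exists f; split=> //.
have zw : con (oadj x) G z w by apply: (con_step zv _ Gw); exists f.
rewrite -exy //; apply/eqP => -[fe]; rewrite fe in fj.
case: eab fj => -[h1 h2] [] [h3 h4]; rewrite h1 h2 in h3 h4; subst => //.
Qed.

Lemma con_upd_mono G (x : conf) e z u :
  con (oadj (upd x (inl e) false)) G z u -> con (oadj (upd x (inl e) true)) G z u.
Proof.
apply: con_adj => p q [f [fj xf]]; exists f; split=> //; move: xf; rewrite /upd.
by case: eqP.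
Qed.

(** Opening e can only attach further vertices to the cluster of v, which v represents in either
    state; the attached vertices take the colour of v. So opening e blackens vertices if v is black
    and whitens them if v is white. *)
Lemma black_monotone_edge G (x : conf) e a b v : edge_joins e a b ->
  (forall c u, con (oadj (upd x (inl e) c)) G v u -> (key v <= key u)%N) ->
  (forall c, con (oadj (upd x (inl e) c)) G v a) -> G b ->
  forall z, if x (inr v) then blackG G (upd x (inl e) false) z -> blackG G (upd x (inl e) true) z
            else blackG G (upd x (inl e) true) z -> blackG G (upd x (inl e) false) z.
Proof.
move=> eab mv va Gb z; set x0 := upd x (inl e) false; set x1 := upd x (inl e) true.
have xv c : upd x (inl e) c (inr v) = x (inr v) by [].
have av c := con_sym (@oadj_sym (upd x (inl e) c)) (va c).
have Gv : G v by exact: con_l (va true).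
have nob : ~ con (oadj x1) G z v ->
   (forall u, con (oadj x0) G z u <-> con (oadj x1) G z u).
  move=> nv u; split; first exact: con_upd_mono.
  have na : ~ con (oadj x1) G z a by move=> k; apply: nv; exact: con_trans k (av true).
  have nb : ~ con (oadj x1) G z b.
    move=> k; apply: na; apply: con_step k _ (con_r (va true)).
    by exists e; split; [exact: edge_joins_sym|exact: updE].
  by apply: con_avoid eab na nb => i /negbTE ie; rewrite /x0 /x1 /upd ie.
case: ifP => xvb.
  move=> [r [c m xr]].
  have [zv|nv] := pselect (con (oadj x1) G z v).
    exists v; split=> //.
    move=> u zu; apply: (mv true); exact: con_trans (con_sym (@oadj_sym x1) zv) zu.
  have E := nob nv; exists r; split=> //; first exact/E.
  by move=> u /E /m.
move=> [r [c m xr]].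
have nv : ~ con (oadj x1) G z v.
  move=> zv; have rv : r = v.
    apply: key_inj; apply/eqP; rewrite eqn_leq m //=; apply: (mv true).
    exact: con_trans (con_sym (@oadj_sym x1) zv) c.
  by move: xr; rewrite rv /x1 (xv true) xvb.
have E := nob nv; exists r; split=> //; first exact/E.
by move=> u /E /m.
Qed.

Lemma black_monotone_vertex G (x : conf) v z :
  blackG G (upd x (inr v) false) z -> blackG G (upd x (inr v) true) z.
Proof.
have E b u : con (oadj (upd x (inr v) b)) G z u <-> con (oadj x) G z u.
  by split; apply: con_adj => p q [f [fj xf]]; exists f.
move=> [r [c m xr]]; exists r; split; first by apply/E; move/E: c.
  by move=> u /E h; apply: m; apply/E.
by move: xr; rewrite /upd; case: eqP.
Qed.

Section Fkg.
Variables (R : realType) (q : rindex -> R) (hq : probs q) (G : vertex -> Prop).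

(* At every stage of the exploration, query a bit of the smallest vertex whose
   cluster or colour is not yet determined: being the representative of its
   cluster, it makes the colouring monotone in that bit. *)
Lemma black_fkg (f g : (vertex -> Prop) -> R) s x : uniq s ->
  (forall S S' : vertex -> Prop, (forall z, S z -> S' z) -> f S <= f S') ->
  (forall S S' : vertex -> Prop, (forall z, S z -> S' z) -> g S <= g S') ->
  Ex q s (fun x => f (blackG G x)) x * Ex q s (fun x => g (blackG G x)) x <=
  Ex q s (fun x => f (blackG G x) * g (blackG G x)) x.
Proof.
move=> us mf mg; apply: Ex_fkg_tree us => // {}s {}x us s0.
pose rev u v := exists e, [/\ edge_joins e u v, inl e \notin s & x (inl e)].
have rev_sym u v : rev u v -> rev v u by case=> e [/edge_joins_sym ? ? ?]; exists e.
(* [K v] is the known part of the cluster of v. It is loose while an unrevealed edge may enlarge it,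
   and settled once it is complete and its colour is revealed. *)
pose K := con rev G.
pose loose v := exists e a b, [/\ inl e \in s, edge_joins e a b, K v a, G b & ~ K v b].
pose settled v := ~ loose v /\ exists r, [/\ K v r, forall u, K v u -> (key r <= key u)%N & inr r \notin s].
have Ky y v u : (forall j, j \notin s -> y j = x j) -> K v u -> con (oadj y) G v u.
  move=> hy; apply: con_adj => p q' [e [ej es xe]]; exists e; split=> //; by rewrite hy.
have yK y v u : (forall j, j \notin s -> y j = x j) -> ~ loose v -> con (oadj y) G v u -> K v u.
  move=> hy nl c; have Gv := con_l c; move: u c; apply: con_ind; first exact: con_refl.
  move=> p w vp Kp [e [ej ye]] Gw.
  have [es|es] := boolP (inl e \in s); last by apply: (con_step Kp _ Gw); exists e; split=> //; rewrite -hy.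
  by apply: contrapT => nK; apply: nl; exists e, p, w.
have Keq u v : K u v -> forall w, K u w <-> K v w.
  by move=> uv w; split=> h; [exact: con_trans (con_sym rev_sym uv) h|exact: con_trans uv h].
have [alls|] := pselect (forall v, G v -> settled v).
  have [i is_] : exists i, i \in s by case: (s) s0 => // i s1 _; exists i; exact: mem_head.
  exists i => //.
  left=> y hy.
  have agree b j : j \notin s -> upd y i b j = x j.
    by move=> js; rewrite updN ?hy //; apply: contraNneq js => ->.
  suff E : blackG G (upd y i false) = blackG G (upd y i true) by rewrite E.
  apply/funext => v; apply/propext.
  have dir b c : blackG G (upd y i b) v -> blackG G (upd y i c) v.
    move=> bl; have Gv := blackG_sub bl; have [nl [r [Kr mr rs]]] := alls v Gv.
    move: bl => [r' [c' m' xr']].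
    have er : r' = r.
      apply: (rep_unique c' _ m'); first by apply: Ky Kr; exact: agree.
      by move=> u cu; apply: mr; apply: yK nl cu; exact: agree.
    subst r'; exists r; split.
    - by apply: Ky Kr; exact: agree.
    - by move=> u cu; apply: mr; apply: yK nl cu; exact: agree.
    - by rewrite agree // -(agree b).
  by split; exact: dir.
move=> /existsNP[v0 /not_implyP[Gv0 ns0]].
pose p n := `[< exists v, [/\ G v, ~ settled v & key v = n] >].
have ex : exists n, p n by exists (key v0); apply/asboolP; exists v0.
have [n /asboolP[v [Gv nsv ev]] mn] := ex_minnP ex.
have small u : G u -> (key u < key v)%N -> settled u.
  move=> Gu uv; apply: contrapT => nu; move: uv; rewrite ltnNge => /negP; apply.
  by rewrite ev; apply: mn; apply/asboolP; exists u.
(* A smaller vertex u in the final cluster of v is settled, so its known cluster is complete and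
   contains v, which would make v settled. Hence v represents its cluster whatever the remaining
   bits are. *)
have vmin y u : (forall j, j \notin s -> y j = x j) -> con (oadj y) G v u -> (key v <= key u)%N.
  move=> hy vu; rewrite leqNgt; apply/negP => uv; apply: nsv.
  have [nl [r [Kr mr rs]]] := small u (con_r vu) uv.
  have Kuv : K u v by apply: yK hy nl _; exact: (con_sym (@oadj_sym y) vu).
  split.
    move=> [e [a [b [es ej Ka Gb nK]]]]; apply: nl; exists e, a, b; split=> //; first exact/(Keq _ _ Kuv).
    by move/(Keq _ _ Kuv).
  by exists r; split=> // [|w]; [exact/(Keq _ _ Kuv)|move/(Keq _ _ Kuv)/mr].
have [vs|vs] := boolP (inr v \in s).
  exists (inr v) => //; left=> y hy.
  by split; [apply: mf|apply: mg] => z; exact: black_monotone_vertex.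
(* The colour bit of v is revealed, so v is unsettled only because it is loose; the known colour
   then fixes the direction in which the queried edge acts. *)
have [[e [a [b [es ej Ka Gb nK]]]]|nl] := pselect (loose v); last first.
  exfalso; apply: nsv; split=> //; exists v; split=> //; first exact: con_refl.
  by move=> u Ku; apply: (vmin x) => //; exact: Ky Ku.
exists (inl e) => //.
have agree y c j : (forall j, j \notin s -> y j = x j) -> j \notin s -> upd y (inl e) c j = x j.
  by move=> hy js; rewrite updN ?hy //; apply: contraNneq js => ->.
have step y : (forall j, j \notin s -> y j = x j) -> forall z,
   if x (inr v) then blackG G (upd y (inl e) false) z -> blackG G (upd y (inl e) true) z
            else blackG G (upd y (inl e) true) z -> blackG G (upd y (inl e) false) z.
  move=> hy z; rewrite -(hy _ vs); apply: (black_monotone_edge ej) => //.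
    by move=> c u; apply: vmin => j; exact: agree.
  by move=> c; apply: Ky Ka => j; exact: agree.
case xv : (x (inr v)) step => step; [left|right] => y /step h;
  by split; [apply: mf|apply: mg] => z; exact: h.
Qed.

End Fkg.
End Colour.

(** * Choice of representatives and lattice symmetries in finite regions *)

Definition bits_of (gl : seq vertex) : seq rindex :=
  [seq inl (v, true) | v <- gl] ++ [seq inl (v, false) | v <- gl] ++ [seq inr v | v <- gl].

Lemma bits_of_uniq gl : uniq gl -> uniq (bits_of gl).
Proof.
move=> u; rewrite /bits_of !cat_uniq !map_inj_uniq ?u; try by move=> a b [].
rewrite /= andbT; apply/andP; split; apply/hasPn => i; last first.
  by case/mapP => v _ ->; apply/negP => /mapP[].
by rewrite mem_cat => /orP[] /mapP[v _ ->]; apply/negP => /mapP[].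
Qed.

Lemma gbit_bits gl i : gbit (fun z => z \in gl) i -> i \in bits_of gl.
Proof.
rewrite /bits_of !mem_cat; case: i => [[z b] [/= zg _]|v /= vg].
  by case: b; rewrite (map_f (fun v => inl (v, _))) ?orbT.
by rewrite (map_f inr) ?orbT.
Qed.

Lemma bits_ofP gl i : i \in bits_of gl ->
  match i with inl e => edge_src e \in gl | inr v => v \in gl end.
Proof. by rewrite /bits_of !mem_cat => /or3P[] /mapP[v vg ->]. Qed.

Lemma Ex_cat (R : realType) (I : eqType) (q : I -> R) s1 s2 F x :
  Ex q (s1 ++ s2) F x = Ex q s1 (Ex q s2 F) x.
Proof. by elim: s1 x => //= i s1 IH x; rewrite !IH. Qed.

Lemma Ex_eq_on (R : realType) (I : eqType) (q : I -> R) s F G x :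
  (forall y, (forall j, j \notin s -> y j = x j) -> F y = G y) -> Ex q s F x = Ex q s G x.
Proof.
elim: s x => [|i s IH] x H /=; first by apply: H.
by congr (_ * _ + _ * _); apply: IH => y Hy; apply: H => j;
  rewrite in_cons negb_or => /andP[ji js]; rewrite Hy // updN.
Qed.

Lemma Ex_any (R : realType) (I : eqType) (q : I -> R) s t F x y : uniq s -> uniq t ->
  dep (fun i => i \in s) F -> dep (fun i => i \in t) F -> Ex q s F x = Ex q t F y.
Proof.
move=> us ut ds dt; pose w := undup (s ++ t).
have -> : Ex q s F x = Ex q w F x.
  by rewrite (Ex_supp q x ds (undup_uniq _) us) // => i h; rewrite mem_undup mem_cat h.
rewrite (Ex_supp q x dt (undup_uniq _) ut); last by move=> i h; rewrite mem_undup mem_cat h orbT.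
by apply: Ex_base dt _ => i it /negP.
Qed.

Section Resample.
Variables (R : realType) (r : R) (gl : seq vertex) (f : (vertex -> Prop) -> R).

(** Sending one representative of a cluster to the other is injective on representatives, and all
    colour bits have the same parameter; so it transports one colouring to the other. *)
Lemma rep_resample (rho rho' : vertex -> vertex) x y : uniq gl ->
  (forall v, v \in gl -> rho v \in gl) -> (forall v, v \in gl -> rho' v \in gl) ->
  (forall v w, v \in gl -> w \in gl -> rho' v = rho' w -> rho v = rho w) ->
  (forall v, v \in gl -> rho' (rho v) = rho' v) ->
  Ex (fun=> r) gl (fun b => f (fun v => v \in gl /\ b (rho' v))) x =
  Ex (fun=> r) gl (fun b => f (fun v => v \in gl /\ b (rho v))) y.
Proof.
move=> ug r1 r2 eq12 rr.
pose F (b : vertex -> bool) := f (fun v => v \in gl /\ b (rho v)).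
pose t := undup (map rho gl).
have dF : dep (fun i => i \in t) F.
  move=> b c bc; congr f; apply/funext => v; apply/propext.
  by split=> -[vg]; rewrite bc // /t mem_undup map_f.
have tg i : i \in t -> i \in gl by rewrite mem_undup => /mapP[v vg ->]; exact: r1.
have E1 : Ex (fun=> r) gl F y = Ex (fun=> r) t F y by apply: Ex_supp => //; exact: undup_uniq.
have inj i j : i \in t -> j \in t -> rho' i = rho' j -> i = j.
  rewrite !mem_undup => /mapP[v vg ->] /mapP[w wg ->]; rewrite !rr // => e.
  by rewrite (eq12 v w vg wg e).
rewrite -/F E1; pose x' i := x (rho' i).
rewrite (_ : Ex (fun=> r) t F y = Ex (fun=> r) t F x'); last first.
  by apply: Ex_base dF _ => i it /negP.
have := @Ex_map R _ _ (fun=> r) rho' (fun i => i \in t) F t x x' dF inj (fun _ h => h) (fun _ _ => erefl).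
move=> <-; rewrite (_ : (fun b : vertex -> bool => f (fun v => v \in gl /\ b (rho' v))) = (fun b => F (b \o rho'))); last first.
  apply/funext => b; congr f; apply/funext => v; apply/propext => /=.
  by split=> -[vg]; rewrite ?rr // -?rr.
apply: Ex_supp => //.
- move=> b c bc; apply: dF => i it /=; apply: bc; exact: map_f.
- by rewrite map_inj_in_uniq ?undup_uniq.
- by move=> i /mapP[j /tg/r2 h ->].
Qed.

Lemma blackG_map key x (rho : vertex -> vertex) : injective key ->
  (forall v, v \in gl -> con (oadj x) (fun z => z \in gl) v (rho v) /\
    forall u, con (oadj x) (fun z => z \in gl) v u -> (key (rho v) <= key u)%N) ->
  forall y : conf, (forall e, y (inl e) = x (inl e)) ->
  blackG key (fun z => z \in gl) y = (fun v => v \in gl /\ y (inr (rho v))).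
Proof.
move=> ki hr y yx; apply/funext => v; apply/propext.
have E u : con (oadj y) (fun z => z \in gl) v u <-> con (oadj x) (fun z => z \in gl) v u.
  by split; apply: con_adj => a b [e [ej ye]]; exists e; split=> //; rewrite ?yx // -yx.
split.
  case=> s [c m ys]; have vg := con_l c; split=> //.
  have [h1 h2] := hr v vg; suff -> : rho v = s by [].
  by apply: (rep_unique ki h1 _ h2); [exact/E|move=> u /E/m].
case=> vg yr; have [h1 h2] := hr v vg; exists (rho v); split=> //; first exact/E.
by move=> u /E/h2.
Qed.

(** In [bits_of] the edge bits come before the colour bits, so it is enough to compare the
    colourings for each fixed edge configuration. *)
Lemma black_order (q : rindex -> R) key key' x : (forall v, q (inr v) = r) -> uniq gl ->
  injective key -> injective key' ->
  Ex q (bits_of gl) (fun x => f (blackG key (fun z => z \in gl) x)) x =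
  Ex q (bits_of gl) (fun x => f (blackG key' (fun z => z \in gl) x)) x.
Proof.
move=> qr ug ki ki'; rewrite /bits_of catA !(Ex_cat q (_ ++ _)); apply: Ex_ext => {}x.
have K k : injective k -> exists rho, forall v, v \in gl ->
   con (oadj x) (fun z => z \in gl) v (rho v) /\
    forall u, con (oadj x) (fun z => z \in gl) v u -> (k (rho v) <= k u)%N.
  move=> kin.
  have H (v : vertex) : exists s : vertex, v \in gl -> con (oadj x) (fun z => z \in gl) v s /\
    forall u, con (oadj x) (fun z => z \in gl) v u -> (k s <= k u)%N.
    have [vg|vg] := pselect (v \in gl); last by exists v.
    by have [s hs] := rep_exists k x (G := fun z => z \in gl) vg; exists s.
  by have [rho hrho] := choice H; exists rho.
have [rho hr] := K _ ki; have [rho' hr'] := K _ ki'.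
have red k rh : injective k -> (forall v, v \in gl ->
   con (oadj x) (fun z => z \in gl) v (rh v) /\
    forall u, con (oadj x) (fun z => z \in gl) v u -> (k (rh v) <= k u)%N) ->
   Ex q [seq inr v | v <- gl] (fun x => f (blackG k (fun z => z \in gl) x)) x =
   Ex (fun=> r) gl (fun b => f (fun v => v \in gl /\ b (rh v))) (fun v => x (inr v)).
  move=> kin hrh.
  rewrite (@Ex_eq_on _ _ _ _ _ (fun y => f (fun v => v \in gl /\ y (inr (rh v))))); last first.
    move=> y hy; congr f; apply: (blackG_map kin hrh) => e; apply: hy.
    by apply/negP => /mapP[].
  rewrite -(_ : q \o inr = (fun=> r)); last by apply/funext => v /=.
  apply: (@Ex_map R _ _ q inr (fun=> True) (fun b => f (fun v => v \in gl /\ b (rh v)))) => //.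
    by move=> b c bc; congr f; apply/funext => v; rewrite bc.
  by move=> i j _ _ [].
rewrite (red key rho) // (red key' rho') //.
apply: rep_resample => //.
- by move=> v /hr'[/con_r].
- by move=> v /hr[/con_r].
- move=> v w vg wg e; have [c1 m1] := hr v vg; have [c2 m2] := hr w wg.
  have [c1' m1'] := hr' v vg; have [c2' m2'] := hr' w wg.
  have vw : con (oadj x) (fun z => z \in gl) v w.
    by apply: con_trans c1 _; rewrite e; exact: (con_sym (@oadj_sym x) c2).
  apply: (rep_unique ki' c1' _ m1'); first exact: con_trans vw c2'.
  by move=> u vu; apply: m2'; exact: con_trans (con_sym (@oadj_sym x) vw) vu.
- move=> v vg; have [c1 m1] := hr v vg; have [c1' m1'] := hr' v vg.
  have [c2 m2] := hr _ (con_r c1').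
  apply: (rep_unique ki _ c1 _ m1); first exact: con_trans c1' c2.
  by move=> u vu; apply: m2; exact: con_trans (con_sym (@oadj_sym x) c1') vu.
Qed.

End Resample.

Definition bsym (s : vertex -> vertex) (h : rindex -> rindex) := [/\ injective h,
  forall v, h (inr v) = inr (s v),
  forall e, exists e', h (inl e) = inl e' /\ forall u v, edge_joins e u v -> edge_joins e' (s u) (s v),
  forall u v, nn (s u) (s v) -> nn u v & forall z, exists z', s z' = z].

Lemma bsym_inj s h : bsym s h -> injective s.
Proof. by case=> hi hv _ _ _ a b e; have /hi[] : h (inr a) = h (inr b) by rewrite !hv e. Qed.

Lemma bsym_oadj s h x u v : bsym s h -> (oadj x (s u) (s v) <-> oadj (x \o h) u v).
Proof.
case=> hi hv he hn hs; split.
  case=> e' [ej xe]; have /hn/nn_adjP[e eu] : nn (s u) (s v) by exact: edge_joins_nn ej.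
  exists e; split=> //=; have [e'' [-> k]] := he e.
  by rewrite (edge_unique (k _ _ eu) ej).
by case=> e [ej /=]; have [e' [-> k]] := he e => xe; exists e'; split=> //; exact: k.
Qed.

Lemma bsym_con s h x (G : vertex -> Prop) u v : bsym s h ->
  (con (oadj x) G (s u) (s v) <-> con (oadj (x \o h)) (fun z => G (s z)) u v).
Proof.
move=> bs; have [_ _ _ _ hs] := bs; split; last first.
  move=> c; have Gu := con_l c; move: v c; apply: con_ind; first exact: con_refl.
  by move=> a b _ c /(bsym_oadj _ _ _ bs) ab Gb; exact: con_step c ab Gb.
move=> c; have Gu := con_l c.
suff H w : con (oadj x) G (s u) w -> exists v', w = s v' /\ con (oadj (x \o h)) (fun z => G (s z)) u v'.
  by have [v' [/(bsym_inj bs) <-]] := H _ c.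
move: w; apply: con_ind; first by exists u; split=> //; exact: con_refl.
move=> a b _ [a' [-> c']] ab Gb; have [b' eb] := hs b; rewrite -eb in ab Gb *.
exists b'; split=> //; apply: (con_step c') => //; exact/(bsym_oadj _ _ _ bs).
Qed.

Lemma bsym_black s h key x (G : vertex -> Prop) v : bsym s h ->
  (blackG key G x (s v) <-> blackG (key \o s) (fun z => G (s z)) (x \o h) v).
Proof.
move=> bs; have [_ hv _ _ hs] := bs; split.
  case=> r [c m xr]; have [r' er] := hs r; subst r; exists r'; split; first exact/(bsym_con _ _ _ _ bs).
    by move=> u /(bsym_con _ _ _ _ bs)/m.
  by rewrite /= hv.
case=> r [c m xr]; exists (s r); split; first exact/(bsym_con _ _ _ _ bs).
  by move=> u; have [u' <-] := hs u => /(bsym_con _ _ _ _ bs)/m.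
by move: xr; rewrite /= hv.
Qed.

Lemma blackG_dep_bits (R : realType) gl key (f : (vertex -> Prop) -> R) :
  dep (fun i => i \in bits_of gl) (fun x => f (blackG key (fun z => z \in gl) x)).
Proof.
move=> x y xy; congr f; apply/funext => v; apply/propext.
by split; apply: blackG_dep => i /gbit_bits/xy.
Qed.

(** Relabelling the bits by h reproduces the colouring with the transported order [key \o s], and
    [black_order] restores the original one. *)
Lemma black_sym (R : realType) (q : rindex -> R) (r : R) s h key gl (f : (vertex -> Prop) -> R) x y :
  bsym s h -> injective key -> (forall i, q (h i) = q i) -> (forall v, q (inr v) = r) -> uniq gl ->
  Ex q (bits_of (map s gl)) (fun x => f (fun z => blackG key (fun z => z \in map s gl) x (s z))) x =
  Ex q (bits_of gl) (fun x => f (blackG key (fun z => z \in gl) x)) y.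
Proof.
move=> bs ki qh qr ug; have si := bsym_inj bs; have [hi _ _ _ _] := bs.
pose F' (y : conf) := f (blackG (key \o s) (fun z => z \in gl) y).
have EF : (fun x : conf => f (fun z => blackG key (fun z => z \in map s gl) x (s z))) =
   (fun x : conf => F' (x \o h)).
  apply/funext => z; congr f; apply/funext => v; apply/propext.
  have e : (fun z => s z \in map s gl : Prop) = (fun z => z \in gl : Prop).
    by apply/funext => w; rewrite mem_map.
  by split=> [/(bsym_black _ _ _ _ bs)|] k; [|apply/(bsym_black _ _ _ _ bs)]; move: k; rewrite e.
have dF' := @blackG_dep_bits R gl (key \o s) f.
rewrite EF (@Ex_any _ _ _ _ (map h (bits_of gl)) _ _ x).
- rewrite (@Ex_map R _ _ q h (fun i => i \in bits_of gl) F' _ _ (x \o h)) //; last by move=> i j _ _ /hi.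
  rewrite (_ : q \o h = q); last by apply/funext => i /=.
  rewrite /F' (black_order f _ qr ug (inj_comp ki si) ki).
  by apply: Ex_base (@blackG_dep_bits R gl key f) _ => i ib /negP.
- by apply: bits_of_uniq; rewrite map_inj_uniq.
- by rewrite map_inj_uniq //; exact: bits_of_uniq.
- rewrite -EF => z w zw; congr f; apply/funext => v; apply/propext.
  by split; apply: blackG_dep => i /gbit_bits/zw.
- by move=> z w zw; apply: dF' => i ib /=; apply: zw; exact: map_f.
Qed.

Definition hswap (i : rindex) : rindex :=
  match i with inl e => inl (swap e.1, ~~ e.2) | inr v => inr (swap v) end.
(** The reflection exchanges the two ends of a vertical edge, so the new source is the image of the
    old upper end. *)
Definition hflip (i : rindex) : rindex :=
  match i with inl e => inl (if e.2 then (e.1.1, - e.1.2 - 1) else flipy e.1, e.2)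
             | inr v => inr (flipy v) end.
Definition hshift c (i : rindex) : rindex :=
  match i with inl e => inl (shift c e.1, e.2) | inr v => inr (shift c v) end.

Lemma bsym_swap : bsym swap hswap.
Proof.
split=> //.
- move=> [[[a b] c]|[a b]] [[[a' b'] c']|[a' b']] //= [] => [-> -> /(can_inj negbK) -> //|-> ->//].
- move=> [[a b] c]; eexists; split; first by [].
  move=> [x y] [x' y']; rewrite /edge_joins /edge_src /edge_dst /swap /=.
  by case: c => /=; case=> -[[<- <-] [<- <-]] /=; [left|right|left|right].
- by move=> u v /swap_nn; rewrite !swapK.
- by move=> z; exists (swap z); rewrite swapK.
Qed.

Lemma bsym_flip : bsym flipy hflip.
Proof.
split=> //.
- move=> [[[a b] c]|[a b]] [[[a' b'] c']|[a' b']] //=.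
    by case: c; case: c' => //= -[-> h]; have -> : b = b' by lia.
  by case=> -> h; have -> : b = b' by lia.
- move=> [[a b] c]; eexists; split; first by [].
  move=> [x y] [x' y']; rewrite /edge_joins /edge_src /edge_dst /flipy /=.
  case: c => /=; case=> -[[<- <-] [<- <-]] /=.
  + by right; split; congr pair; lia.
  + by left; split; congr pair; lia.
  + by left.
  + by right.
- by move=> u v /flipy_nn; rewrite !flipyK.
- by move=> z; exists (flipy z); rewrite flipyK.
Qed.

Lemma bsym_shift c : bsym (shift c) (hshift c).
Proof.
case: c => c1 c2; split=> //.
- move=> [[[a b] c]|[a b]] [[[a' b'] c']|[a' b']] //= [] h1 h2.
    by move=> <-; move/addrI: h1 => ->; move/addrI: h2 => ->.
  by move/addrI: h1 => ->; move/addrI: h2 => ->.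
- move=> [[a b] c]; eexists; split; first by [].
  move=> [x y] [x' y']; rewrite /edge_joins /edge_src /edge_dst /shift /=.
  case: c => /=; case=> -[[<- <-] [<- <-]] /=; [left|right|left|right]; split=> //; congr pair; lia.
- by move=> u v; rewrite /nn /=; lia.
- by move=> [a b]; exists (a - c1, b - c2); rewrite /shift /=; congr pair; lia.
Qed.

(** * Probabilities of cylinder events *)

Section Meas.
Context {R : realType} {d : measure_display} {Omega : measurableType d}.
Variable P : probability Omega R.

Definition Pr (A : set Omega) : R := fine (P A).

Lemma P_fin A : measurable A -> (P A \is a fin_num)%E.
Proof. by move=> mA; exact: fin_num_measure. Qed.

Lemma PrE A : measurable A -> P A = (Pr A)%:E.
Proof. by move=> mA; rewrite /Pr fineK //; exact: P_fin. Qed.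

Lemma Pr_ge0 A : 0 <= Pr A.
Proof. by rewrite /Pr fine_ge0 // measure_ge0. Qed.

Lemma Pr_mono A B : measurable A -> measurable B -> A `<=` B -> Pr A <= Pr B.
Proof.
by move=> mA mB AB; apply: fine_le; rewrite ?P_fin //; apply: le_measure; rewrite ?inE.
Qed.

Lemma Pr_T : Pr setT = 1.
Proof. by rewrite /Pr probability_setT. Qed.

Lemma Pr_le1 A : measurable A -> Pr A <= 1.
Proof. by move=> mA; rewrite -Pr_T; apply: Pr_mono. Qed.

Lemma Pr_C A : measurable A -> Pr (~` A) = 1 - Pr A.
Proof.
move=> mA; have := probability_setC P mA.
by rewrite !PrE // ?EFinB; [rewrite -EFinB => -[]|exact: measurableC].
Qed.

Lemma Pr_U A B : measurable A -> measurable B -> A `&` B = set0 -> Pr (A `|` B) = Pr A + Pr B.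
Proof.
move=> mA mB AB; have := measureU P mA mB AB.
by rewrite /Pr => ->; rewrite fineD // P_fin.
Qed.

Lemma Pr_UI A B : measurable A -> measurable B -> Pr (A `|` B) + Pr (A `&` B) = Pr A + Pr B.
Proof.
move=> mA mB.
have mD : measurable (A `\` B) by exact: measurableD.
have mI : measurable (A `&` B) by exact: measurableI.
have -> : A `|` B = (A `\` B) `|` B by rewrite setUDl setDv setD0.
rewrite Pr_U //; last by rewrite setDE -setIA setICl setI0.
have -> : Pr A = Pr (A `\` B) + Pr (A `&` B).
  rewrite -Pr_U //; last by apply/seteqP; split=> // w [[_ nB] [_ ?]].
  by congr Pr; rewrite setUC setUIDK.
ring.
Qed.

Lemma Pr_sub2 A B : measurable A -> measurable B -> Pr (A `|` B) <= Pr A + Pr B.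
Proof. by move=> mA mB; rewrite -Pr_UI // lerDl Pr_ge0. Qed.

Lemma Pr_decr (E : nat -> set Omega) (e : R) : (forall n, measurable (E n)) ->
  (forall n, E n.+1 `<=` E n) -> (forall w, exists n, ~ E n w) -> 0 < e ->
  exists n, Pr (E n) < e.
Proof.
move=> mE dE vE e0.
have dE' : {homo E : n m / (n <= m)%N >-> (m <= n)%O}.
  by apply: homo_leq => [A|A B C|n]; [exact: lexx|by move=> h1 h2; exact: le_trans h2 h1|apply/subsetPset].
have cap0 : \bigcap_n E n = set0.
  by apply/seteqP; split=> // w h; have [n hn] := vE w; exact: hn (h n I).
have h0 : (P (E 0%N) < +oo)%E by rewrite ltey_eq P_fin.
have := @nonincreasing_cvg_mu _ _ _ P E h0 mE.
rewrite cap0 measure0 => /(_ measurable0 dE').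
move/fine_cvgP => [_ /cvgr_lt /(_ e e0)] [n _ /(_ n (leqnn n)) h].
by exists n.
Qed.

Lemma Pr_decr_inf (E : nat -> set Omega) (c : R) : (forall n, measurable (E n)) ->
  (forall n, E n.+1 `<=` E n) -> (forall n, c <= Pr (E n)) -> c <= Pr (\bigcap_n E n).
Proof.
move=> mE dE h.
have dE' : {homo E : n m / (n <= m)%N >-> (m <= n)%O}.
  by apply: homo_leq => [A|A B C|n]; [exact: lexx|by move=> h1 h2; exact: le_trans h2 h1|apply/subsetPset].
have mc : measurable (\bigcap_n E n) by exact: bigcapT_measurable.
have h0 : (P (E 0%N) < +oo)%E by rewrite ltey_eq P_fin.
have := @nonincreasing_cvg_mu _ _ _ P E h0 mE mc dE'.
move=> c1; rewrite -lee_fin -PrE //; apply: (cvge_to_ge c1).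
by apply: nearW => n /=; rewrite PrE // lee_fin.
Qed.

Lemma meas_cst (Q : Prop) : measurable [set w : Omega | Q].
Proof.
have [q|q] := pselect Q.
  by rewrite (_ : [set _ | _] = setT) //; apply/seteqP; split.
by rewrite (_ : [set _ | _] = set0) //; apply/seteqP; split.
Qed.

Lemma meas_ex (T : countType) (Q : T -> Omega -> Prop) :
  (forall t, measurable [set w | Q t w]) -> measurable [set w | exists t, Q t w].
Proof.
move=> mQ.
rewrite (_ : [set _ | _] = \bigcup_n [set w | exists2 t, unpickle n = Some t & Q t w]).
  apply: bigcupT_measurable => n; case e : (unpickle n) => [t|].
    rewrite (_ : [set _ | _] = [set w | Q t w]) //.
    by apply/seteqP; split=> w; [case=> t' [<-]|move=> h; exists t].
  rewrite (_ : [set _ | _] = set0) //; by apply/seteqP; split=> // w [].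
apply/seteqP; split=> w.
  by case=> t h; exists (pickle t) => //; exists t; rewrite ?pickleK.
by case=> n _ [t _ h]; exists t.
Qed.

Lemma meas_not (Q : Omega -> Prop) : measurable [set w | Q w] -> measurable [set w | ~ Q w].
Proof. exact: measurableC. Qed.

Lemma meas_all (T : countType) (Q : T -> Omega -> Prop) :
  (forall t, measurable [set w | Q t w]) -> measurable [set w | forall t, Q t w].
Proof.
move=> mQ; rewrite (_ : [set _ | _] = ~` [set w | exists t, ~ Q t w]).
  by apply: measurableC; apply: meas_ex => t; exact: meas_not.
apply/seteqP; split=> w /=; first by move=> h [t]; apply.
by move/forallNP => h t; apply: contrapT; exact: h.
Qed.

Lemma meas_and (Q Q' : Omega -> Prop) : measurable [set w | Q w] -> measurable [set w | Q' w] ->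
  measurable [set w | Q w /\ Q' w].
Proof. exact: measurableI. Qed.

Lemma meas_or (Q Q' : Omega -> Prop) : measurable [set w | Q w] -> measurable [set w | Q' w] ->
  measurable [set w | Q w \/ Q' w].
Proof. exact: measurableU. Qed.

Lemma meas_imp (Q Q' : Omega -> Prop) : measurable [set w | Q w] -> measurable [set w | Q' w] ->
  measurable [set w | Q w -> Q' w].
Proof.
move=> m m'; rewrite (_ : [set _ | _] = [set w | ~ Q w \/ Q' w]).
  by apply: meas_or => //; exact: meas_not.
by apply/seteqP; split=> w /=; [have [q|q] := pselect (Q w); tauto|tauto].
Qed.

Lemma meas_iff (Q Q' : Omega -> Prop) : (forall w, Q w <-> Q' w) ->
  measurable [set w | Q w] -> measurable [set w | Q' w].
Proof. by move=> h; rewrite (_ : [set w | Q w] = [set w | Q' w]) //; apply/seteqP; split=> w /h. Qed.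

Lemma meas_dep (I : eqType) (b : Omega -> I -> bool) (A : (I -> bool) -> Prop) (t : seq I) :
  (forall i, measurable [set w | b w i]) -> dep (fun i => i \in t) A ->
  measurable [set w | A (b w)].
Proof.
move=> mb; elim: t A => [|i t IH] A dA.
  apply: (@meas_iff (fun=> A (fun=> false))); last exact: meas_cst.
  by move=> w; rewrite (dA (b w) (fun=> false)).
have dU c : dep (fun i => i \in t) (fun x => A (upd x i c)).
  move=> x y xy; apply: dA => j; rewrite in_cons /upd; case: eqP => //= _; exact: xy.
apply: (@meas_iff (fun w => (b w i /\ A (upd (b w) i true)) \/ (~ b w i /\ A (upd (b w) i false)))).
  move=> w; have := upd_id (b w) i; case: (b w i) => ->; split.
  - by case=> -[].
  - by move=> ?; left.
  - by case=> -[].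
  - by move=> ?; right.
apply: meas_or; apply: meas_and; try exact: IH (dU _); first exact: mb.
apply: meas_not; exact: mb.
Qed.

Section Iid.
Variables (W : rindex -> Omega -> R) (hW : iid_uniform P W) (thr : rindex -> R).
Hypothesis hthr : probs thr.

Definition bits (w : Omega) : conf := fun i => W i w < thr i.

Lemma meas_bit i : measurable [set w | bits w i].
Proof.
have [mW _] := hW; have := mW i measurableT _ (measurable_itv `]-oo, (thr i)[).
rewrite setTI; apply: meas_iff => w; by rewrite /= in_itv.
Qed.

Lemma meas_le i t : measurable [set w | W i w <= t].
Proof.
have [mW _] := hW; have := mW i measurableT _ (measurable_itv `]-oo, t]).
rewrite setTI; apply: meas_iff => w; by rewrite /= in_itv.
Qed.

Lemma Pr_bit i : Pr [set w | bits w i] = thr i.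
Proof.
have [_ [hle _]] := hW; have /andP[t0 t1] := hthr i.
have le t : Pr [set w | W i w <= t] = Num.max 0 (Num.min t 1) by rewrite /Pr hle.
apply/eqP; rewrite eq_le; apply/andP; split.
  rewrite -[leRHS](_ : Num.max 0 (Num.min (thr i) 1) = _).
    by rewrite -le; apply: Pr_mono; [exact: meas_bit|exact: meas_le|move=> w; exact: ltW].
  by rewrite min_l // max_r.
rewrite leNgt; apply/negP; set p := Pr _ => pt.
(* For t strictly between, the event W <= t has probability t > p although it is contained in the
   event W < thr of probability p. *)
pose t := (p + thr i) / 2.
have tt : p < t < thr i by rewrite /t; lra.
have p0 : 0 <= p by exact: Pr_ge0.
have : Pr [set w | W i w <= t] <= p.
  apply: Pr_mono; [exact: meas_le|exact: meas_bit|].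
  by move=> w /= h; rewrite /bits (le_lt_trans h) //; lra.
by rewrite le min_l ?max_r; lra.
Qed.

Definition bitset (c : conf) (i : rindex) : set R :=
  if c i then `]-oo, (thr i)[%classic else `[(thr i), +oo[%classic.

Lemma bitsetE c i w : (W i @^-1` bitset c i) w <-> bits w i = c i.
Proof.
rewrite /bitset /preimage /= /bits; case: (c i) => /=; rewrite in_itv /= ?andbT; first by [].
by rewrite leNgt; split=> [/negbTE|->].
Qed.

Definition wt (c : conf) i : R := if c i then thr i else 1 - thr i.

Lemma Pr_bitset c i : P (W i @^-1` bitset c i) = (wt c i)%:E.
Proof.
have m : measurable (W i @^-1` bitset c i).
  have [mW _] := hW; have := mW i measurableT (bitset c i); rewrite setTI; apply.
  by rewrite /bitset; case: (c i).
rewrite PrE //; congr EFin; rewrite /wt.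
rewrite (_ : _ @^-1` _ = [set w | bits w i = c i]); last by apply/seteqP; split=> w /bitsetE.
case: (c i); first exact: Pr_bit.
rewrite -(Pr_bit i) -Pr_C; last exact: meas_bit.
by congr Pr; apply/seteqP; split=> w /=; case: (bits w i).
Qed.

Lemma Pr_cylinder (c : conf) (t : seq rindex) : uniq t ->
  Pr [set w | forall i, i \in t -> bits w i = c i] = \prod_(i <- t) wt c i.
Proof.
move=> ut; have [_ [_ hind]] := hW.
have := hind t (bitset c) ut; rewrite /Pr.
rewrite (_ : \bigcap_(i in _) _ = [set w | forall i, i \in t -> bits w i = c i]); last first.
  by apply/seteqP; split=> w /= h i it; [apply/bitsetE; exact: h|apply/bitsetE; exact: h].
move=> ->; last by move=> i; rewrite /bitset; case: (c i).
rewrite (eq_bigr (fun i => (wt c i)%:E)); last by move=> i _; exact: Pr_bitset.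
by rewrite prodEFin.
Qed.

Lemma meas_loc (A : conf -> Prop) (s : seq rindex) : dep (fun i => i \in s) A -> measurable [set w | A (bits w)].
Proof. by move=> dA; apply: meas_dep dA; exact: meas_bit. Qed.

(** The bits of t are fixed to their values in c and those of s are averaged; the induction moves
    one bit at a time from s to t. *)
Lemma Pr_Ex_cyl (A : conf -> Prop) (s t : seq rindex) (c : conf) : uniq (t ++ s) -> dep (fun i => i \in t ++ s) A ->
  Pr [set w | (forall i, i \in t -> bits w i = c i) /\ A (bits w)] =
  (\prod_(i <- t) wt c i) * Ex thr s (fun x => ind (A x)) c.
Proof.
elim: s t c => [|i s IH] t c us dA.
  rewrite cats0 in us dA; rewrite /=.
  have [a|a] := pselect (A c).
    rewrite (indT R a) mulr1 -Pr_cylinder //; congr Pr; apply/seteqP; split=> w /=; first by case.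
    by move=> h; split=> //; rewrite (dA _ c).
  rewrite (indF R a) mulr0 (_ : [set _ | _] = set0) ?/Pr ?measure0 //.
  by apply/seteqP; split=> // w [h]; rewrite (dA _ c).
have us' : uniq ((i :: t) ++ s) by move: us; rewrite -[i :: s]/([:: i] ++ s) uniq_catCA.
have dA' : dep (fun j => j \in (i :: t) ++ s) A.
  by move=> x y xy; apply: dA => j; rewrite mem_cat in_cons orbCA => h; apply: xy; rewrite mem_cat in_cons -orbA.
have it : i \notin t by move: us' => /= /andP[]; rewrite mem_cat negb_or => /andP[].
pose E b := [set w | (forall j, j \in i :: t -> bits w j = upd c i b j) /\ A (bits w)].
have mE b : measurable (E b).
  apply: (@meas_loc (fun x => (forall j, j \in i :: t -> x j = upd c i b j) /\ A x) ((i :: t) ++ s)).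
  have K x y : (forall j, j \in (i :: t) ++ s -> x j = y j) ->
    (forall j, j \in i :: t -> x j = upd c i b j) /\ A x ->
    (forall j, j \in i :: t -> y j = upd c i b j) /\ A y.
    move=> xy [h a]; split; last by rewrite -(dA' x y).
    by move=> j jt; rewrite -xy ?h // mem_cat jt.
  by move=> x y xy; apply/propext; split; apply: K => // j jt; rewrite xy.
have -> : [set w | (forall j, j \in t -> bits w j = c j) /\ A (bits w)] = E true `|` E false.
  apply/seteqP; split=> w.
    move=> [h a]; case e : (bits w i); [left|right]; split=> // j; rewrite in_cons /upd;
    by case: eqP => [->|_] //=; exact: h.
  have nt j : j \in t -> j != i by apply: contraTneq => ->.
  by case=> -[h a]; split=> // j jt; rewrite h ?in_cons ?jt ?orbT // updN // nt.
rewrite Pr_U //; last first.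
  apply/seteqP; split=> // w [[h _] [h' _]].
  by have := h i (mem_head _ _); rewrite h' ?mem_head // !updE.
rewrite !IH // !big_cons /= {1 3}/wt !updE.
have pr b : \prod_(j <- t) wt (upd c i b) j = \prod_(j <- t) wt c j.
  by apply: eq_big_seq => j jt; rewrite /wt updN //; apply: contraTneq jt => ->.
by rewrite !pr; ring.
Qed.

Lemma Pr_Ex (A : conf -> Prop) (s : seq rindex) (x : conf) : uniq s -> dep (fun i => i \in s) A ->
  Pr [set w | A (bits w)] = Ex thr s (fun x => ind (A x)) x.
Proof.
move=> us dA; have := @Pr_Ex_cyl A s [::] x us dA; rewrite big_nil mul1r => <-.
by congr Pr; apply/seteqP; split=> w //= [].
Qed.

End Iid.
End Meas.

(** * Laws of random colourings *)

Definition irange (n : int) : seq int := [seq k%:Z - n | k <- iota 0 (2 * `|n| + 1)].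
Definition boxl (n : int) : seq vertex :=
  [seq z <- [seq (a, b) | a <- irange n, b <- irange n] | box n z].

Lemma mem_boxl n z : (z \in boxl n) = box n z.
Proof.
rewrite mem_filter; case: (boolP (box n z)) => //= bz; case: z bz => a b bz.
have K (c : int) : `|c| <= n -> c \in irange n.
  move=> h; apply/mapP; exists (absz (c + n)); [rewrite mem_iota|]; lia.
apply/allpairsP; exists (a, b); split=> //=; apply: K; move: bz; rewrite /box /nrm /=; lia.
Qed.

Lemma boxl_uniq n : uniq (boxl n).
Proof.
apply: filter_uniq; apply: allpairs_uniq; last by move=> [a b] [c e] _ _ [-> ->].
all: by rewrite map_inj_uniq ?iota_uniq // => a b /addIr [].
Qed.

Section LawIntro.
Context {R : realType} {d : measure_display} {Omega : measurableType d}.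
Variable P : probability Omega R.
Variable col : Omega -> vertex -> Prop.
Hypothesis mcol : forall v, measurable [set w | col w v].

Lemma meas_col A : loc A -> measurable [set w | A (col w)].
Proof.
case=> n oA; pose b w v := `[< col w v >].
have E w : (fun v => is_true (b w v)) = col w by apply/funext => v; apply/propext; split=> /asboolP.
apply: (@meas_iff _ _ (fun w => A (fun v => b w v))); first by move=> w; rewrite E.
apply: (@meas_dep _ _ _ b (fun x => A (fun v => x v)) (boxl n)).
  by move=> v; apply: meas_iff (mcol v) => w; split=> /asboolP.
have K (x y : vertex -> bool) : (forall i, i \in boxl n -> x i = y i) -> A (fun v => x v) -> A (fun v => y v).
  by move=> xy; apply: oA => z bz; rewrite xy ?mem_boxl.
by move=> x y xy; apply/propext; split; apply: K => // i /xy.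
Qed.

Definition prc (A : event) : R := Pr P [set w | A (col w)].

Lemma law_intro :
  (forall A B, loc A -> loc B -> inc A -> inc B -> prc A * prc B <= prc (fun S => A S /\ B S)) ->
  (forall A, loc A -> prc (fun S => A (fun z => S (swap z))) = prc A) ->
  (forall A, loc A -> prc (fun S => A (fun z => S (flipy z))) = prc A) ->
  (forall c A, loc A -> prc (fun S => A (fun z => S (shift (dbl c) z))) = prc A) ->
  (forall (n : int) (e : R), 0 < e -> exists m : int, forall A B,
    on_set (fun z => box n z) A -> loc B -> on_set (fun z => ~~ box m z) B ->
    prc (fun S => A S /\ B S) <= prc A * prc B + e) -> law prc.
Proof.
move=> h1 h2 h3 h4 h5; split=> //.
- by move=> A _; exact: Pr_ge0.
- move=> A B lA lB AB; apply: Pr_mono; [exact: meas_col|exact: meas_col|by move=> w; exact: AB].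
- by move=> A lA; rewrite /prc -Pr_C //; exact: meas_col.
- by move=> A B lA lB; apply: Pr_UI; exact: meas_col.
Qed.

End LawIntro.

Section NoPerc.
Context {R : realType} (pr : event -> R) (Hpr : law pr).

(** Unlike an arm, this event ignores the colours inside the inner box, so mixing applies to it when
    m is large. *)
Definition crossing_annulus (m N : int) : event := fun S => exists u v,
  [/\ nrm u = m, nrm v = N & con nn (fun z => S z /\ m <= nrm z <= N) u v].

Lemma crossing_annulus_on m N : on_set (fun z => m <= nrm z <= N) (crossing_annulus m N).
Proof.
move=> S S' e [u [v [h1 h2 c]]]; exists u, v; split=> //; apply: con_sub c => z [Sz bz].
by split=> //; apply/e.
Qed.

(* If the arms of large boxes do not become certain, blocking events recur at
   infinitely many scales and mixing makes one of them occur. *)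
Lemma no_perc : ~ percolates pr -> forall (m0 : int) (e : R), 0 < e -> exists N : int, m0 <= N /\
  pr (arm (fun z => box m0 z) (fun z => box N z) (fun v => nrm v = N)) <= e.
Proof.
move=> np m0 e e0.
have [c c0 hc] : exists2 c : R, 0 < c & forall m, 0 <= m -> exists2 N : int, m <= N &
   pr (arm (fun z => box m z) (fun z => box N z) (fun v => nrm v = N)) < 1 - c.
  move/existsNP: np => [c /not_implyP[c0 /forallNP h]]; exists c => // m m0'.
  have := h m; move/not_andP => [//|/existsNP[N /not_implyP[mN ng]]]; exists N => //.
  rewrite ltNge; apply/negP => k; apply: ng; split=> //; last exact: arm_inc.
  exact: (arm_loc _ _ (fun _ h => h)).
have larm m N : loc (arm (fun z => box m z) (fun z => box N z) (fun v => nrm v = N)).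
  exact: (arm_loc _ _ (fun _ h => h)).
have c1 : c <= 1.
  by have [N _ h] := hc 0 (lexx 0); have := law_ge0 Hpr (larm 0 N); lra.
pose K D := exists m N : int, [/\ m0 <= m, m <= N & D = (fun S => ~ crossing_annulus m N S)].
have c01 : 0 < c <= 1 by rewrite c0.
have lca m N : loc (crossing_annulus m N).
  by exists N; apply: on_set_sub (@crossing_annulus_on m N) => z; rewrite /box; lia.
have [|l [hl pl]] := mix_none Hpr (K := K) c01 _ e0.
  move=> m'; pose m := Num.max (Num.max m0 0) (m' + 1).
  have m0' : 0 <= m by rewrite /m; lia.
  have [N mN hN] := hc m m0'.
  exists (fun S => ~ crossing_annulus m N S); split.
  - by exists m, N; split=> //; rewrite /m; lia.
  - exact: loc_not.
  - apply: on_set_not; apply: on_set_sub (@crossing_annulus_on m N) => z; rewrite /box /m; lia.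
  - rewrite (law_not Hpr (lca _ _)).
    rewrite lerBrDl -lerBrDr; apply: le_trans (ltW hN).
    apply: (law_mono Hpr (lca m N) (larm m N)) => S [u [v [h1 h2 h3]]]; exists u, v; split=> //.
      by rewrite /box h1.
    by apply: con_sub h3 => z [Sz bz]; split=> //; rewrite /box; lia.
have [N [mN hN]] : exists N : int, m0 <= N /\ forall D, List.In D l ->
   exists m n, [/\ m0 <= m, m <= n, n <= N & D = (fun S => ~ crossing_annulus m n S)].
  elim: l hl {pl} => [|D l IH] hl; first by exists m0.
  have [N [mN hN]] := IH (fun D' i => hl D' (or_intror i)).
  have [[m [n [h1 h2 ->]]] _] := hl D (or_introl erefl).
  exists (Num.max N n); split; first by lia.
  move=> D' [<-|/hN[m' [n' [k1 k2 k3 k4]]]]; [exists m, n|exists m', n']; split=> //; lia.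
exists N; split=> //; apply: le_trans pl; apply: law_mono => //.
  by apply: none_loc => D /hl[].
move=> S [u [v [hu hv c']]] D /hN[m [n [h1 h2 h3 ->]]]; apply.
have [||p [q [e1 e2 _ k]]] := con_trunc (fun x y h => star_nrm (nn_star h)) h2 c'.
- by move: hu; rewrite /box; lia.
- by rewrite hv.
by exists p, q; split=> //; apply: con_sub k => z [[]].
Qed.

End NoPerc.

Section Relabel.
Context {R : realType} {d : measure_display} {Omega : measurableType d}.
Variables (P : probability Omega R) (W : rindex -> Omega -> R) (hW : iid_uniform P W).
Variables (thr : rindex -> R) (hthr : probs thr).

Lemma Pr_relabel (h : rindex -> rindex) (A : conf -> Prop) s : injective h ->
  (forall i, thr (h i) = thr i) -> uniq s -> dep (fun i => i \in s) A ->
  Pr P [set w | A (bits W thr w \o h)] = Pr P [set w | A (bits W thr w)].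
Proof.
move=> hi th us dA; pose x0 : conf := fun=> false.
rewrite (@Pr_Ex _ _ _ _ _ hW _ hthr (fun x => A (x \o h)) (map h s) x0).
- have dF : dep (fun i => i \in s) (fun x => ind (A x) : R) by move=> x y xy; rewrite (dA _ _ xy).
  rewrite (@Ex_map R _ _ thr h (fun i => i \in s) (fun x => ind (A x)) s x0 (x0 \o h)) //.
    rewrite (_ : thr \o h = thr); last by apply/funext => i /=.
    by rewrite (@Pr_Ex _ _ _ _ _ hW _ hthr A s (x0 \o h)).
  by move=> i j _ _ /hi.
- by rewrite map_inj_uniq.
- by move=> x y xy; apply: dA => i is_ /=; apply: xy; exact: map_f.
Qed.

Lemma Pr_flip (A : conf -> Prop) s : (forall i, thr i = 1 - thr i) -> uniq s ->
  dep (fun i => i \in s) A ->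
  Pr P [set w | A (fun i => ~~ bits W thr w i)] = Pr P [set w | A (bits W thr w)].
Proof.
move=> th us dA; pose x0 : conf := fun=> false.
rewrite (@Pr_Ex _ _ _ _ _ hW _ hthr (fun x => A (fun i => ~~ x i)) s x0) //; last first.
  by move=> x y xy; apply: dA => i is_; rewrite xy.
have := @Ex_flip R _ thr (fun x => ind (A x)) s x0; rewrite /= => ->.
rewrite -(_ : thr = fun i => 1 - thr i); last by apply/funext => i; exact: th.
by rewrite (@Pr_Ex _ _ _ _ _ hW _ hthr A s (fun i => ~~ x0 i)).
Qed.

End Relabel.

(** * Bond percolation as a site colouring of the refined lattice *)

(* The vertex [u] sits at [2u], the edges sit at their midpoints, and the sites with
   two odd coordinates are the (always white) dual vertices. *)
Definition oddz (a : int) : bool := (a %% 2)%Z == 1.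
Definition half (z : vertex) : vertex := ((z.1 %/ 2)%Z, (z.2 %/ 2)%Z).
Definition rho (x : conf) (z : vertex) : bool :=
  if oddz z.1 && oddz z.2 then false
  else if ~~ oddz z.1 && ~~ oddz z.2 then true else x (inl (half z, oddz z.2)).
Definition site (e : edge) : vertex :=
  if e.2 then (2 * e.1.1, 2 * e.1.2 + 1) else (2 * e.1.1 + 1, 2 * e.1.2).

Lemma siteK z : oddz z.1 != oddz z.2 -> site (half z, oddz z.2) = z.
Proof.
rewrite /site /=; case: (boolP (oddz z.2)) => h2 h1; apply: vtx_eq; move: h1 h2;
  by rewrite /oddz /half /=; lia.
Qed.

Lemma rho_site x e : rho x (site e) = x (inl e).
Proof.
case: e => -[a b] c; rewrite /rho /site /half /oddz /=; case: c => /=.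
  have -> : ((2 * a) %% 2)%Z == 1 = false by lia.
  have -> : ((2 * b + 1) %% 2)%Z == 1 by lia.
  by rewrite /=; congr (x (inl (_, _))); apply: vtx_eq => /=; lia.
have -> : ((2 * b) %% 2)%Z == 1 = false by lia.
have -> : ((2 * a + 1) %% 2)%Z == 1 by lia.
by rewrite /=; congr (x (inl (_, _))); apply: vtx_eq => /=; lia.
Qed.

Variant rho_spec (x : conf) (z : vertex) : bool -> Prop :=
| RhoPrimal u : z = dbl u -> rho_spec x z true
| RhoDual u : z = (2 * u.1 + 1, 2 * u.2 + 1) -> rho_spec x z false
| RhoEdge e : z = site e -> rho_spec x z (x (inl e)).

Lemma rhoP x z : rho_spec x z (rho x z).
Proof.
have E : oddz z.1 != oddz z.2 -> rho_spec x z (x (inl (half z, oddz z.2))).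
  by move=> h; apply: RhoEdge; rewrite siteK.
rewrite /rho; case h1 : (oddz z.1) E; case h2 : (oddz z.2) => //= E; try exact: E.
- apply: (@RhoDual _ _ (half z)); apply: vtx_eq; move: h1 h2; rewrite /oddz /half /=; lia.
- apply: (@RhoPrimal _ _ (half z)); apply: vtx_eq; move: h1 h2; rewrite /oddz /half /=; lia.
Qed.

Lemma rho_dbl x u : rho x (dbl u) = true.
Proof.
have E (a : int) : oddz (2 * a) = false by rewrite /oddz; lia.
by rewrite /rho /= !E.
Qed.

Lemma rho_dep (F : vertex -> Prop) x y : (forall e, F (site e) -> x (inl e) = y (inl e)) ->
  forall z, F z -> rho x z = rho y z.
Proof.
move=> xy z Fz; rewrite /rho; case: ifP => //; case: ifP => // h1 h2; apply: xy.
by rewrite siteK //; move: h1 h2; case: (oddz z.1); case: (oddz z.2).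
Qed.

Lemma rho_mono (x y : conf) : (forall i, x i -> y i) -> forall z, rho x z -> rho y z.
Proof. by move=> xy z; rewrite /rho; case: ifP => //; case: ifP => // _ _; exact: xy. Qed.

Lemma rho_swap x z : rho x (swap z) = rho (x \o hswap) z.
Proof.
rewrite /rho /=; case: (boolP (oddz z.1)) => h1; case: (boolP (oddz z.2)) => h2 //=; by rewrite /swap /half /= ?h1 ?(negbTE h1).
Qed.

Lemma rho_flip x z : rho x (flipy z) = rho (x \o hflip) z.
Proof.
case: z => a b; rewrite /rho /= /half /flipy /=.
have -> : oddz (- b) = oddz b by rewrite /oddz; lia.
case: (boolP (oddz a)) => h1; case: (boolP (oddz b)) => h2 //=; congr (x (inl (_, _))); apply: vtx_eq => /=;
  by move: h1 h2; rewrite /oddz; lia.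
Qed.

Lemma rho_shift x c z : rho x (shift (dbl c) z) = rho (x \o hshift c) z.
Proof.
case: z c => a b [c e]; rewrite /rho /= /half /shift /dbl /=.
have -> : oddz (2 * c + a) = oddz a by rewrite /oddz; lia.
have -> : oddz (2 * e + b) = oddz b by rewrite /oddz; lia.
case: ifP => //; case: ifP => // _ _; congr (x (inl (_, _))); apply: vtx_eq => /=; lia.
Qed.

(** The primal edge crossed by a dual edge, where the dual vertex u sits at 2u + (1, 1) in the
    refined lattice. *)
Definition hdual (i : rindex) : rindex :=
  match i with
  | inl e => inl (if e.2 then (e.1.1, e.1.2 + 1) else (e.1.1 + 1, e.1.2), ~~ e.2)
  | inr v => inr v
  end.

Lemma hdual_inj : injective hdual.
Proof.
move=> [[[a b] c]|v] [[[a' b'] c']|v'] //=.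
case: c; case: c' => //= -[h1 h2].
  by rewrite h1 (_ : b = b') //; lia.
by rewrite h2 (_ : a = a') //; lia.
Qed.

(** Duality as a translation: the white set moved by (1, 1) is the refined picture of the
    configuration in which a dual edge is open when the primal edge it crosses is closed. *)
Lemma rho_dual x z : ~~ rho x (shift (1, 1) z) = rho (fun i => ~~ x (hdual i)) z.
Proof.
case: z => a b; rewrite /rho /= /half /shift /=.
have -> : oddz (1 + a) = ~~ oddz a by rewrite /oddz; lia.
have -> : oddz (1 + b) = ~~ oddz b by rewrite /oddz; lia.
case: (boolP (oddz a)) => h1; case: (boolP (oddz b)) => h2 //=; congr (~~ x (inl (_, _))); apply: vtx_eq => /=;
  by move: h1 h2; rewrite /oddz; lia.
Qed.

Lemma rho_loc_dep (A : event) n : on_set (fun z => box n z) A ->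
  dep (fun i => i \in bits_of (boxl n)) (fun x => A (rho x)).
Proof.
move=> oA.
have K (x y : conf) : (forall i, i \in bits_of (boxl n) -> x i = y i) -> A (rho x) -> A (rho y).
  move=> xy; apply: oA => z bz.
  rewrite (@rho_dep (fun z => box n z) x y) // => e be; apply: xy.
  have se : edge_src e \in boxl n.
    by rewrite mem_boxl; case: (e) be => -[a b] c; rewrite /site /box /nrm /edge_src /=; case: c => /=; lia.
  by rewrite /bits_of !mem_cat; case: (e) se => u [] /= h; rewrite (map_f (fun v => inl (v, _))) ?orbT.
by move=> x y xy; apply/propext; split; apply: K => // i /xy.
Qed.

Section BondHalf.
Context {R : realType} {d : measure_display} {Omega : measurableType d}.
Variables (P : probability Omega R) (W : rindex -> Omega -> R) (hW : iid_uniform P W).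

Definition thr2 : rindex -> R := fun=> 2^-1.
Lemma probs2 : probs thr2. Proof. by move=> i; rewrite /thr2; lra. Qed.

Definition bcol (w : Omega) (z : vertex) : Prop := rho (bits W thr2 w) z.
Notation pr := (prc P bcol).

Lemma meas_rho z : measurable [set w | bcol w z].
Proof.
apply: (@meas_loc _ _ _ _ _ hW thr2 (fun x => rho x z) (bits_of (boxl (nrm z)))).
apply: (@rho_loc_dep (fun S => S z) (nrm z)) => S S' e; apply: (e z _).1; exact: lexx.
Qed.

Lemma bond_Ex (A : event) n x : on_set (fun z => box n z) A ->
  pr A = Ex thr2 (bits_of (boxl n)) (fun x => ind (A (rho x))) x.
Proof.
move=> oA; apply: (Pr_Ex hW probs2) => //; last exact: rho_loc_dep.
by apply: bits_of_uniq; exact: boxl_uniq.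
Qed.

Lemma bond_relabel (h : rindex -> rindex) s A : injective h ->
  (forall x z, rho x (s z) = rho (x \o h) z) -> loc A -> pr (fun S => A (fun z => S (s z))) = pr A.
Proof.
move=> hi hs [n oA]; rewrite /prc /bcol.
rewrite -(@Pr_relabel _ _ _ _ _ hW thr2 probs2 h (fun x => A (rho x)) (bits_of (boxl n))) //.
- congr Pr; apply/seteqP; split=> w /=; rewrite (_ : (fun z => _) = (rho (bits W thr2 w \o h) : _ -> Prop)) //;
    by apply/funext => z; rewrite hs.
- by apply: bits_of_uniq; exact: boxl_uniq.
- exact: rho_loc_dep.
Qed.

Lemma bond_law : law pr.
Proof.
apply: law_intro => [z|A B [n oA] lB iA iB|A|A|c A|n e e0].
- exact: meas_rho.
- have [m nm oB] := loc_box n lB.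
  have oA' : on_set (fun z => box m z) A by apply: on_set_sub oA => z; rewrite /box; lia.
  pose x0 : conf := fun=> false.
  rewrite (bond_Ex x0 oA') (bond_Ex x0 oB) (bond_Ex x0 (on_set_and oA' oB)).
  rewrite [leRHS](_ : _ = Ex thr2 (bits_of (boxl m)) (fun x => ind (A (rho x)) * ind (B (rho x))) x0); last first.
    by apply: Ex_ext => x; rewrite ind_and.
  have incr_of D : inc D -> incr (fun x : conf => ind (D (rho x)) : R).
    move=> iD x y xy; apply: ind_mono; apply: iD => z; exact: rho_mono.
  apply: Ex_fkg; [exact: probs2|exact: incr_of|exact: incr_of|].
  by apply: bits_of_uniq; exact: boxl_uniq.
- by apply: (bond_relabel (h := hswap)); [case: bsym_swap|exact: rho_swap].
- by apply: (bond_relabel (h := hflip)); [case: bsym_flip|exact: rho_flip].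
- by apply: (bond_relabel (h := hshift c)); [case: (bsym_shift c)|move=> x z; exact: rho_shift].
exists n => A B oA lB oB; have [m nm oB'] := loc_box n lB.
have oA' : on_set (fun z => box m z) A by apply: on_set_sub oA => z; rewrite /box; lia.
pose x0 : conf := fun=> false.
rewrite (bond_Ex x0 oA') (bond_Ex x0 oB') (bond_Ex x0 (on_set_and oA' oB')).
rewrite [leLHS](_ : _ = Ex thr2 (bits_of (boxl m)) (fun x => ind (A (rho x)) * ind (B (rho x))) x0); last first.
  by apply: Ex_ext => x; rewrite ind_and.
pose dp (F : vertex -> Prop) (i : rindex) := match i with inl e => F (site e) | inr _ => False end.
have dpP (F : vertex -> Prop) D : on_set F D -> dep (dp F) (fun x : conf => ind (D (rho x)) : R).
  move=> oD x y xy; apply: ind_iff.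
  have E z : F z -> rho x z = rho y z by apply: rho_dep => e' Fe; exact: (xy (inl e')).
  by split; apply: oD => z /E ->.
rewrite (Ex_mul _ _ (dpP _ _ oA) (dpP _ _ oB)); first by rewrite lerDl ltW.
by move=> [e'|v] _ //= b /negP; apply.
Qed.

Definition all_open (m : int) : event := fun S => forall z, box m z -> ~~ (oddz z.1 && oddz z.2) -> S z.

(** When all edges of a box are open, its even rows and columns join all arms that start inside
    it. *)
Lemma bond_glue (m : int) : 0 <= m -> exists (M : int) Z (k : R),
  [/\ m <= M, 0 < k, good pr Z k & glues m M Z].
Proof.
move=> m0; exists (m + 1), (all_open (m + 1)).
pose c : conf := fun=> true; exists (\prod_(i <- bits_of (boxl (m + 1))) wt thr2 c i); split; first by lia.
- by rewrite prodr_gt0 // => i _; rewrite /wt /= /thr2; lra.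
- have oZ : on_set (fun z => box (m + 1) z) (all_open (m + 1)).
    by move=> S S' e h z bz oz; apply/e => //; exact: h.
  split; first by exists (m + 1).
    by move=> S S' e h z bz oz; apply/e; exact: h.
  rewrite -(Pr_cylinder hW probs2); last by apply: bits_of_uniq; exact: boxl_uniq.
  apply: Pr_mono.
  + apply: (@meas_loc _ _ _ _ _ hW thr2 (fun x : conf => forall i, i \in bits_of (boxl (m + 1)) -> x i = c i)
      (bits_of (boxl (m + 1)))).
    by move=> x y xy; apply/propext; split=> h i ib; rewrite -(h i ib) xy.
  + by apply: (meas_col meas_rho); exists (m + 1).
  move=> w h z bz oz; rewrite /bcol; move: oz; case: (rhoP _ z) => [//|u ->|e ez _].
    by rewrite (_ : oddz _ && oddz _) //= /oddz; lia.
  apply: (h (inl e)); have se : edge_src e \in boxl (m + 1).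
    by rewrite mem_boxl; move: bz; rewrite ez; case: (e) => -[a b] k; rewrite /site /box /nrm /edge_src /=; case: k => /=; lia.
  by rewrite /bits_of !mem_cat; case: (e) se => u [] /= hh; rewrite (map_f (fun v => inl (v, _))) ?orbT.
move=> S hS Q u u' v v' bQ c1 c2 bu bu' _ _.
suff H : forall z, S z -> box m z -> con nn (fun z => S z /\ Q z) (0, 0) z.
  have [Su _] := con_l c1; have [Su' _] := con_l c2.
  exact: (con_trans (con_sym nn_sym c1) (con_trans (con_sym nn_sym (H u Su bu)) (con_trans (H u' Su' bu') c2))).
have SQ z : box (m + 1) z -> ~~ (oddz z.1 && oddz z.2) -> S z /\ Q z by move=> bz oz; split; [exact: hS|exact: bQ].
have row (a b y : int) : `|a| <= m + 1 -> `|b| <= m + 1 -> `|y| <= m + 1 -> ~~ oddz y ->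
    con nn (fun z => S z /\ Q z) (a, y) (b, y).
  move=> ha hb hy oy; have [ab|ab] := leP a b; last apply: con_sym; try exact: nn_sym.
    by apply: con_row => // x hx; apply: SQ; rewrite ?(negbTE oy) ?andbF //= /box /nrm /=; lia.
  by apply: con_row; [exact: ltW|move=> x hx; apply: SQ; rewrite ?(negbTE oy) ?andbF //= /box /nrm /=; lia].
have col (a b x : int) : `|a| <= m + 1 -> `|b| <= m + 1 -> `|x| <= m + 1 -> ~~ oddz x ->
    con nn (fun z => S z /\ Q z) (x, a) (x, b).
  move=> ha hb hy oy; have [ab|ab] := leP a b; last apply: con_sym; try exact: nn_sym.
    by apply: con_col => // y hx; apply: SQ; rewrite ?(negbTE oy) //= /box /nrm /=; lia.
  by apply: con_col; [exact: ltW|move=> y hx; apply: SQ; rewrite ?(negbTE oy) //= /box /nrm /=; lia].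
have o0 : ~~ oddz 0 by [].
have H' z : box (m + 1) z -> ~~ (oddz z.1 && oddz z.2) -> con nn (fun z => S z /\ Q z) (0, 0) z.
  case: z => a b bz; have ha : `|a| <= m + 1 by move: bz; rewrite /box /nrm /=; lia.
  have hb : `|b| <= m + 1 by move: bz; rewrite /box /nrm /=; lia.
  rewrite negb_and => /orP[] /= o.
    by apply: (@con_trans _ _ _ (a, 0)); [apply: row|apply: col] => //; lia.
  by apply: (@con_trans _ _ _ (0, b)); [apply: col|apply: row] => //; lia.
move=> z Sz bz; case: (boolP (oddz z.1 && oddz z.2)) => oz; last by apply: H' => //; move: bz; rewrite /box; lia.
(* [glues] ranges over arbitrary colourings, in which a site with two odd coordinates may be
   coloured; it is joined to a neighbour, hence the margin m + 1. *)
apply: (@con_step _ _ _ (z.1 + 1, z.2)).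
- apply: H'; first by move: bz; rewrite /box /nrm /=; lia.
  by move: oz; rewrite /oddz /=; lia.
- by right => /=; lia.
- by split=> //; apply: bQ; move: bz; rewrite /box; lia.
Qed.

Definition dcol (w : Omega) (z : vertex) : Prop := ~ bcol w (shift (1, 1) z).

Lemma bond_dual A : loc A -> prc P dcol A = pr A.
Proof.
case=> n oA; have [ub dA] := (bits_of_uniq (boxl_uniq n), rho_loc_dep oA).
rewrite /prc -[RHS](@Pr_flip _ _ _ _ _ hW thr2 probs2 (fun x => A (rho x)) (bits_of (boxl n))) //; last first.
  by move=> i; rewrite /thr2; lra.
have dA' : dep (fun i => i \in bits_of (boxl n)) (fun x : conf => A (rho (fun i => ~~ x i))).
  by move=> x y xy; apply: dA => i ib; rewrite xy.
rewrite -(@Pr_relabel _ _ _ _ _ hW thr2 probs2 hdual _ _ hdual_inj _ ub dA') //.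
congr Pr; apply/seteqP; split=> w /=;
  rewrite (_ : (rho (fun i => ~~ (bits W thr2 w \o hdual) i) : _ -> Prop) = dcol w) //;
  by apply/funext => z; rewrite /dcol /bcol -rho_dual; apply/propext; split=> /negP.
Qed.

(** Percolation would give circuits with probability at least 3/4, and, by duality, white arms
    through the same annuli with probability at least 3/4. These events exclude each other, but 3/4
    + 3/4 > 1. *)
Lemma bond_not_perc : ~ percolates pr.
Proof.
move=> pc; have [c c0 io] := circuits_io bond_law pc bond_glue.
have h2 : 0 < (4^-1 : R) by rewrite invr_gt0.
have [m [m0 hm]] := pc _ h2.
have [M [Z [mM [lZ iZ gZ] hZ]]] := circ_whp bond_law c0 io (m + 1) h2.
(* The translation by (1, 1) relating the dual picture to the white sites changes norms by at most
   one; the margins m + 1 and M + 2 absorb this. *)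
pose N := M + 2.
pose A := arm (fun z => box m z) (fun z => box N z) (fun v => nrm v = N).
have mN : m <= N by rewrite /N; lia.
have [lA _ gA] := hm N mN.
have := bond_dual lA; rewrite -/A => dA.
have mZ : measurable [set w | Z (bcol w)] by exact: (meas_col meas_rho).
have mA : measurable [set w | A (dcol w)].
  have mdcol v : measurable [set w | dcol w v] by apply: meas_not; exact: meas_rho.
  exact: (meas_col mdcol).
have : Pr P ([set w | Z (bcol w)] `|` [set w | A (dcol w)]) = pr Z + prc P dcol A.
  rewrite Pr_U //; apply/seteqP; split=> // w [/= /hZ[n [h1 h3 cn]] [u [v [hu hv c']]]].
  have c2 : con star (fun z => ~ bcol w z) (shift (1, 1) u) (shift (1, 1) v).
    apply: (con_adj nn_star); apply: con_map; first exact: shift_nn.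
    by apply: con_sub c' => z [].
  have [|||s [? ?]] := circ_blocks _ cn c2 => //.
  - by move: hu; lia.
  - by move: hu h1; rewrite /box /nrm /shift /=; lia.
  - by move: hv h3; rewrite /N /nrm /shift /=; lia.
have : Pr P ([set w | Z (bcol w)] `|` [set w | A (dcol w)]) <= 1 by apply: Pr_le1; exact: measurableU.
rewrite dA; move: gZ gA; rewrite -/A; lra.
Qed.

Lemma bond_arm_small (m0 : int) (e : R) : 0 < e -> exists N : int, m0 <= N /\
  pr (arm (fun z => box m0 z) (fun z => box N z) (fun v => nrm v = N)) <= e.
Proof. exact: (no_perc bond_law bond_not_perc). Qed.

End BondHalf.

(** * Open clusters *)

Definition sub (v a : vertex) : vertex := (v.1 - a.1, v.2 - a.2).
Definition reach (a : vertex) (n : int) (x : conf) : Prop :=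
  exists v, n <= nrm (sub v a) /\ con (oadj x) (fun=> True) a v.

Lemma oadj_star x u v : oadj x u v -> star u v.
Proof. by move/oadj_nn/nn_star. Qed.

Lemma reach_loc a n x : 0 <= n -> reach a n x <->
  exists v, nrm (sub v a) = n /\ con (oadj x) (fun z => nrm (sub z a) <= n) a v.
Proof.
move=> n0; split; last first.
  by case=> v [e c]; exists v; split; [rewrite e|apply: con_sub c].
case=> v [nv c].
have lip u w : oadj x u w -> nrm (sub u a) <= nrm (sub w a) + 1 /\ nrm (sub w a) <= nrm (sub u a) + 1.
  by move/oadj_star; rewrite /star /nrm /sub /=; lia.
have [||u' [v' [e1 e2 _ c']]] := con_trunc lip n0 c => //.
  by rewrite /nrm /sub /=; lia.
exists v'; split=> //.
have -> : a = u' by apply: vtx_eq; move: e1; rewrite /nrm /sub /=; lia.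
have eu : u' = a by apply: vtx_eq; move: e1; rewrite /nrm /sub /=; lia.
by rewrite {1}eu -eu; apply: con_sub c' => z [_ /andP[_]]; rewrite eu.
Qed.

Lemma oadj_ext (x y : conf) u v : (forall e, x (inl e) = y (inl e)) -> oadj x u v -> oadj y u v.
Proof. by move=> xy [e [h k]]; exists e; split=> //; rewrite -xy. Qed.

Lemma reach_ext (x y : conf) a n : (forall e, x (inl e) = y (inl e)) -> reach a n x -> reach a n y.
Proof.
by move=> xy [v [h c]]; exists v; split=> //; apply: con_adj c => p q; exact: oadj_ext.
Qed.

Lemma reach_incr (x y : conf) a n : (forall i, x i -> y i) -> reach a n x -> reach a n y.
Proof.
move=> xy [v [h c]]; exists v; split=> //; apply: con_adj c => p q [e [ej xe]].
by exists e; split=> //; exact: xy.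
Qed.

Lemma reach_mono a (n m : int) x : n <= m -> reach a m x -> reach a n x.
Proof. by move=> nm [v [h c]]; exists v; split=> //; lia. Qed.

Lemma reach_dep a n : 0 <= n -> dep (fun i => i \in bits_of (boxl (n + nrm a))) (reach a n).
Proof.
move=> n0; have K x y : (forall i, i \in bits_of (boxl (n + nrm a)) -> x i = y i) -> reach a n x -> reach a n y.
  move=> xy /(reach_loc _ _ n0)[v [e c]]; apply/(reach_loc _ _ n0); exists v; split=> //.
  apply: con_dep c => i gi; apply: xy; apply: gbit_bits.
  have h z : nrm (sub z a) <= n -> z \in boxl (n + nrm a).
    by rewrite mem_boxl /box /nrm /sub /=; lia.
  by case: i gi => [e' [h1 h2]|v'] /=; [split; exact: h|exact: h].
by move=> x y xy; apply/propext; split; apply: K => // i /xy.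
Qed.

Lemma reach_shift a n x : reach a n x <-> reach origin n (x \o hshift a).
Proof.
have bs := bsym_shift a; have sa : shift a origin = a by rewrite /shift /= !addr0; case: (a).
split=> -[v [h c]].
  exists (sub v a); split; first by move: h; rewrite /nrm /sub /=; lia.
  apply/(@bsym_con _ _ x (fun=> True) _ _ bs); rewrite sa.
  by rewrite (_ : shift a (sub v a) = v) //; apply: vtx_eq => /=; lia.
exists (shift a v); split; first by move: h; rewrite /nrm /sub /=; lia.
by move/(@bsym_con _ _ x (fun=> True) _ _ bs): c; rewrite sa.
Qed.

Section Theta.
Context {R : realType} {d : measure_display} {Omega : measurableType d}.
Variables (P : probability Omega R) (W : rindex -> Omega -> R) (hW : iid_uniform P W).

Lemma Pr_ex_seq (T : eqType) (l : seq T) (Q : T -> Omega -> Prop) :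
  (forall i, i \in l -> measurable [set w | Q i w]) ->
  measurable [set w | exists2 i, i \in l & Q i w] /\
  Pr P [set w | exists2 i, i \in l & Q i w] <= \sum_(i <- l) Pr P [set w | Q i w].
Proof.
elim: l => [|a l IH] m.
  rewrite (_ : [set _ | _] = set0); last by apply/seteqP; split=> // w [].
  by split; [exact: measurable0|rewrite big_nil /Pr measure0].
have [|ml IHl] := IH; first by move=> i il; apply: m; rewrite in_cons il orbT.
have ma : measurable [set w | Q a w] by apply: m; exact: mem_head.
rewrite (_ : [set _ | _] = [set w | Q a w] `|` [set w | exists2 i, i \in l & Q i w]); last first.
  apply/seteqP; split=> w.
    by case=> i; rewrite in_cons => /orP[/eqP->|il] h; [left|right; exists i].
  by case=> [h|[i il h]]; [exists a; rewrite ?mem_head|exists i; rewrite // in_cons il orbT].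
split; first exact: measurableU.
by rewrite big_cons; apply: le_trans (Pr_sub2 P ma ml) _; rewrite lerD2l.
Qed.

Definition theta (p : R) (n : int) : R := Pr P [set w | reach origin n (bits W (fun=> p) w)].

Section P.
Variables (thr : rindex -> R) (p : R).
Hypotheses (hthr : probs thr) (hp : forall e, thr (inl e) = p).

Lemma p01 : 0 <= p <= 1. Proof. by rewrite -(hp (origin, true)). Qed.

Lemma meas_reach a n : 0 <= n -> measurable [set w | reach a n (bits W thr w)].
Proof. by move=> n0; apply: (meas_loc hW); exact: reach_dep. Qed.

Lemma Pr_reach a n : 0 <= n -> Pr P [set w | reach a n (bits W thr w)] = theta p n.
Proof.
move=> n0; pose pp : rindex -> R := fun=> p; have hpp : probs pp by move=> i; exact: p01.
have -> : Pr P [set w | reach a n (bits W thr w)] =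
   Pr P [set w | reach origin n (bits W pp w \o hshift a)].
  congr Pr; apply/seteqP; split=> w.
    move=> /= h; apply: (reach_shift _ _ _).1; apply: reach_ext h => e; by rewrite /bits hp.
  move/(reach_shift _ _ _).2; apply: reach_ext => e; by rewrite /bits hp.
rewrite (@Pr_relabel _ _ _ _ _ hW pp hpp (hshift a) (reach origin n) (bits_of (boxl (n + nrm origin)))) //.
- by case: (bsym_shift a).
- by apply: bits_of_uniq; exact: boxl_uniq.
- exact: reach_dep.
Qed.

End P.

Lemma theta_decr p (n m : int) : 0 <= p <= 1 -> 0 <= n -> n <= m -> theta p m <= theta p n.
Proof.
move=> p01 n0 nm; have m0 : 0 <= m by lia.
by apply: Pr_mono; [exact: meas_reach|exact: meas_reach|move=> w; exact: reach_mono].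
Qed.

Lemma theta_Ex p n x : 0 <= p <= 1 -> 0 <= n ->
  theta p n = Ex (fun=> p) (bits_of (boxl n)) (fun x => ind (reach origin n x)) x.
Proof.
move=> p01 n0; rewrite /theta (@Pr_Ex _ _ _ _ _ hW (fun=> p) (fun=> p01) (reach origin n) (bits_of (boxl n)) x) //.
  by apply: bits_of_uniq; exact: boxl_uniq.
by have := @reach_dep origin n n0; rewrite (_ : n + nrm origin = n) // /nrm /=; lia.
Qed.

Lemma nn_dbl_rho x v z : nn (dbl v) z -> rho x z ->
  exists e v', [/\ edge_joins e v v', x (inl e) & z = site e].
Proof.
case: (rhoP x z) => [u -> h _|u _ //|e -> h xe].
  by exfalso; move: h; rewrite /nn /dbl /=; lia.
exists e; have [k|k] : v = edge_src e \/ v = edge_dst e.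
- case: (e) h => -[a b] c; rewrite /nn /dbl /site /edge_src /edge_dst /=; case: c => /=; case: v => v1 v2 /= h.
  + have [k|k] : v2 = b \/ v2 = b + 1 by lia.
      by left; apply: vtx_eq => /=; lia.
    by right; apply: vtx_eq => /=; lia.
  + have [k|k] : v1 = a \/ v1 = a + 1 by lia.
      by left; apply: vtx_eq => /=; lia.
    by right; apply: vtx_eq => /=; lia.
- by exists (edge_dst e); split=> //; left.
- by exists (edge_src e); split=> //; right.
Qed.

Lemma nn_site_rho x e v v' z : edge_joins e v v' -> nn (site e) z -> rho x z -> z = dbl v \/ z = dbl v'.
Proof.
case: (rhoP x z) => [u -> ej h _|u _ //|e' -> _ h _]; last first.
  by exfalso; case: (e) (e') h => -[a b] c [[a' b'] c']; rewrite /nn /site /=; case: c; case: c' => /=; lia.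
have [k|k] : u = edge_src e \/ u = edge_dst e.
- case: (e) h => -[a b] c; rewrite /nn /dbl /site /edge_src /edge_dst /=; case: c => /=; case: u => v1 v2 /= h.
  + have [k|k] : v2 = b \/ v2 = b + 1 by lia.
      by left; apply: vtx_eq => /=; lia.
    by right; apply: vtx_eq => /=; lia.
  + have [k|k] : v1 = a \/ v1 = a + 1 by lia.
      by left; apply: vtx_eq => /=; lia.
    by right; apply: vtx_eq => /=; lia.
- by rewrite k; case: ej => -[<- <-]; [left|right].
- by rewrite k; case: ej => -[<- <-]; [right|left].
Qed.

Lemma dbl_site e v v' : edge_joins e v v' -> nn (dbl v) (site e).
Proof.
case: e => -[a b] c; rewrite /edge_joins /edge_src /edge_dst /nn /dbl /site /=.
by case: c => /=; case=> -[e1 e2]; subst; rewrite /=; lia.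
Qed.

Lemma lift_open x u v : con (oadj x) (fun=> True) u v -> con nn (fun z => rho x z) (dbl u) (dbl v).
Proof.
move: v; apply: con_ind; first by apply: con_refl; rewrite rho_dbl.
move=> v w _ c [e [ej xe]] _; apply: (@con_step _ _ _ (site e)).
- by apply: (con_step c); [exact: dbl_site ej|rewrite rho_site].
- by apply: nn_sym; apply: dbl_site (edge_joins_sym ej).
- by rewrite rho_dbl.
Qed.

Lemma lower_open x u z : con nn (fun z => rho x z) (dbl u) z -> exists v,
  con (oadj x) (fun=> True) u v /\
  (z = dbl v \/ exists e v', [/\ edge_joins e v v', x (inl e) & z = site e]).
Proof.
move: z; apply: con_ind; first by exists u; split; [exact: con_refl|left].
move=> z z' _ [v [c [->|[e [v' [ej xe ->]]]]]] zz rz.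
  by exists v; split=> //; right; exact: nn_dbl_rho zz rz.
have [->|->] := nn_site_rho ej zz rz; first by exists v; split=> //; left.
by exists v'; split; [apply: (con_step c) => //; exists e|left].
Qed.

Lemma site_near e v v' : edge_joins e v v' -> star (site e) (dbl v).
Proof. by move/dbl_site/nn_sym/nn_star. Qed.

Lemma lower_reach x a n z : con nn (fun z => rho x z) (dbl a) z -> 2 * n <= nrm (sub z (dbl a)) ->
  reach a n x.
Proof.
move=> /lower_open[v [c h]] nz; exists v; split=> //.
case: h => [e|[e [v' [ej _ ez]]]]; first by move: nz; rewrite e /nrm /sub /=; lia.
by have := site_near ej; move: nz; rewrite -ez /nrm /sub /star /=; lia.
Qed.

(** A diagonal step between white sites joins two edge sites, and one of the other two corners of
    their unit square is a dual vertex, which is always white. *)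
Lemma white_star_nn x u v : con star (fun z => ~ rho x z) u v -> con nn (fun z => ~ rho x z) u v.
Proof.
move=> c; have Su := con_l c; move: v c; apply: con_ind; first exact: con_refl.
move=> v w uv c vw nw; have nv := con_r uv.
have [e1|e1] := eqVneq v.1 w.1; have [e2|e2] := eqVneq v.2 w.2.
- by rewrite -(vtx_eq e1 e2).
- by apply: (con_step c) => //; move: vw; rewrite /star /nn; lia.
- by apply: (con_step c) => //; move: vw; rewrite /star /nn; lia.
have mixed z z' : star z z' -> z.1 != z'.1 -> z.2 != z'.2 -> ~ rho x z -> ~ rho x z' ->
   oddz z.1 != oddz z.2.
  move=> s h1 h2; rewrite /rho.
  case o1 : (oddz z.1); case o2 : (oddz z.2) => //= _.
  have -> : oddz z'.1 = false by move: s h1 o1; rewrite /star /oddz; lia.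
  by have -> : oddz z'.2 = false by move: s h2 o2; rewrite /star /oddz; lia.
have mv := mixed _ _ vw e1 e2 nv nw.
pose m : vertex := if oddz v.1 then (v.1, w.2) else (w.1, v.2).
have om : oddz m.1 && oddz m.2.
  by move: mv vw e1 e2; rewrite /m /star; case o1 : (oddz v.1); case o2 : (oddz v.2) => //=; move: o1 o2; rewrite /oddz; lia.
apply: (@con_step _ _ _ m) => //.
- apply: (con_step c); last by rewrite /rho om.
  by move: vw e1 e2; rewrite /m /star /nn; case: (oddz v.1) => /=; lia.
- by move: vw e1 e2; rewrite /m /star /nn; case: (oddz v.1) => /=; lia.
Qed.

Notation bit2 := (bits W (@thr2 R)).
Notation bit2d w := (fun i => ~~ bit2 w (hdual i)).

Lemma Pr_reach_dual a n : 0 <= n -> Pr P [set w | reach a n (bit2d w)] = theta 2^-1 n.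
Proof.
move=> n0; have dr := @reach_dep a n n0; have ub := bits_of_uniq (boxl_uniq (n + nrm a)).
have dr' : dep (fun i => i \in bits_of (boxl (n + nrm a))) (fun x : conf => reach a n (fun i => ~~ x i)).
  by move=> x y xy; apply: dr => i ib; rewrite xy.
have := @Pr_relabel _ _ _ _ _ hW _ (@probs2 R) hdual _ _ hdual_inj _ ub dr'; rewrite /= => -> //.
have := @Pr_flip _ _ _ _ _ hW _ (@probs2 R) (reach a n) _ _ ub dr; rewrite /= => ->.
  exact: (Pr_reach (@probs2 R)).
by move=> i; rewrite /thr2; lra.
Qed.

(** Apply [hex] to the refined square of side 2n, whose side is lattice distance n. A white crossing
    starts at a closed horizontal edge of the bottom row and is extended down to the dual vertex
    below it, which explains the second coordinate -1. *)
Lemma hex_reach (x : conf) (n : nat) :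
  (exists2 j, j \in iota 0 n.+1 & reach (0, j%:Z) n%:Z x) \/
  (exists2 j, j \in iota 0 n.+1 & reach (j%:Z, -1) n%:Z (fun i => ~~ x (hdual i))).
Proof.
have n0 : 0 <= 2 * n%:Z by lia.
have [[u [v [eu ev c]]]|[u [v [eu ev c]]]] := hex (fun z => rho x z) n0 n0; [left|right].
  have cS : con nn (fun z => rho x z) u v by apply: con_sub c => z [].
  have [_ ru] := con_l c; have := con_l cS; case: (rhoP x u) => [a ea _|a _ //|e ee xe].
    exists `|a.2|%N; first by rewrite mem_iota; move: ru; rewrite ea /in_rect /=; lia.
    have ea' : (0, (`|a.2|%N)%:Z) = a by apply: vtx_eq => /=; move: ru eu; rewrite ea /in_rect /=; lia.
    by rewrite ea'; apply: (@lower_reach _ _ _ v); [rewrite -ea|move: eu ev; rewrite ea /nrm /sub /=; lia].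
  case: e ee xe => -[a b] k ee xe.
  have ek : k by case: (k) ee => //= ee; move: eu; rewrite ee /site /=; lia.
  rewrite ek in ee xe.
  have ab : a = 0 /\ 0 <= b <= n%:Z by move: ru eu; rewrite ee /site /in_rect /=; lia.
  exists `|b|%N; first by rewrite mem_iota; lia.
  apply: (@lower_reach _ _ _ v); last by move: ev; rewrite /nrm /sub /=; lia.
  apply: con_cons cS; first by rewrite rho_dbl.
  by rewrite ee /nn /dbl /site /=; lia.
have cS : con nn (fun z => ~ rho x z) u v by apply: white_star_nn; apply: con_sub c => z [].
have [_ ru] := con_l c.
have [i [hi eui]] : exists i : int, 0 <= i <= n%:Z /\ u = (2 * i + 1, 0).
  have := con_l cS; case: (rhoP x u) => [//|a ea _|[[a b] k] ee _].
    by exfalso; move: eu; rewrite ea /=; lia.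
  case: k ee => ee; first by exfalso; move: eu; rewrite ee /=; lia.
  exists a; split; first by move: ru; rewrite ee /site /in_rect /=; lia.
  by rewrite ee /site /=; apply: vtx_eq => /=; move: eu; rewrite ee /=; lia.
exists `|i|%N; first by rewrite mem_iota; lia.
have cD : con nn (fun z => ~ rho x z) (2 * i + 1, -1) v.
  apply: con_cons cS; last by rewrite eui; left => /=; lia.
  by rewrite /rho (_ : oddz _ && oddz _) // /oddz /=; lia.
have cR : con nn (fun z => rho (fun i => ~~ x (hdual i)) z) (dbl (i, -1)) (sub v (1, 1)).
  have -> : dbl (i, -1) = sub (2 * i + 1, -1) (1, 1) by apply: vtx_eq => /=; lia.
  apply: (con_map (f := fun z => sub z (1, 1))); first by rewrite /nn /sub /=; lia.
  apply: con_sub cD => z nz; rewrite -rho_dual (_ : shift (1, 1) (sub z (1, 1)) = z); last first.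
    by apply: vtx_eq => /=; lia.
  exact/negP.
have -> : (`|i|%N)%:Z = i by lia.
by apply: (lower_reach cR); move: ev; rewrite /nrm /sub /=; lia.
Qed.

(** Union bound over the n + 1 starting points of the open crossing and the n + 1 of the dual one;
    at 1/2 all of them have the same probability. *)
Lemma theta_half_lower (n : nat) : 1 <= (2 * n.+1)%:R * theta 2^-1 n%:Z.
Proof.
have n0 : 0 <= n%:Z by [].
have m1 j : measurable [set w | reach (0, j%:Z) n%:Z (bit2 w)] by exact: meas_reach.
have m2 j : measurable [set w | reach (j%:Z, -1) n%:Z (bit2d w)].
  have dr := @reach_dep (j%:Z, -1) n%:Z n0.
  apply: (@meas_loc _ _ _ _ _ hW _ (fun x : conf => reach (j%:Z, -1) n%:Z (fun i => ~~ x (hdual i)))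
     (map hdual (bits_of (boxl (n%:Z + nrm (j%:Z, -1)))))).
  by move=> x y xy; apply: dr => i ib; rewrite xy // map_f.
have [M1 S1] := @Pr_ex_seq _ (iota 0 n.+1) (fun j w => reach (0, j%:Z) n%:Z (bit2 w)) (fun j _ => m1 j).
have [M2 S2] := @Pr_ex_seq _ (iota 0 n.+1) (fun j w => reach (j%:Z, -1) n%:Z (bit2d w)) (fun j _ => m2 j).
rewrite -[leLHS](Pr_T P); apply: le_trans (_ : _ <= Pr P (_ `|` _)) _.
  apply: Pr_mono; [exact: measurableT|exact: measurableU M1 M2|].
  by move=> w _; exact: hex_reach.
apply: le_trans (Pr_sub2 P M1 M2) _; apply: le_trans (lerD S1 S2) _.
rewrite (eq_bigr (fun=> theta 2^-1 n%:Z)); last first.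
  by move=> j _; apply: (Pr_reach (@probs2 R)).
rewrite [X in _ + X](eq_bigr (fun=> theta 2^-1 n%:Z)); last by move=> j _; exact: Pr_reach_dual.
by rewrite !big_const_seq !count_predT size_iota !iter_addr_0 mulr_natl mul2n -addnn mulrnDr lexx.
Qed.

Lemma theta_half_small (e : R) : 0 < e -> exists2 n : int, 0 <= n & theta 2^-1 n <= e.
Proof.
move=> e0; have [N [N0 h]] := bond_arm_small hW 0 e0; exists N => //; apply: le_trans h.
apply: Pr_mono; first exact: meas_reach.
  by apply: (meas_col (meas_rho hW)); exact: (arm_loc _ _ (fun _ h => h)).
move=> w [v [nv /lift_open c]].
have [||p [q [e1 e2 _ k]]] := con_trunc (fun x y h => star_nrm (nn_star h)) N0 c.
- by rewrite /nrm /=; lia.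
- by move: nv; rewrite /nrm /sub /=; lia.
exists p, q; split=> //; first by rewrite /box e1.
by apply: con_sub k => z [rz hz]; split=> //; rewrite /box; lia.
Qed.

End Theta.

(** * Sharpness of the bond percolation transition *)

Definition eds (a : vertex) : seq edge :=
  [:: (a, false); (a, true); ((a.1 - 1, a.2), false); ((a.1, a.2 - 1), true)].
Definition oth (e : edge) (a : vertex) : vertex := if e.1 == a then edge_dst e else e.1.

Lemma edsP e a b : edge_joins e a b -> e \in eds a /\ b = oth e a.
Proof.
rewrite /edge_joins /edge_src /oth => -[[<- <-]|[e1 e2]].
  by rewrite eqxx; split=> //; case: e => u [] /=; rewrite !inE !eqxx ?orbT.
case: e e1 e2 => -[c d] k /= e1 e2; subst.
case: k => /=; rewrite !inE /=; split.
- by apply/or4P; apply: Or44; apply/eqP; congr (_, _); apply: vtx_eq => /=; lia.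
- by rewrite ifF //; apply/eqP => -[]; lia.
- by apply/or4P; apply: Or43; apply/eqP; congr (_, _); apply: vtx_eq => /=; lia.
- by rewrite ifF //; apply/eqP => -[]; lia.
Qed.

Lemma eds_uniq a : uniq (eds a).
Proof.
case: a => a b; have ha : (a == a - 1) = false by apply/eqP; lia.
have hb : (b == b - 1) = false by apply/eqP; lia.
by rewrite /eds /= !inE !xpair_eqE /= ha hb !andbF.
Qed.

Lemma eds_joins e a : e \in eds a -> edge_joins e a (oth e a).
Proof.
rewrite /oth /edge_joins /edge_src !inE => /or4P[] /eqP -> /=; rewrite ?eqxx; try by left.
- rewrite ifF; last by apply/eqP => /(congr1 fst) /=; lia.
  by right; split=> //; rewrite /edge_dst /=; apply: vtx_eq => /=; lia.
- rewrite ifF; last by apply/eqP => /(congr1 snd) /=; lia.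
  by right; split=> //; rewrite /edge_dst /=; apply: vtx_eq => /=; lia.
Qed.

Lemma con_dep_e (G : vertex -> Prop) (x y : conf) u v :
  (forall e, G (edge_src e) -> G (edge_dst e) -> x (inl e) = y (inl e)) ->
  con (oadj x) G u v -> con (oadj y) G u v.
Proof.
move=> e c; have Gu := con_l c; move: v c; apply: con_ind; first exact: con_refl.
move=> v w uv c [f [fj xf]] Gw; apply: (con_step c _ Gw); exists f; split=> //.
have [g1 g2] : G (edge_src f) /\ G (edge_dst f) by have := con_r uv; case: fj => -[-> ->].
by rewrite -e.
Qed.

Lemma last_exit adj (T K : vertex -> Prop) u v : con adj T u v -> K u -> ~ K v ->
  exists a b, [/\ K a /\ T a, ~ K b, adj a b & con adj (fun z => T z /\ ~ K z) b v].
Proof.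
move=> c Ku; move: v c; apply: con_ind => // v w uv IH vw Tw nKw.
have [Kv|nKv] := pselect (K v).
  by exists v, w; split=> //; [split=> //; exact: con_r uv|exact: con_refl].
have [a [b [h1 h2 h3 h4]]] := IH nKv; exists a, b; split=> //.
exact: (con_step h4 vw).
Qed.

Definition ebits (gl : seq vertex) : seq rindex :=
  [seq i <- bits_of gl | if i is inl e then edge_dst e \in gl else false].

Lemma ebits_uniq gl : uniq gl -> uniq (ebits gl).
Proof. by move=> u; apply: filter_uniq; exact: bits_of_uniq. Qed.

Lemma mem_ebits gl i : i \in ebits gl <->
  exists e, [/\ i = inl e, edge_src e \in gl & edge_dst e \in gl].
Proof.
rewrite mem_filter; split.
  by case: i => // e /andP[h /bits_ofP h']; exists e.
by case=> e [-> h1 h2]; rewrite h2 /=; apply: gbit_bits.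
Qed.

Lemma inl_ebits gl e : inl e \in ebits gl <-> edge_src e \in gl /\ edge_dst e \in gl.
Proof.
rewrite mem_ebits; split; first by case=> e' [[->]].
by case=> h1 h2; exists e.
Qed.

Lemma ebits_dep (R : realType) gl u v :
  dep (fun i => i \in ebits gl) (fun x : conf => ind (con (oadj x) (fun z => z \in gl) u v) : R).
Proof.
move=> x y xy; apply: ind_iff.
by split; apply: con_dep_e => e h1 h2; rewrite xy //; apply/inl_ebits.
Qed.

(** Exploration principle: while the invariant permits, reveal a bit chosen according to what is
    known; it suffices to compare conditional expectations when the exploration stops. *)
Lemma explore_le (R : realType) (q : rindex -> R) (F G : conf -> R) (Inv : seq rindex -> conf -> Prop) :
  probs q ->
  (forall s x, uniq s -> Inv s x ->
     (exists i, i \in s /\ forall b, Inv (rem i s) (upd x i b)) \/ Ex q s F x <= Ex q s G x) ->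
  forall s x, uniq s -> Inv s x -> Ex q s F x <= Ex q s G x.
Proof.
move=> hq H s; have [n] := ubnP (size s); elim: n s => // n IH s sn x us inv.
have [[i [is_ hi]]|//] := H s x us inv.
rewrite !(Ex_pull _ _ _ us is_); have /andP[q0 q1] := hq i.
have sz : (size (rem i s) < n)%N by rewrite size_rem //; case: (s) is_ sn.
by apply: lerD; apply: ler_wpM2l; rewrite ?subr_ge0 //; apply: IH => //; exact: rem_uniq.
Qed.

Definition revealed (s : seq rindex) (x : conf) (a b : vertex) : Prop :=
  exists e, [/\ edge_joins e a b, inl e \notin s & x (inl e)].

Lemma nrm_sub z a : nrm z <= nrm (sub z a) + nrm a.
Proof. rewrite /nrm /sub /=; lia. Qed.

Section Sharp.
Context {R : realType}.
Implicit Types (p : R) (Sl : seq vertex).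

Definition x0 : conf := fun=> false.

(** Expected number of open edges leaving Sl from the cluster of the origin inside Sl. *)
Definition phi p Sl : R := p * \sum_(a <- Sl) \sum_(e <- eds a | oth e a \notin Sl)
  Ex (fun=> p) (ebits Sl) (fun x => ind (con (oadj x) (fun z => z \in Sl) origin a)) x0.

Definition th p (n : int) : R := Ex (fun=> p) (ebits (boxl n)) (fun x => ind (reach origin n x)) x0.

Lemma reach_ebits a n m x y : 0 <= n -> n + nrm a <= m ->
  (forall i, i \in ebits (boxl m) -> x i = y i) -> reach a n x -> reach a n y.
Proof.
move=> n0 nm xy /(reach_loc _ _ n0)[v [e c]]; apply/(reach_loc _ _ n0); exists v; split=> //.
apply: con_dep_e c => e' h1 h2; apply: xy; apply/inl_ebits; rewrite !mem_boxl.
by rewrite /box; have := nrm_sub (edge_src e') a; have := nrm_sub (edge_dst e') a; split; lia.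
Qed.

Lemma reach_dep_e a n m : 0 <= n -> n + nrm a <= m ->
  dep (fun i => i \in ebits (boxl m)) (fun x => ind (reach a n x) : R).
Proof.
move=> n0 nm x y xy; apply: ind_iff.
by split; apply: reach_ebits nm _ => // i /xy.
Qed.

Lemma Ex_reach p a n m : 0 <= n -> n + nrm a <= m ->
  Ex (fun=> p) (ebits (boxl m)) (fun x => ind (reach a n x)) x0 = th p n.
Proof.
move=> n0 nm; pose F (x : conf) : R := ind (reach origin n x).
pose M := m + nrm a.
have e0 : nrm origin = 0 by rewrite /nrm /=; lia.
have mM : n + nrm a <= M by move: nm; rewrite /M /nrm; lia.
have n1 : n + nrm origin <= n by rewrite e0 addr0.
rewrite (@Ex_any _ _ _ _ (map (hshift a) (ebits (boxl n))) _ _ x0).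
- rewrite (_ : (fun x => ind (reach a n x)) = (fun x : conf => F (x \o hshift a))); last first.
    by apply/funext => x; apply: ind_iff; exact: reach_shift.
  by apply: (@Ex_map R _ _ (fun=> p) (hshift a) (fun i => i \in ebits (boxl n)) F) => //;
     [exact: reach_dep_e|move=> i j _ _; case: (bsym_shift a) => hi _ _ _ _ /hi].
- by apply: ebits_uniq; exact: boxl_uniq.
- rewrite map_inj_uniq; last by case: (bsym_shift a).
  by apply: ebits_uniq; exact: boxl_uniq.
- exact: reach_dep_e.
- move=> x y xy; rewrite (ind_iff R (reach_shift a n x)) (ind_iff R (reach_shift a n y)).
  by apply: (reach_dep_e n0 n1) => i ib /=; apply: xy; exact: map_f.
Qed.

(** Explore the cluster K of the origin inside Sl. An arm to norm m leaves K for the last time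
    through an edge to some b outside Sl; as b has norm at most L + 1, the rest of the arm has
    length at least m - L - 1. *)
Lemma decay_step p Sl (L m : int) : 0 <= p <= 1 -> uniq Sl -> origin \in Sl ->
  (forall z, z \in Sl -> box L z) -> L + 1 <= m -> 0 <= L ->
  th p m <= phi p Sl * th p (m - L - 1).
Proof.
move=> p01 uS oS SL Lm L0; pose q : rindex -> R := fun=> p; have hq : probs q by move=> i.
pose s0 := ebits (boxl m); pose T := th p (m - L - 1).
pose F (x : conf) : R := ind (reach origin m x).
pose G (x : conf) : R := \sum_(a <- Sl) \sum_(e <- [seq e <- eds a | oth e a \notin Sl])
  ind (con (oadj x) (fun z => z \in Sl) origin a) * (p * T).
have m0 : 0 <= m by lia.
have us0 : uniq s0 by apply: ebits_uniq; exact: boxl_uniq.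
have Sin e : edge_src e \in Sl -> edge_dst e \in Sl -> inl e \in s0.
  by move=> /SL h1 /SL h2; apply/inl_ebits; rewrite !mem_boxl; move: h1 h2; rewrite /box; lia.
have sub0 i : i \in ebits Sl -> i \in s0 by move/mem_ebits => [e [-> h1 h2]]; exact: Sin.
have -> : phi p Sl * T = Ex q s0 G x0.
  rewrite /phi mulrAC /G Ex_sum mulrC mulr_suml; apply: eq_bigr => a _.
  rewrite Ex_sum big_filter mulr_suml; apply: eq_bigr => e _.
  transitivity (Ex q s0 (fun x => (p * T) * ind (con (oadj x) (fun z => z \in Sl) origin a)) x0); last first.
    by apply: Ex_ext => y; rewrite mulrC.
  rewrite ExZ mulrC; congr (_ * _); symmetry.
  by apply: Ex_supp => //; [exact: ebits_dep|exact: ebits_uniq].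
pose K s x := con (revealed s x) (fun z => z \in Sl) origin.
pose Inv s x := {subset s <= s0} /\ forall e, inl e \in s0 -> inl e \notin s ->
  [/\ edge_src e \in Sl, edge_dst e \in Sl & K s x (edge_src e) \/ K s x (edge_dst e)].
apply: (@explore_le _ q F G Inv) => //; last by split=> // e ->.
move=> s x us [ss inv].
have [[e [es h1 h2 Ke]]|nf] := pselect (exists e, [/\ inl e \in s, edge_src e \in Sl, edge_dst e \in Sl &
   K s x (edge_src e) \/ K s x (edge_dst e)]).
  left; exists (inl e); split=> // b.
  have KK z : K s x z -> K (rem (inl e) s) (upd x (inl e) b) z.
    apply: con_adj => u v [e' [ej e's xe]]; exists e'; split=> //.
      by apply: contra e's; exact: mem_rem.
    by rewrite updN //; apply: contraNneq e's => ->.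
  split; first by move=> i /mem_rem/ss.
  move=> e' e'0; have [->|ne] := eqVneq e' e.
    by move=> _; split=> //; case: Ke => /KK; [left|right].
  move=> hn; have e's : inl e' \notin s.
    move: hn; apply: contra => e's; rewrite (mem_rem_uniq _ us) !inE e's andbT.
    by apply: contra ne => /eqP[->].
  have [h1' h2' h3'] := inv e' e'0 e's; split=> //; case: h3' => h3'; [left|right]; exact: KK.
right.
have rvl e : edge_src e \in Sl -> edge_dst e \in Sl -> K s x (edge_src e) \/ K s x (edge_dst e) ->
   inl e \notin s.
  by move=> h1 h2 h3; apply/negP => es; apply: nf; exists e.
have Kin z : K s x z -> z \in Sl by move/con_r.
have KE y z : (forall j, j \notin s -> y j = x j) -> (con (oadj y) (fun z => z \in Sl) origin z <-> K s x z).
  move=> hy; split; last first.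
    by apply: con_adj => u v [e [ej es xe]]; exists e; split=> //; rewrite hy.
  move: z; apply: con_ind; first exact: con_refl.
  move=> v w _ Kv [e [ej ye]] wS; apply: (con_step Kv _ wS); have vS := Kin _ Kv.
  have es : inl e \notin s.
    by apply: rvl; case: ej => -[h1 h2]; rewrite ?h1 ?h2 //; [left|right].
  by exists e; split=> //; rewrite -hy.
(* Every revealed edge has an end in K, so a continuation off K uses unrevealed edges only; for the
   same reason it is independent of the edge through which K is left. *)
pose offP b (y : conf) := exists v, nrm v = m /\ con (oadj y) (fun z => nrm z <= m /\ ~ K s x z) b v.
pose nK (i : rindex) := match i with inl e => [/\ inl e \in s, ~ K s x (edge_src e) & ~ K s x (edge_dst e)]
  | inr _ => False end.
have doff b : dep nK (fun y => ind (offP b y) : R).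
  have k y z : (forall i, nK i -> y i = z i) -> offP b y -> offP b z.
    move=> yz [v [h c]]; exists v; split=> //; apply: con_dep_e c => e [h1 k1] [h2 k2]; apply: yz; split=> //.
    apply/negPn/negP => es; have e0 : inl e \in s0 by apply/inl_ebits; rewrite !mem_boxl.
    by have [_ _ []] := inv e e0 es.
  by move=> y z yz; apply: ind_iff; split; apply: k => // i /yz.
have inS i : nK i -> i \in s by case: i => // e [].
have offT b : nrm b <= L + 1 -> Ex q s (fun y => ind (offP b y)) x <= T.
  move=> nb; rewrite (@Ex_any _ _ _ s s0 _ x x0) //.
  - rewrite /T -(@Ex_reach p b (m - L - 1) m); [|lia|lia].
    apply: Ex_le => // y _; apply: ind_mono => -[v [nv c]]; exists v; split.
      by have := nrm_sub v b; lia.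
    by apply: con_sub c.
  - by move=> y z yz; apply: doff => i /inS/yz.
  - by move=> y z yz; apply: doff => i /inS/ss/yz.
have -> : Ex q s G x = \sum_(a <- Sl) \sum_(e <- [seq e <- eds a | oth e a \notin Sl]) ind (K s x a) * (p * T).
  rewrite -[RHS](Ex_cst q s _ x); apply: Ex_eq_on => y hy; rewrite /G.
  by apply: eq_bigr => a _; apply: eq_bigr => e _; rewrite (ind_iff R (KE y a hy)).
pose H (y : conf) : R := \sum_(a <- Sl) \sum_(e <- [seq e <- eds a | oth e a \notin Sl])
  ind (K s x a) * (ind (y (inl e)) * ind (offP (oth e a) y)).
have FH : Ex q s F x <= Ex q s H x.
  apply: Ex_le => // y hy; rewrite /F /H.
  apply: (@le_trans _ _ (ind (exists2 a, a \in Sl & exists2 e, e \in [seq e <- eds a | oth e a \notin Sl] &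
      K s x a /\ y (inl e) /\ offP (oth e a) y))).
    apply: ind_mono => /(reach_loc _ _ m0)[v [nv c]].
    have e0 z : sub z origin = z by apply: vtx_eq => /=; lia.
    rewrite e0 in nv.
    have Ko : K s x origin by exact: con_refl.
    have nKv : ~ K s x v by move=> /Kin/SL; rewrite /box nv; lia.
    have [a [b [[Ka _] nKb [e [ej ye]] c']]] := last_exit c Ko nKv.
    have [ea eb] := edsP ej; have aS := Kin _ Ka.
    have nb : oth e a \notin Sl.
      rewrite -eb; apply/negP => bS; apply: nKb.
      have es : inl e \notin s by apply: rvl; case: ej => -[h1 h2]; rewrite ?h1 ?h2 //; [left|right].
      by apply: (con_step Ka) => //; exists e; split=> //; rewrite -hy.
    exists a => //; exists e; first by rewrite mem_filter nb.
    split=> //; split=> //; rewrite -eb; exists v; split=> //.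
    by apply: con_sub c' => z [h ?]; split=> //; move: h; rewrite e0.
  apply: le_trans (ind_ex_seq _ _ _) _; apply: ler_sum => a _.
  apply: le_trans (ind_ex_seq _ _ _) _; apply: ler_sum => e _.
  by rewrite !ind_and.
apply: le_trans FH _; rewrite /H Ex_sum !big_seq; apply: ler_sum => a aS.
rewrite Ex_sum !big_seq; apply: ler_sum => e; rewrite mem_filter => /andP[nb ea].
rewrite ExZ; have [Ka|nKa] := pselect (K s x a); last by rewrite (indF R nKa) !mul0r.
rewrite (indT R Ka) !mul1r.
have ej := eds_joins ea; have La := SL _ aS.
have st := nn_star (edge_joins_nn ej).
have nbb : nrm (oth e a) <= L + 1 by have := star_nrm st; move: La; rewrite /box; lia.
have es : inl e \in s.
  apply/negPn/negP => es.
  have e0 : inl e \in s0.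
    apply/inl_ebits; rewrite !mem_boxl /box; move: La; rewrite /box.
    by case: ej => -[-> ->]; clear -nbb Lm; split; lia.
  have [h1 h2 _] := inv e e0 es; move: nb; case: ej h1 h2 => -[-> ->] h1 h2; by rewrite ?h1 ?h2.
rewrite (@Ex_mul _ _ q s (fun i => i = inl e) nK) //.
- have -> : Ex q s (fun y => ind (y (inl e))) x = p.
    rewrite (Ex_pull _ _ _ us es).
    rewrite !(@Ex_upd _ _ _ _ (fun y => ind (y (inl e)))) ?mem_rem_uniqF //.
    rewrite (@Ex_ext _ _ _ _ _ (fun=> 1)); last by move=> y; rewrite indT // updE.
    rewrite (@Ex_ext _ _ _ _ (fun y => ind (upd y (inl e) false (inl e))) (fun=> 0)); last first.
      by move=> y; rewrite indF // updE.
    by rewrite !Ex_cst mulr1 mulr0 addr0.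
  by apply: ler_wpM2l; [case/andP: p01|exact: offT].
- by move=> y z yz; rewrite (yz (inl e)).
- move=> i is_ -> [_ k1 k2]; case: ej => -[h1 h2]; [exact: k1 (eq_ind_r _ Ka h1)|exact: k2 (eq_ind_r _ Ka h2)].
Qed.

(** Russo's formula, by induction on the bits; for an increasing indicator F, the summand at i is
    the probability that bit i is pivotal. *)
Lemma Ex_derive (s : seq rindex) (F : conf -> R) x p : uniq s ->
  is_derive p 1 (fun p => Ex (fun=> p) s F x)
    (\sum_(i <- s) Ex (fun=> p) s (fun y => F (upd y i true) - F (upd y i false)) x).
Proof.
elim: s x => [|i s IH] x /=; first by rewrite big_nil => _; exact: is_derive_cst.
case/andP=> is_ us; have d1 := IH (upd x i true) us; have d0 := IH (upd x i false) us.
set D1 := (X in is_derive _ _ _ X) in d1; set D0 := (X in is_derive _ _ _ X) in d0.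
have -> : (fun p => p * Ex (fun=> p) s F (upd x i true) + (1 - p) * Ex (fun=> p) s F (upd x i false)) =
  id * (fun p => Ex (fun=> p) s F (upd x i true)) + (cst 1 - id) * (fun p => Ex (fun=> p) s F (upd x i false)).
  by apply/funext => y.
apply: is_derive_eq; rewrite big_cons.
have -> : \sum_(j <- s) (p * Ex (fun=> p) s (fun y => F (upd y j true) - F (upd y j false)) (upd x i true) +
   (1 - p) * Ex (fun=> p) s (fun y => F (upd y j true) - F (upd y j false)) (upd x i false)) = p * D1 + (1 - p) * D0.
  by rewrite big_split /= -!mulr_sumr.
have E b : Ex (fun=> p) s (fun y => F (upd y i true) - F (upd y i false)) (upd x i b) =
   Ex (fun=> p) s F (upd x i true) - Ex (fun=> p) s F (upd x i false).
  rewrite Ex_upd // !(@Ex_upd _ _ _ _ F) // -ExB; apply: Ex_ext => y.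
  by rewrite !upd_upd.
rewrite !E /GRing.scale /= !fctE /=; ring.
Qed.

Lemma incr_reach a n : incr (fun x => ind (reach a n x) : R).
Proof. by move=> x y xy; apply: ind_mono; apply: reach_incr. Qed.

Lemma ler_sum_sub (T : eqType) (l s : seq T) (f : T -> R) : uniq l -> uniq s -> {subset l <= s} ->
  (forall i, 0 <= f i) -> \sum_(i <- l) f i <= \sum_(i <- s) f i.
Proof.
move=> ul us ls f0; rewrite [leRHS](bigID (mem l)) /= -[leLHS]addr0; apply: lerD; last exact: sumr_ge0.
rewrite -[X in _ <= X]big_filter le_eqVlt; apply/orP; left; apply/eqP; apply: perm_big; apply: uniq_perm => //.
  exact: filter_uniq.
by move=> i; rewrite mem_filter; apply/idP/andP => [il|[]//]; split=> //; exact: ls.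
Qed.

(** Explore the clusters of the sphere of radius n. If the origin is not reached, the unreached set
    Sl contains it, and the edges leaving Sl are revealed and closed. Such an edge is pivotal as
    soon as its inner end is joined to the origin inside Sl, and the expected number of these is at
    least [phi p Sl]. *)
Lemma pivotal_sum p (n : int) : 0 <= p <= 1 -> 0 <= n ->
  (forall Sl, uniq Sl -> origin \in Sl -> 1 <= phi p Sl) ->
  1 - th p n <= \sum_(i <- ebits (boxl n)) Ex (fun=> p) (ebits (boxl n))
    (fun y => ind (reach origin n (upd y i true)) - ind (reach origin n (upd y i false))) x0.
Proof.
move=> p01 n0 hphi; pose q : rindex -> R := fun=> p; have hq : probs q by move=> i.
pose s0 := ebits (boxl n); rewrite -/s0.
pose F (x : conf) : R := ind (reach origin n x).
pose D i (y : conf) : R := F (upd y i true) - F (upd y i false).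
have D0 i y : 0 <= D i y by rewrite subr_ge0; apply: incr_upd; exact: incr_reach.
pose F1 (y : conf) : R := 1 - F y; pose G (y : conf) := \sum_(i <- s0) D i y.
have us0 : uniq s0 by apply: ebits_uniq; exact: boxl_uniq.
have -> : 1 - th p n = Ex q s0 F1 x0 by rewrite /F1 (ExB _ _ (fun=> 1)) Ex_cst.
rewrite -[leRHS](@Ex_sum _ _ q s0 _ s0 D x0).
pose B := fun z : vertex => box n z.
pose O s x z := exists v, nrm v = n /\ con (revealed s x) B v z.
pose Inv s x := {subset s <= s0} /\ forall e, inl e \in s0 -> inl e \notin s ->
  O s x (edge_src e) \/ O s x (edge_dst e).
apply: (@explore_le _ q F1 G Inv) => //; last by split=> // e ->.
move=> s x us [ss inv].
have [[e [es Oe]]|nf] := pselect (exists e, inl e \in s /\ (O s x (edge_src e) \/ O s x (edge_dst e))).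
  left; exists (inl e); split=> // b.
  have OO z : O s x z -> O (rem (inl e) s) (upd x (inl e) b) z.
    case=> v [nv c]; exists v; split=> //; apply: con_adj c => u w [e' [ej e's xe]]; exists e'; split=> //.
      by apply: contra e's; exact: mem_rem.
    by rewrite updN //; apply: contraNneq e's => ->.
  split; first by move=> i /mem_rem/ss.
  move=> e' e'0; have [->|ne] := eqVneq e' e.
    by move=> _; case: Oe => /OO; [left|right].
  move=> hn; have e's : inl e' \notin s.
    move: hn; apply: contra => e's; rewrite (mem_rem_uniq _ us) !inE e's andbT.
    by apply: contra ne => /eqP[->].
  have [h|h] := inv e' e'0 e's; [left|right]; exact: OO.
right.
have rvl e : O s x (edge_src e) \/ O s x (edge_dst e) -> inl e \notin s.
  by move=> h; apply/negP => es; apply: nf; exists e.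
have Ob z : O s x z -> B z by case=> v [_ /con_r].
have OE y v z : (forall j, j \notin s -> y j = x j) -> nrm v = n -> con (oadj y) B v z -> O s x z.
  move=> hy nv; move: z; apply: con_ind; first by exists v; split=> //; apply: con_refl; rewrite /B /box nv.
  move=> a b _ Oa [e [ej ye]] Bb; have es : inl e \notin s.
    by apply: rvl; case: ej => -[-> ->]; [left|right].
  have [v' [nv' c]] := Oa; exists v'; split=> //; apply: (con_step c _ Bb).
  by exists e; split=> //; rewrite -hy.
have EO y z : (forall j, j \notin s -> y j = x j) -> O s x z -> exists v, nrm v = n /\ con (oadj y) B v z.
  move=> hy [v [nv c]]; exists v; split=> //.
  by apply: con_adj c => u w [e [ej es xe]]; exists e; split=> //; rewrite hy.
have e0 z : sub z origin = z by apply: vtx_eq => /=; lia.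
have RO y : (forall j, j \notin s -> y j = x j) -> (reach origin n y <-> O s x origin).
  move=> hy; split.
    move/(reach_loc _ _ n0) => [v [nv c]]; rewrite e0 in nv; apply: (OE y v) => //.
    apply: con_sub (con_sym (@oadj_sym y) c) => z; by rewrite e0.
  move/(EO y _ hy) => [v [nv c]]; exists v; rewrite e0 nv; split=> //.
  exact: con_sub (con_sym (@oadj_sym y) c).
have [Oo|nOo] := pselect (O s x origin).
  apply: Ex_le => // y hy; rewrite /F1 /F (indT R ((RO y hy).2 Oo)) subrr.
  by apply: sumr_ge0 => i _.
pose Sl := [seq z <- boxl n | ~~ `[< O s x z >]].
have SlP z : z \in Sl <-> B z /\ ~ O s x z.
  by rewrite mem_filter mem_boxl; split=> [/andP[/asboolPn ? ?]|[Bz /asboolPn ->]].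
have uS : uniq Sl by apply: filter_uniq; exact: boxl_uniq.
have oS : origin \in Sl by apply/SlP; split=> //; rewrite /B /box /nrm /=; lia.
have Sn z : z \in Sl -> nrm z < n.
  case/SlP=> Bz nO; rewrite lt_neqAle; move: (Bz); rewrite /B /box => ->; rewrite andbT.
  by apply/eqP => nz; apply: nO; exists z; split=> //; exact: con_refl.
apply: (@le_trans _ _ 1).
  by rewrite -[leRHS](Ex_cst q s 1 x); apply: Ex_le => // y _; rewrite /F1 lerBlDr lerDl ind_ge0.
apply: le_trans (hphi Sl uS oS) _.
pose C a (y : conf) : R := ind (con (oadj y) (fun z => z \in Sl) origin a).
have eS i : i \in ebits Sl -> i \in s.
  case/mem_ebits=> e [-> /SlP[h1 h1'] /SlP[h2 h2']]; apply/negPn/negP => es.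
  have e0' : inl e \in s0 by apply/inl_ebits; rewrite !mem_boxl.
  by case: (inv e e0' es).
(* All edges inside Sl are still unrevealed, so connections inside Sl keep their original
   probability and [hphi] can be used conditionally. *)
have CE a : Ex q (ebits Sl) (C a) x0 = Ex q s (C a) x.
  apply: Ex_any => //; [exact: ebits_uniq|exact: ebits_dep|].
  by move=> y z yz; apply: ebits_dep => i /eS/yz.
apply: (@le_trans _ _ (Ex q s (fun y => \sum_(a <- Sl) \sum_(e <- [seq e <- eds a | oth e a \notin Sl]) C a y) x)).
  have S0 : 0 <= \sum_(a <- Sl) \sum_(e <- eds a | oth e a \notin Sl) Ex q (ebits Sl) (C a) x0.
    by apply: sumr_ge0 => a _; apply: sumr_ge0 => e _; apply: Ex_ge0 => // y; exact: ind_ge0.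
  case/andP: p01 => p0 p1; apply: le_trans (ler_piMl S0 p1) _.
  rewrite le_eqVlt; apply/orP; left; apply/eqP; rewrite Ex_sum; apply: eq_bigr => a _; rewrite Ex_sum big_filter.
  by apply: eq_bigr => e _; exact: CE.
apply: Ex_le => // y hy.
pose l : seq rindex := [seq inl e | a <- Sl, e <- [seq e <- eds a | oth e a \notin Sl]].
have ledge a e : a \in Sl -> e \in [seq e <- eds a | oth e a \notin Sl] ->
   [/\ edge_joins e a (oth e a), oth e a \notin Sl & O s x (oth e a)].
  move=> aS; rewrite mem_filter => /andP[nb ea]; have ej := eds_joins ea; split=> //.
  have nb' := star_nrm (nn_star (edge_joins_nn ej)); have an := Sn _ aS.
  have Bb : B (oth e a) by rewrite /B /box; lia.
  by apply: contrapT => nO; move/negP: nb; apply; apply/SlP.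
have ul : uniq l.
  apply: allpairs_uniq_dep => //.
    by move=> a aS; apply: filter_uniq; exact: eds_uniq.
  move=> [a e] [a' e'] /allpairsPdep[a1 [e1 [aS ea /= [? ?]]]] /allpairsPdep[a2 [e2 [aS' ea' /= [? ?]]]] /= [ee]; subst.
  have [ej nb _] := ledge _ _ aS ea; have [ej' _ _] := ledge _ _ aS' ea'.
  suff -> : a1 = a2 by [].
  case: ej ej' => -[h1 h2] [] [h3 h4]; try by rewrite -?h1 -?h2 -?h3 -?h4.
  - by move: nb; rewrite -h2 h4 aS'.
  - by move: nb; rewrite -h1 h3 aS'.
have ls : {subset l <= s0}.
  move=> i /allpairsPdep[a [e [aS ea ->]]]; have [ej _ /Ob Bb] := ledge _ _ aS ea.
  have /SlP[Ba _] := aS; apply/inl_ebits; rewrite !mem_boxl.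
  by case: ej => -[-> ->].
apply: le_trans (@ler_sum_sub _ l s0 (D^~ y) ul us0 ls (fun i => D0 i y)).
rewrite /l big_allpairs_dep /=; rewrite !big_seq; apply: ler_sum => a aS.
rewrite !big_seq; apply: ler_sum => e ea.
have [ej nb Ob'] := ledge _ _ aS ea; have /SlP[Ba nOa] := aS.
have [ca|nca] := pselect (con (oadj y) (fun z => z \in Sl) origin a); last by rewrite /C indF // D0.
have es : inl e \notin s by apply: rvl; case: ej => -[-> ->]; [right|left].
have ye : y (inl e) = false.
  apply/negP => ye; apply: nOa; have [v [nv c]] := EO y _ hy Ob'.
  apply: (OE y v) => //; apply: (con_step c _ Ba); exists e; split=> //; exact: edge_joins_sym.
have up i : y i -> upd y (inl e) true i by rewrite /upd; case: eqP.
rewrite /C (indT R ca) /D /F (_ : upd y (inl e) false = y); last by rewrite -ye upd_id.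
rewrite (indF R (fun h => nOo ((RO y hy).1 h))) subr0 indT //.
have [v [nv c]] := EO y _ hy Ob'; exists v; rewrite e0 nv; split=> //.
have Up (K : vertex -> Prop) a1 a2 : con (oadj y) K a1 a2 -> con (oadj (upd y (inl e) true)) (fun=> True) a1 a2.
  move=> c1; apply: (con_sub (S := K)) => //; apply: con_adj c1 => u w [e' [ej' ye']]; exists e'; split=> //; exact: up.
apply: (con_trans (Up _ _ _ ca)).
apply: (con_cons (v := oth e a)) => //; first by exists e; rewrite updE.
exact: (Up _ _ _ (con_sym (@oadj_sym y) c)).
Qed.

Lemma phi_mono p p' Sl : 0 <= p -> p <= p' -> p' <= 1 -> phi p Sl <= phi p' Sl.
Proof.
move=> p0 pp' p1; have E0 b (q : R) : 0 <= q <= 1 ->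
   0 <= Ex (fun=> q) (ebits Sl) (fun x => ind (con (oadj x) (fun z => z \in Sl) origin b) : R) x0.
  by move=> hq; apply: Ex_ge0 => // y; exact: ind_ge0.
apply: ler_pM => //.
  by apply: sumr_ge0 => a _; apply: sumr_ge0 => e _; apply: E0; rewrite p0 (le_trans pp').
apply: ler_sum => a _; apply: ler_sum => e _; apply: Ex_mono_q => //.
- by move=> i; rewrite p0 (le_trans pp').
- by move=> i; rewrite p1 (le_trans p0).
move=> x y xy; apply: ind_mono; apply: con_adj => u w [e' [ej xe]]; exists e'; split=> //; exact: xy.
Qed.

(** Between p0 and p1 the derivative of [th] is at least 1 - [th], hence at least its value at p1.
    The mean value theorem then gives (1 - [th] p1) (p1 - p0) <= [th] p1. *)
Lemma th_ge p0 p1 n : 0 <= p0 -> p0 < p1 -> p1 <= 1 -> 0 <= n ->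
  (forall Sl, uniq Sl -> origin \in Sl -> 1 <= phi p0 Sl) ->
  (p1 - p0) / (1 + (p1 - p0)) <= th p1 n.
Proof.
move=> h0 h01 h1 n0 hphi; pose f p := th p n.
pose df p := \sum_(i <- ebits (boxl n)) Ex (fun=> p) (ebits (boxl n))
    (fun y => ind (reach origin n (upd y i true)) - ind (reach origin n (upd y i false)) : R) x0.
have us0 : uniq (ebits (boxl n)) by apply: ebits_uniq; exact: boxl_uniq.
have dv (x : R) : is_derive x 1 f (df x) by apply: Ex_derive.
have [c] := @MVT R f df p0 p1 h01 (fun x _ => dv x)
  (derivable_within_continuous (fun x _ => @ex_derive _ _ _ _ _ _ _ (dv x))).
rewrite in_itv /= => /andP[c0 c1] e.
have cp : 1 - f c <= df c.
  apply: pivotal_sum => //; first by rewrite (ltW (le_lt_trans h0 c0)) (ltW (lt_le_trans c1 h1)).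
  move=> Sl u o; apply: le_trans (hphi Sl u o) _; apply: phi_mono => //; first exact: ltW.
  exact: ltW (lt_le_trans c1 h1).
have fm : f c <= f p1.
  apply: Ex_mono_q; [| |by move=> _; exact: ltW|exact: incr_reach].
  - by move=> i; rewrite (ltW (le_lt_trans h0 c0)) (ltW (lt_le_trans c1 h1)).
  - by move=> i; rewrite h1 (le_trans h0 (ltW h01)).
have f0 : 0 <= f p0.
  by apply: Ex_ge0 => [i|y]; [rewrite h0 (ltW (lt_le_trans h01 h1))|exact: ind_ge0].
rewrite -/(f p1) ler_pdivrMr; last lra.
have : (1 - f p1) * (p1 - p0) <= f p1 - f p0.
  by rewrite e; apply: ler_wpM2r; lra.
by nra.
Qed.

Lemma geom_decay (c : R) (j : nat) : 0 <= c -> c < 1 -> c ^+ j * (j%:R * (1 - c)) <= 1.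
Proof.
move=> c0 c1; apply: (@le_trans _ _ (c ^+ j * (1 + j%:R * (1 - c)))).
  by apply: ler_wpM2l; [exact: exprn_ge0|lra].
elim: j => [|j IH]; first by rewrite expr0 mul0r addr0 mulr1.
have cj : 0 <= c ^+ j by exact: exprn_ge0.
have cj1 : c ^+ j <= 1 by apply: exprn_ile1 => //; exact: ltW.
have h1 := ler_wpM2l c0 IH; have h2 : c * (c ^+ j * (1 - c)) <= 1 - c.
  by rewrite mulrA ger_pMl ?subr_gt0 // mulr_ile1 // ltW.
rewrite exprS -natr1; move: (c ^+ j) h1 h2 => C h1 h2; nra.
Qed.

Lemma th_pow p Sl (L : nat) k (m : int) : 0 <= p <= 1 -> uniq Sl -> origin \in Sl ->
  (forall z, z \in Sl -> box L%:Z z) -> (k * L.+1)%N%:Z <= m -> th p m <= phi p Sl ^+ k.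
Proof.
move=> p01 uS oS SL; have ph0 : 0 <= phi p Sl.
  case/andP: (p01) => p0 _; apply: mulr_ge0 => //; apply: sumr_ge0 => a _; apply: sumr_ge0 => e _.
  by apply: Ex_ge0 => // y; exact: ind_ge0.
elim: k m => [|k IH] m km.
  by rewrite expr0; apply: Ex_le1 => // y; exact: ind_le1.
apply: le_trans (@decay_step p Sl L%:Z m p01 uS oS SL _ _) _ => //; [lia|].
rewrite exprS; apply: ler_wpM2l => //; apply: IH; lia.
Qed.

(** The factor (n + 1)^2 is the order of the number of sites in a box of radius n, over which union
    bounds will be taken. *)
Lemma th_decay p Sl (e : R) : 0 <= p <= 1 -> uniq Sl -> origin \in Sl -> phi p Sl < 1 -> 0 < e ->
  exists N : nat, forall n : nat, (N <= n)%N -> n.+1%:R ^+ 2 * th p n%:Z <= e.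
Proof.
move=> p01 uS oS ph e0; pose c := phi p Sl.
have ph0 : 0 <= c.
  case/andP: (p01) => p0 _; apply: mulr_ge0 => //; apply: sumr_ge0 => a _; apply: sumr_ge0 => f _.
  by apply: Ex_ge0 => // y; exact: ind_ge0.
have [L SL] : exists L : nat, forall z, z \in Sl -> box L%:Z z.
  elim: (Sl) => [|a l [L IH]]; first by exists 0%N.
  exists (maxn L `|nrm a|); move=> z; rewrite inE => /orP[/eqP ->|/IH]; rewrite /box; lia.
pose M : R := 36%:R * (L.+1%:R ^+ 2).
have g0 : 0 < 1 - c by rewrite subr_gt0.
have [J hJ] : exists J : nat, M / (e * (1 - c) ^+ 3) <= J%:R.
  exists (Num.bound (M / (e * (1 - c) ^+ 3))); apply/ltW/archi_boundP.
  by rewrite divr_ge0 ?mulr_ge0 ?exprn_ge0 ?ler0n // ltW.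
(* With j close to n / (3 (L + 1)), [th] is at most (c^j)^3. Each c^j is at most 1 / (j (1 - c)):
   two of them absorb (n + 1)^2 and the third makes the product small. *)
exists (3 * L.+1 * J.+1)%N => n Nn; pose j := (n %/ (3 * L.+1))%N.
have jJ : (J.+1 <= j)%N by rewrite /j leq_divRL // mulnC.
have nj : (n.+1 <= 6 * L.+1 * j)%N.
  have := divn_eq n (3 * L.+1); have := ltn_pmod n (isT : 0 < 3 * L.+1)%N; rewrite -/j.
  move: (n %% _)%N => r hr ->; nia.
have jn : (3 * j * L.+1 <= n)%N.
  by have := leq_trunc_div n (3 * L.+1); rewrite -/j mulnCA mulnA.
have t1 : th p n%:Z <= (c ^+ j) ^+ 3.
  rewrite -exprM; apply: (@th_pow p Sl L) => //; rewrite lez_nat; apply: leq_trans jn.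
  by rewrite (mulnC j).
have gd := @geom_decay c j ph0 ph.
have cj : 0 <= c ^+ j by exact: exprn_ge0.
have j0 : 0 < (j%:R : R) by rewrite ltr0n; exact: leq_trans jJ.
have n1 : n.+1%:R <= 6%:R * L.+1%:R * j%:R :> R by rewrite -!natrM ler_nat.
have th0 : 0 <= th p n%:Z by apply: Ex_ge0 => // y; exact: ind_ge0.
have h1 : n.+1%:R ^+ 2 * th p n%:Z <= M * j%:R ^+ 2 * (c ^+ j) ^+ 3.
  apply: ler_pM => //.
  have -> : M * j%:R ^+ 2 = (6%:R * L.+1%:R * j%:R) ^+ 2 :> R by rewrite /M; ring.
  by rewrite ler_pXn2r // nnegrE ?ler0n // !mulr_ge0 ?ler0n.
apply: le_trans h1 _.
have h2 : (c ^+ j * (j%:R * (1 - c))) ^+ 3 <= 1.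
  by apply: exprn_ile1 => //; apply: mulr_ge0 => //; apply: mulr_ge0; exact: ltW.
have h3 : M <= e * (1 - c) ^+ 3 * j%:R.
  rewrite -ler_pdivrMl; last by rewrite mulr_gt0 ?exprn_gt0.
  by rewrite mulrC; apply: le_trans hJ _; rewrite ler_nat; exact: ltnW.
apply: (@le_trans _ _ (e * (1 - c) ^+ 3 * j%:R * j%:R ^+ 2 * (c ^+ j) ^+ 3)).
  by apply: ler_wpM2r; [exact: exprn_ge0|apply: ler_wpM2r => //; exact: exprn_ge0 (ltW j0)].
have -> : e * (1 - c) ^+ 3 * j%:R * j%:R ^+ 2 * (c ^+ j) ^+ 3 = e * (c ^+ j * (j%:R * (1 - c))) ^+ 3 by ring.
by rewrite ger_pMr.
Qed.

End Sharp.

Section Transition.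
Context {R : realType} {d : measure_display} {Omega : measurableType d}.
Variables (P : probability Omega R) (W : rindex -> Omega -> R) (hW : iid_uniform P W).

Lemma theta_th p n : 0 <= p <= 1 -> 0 <= n -> theta P W p n = th p n.
Proof.
move=> p01 n0; rewrite (theta_Ex hW x0 p01 n0); apply: Ex_any.
- by apply: bits_of_uniq; exact: boxl_uniq.
- by apply: ebits_uniq; exact: boxl_uniq.
- move=> x y xy; apply: ind_iff.
  have e0 : nrm origin = 0 by rewrite /nrm /=; lia.
  have -> // : reach origin n x = reach origin n y.
  by apply: (reach_dep n0) => i; rewrite e0 addr0 => /xy.
- by apply: reach_dep_e => //; rewrite /nrm /=; lia.
Qed.

(** If [phi] were below 1 on some set at 1/2, then [th] would decay faster than 1 / n^2, against
    [theta_half_lower]. So [phi] is at least 1 on all sets at 1/2, and [th_ge] applies above it. *)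
Lemma theta_supercritical p : 2^-1 < p <= 1 ->
  exists2 c : R, 0 < c & forall n : int, 0 <= n -> c <= theta P W p n.
Proof.
case/andP=> p2 p1; exists ((p - 2^-1) / (1 + (p - 2^-1))); first by rewrite divr_gt0; lra.
move=> n n0; rewrite theta_th //; last by apply/andP; split; lra.
apply: th_ge => //; try lra.
move=> Sl uS oS; rewrite leNgt; apply/negP => ph.
have h01 : 0 <= (2^-1 : R) <= 1 by apply/andP; split; lra.
have [N hN] := @th_decay R 2^-1 Sl 4^-1 h01 uS oS ph ltac:(lra).
have := hN N (leqnn N); have := theta_half_lower hW N; rewrite theta_th //.
have N1 : (1 : R) <= N.+1%:R by rewrite ler1n.
rewrite natrM; move: (th _ _) => t h1 h2.
have t0 : 0 <= t by rewrite leNgt; apply/negP => t0; nra.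
by nra.
Qed.

(** If [phi] were at least 1 on every set at p, [th_ge] would bound [th] at 1/2 from below, against
    [theta_half_small]. *)
Lemma theta_subcritical p (e : R) : 0 <= p < 2^-1 -> 0 < e ->
  exists N : nat, forall n : nat, (N <= n)%N -> n.+1%:R ^+ 2 * theta P W p n%:Z <= e.
Proof.
case/andP=> p0 p2 e0; have p01 : 0 <= p <= 1 by apply/andP; split; lra.
have [[Sl [uS oS ph]]|nS] := pselect (exists Sl, [/\ uniq Sl, origin \in Sl & phi p Sl < 1]).
  have [N hN] := th_decay p01 uS oS ph e0; exists N => n Nn; rewrite theta_th //; exact: hN.
exfalso; pose c : R := (2^-1 - p) / (1 + (2^-1 - p)).
have c0 : 0 < c by rewrite divr_gt0; lra.
have c2 : 0 < c / 2 by rewrite divr_gt0.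
have [n n0 hn] := theta_half_small hW c2.
have : c <= th 2^-1 n.
  apply: th_ge => //; try lra.
  by move=> Sl u o; rewrite leNgt; apply/negP => h; apply: nS; exists Sl.
by move: hn; rewrite theta_th //; last (by apply/andP; split; lra); lra.
Qed.

End Transition.

(** * The divide-and-colour law *)

Definition kv (v : vertex) : nat := pickle v.

Lemma kv_inj : injective kv.
Proof. exact: pcan_inj (@pickleK _). Qed.

Lemma con_true adj u v : con adj (fun=> True) u v <-> path_conn adj u v.
Proof.
split=> [[_]|].
  by elim=> [|a b _ h [ab _]]; [exact: path_refl|exact: path_step h ab].
by move=> h; split=> //; elim: h => [|a b _ h ab]; [exact: path_refl|exact: path_step h _].
Qed.

Lemma con_loc_dep (G : vertex -> Prop) (L : int) u v :
  dep (fun i => i \in bits_of (boxl L)) (fun x => con (oadj x) (fun z => G z /\ box L z) u v).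
Proof.
move=> x y xy; apply/propext; split; apply: con_dep => i gi; [rewrite xy //|rewrite -xy //];
  apply: gbit_bits; case: i gi => [e [[_ h1] [_ h2]]|z [_ h]]; by rewrite /gbit ?mem_boxl.
Qed.

Lemma blackG_depP gl (A : event) :
  dep (fun i => i \in bits_of gl) (fun x => A (blackG kv (fun z => z \in gl) x)).
Proof.
move=> x y xy; congr (A _); apply/funext => v; apply/propext.
by split; apply: blackG_dep => i /gbit_bits/xy.
Qed.

(** The colouring equal to S on F and to S' elsewhere is an intermediate step between the two. *)
Lemma on_setI (F F' : vertex -> Prop) A : on_set F A -> on_set F' A -> on_set (fun z => F z /\ F' z) A.
Proof.
move=> h h' S S' e AS.
apply: (h' (fun z => (F z /\ S z) \/ (~ F z /\ S' z))).
  move=> z F'z; have [Fz|nFz] := pselect (F z); last by split; [case=> -[]|right].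
  by split; [case=> -[] // _ /e; apply|move=> ?; left; split=> //; apply/e].
apply: (h S) => // z Fz; split; first by left.
by case=> -[].
Qed.

Section ManyColours.
Context {R : realType} (q : rindex -> R) (r : R) (gl : seq vertex).
Hypotheses (qr : forall v, q (inr v) = r) (ugl : uniq gl).
Notation gin := (fun z => z \in gl).

Lemma Ex_bit (s : seq rindex) i x : uniq s -> i \in s -> Ex q s (fun y => ind (y i)) x = q i.
Proof.
move=> us is_; rewrite (@Ex_supp _ _ q s [:: i]) //=.
- by rewrite !updE (@indT R true isT) (@indF R false notF) mulr1 mulr0 addr0.
- by move=> y z yz; rewrite (yz i) // mem_head.
- by move=> j; rewrite inE => /eqP->.
Qed.

Lemma Ex_bits (s l : seq rindex) x : uniq s -> uniq l -> {subset l <= s} ->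
  Ex q s (fun y => ind (forall i, i \in l -> y i)) x = \prod_(i <- l) q i.
Proof.
move=> us; elim: l => [|i l IH] /=.
  by move=> _ _; rewrite big_nil -[RHS](Ex_cst q s 1 x); apply: Ex_ext => y; rewrite indT.
case/andP=> il ul ls; rewrite big_cons -IH //; last by move=> j jl; apply: ls; rewrite in_cons jl orbT.
rewrite -(@Ex_bit s i x us); last by apply: ls; exact: mem_head.
rewrite -(@Ex_mul _ _ q s (fun j => j = i) (fun j => j \in l)).
- apply: Ex_ext => y; rewrite -ind_and; apply: ind_iff; split.
    by move=> h; split; [apply: h; exact: mem_head|move=> j jl; apply: h; rewrite in_cons jl orbT].
  by case=> h1 h2 j; rewrite in_cons => /orP[/eqP->|/h2].
- by move=> y z yz; rewrite (yz i).
- by move=> y z yz; apply: ind_iff; split=> h j jl; [rewrite -yz ?h|rewrite yz ?h].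
- by move=> j _ ->; apply/negP.
Qed.

Lemma black_colours (vs : seq vertex) x : uniq vs -> {subset vs <= gl} ->
  (forall u v, u \in vs -> v \in vs -> con (oadj x) gin u v -> u = v) ->
  Ex q [seq inr v | v <- gl] (fun y => ind (forall v, v \in vs -> blackG kv gin y v)) x = r ^+ size vs.
Proof.
move=> uv vg dv.
have [rho hrho] : {rho : vertex -> vertex & forall v, v \in gl -> con (oadj x) gin v (rho v) /\
    forall u, con (oadj x) gin v u -> (kv (rho v) <= kv u)%N}.
  apply: (@choice _ _ (fun v w => v \in gl -> con (oadj x) gin v w /\
    forall u, con (oadj x) gin v u -> (kv w <= kv u)%N)) => v.
  have [vg'|nv] := boolP (v \in gl); last by exists v.
  by have [w hw] := @rep_exists kv gin x v vg'; exists w.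
pose l : seq rindex := [seq inr (rho v) | v <- vs].
have -> : r ^+ size vs = \prod_(i <- l) q i.
  by rewrite /l big_map (eq_bigr (fun=> r)) ?big_const_seq ?count_predT ?iter_mulr_1 // => v _; exact: qr.
rewrite -(@Ex_bits [seq inr v | v <- gl] l x).
- apply: Ex_eq_on => y hy; apply: ind_iff.
  have ye e : y (inl e) = x (inl e) by apply: hy; apply/mapP => -[].
  rewrite (blackG_map kv_inj hrho ye); split=> h.
    by move=> i /mapP[v vv ->]; have [] := h v vv.
  by move=> v vv; split; [exact: vg|apply: h; apply/mapP; exists v].
- by rewrite map_inj_uniq // => u v [].
- rewrite map_inj_in_uniq // => u v uu vv [e]; apply: dv => //.
  have [c1 _] := hrho u (vg _ uu); have [c2 _] := hrho v (vg _ vv).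
  by rewrite e in c1; exact: (con_trans c1 (con_sym (@oadj_sym x) c2)).
- move=> i /mapP[v vv ->]; apply: map_f; have [c _] := hrho v (vg _ vv); exact: (con_r c).
Qed.

(* Given the edges, distinct clusters are coloured independently. *)
Lemma black_many k (g : conf -> R) (vs : conf -> seq vertex) x :
  (forall y z : conf, (forall e, y (inl e) = z (inl e)) -> g y = g z /\ vs y = vs z) ->
  (forall y, g y != 0 -> [/\ uniq (vs y), size (vs y) = k, {subset vs y <= gl} &
     forall u v, u \in vs y -> v \in vs y -> con (oadj y) gin u v -> u = v]) ->
  Ex q (bits_of gl) (fun y => g y * ind (forall v, v \in vs y -> blackG kv gin y v)) x =
  r ^+ k * Ex q (bits_of gl) g x.
Proof.
move=> he hv; pose V : seq rindex := [seq inr v | v <- gl].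
rewrite /bits_of catA -/V; set s := (X in Ex q (X ++ V)); move: s => s.
rewrite !Ex_cat -ExZ; apply: Ex_ext => y.
have E z : (forall j, j \notin V -> z j = y j) -> g z = g y /\ vs z = vs y.
  by move=> hz; apply: he => e; apply: hz; apply/mapP => -[].
rewrite (@Ex_eq_on _ _ q V _ (fun z => g y * ind (forall v, v \in vs y -> blackG kv gin z v))); last first.
  by move=> z hz; have [-> ->] := E z hz.
rewrite (@Ex_eq_on _ _ q V g (fun=> g y)); last by move=> z hz; have [-> _] := E z hz.
rewrite ExZ Ex_cst; have [->|gy] := eqVneq (g y) 0; first by rewrite mul0r mulr0.
by have [h1 <- h2 h3] := hv y gy; rewrite black_colours // mulrC.
Qed.

End ManyColours.

Definition all_black (l : seq vertex) : event := fun S => forall v, v \in l -> S v.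

Lemma all_black_loc l : loc (all_black l).
Proof.
have [n hn] : exists n : int, forall z, z \in l -> box n z.
  elim: l => [|a l [n IH]]; first by exists 0.
  exists (Num.max (nrm a) n) => z; rewrite in_cons => /orP[/eqP->|/IH]; rewrite /box; lia.
by exists n => S S' e h v vl; apply/e; [exact: hn|exact: h].
Qed.

Lemma reach_box (L N : int) (x : conf) (G : vertex -> Prop) u v : box L u -> L + N <= nrm v ->
  con (oadj x) G u v -> reach u N x.
Proof.
move=> bu nv c; exists v; split; last exact: con_sub c.
by have := nrm_sub v u; move: bu; rewrite /box; lia.
Qed.

(** * Finite-volume approximation, positive association and mixing *)

Section Dac.
Context {R : realType} {d : measure_display} {Omega : measurableType d}.
Variables (P : probability Omega R) (W : rindex -> Omega -> R) (hW : iid_uniform P W).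

Lemma Pr_near (A B U : set Omega) : measurable A -> measurable B -> measurable U ->
  (forall w, ~ U w -> (A w <-> B w)) -> `|Pr P A - Pr P B| <= Pr P U.
Proof.
move=> mA mB mU h.
have K (C D : set Omega) : measurable C -> measurable D -> (forall w, ~ U w -> C w -> D w) -> Pr P C <= Pr P D + Pr P U.
  move=> mC mD CD; apply: le_trans (Pr_sub2 P mD mU); apply: Pr_mono => //; first exact: measurableU.
  by move=> w Cw; have [Uw|nU] := pselect (U w); [right|left; exact: CD].
have k1 := K _ _ mA mB (fun w nU => (h w nU).1); have k2 := K _ _ mB mA (fun w nU => (h w nU).2).
by rewrite ler_norml; apply/andP; split; lra.
Qed.

Lemma Pr_indep (thr : rindex -> R) (A B : conf -> Prop) (s t : seq rindex) : probs thr ->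
  uniq s -> uniq t -> (forall i, i \in s -> i \notin t) ->
  dep (fun i => i \in s) A -> dep (fun i => i \in t) B ->
  Pr P [set w | A (bits W thr w) /\ B (bits W thr w)] =
  Pr P [set w | A (bits W thr w)] * Pr P [set w | B (bits W thr w)].
Proof.
move=> hthr us ut st dA dB; pose y : conf := fun=> false.
have ust : uniq (s ++ t).
  by rewrite cat_uniq us ut andbT; apply/hasPn => i it; apply/negP => is_; move: (st i is_); rewrite it.
have dA' : dep (fun i => i \in s ++ t) A by move=> u v uv; apply: dA => i is_; apply: uv; rewrite mem_cat is_.
have dB' : dep (fun i => i \in s ++ t) B by move=> u v uv; apply: dB => i is_; apply: uv; rewrite mem_cat is_ orbT.
rewrite (@Pr_Ex _ _ _ _ _ hW thr hthr (fun x => A x /\ B x) (s ++ t) y) //; last first.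
  by move=> u v uv; rewrite (dA' _ _ uv) (dB' _ _ uv).
rewrite (@Pr_Ex _ _ _ _ _ hW thr hthr A (s ++ t) y) // (@Pr_Ex _ _ _ _ _ hW thr hthr B (s ++ t) y) //.
rewrite -(@Ex_mul _ _ thr (s ++ t) (fun i => i \in s) (fun i => i \in t)).
- by apply: Ex_ext => x; rewrite ind_and.
- by move=> u v uv; rewrite (dA _ _ uv).
- by move=> u v uv; rewrite (dB _ _ uv).
- by move=> i _ /st/negP.
Qed.

Definition thr (p r : R) (i : rindex) : R := match i with inl _ => p | inr _ => r end.

Section PR.
Variables (p r : R).
Hypotheses (hp : 0 <= p <= 1) (hr : 0 <= r <= 1).

Lemma probs_thr : probs (thr p r). Proof. by case. Qed.

Notation bx w := (bits W (thr p r) w).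
Definition blk (w : Omega) (v : vertex) : Prop := blackG kv (fun=> True) (bx w) v.

Lemma blkE w v : blk w v <-> black W p r w v.
Proof.
have e a b : con (oadj (bx w)) (fun=> True) a b <-> same_pcluster W p w a b.
  rewrite con_true /same_pcluster (_ : oadj (bx w) = open_adj W p w) //.
split=> [[rep [h1 h2 h3]]|[rep [[h1 h2] h3]]]; exists rep.
  by split=> //; split; [exact/e|move=> u /e/h2].
by split=> //; [exact/e|move=> u /e/h2].
Qed.

Lemma meas_con (G : vertex -> Prop) u v : measurable [set w | con (oadj (bx w)) G u v].
Proof.
apply: (@meas_iff _ _ (fun w => exists L : nat, con (oadj (bx w)) (fun z => G z /\ box L%:Z z) u v)).
  by move=> w; split=> [[L c]|/con_box//]; apply: con_sub c => z [].
apply: meas_ex => L; apply: (@meas_loc _ _ _ _ _ hW (thr p r)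
  (fun x => con (oadj x) (fun z => G z /\ box L%:Z z) u v) (bits_of (boxl L%:Z))).
exact: con_loc_dep.
Qed.

Lemma meas_blackG G v : measurable [set w | blackG kv G (bx w) v].
Proof.
apply: meas_ex => rep.
apply: (@meas_iff _ _ (fun w => con (oadj (bx w)) G v rep /\
  ((forall u, con (oadj (bx w)) G v u -> (kv rep <= kv u)%N) /\ bx w (inr rep)))).
  by move=> w; split=> [[? []]|[]].
apply: meas_and; first exact: meas_con.
apply: meas_and; last exact: (meas_bit hW).
by apply: meas_all => u; apply: meas_imp; [exact: meas_con|exact: meas_cst].
Qed.

Lemma meas_stable L v : measurable [set w | stable kv L (bx w) v].
Proof.
apply: meas_ex => rep; apply: meas_and; first exact: meas_con.
by apply: meas_all => u; apply: meas_imp; [exact: meas_con|exact: meas_cst].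
Qed.

Definition unstable (n L : int) : set Omega :=
  [set w | exists2 v, v \in boxl n & ~ stable kv L (bx w) v].

Lemma meas_unstable n L : measurable (unstable n L).
Proof. by apply: (Pr_ex_seq P _).1 => v _; apply: meas_not; exact: meas_stable. Qed.

Lemma unstable_small (n : int) (e : R) : 0 < e -> exists L0 : nat, forall L : nat, (L0 <= L)%N ->
  Pr P (unstable n L%:Z) <= e.
Proof.
move=> e0; have mono (L L' : nat) : (L <= L')%N -> unstable n L'%:Z `<=` unstable n L%:Z.
  by move=> LL w [v vn h]; exists v => // s; apply: h; apply: stable_mono s; rewrite lez_nat.
have hw w : exists L : nat, ~ unstable n L%:Z w.
  have [L hL] : exists L : nat, forall v, v \in boxl n -> stable kv L%:Z (bx w) v.
    elim: (boxl n) => [|a l [L IH]]; first by exists 0%N.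
    have [La ha] := @stable_ex kv (bx w) a; exists (maxn L La) => v; rewrite in_cons => /orP[/eqP->|/IH h].
      by apply: stable_mono ha; rewrite lez_nat leq_maxr.
    by apply: stable_mono h; rewrite lez_nat leq_maxl.
  by exists L; case=> v vn; apply; exact: hL.
have [L0 hL0] := @Pr_decr _ _ _ P (fun L : nat => unstable n L%:Z) e
  (fun L => meas_unstable n L%:Z) (fun L => mono L L.+1 (leqnSn L)) hw e0.
exists L0 => L LL; apply: le_trans (ltW hL0); apply: Pr_mono; try exact: meas_unstable.
exact: mono.
Qed.

Lemma stable_blk (n L : int) (G : vertex -> Prop) w : ~ unstable n L w -> (forall z, box L z -> G z) ->
  forall v, box n v -> (blk w v <-> blackG kv G (bx w) v).
Proof.
move=> nU LG v bv; have st : stable kv L (bx w) v.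
  by apply: contrapT => ns; apply: nU; exists v => //; rewrite mem_boxl.
by have := @stable_black kv kv_inj L G (bx w) v st LG; exact: iff_sym.
Qed.

Lemma meas_blk v : measurable [set w | blk w v]. Proof. exact: meas_blackG. Qed.

Lemma meas_event (A : event) : loc A -> measurable [set w | A (blk w)].
Proof. apply: meas_col; exact: meas_blk. Qed.

Notation pr := (prc P blk).
Notation ExA gl A := (Ex (thr p r) (bits_of gl) (fun x => ind (A (blackG kv (fun z => z \in gl) x)))).

Lemma Pr_gl gl (A : event) y : uniq gl ->
  Pr P [set w | A (blackG kv (fun z => z \in gl) (bx w))] = ExA gl A y.
Proof.
move=> u; apply: (@Pr_Ex _ _ _ _ _ hW _ probs_thr (fun x => A (blackG kv (fun z => z \in gl) x))).
  exact: bits_of_uniq.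
exact: blackG_depP.
Qed.

Lemma meas_gl (gl : seq vertex) (A : event) : measurable [set w | A (blackG kv (fun z => z \in gl) (bx w))].
Proof.
apply: (@meas_loc _ _ _ _ _ hW (thr p r) (fun x => A (blackG kv (fun z => z \in gl) x)) (bits_of gl)).
exact: blackG_depP.
Qed.

(** One L0 serves all events on the box n and all finite regions containing the box L0; [dac_sym]
    uses it for the image of a box under a symmetry. *)
Lemma approx (n : int) (e : R) : 0 < e -> exists L0 : nat, forall gl, uniq gl ->
  (forall z, box L0%:Z z -> z \in gl) -> forall A y, on_set (fun z => box n z) A ->
  `|pr A - ExA gl A y| <= e.
Proof.
move=> e0; have [L0 hL] := unstable_small n e0; exists L0 => gl ugl Lg A y oA.
rewrite -Pr_gl //; apply: le_trans (hL L0 (leqnn _)).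
apply: Pr_near; [by apply: meas_event; exists n|exact: meas_gl|exact: meas_unstable|].
move=> w nU; have h := stable_blk nU Lg.
by split; apply: oA => z bz; [|apply: iff_sym]; exact: h.
Qed.

Lemma dac_fkg A B : loc A -> loc B -> inc A -> inc B -> pr A * pr B <= pr (fun S => A S /\ B S).
Proof.
move=> [nA oA] [nB oB] iA iB; pose n : int := Num.max nA nB.
have oA' : on_set (fun z => box n z) A by apply: on_set_sub oA => z; rewrite /box /n; lia.
have oB' : on_set (fun z => box n z) B by apply: on_set_sub oB => z; rewrite /box /n; lia.
apply/ler_addgt0Pr => e e0; have e4 : 0 < e / 4 by rewrite divr_gt0.
have [L hL] := approx n e4; pose gl := boxl L%:Z.
have Lg z : box L%:Z z -> z \in gl by rewrite mem_boxl.
have ugl : uniq gl by exact: boxl_uniq.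
have hA := hL gl ugl Lg A x0 oA'; have hB := hL gl ugl Lg B x0 oB'.
have hAB := hL gl ugl Lg _ x0 (on_set_and oA' oB').
have pq := probs_thr.
have F : ExA gl A x0 * ExA gl B x0 <= ExA gl (fun S => A S /\ B S) x0.
  apply: le_trans (@black_fkg kv kv_inj _ _ pq (fun z => z \in gl) (fun S => ind (A S)) (fun S => ind (B S)) _ x0 _ _ _) _.
  - exact: bits_of_uniq.
  - by move=> S S' SS; apply: ind_mono; exact: iA.
  - by move=> S S' SS; apply: ind_mono; exact: iB.
  by apply: Ex_le => // y _; rewrite ind_and.
have a0 : 0 <= ExA gl A x0 by apply: Ex_ge0 => // y; exact: ind_ge0.
have a1 : ExA gl A x0 <= 1 by apply: Ex_le1 => // y; exact: ind_le1.
have b0 : 0 <= pr B by exact: Pr_ge0.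
have b1 : pr B <= 1 by apply: Pr_le1; apply: meas_event; exists nB.
move: hA hB hAB F a0 a1 b0 b1; rewrite !ler_norml.
move: (ExA gl A x0) (ExA gl B x0) (ExA _ _ _) (pr A) (pr B) (pr _) => a b c a' b' c'.
move=> /andP[h1 h2] /andP[h3 h4] /andP[h5 h6] F a0 a1 b0 b1; nra.
Qed.

Lemma dac_sym s h A : bsym s h -> (forall i, thr p r (h i) = thr p r i) ->
  (forall n : int, exists m : int, forall z, box n z -> box m (s z)) ->
  (forall n : int, exists m : int, forall z, box n (s z) -> box m z) -> loc A ->
  pr (fun S => A (fun z => S (s z))) = pr A.
Proof.
move=> hs ht s1 s2 [n oA]; have [n' hn'] := s1 n.
pose As : event := fun S => A (fun z => S (s z)).
have oAs : on_set (fun z => box n' z) As by move=> S S' e; apply: oA => z bz; apply: e; exact: hn'.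
apply/eqP; rewrite -subr_eq0 -normr_le0; apply/ler_addgt0Pr => e e0; rewrite add0r.
have e2 : 0 < e / 2 by rewrite divr_gt0.
have [L hL] := approx n e2; have [L' hL'] := approx n' e2; have [M hM] := s2 L'%:Z.
pose gl := boxl (Num.max L%:Z M); have ugl : uniq gl by exact: boxl_uniq.
have k1 := hL gl ugl (fun z => _) A x0 oA.
have k2 : `|pr As - ExA (map s gl) As x0| <= e / 2.
  apply: (hL' (map s gl)) => //; first by rewrite map_inj_uniq //; exact: bsym_inj hs.
  move=> z bz; have [_ _ _ _ /(_ z)[z' zz]] := hs; rewrite -zz; apply: map_f; rewrite mem_boxl.
  by have := hM z'; rewrite zz => /(_ bz); rewrite /box; clear; lia.
have k3 : ExA (map s gl) As x0 = ExA gl A x0.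
  exact: (@black_sym _ (thr p r) r s h kv gl (fun S => ind (A S)) x0 x0 hs kv_inj ht (fun=> erefl) ugl).
have k4 : `|pr A - ExA gl A x0| <= e / 2 by apply: k1 => z; rewrite mem_boxl /box; lia.
rewrite k3 in k2; move: k2 k4; rewrite !ler_norml => /andP[? ?] /andP[? ?]; apply/andP; split; lra.
Qed.

Lemma dac_shift c A : loc A -> pr (fun S => A (fun z => S (shift c z))) = pr A.
Proof.
apply: (dac_sym (bsym_shift c)); first by case.
- by move=> n; exists (n + nrm c) => z; rewrite /box /nrm /=; lia.
- by move=> n; exists (n + nrm c) => z; rewrite /box /nrm /=; lia.
Qed.

Lemma dac_swap A : loc A -> pr (fun S => A (fun z => S (swap z))) = pr A.
Proof.
apply: (dac_sym bsym_swap); first by case.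
- by move=> n; exists n => z; rewrite /box /nrm /=; lia.
- by move=> n; exists n => z; rewrite /box /nrm /=; lia.
Qed.

Lemma dac_flip A : loc A -> pr (fun S => A (fun z => S (flipy z))) = pr A.
Proof.
apply: (dac_sym bsym_flip); first by case.
- by move=> n; exists n => z; rewrite /box /nrm /=; lia.
- by move=> n; exists n => z; rewrite /box /nrm /=; lia.
Qed.

(** Up to small errors, A is decided by the colouring built inside the box L, and B by the one built
    in a large box with the box L removed; the second replacement fails if an open cluster joins the
    box L to distance N, or if a representative lies too far out. The two colourings use disjoint
    bits. L and N are chosen before B, while the outer box may depend on B. *)
Lemma dac_mix : p < 2^-1 -> forall (n : int) (e : R), 0 < e -> exists m : int, forall A B,
    on_set (fun z => box n z) A -> loc B -> on_set (fun z => ~~ box m z) B ->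
    pr (fun S => A S /\ B S) <= pr A * pr B + e.
Proof.
move=> p2 n e e0; have e8 : 0 < e / 8 by rewrite divr_gt0.
have pq := probs_thr.
have [L hL] := unstable_small n e8; pose k : R := (size (boxl L%:Z)).+1%:R.
have k0 : 0 < k by rewrite ltr0n.
have ek : 0 < e / 8 / k by rewrite divr_gt0.
have hp2 : 0 <= p < 2^-1 by case/andP: hp => -> _.
have [N hN] := theta_subcritical hW hp2 ek; have hN1 := hN N (leqnn N).
pose U3 : set Omega := [set w | exists2 a, a \in boxl L%:Z & reach a N%:Z (bx w)].
have mr a : a \in boxl L%:Z -> measurable [set w | reach a N%:Z (bx w)].
  by move=> _; apply: (meas_reach hW).
have [mU3 PU3] := Pr_ex_seq P mr; rewrite -/U3 in mU3 PU3.
have t0 : 0 <= theta P W p N%:Z by exact: Pr_ge0.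
have U3e : Pr P U3 <= e / 8.
  apply: le_trans PU3 _; rewrite (eq_bigr (fun=> theta P W p N%:Z)); last first.
    by move=> a _; apply: (Pr_reach hW pq).
  rewrite big_const_seq count_predT iter_addr_0 -(mulr_natr (theta P W p N%:Z)).
  have tk : theta P W p N%:Z * k <= e / 8.
    rewrite -ler_pdivlMr //; apply: le_trans hN1; apply: ler_peMl => //.
    by rewrite exprn_ege1 // ler1n.
  by apply: le_trans tk; apply: ler_wpM2l => //; rewrite ler_nat.
exists (L%:Z + N%:Z) => A B oA lB oB.
have [M1 _ oB1] := loc_box 0 lB; have [M hM] := unstable_small M1 e8.
pose M' := maxn M L; have PM := hM M' (leq_maxl _ _).
pose gA := boxl L%:Z; pose gB := [seq z <- boxl M'%:Z | ~~ box L%:Z z].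
have uA : uniq gA by exact: boxl_uniq.
have uB : uniq gB by apply: filter_uniq; exact: boxl_uniq.
pose A' w := A (blackG kv (fun z => z \in gA) (bx w)).
pose B' w := B (blackG kv (fun z => z \in gB) (bx w)).
have nA w : ~ unstable n L%:Z w -> (A (blk w) <-> A' w).
  move=> nU; have h := @stable_blk n L%:Z (fun z => z \in gA) w nU _.
  have hh : forall v, box n v -> (blk w v <-> blackG kv (fun z => z \in gA) (bx w) v).
    by apply: h => z; rewrite mem_boxl.
  by split; apply: oA => z bz; [|apply: iff_sym]; exact: hh.
have nB w : ~ (unstable M1 M'%:Z `|` U3) w -> (B (blk w) <-> B' w).
  move=> nU; have nU1 : ~ unstable M1 M'%:Z w by move=> h; apply: nU; left.
  have nU3 : ~ U3 w by move=> h; apply: nU; right.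
  have h v : box M1 v /\ ~~ box (L%:Z + N%:Z) v -> (blk w v <-> blackG kv (fun z => z \in gB) (bx w) v).
    case=> b1 b2; rewrite (@stable_blk M1 M'%:Z (fun z => z \in boxl M'%:Z) w nU1) //; last first.
      by move=> z; rewrite mem_boxl.
    apply: blackG_local => [z|u c]; first by rewrite mem_filter => /andP[].
    rewrite mem_filter (con_r c) andbT; apply/negP => bu; apply: nU3; exists u; first by rewrite mem_boxl.
    apply: (reach_box bu _ (con_sym (@oadj_sym _) c)).
    by move: b2; rewrite /box -ltNge => /ltW.
  by split; apply: (on_setI oB1 oB) => z bz; [|apply: iff_sym]; exact: h.
have mA : measurable [set w | A (blk w)] by apply: meas_event; exists n.
have mB : measurable [set w | B (blk w)] by exact: meas_event.
have mA' : measurable [set w | A' w] by exact: meas_gl.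
have mB' : measurable [set w | B' w] by exact: meas_gl.
have mU1 := meas_unstable n L%:Z; have mU2 := meas_unstable M1 M'%:Z.
have mU23 : measurable (unstable M1 M'%:Z `|` U3) by exact: measurableU.
have PU23 : Pr P (unstable M1 M'%:Z `|` U3) <= e / 4.
  by apply: le_trans (Pr_sub2 P mU2 mU3) _; lra.
have PU1 := hL L (leqnn L).
have dA := le_trans (Pr_near mA mA' mU1 nA) PU1.
have dB := le_trans (Pr_near mB mB' mU23 nB) PU23.
have dAB : `|Pr P [set w | A (blk w) /\ B (blk w)] - Pr P [set w | A' w /\ B' w]| <= e / 8 + e / 4.
  apply: le_trans (_ : Pr P (unstable n L%:Z `|` (unstable M1 M'%:Z `|` U3)) <= _); last first.
    by apply: le_trans (Pr_sub2 P mU1 mU23) _; exact: lerD.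
  apply: Pr_near; [exact: measurableI|exact: measurableI|exact: measurableU|].
  move=> w nU; have n1 : ~ unstable n L%:Z w by move=> h; apply: nU; left.
  have n2 : ~ (unstable M1 M'%:Z `|` U3) w by move=> h; apply: nU; right.
  by split=> -[h1 h2]; split; [exact/nA|exact/nB|exact/nA|exact/nB].
have ind' : Pr P [set w | A' w /\ B' w] = Pr P [set w | A' w] * Pr P [set w | B' w].
  apply: (@Pr_indep (thr p r) (fun x => A (blackG kv (fun z => z \in gA) x))
    (fun x => B (blackG kv (fun z => z \in gB) x)) (bits_of gA) (bits_of gB)) => //.
  - exact: bits_of_uniq.
  - exact: bits_of_uniq.
  - move=> i /bits_ofP hi; apply/negP => /bits_ofP; case: i hi => [f|v]; rewrite mem_boxl mem_filter => -> //.
  - exact: blackG_depP.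
  - exact: blackG_depP.
have a0 := Pr_ge0 P [set w | A' w]; have a1 := Pr_le1 P mA'.
have b0 := Pr_ge0 P [set w | B (blk w)]; have b1 := Pr_le1 P mB.
rewrite ind' in dAB; rewrite /prc.
move: dA dB dAB a0 a1 b0 b1; rewrite !ler_norml.
move: (Pr P [set w | A' w]) (Pr P [set w | B' w]) (Pr P [set w | A (blk w)]) (Pr P [set w | B (blk w)]) (Pr _ _).
move=> a' b' a b c /andP[h1 h2] /andP[h3 h4] /andP[h5 h6] a0 a1 b0 b1; nra.
Qed.

Lemma dac_law : p < 2^-1 -> law pr.
Proof.
move=> p2; apply: law_intro.
- exact: meas_blk.
- exact: dac_fkg.
- exact: dac_swap.
- exact: dac_flip.
- by move=> c A; exact: dac_shift.
- exact: dac_mix.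
Qed.

(** Given the edges, the cluster of v is black with probability r. This is [black_many] for one
    vertex in a finite region, followed by a limit. *)
Lemma black_edges (E : conf -> Prop) (s : seq rindex) v : (forall x y : conf, (forall e, x (inl e) = y (inl e)) -> E x -> E y) ->
  dep (fun i => i \in s) E -> uniq s ->
  Pr P [set w | E (bx w) /\ blk w v] = r * Pr P [set w | E (bx w)].
Proof.
move=> hE dE us; apply/eqP; rewrite -subr_eq0 -normr_le0; apply/ler_addgt0Pr => e e0; rewrite add0r.
have pq := probs_thr; have [L hL] := unstable_small (nrm v) e0; have nL := hL L (leqnn L).
have [M hM] : exists M : nat, forall i, i \in s -> (if i is inl f then box M%:Z (edge_src f) else true).
  elim: (s) => [|i l [M IH]]; first by exists 0%N.
  case: i => [f|u]; last by exists M => i; rewrite in_cons => /orP[/eqP->//|/IH].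
  exists (maxn M `|nrm (edge_src f)|) => i; rewrite in_cons => /orP[/eqP->|/IH].
    by rewrite /box; lia.
  by case: i => // f'; rewrite /box; lia.
pose gl := boxl (Num.max (nrm v) (Num.max L%:Z M%:Z)); have ugl : uniq gl by exact: boxl_uniq.
have Lg z : box L%:Z z -> z \in gl by rewrite mem_boxl /box; lia.
have Eg : dep (fun i => i \in bits_of gl) E.
  have K x y : (forall i, i \in bits_of gl -> x i = y i) -> E x -> E y.
    move=> xy Ex; pose z : conf := fun i => if i is inl _ then y i else x i.
    apply: (hE z) => //; rewrite -(dE x) // => -[f|//] fs; rewrite /z xy //.
    have := hM _ fs => b; rewrite /bits_of !mem_cat; case: f b {fs} => u [] b; apply/orP; [left|right; apply/orP; left];
      by apply: map_f; rewrite mem_boxl; move: b; rewrite /box /edge_src /=; lia.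
  by move=> x y xy; apply/propext; split; apply: K => // i /xy.
have mE : measurable [set w | E (bx w)] by apply: (@meas_loc _ _ _ _ _ hW (thr p r) E s).
pose Q (x : conf) := E x /\ blackG kv (fun z => z \in gl) x v.
have dQ : dep (fun i => i \in bits_of gl) Q.
  by move=> x y xy; rewrite /Q (Eg _ _ xy) (@blackG_depP gl (fun S => S v) _ _ xy).
have mQ : measurable [set w | Q (bx w)] by apply: (@meas_loc _ _ _ _ _ hW (thr p r) Q (bits_of gl)).
have <- : Pr P [set w | Q (bx w)] = r * Pr P [set w | E (bx w)].
  rewrite (@Pr_Ex _ _ _ _ _ hW _ pq Q (bits_of gl) x0) //; last exact: bits_of_uniq.
  rewrite (@Pr_Ex _ _ _ _ _ hW _ pq E (bits_of gl) x0) //; last exact: bits_of_uniq.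
  rewrite -[r in RHS]expr1 -(@black_many R (thr p r) r gl (fun=> erefl) ugl 1 _ (fun=> [:: v])).
  - apply: Ex_ext => x; rewrite /Q ind_and; congr (_ * _); apply: ind_iff; split.
      by move=> h u; rewrite inE => /eqP->.
    by apply; rewrite inE.
  - by move=> x y xy; split=> //; apply: ind_iff; split; apply: hE.
  - move=> x _; split=> //.
      by move=> u; rewrite inE => /eqP->; rewrite mem_boxl /box; lia.
    by move=> a b; rewrite !inE => /eqP-> /eqP->.
apply: le_trans nL; apply: Pr_near => //.
- by apply: meas_and => //; exact: meas_blk.
- exact: meas_unstable.
move=> w nU; have := @stable_blk _ _ (fun z => z \in gl) w nU Lg v; rewrite /box lexx => /(_ isT) h.
by split=> -[h1 h2]; split=> //; apply/h.
Qed.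

Lemma Pr_blk v : Pr P [set w | blk w v] = r.
Proof.
have := @black_edges (fun=> True) [::] v (fun _ _ _ h => h) (fun _ _ _ => erefl) isT.
rewrite (_ : [set w | True /\ blk w v] = [set w | blk w v]); last by apply/seteqP; split=> w // [].
by move=> ->; rewrite (_ : [set w | True] = setT) ?Pr_T ?mulr1 //; apply/seteqP.
Qed.

(** Positive association replaces finite energy: a given finite set is entirely black with positive
    probability, however its vertices are distributed among clusters. *)
Lemma all_black_ge l : r ^+ size l <= pr (all_black l).
Proof.
case/andP: (hr) => r0 _; elim: l => [|a l IH] /=.
  by rewrite expr0 /prc (_ : [set w | _] = setT) ?Pr_T //; apply/seteqP; split.
rewrite exprS; apply: (@le_trans _ _ (pr (fun S => S a) * pr (all_black l))).
  by rewrite {1}/prc Pr_blk; apply: ler_wpM2l.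
have la : loc (fun S => S a) by exists (nrm a) => S S' e h; apply: (e a _).1 h; rewrite /box.
apply: le_trans (dac_fkg la (@all_black_loc l) _ _) _.
- by move=> S S' SS; exact: SS.
- by move=> S S' SS h v vl; apply: SS; exact: h.
apply: Pr_mono; [exact: (meas_event (loc_and la (@all_black_loc l)))|exact: (meas_event (@all_black_loc (a :: l)))|].
by move=> w [h1 h2] v; rewrite in_cons => /orP[/eqP->|/h2].
Qed.

Lemma dac_glue (m : int) : 0 < r -> 0 <= m -> exists (M : int) Z (k : R),
  [/\ m <= M, 0 < k, good pr Z k & glues m M Z].
Proof.
move=> r0 m0; exists m, (all_black (boxl m)), (r ^+ size (boxl m)); split=> //.
- exact: exprn_gt0.
- split; [exact: all_black_loc|by move=> S S' SS h v vl; apply: SS; exact: h|exact: all_black_ge].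
move=> S ZS Q u u' v v' mQ c c' bu bu' _ _.
have Zs z : box m z -> S z /\ Q z by move=> bz; split; [apply: ZS; rewrite mem_boxl|exact: mQ].
apply: (con_trans (con_sym nn_sym c)); apply: con_trans c'.
have rect w : box m w -> con nn (fun z => S z /\ Q z) (0, 0) w.
  case: w => a b bw; apply: (@con_trans _ _ _ (a, 0)).
    have [a0|a0] := leP 0 a.
      by apply: con_row => // x hx; apply: Zs; move: bw; rewrite /box /nrm /=; lia.
    apply: (con_sym nn_sym); apply: con_row => [|x hx]; first exact: ltW.
    by apply: Zs; move: bw; rewrite /box /nrm /=; lia.
  have [b0|b0] := leP 0 b.
    by apply: con_col => // x hx; apply: Zs; move: bw; rewrite /box /nrm /=; lia.
  apply: (con_sym nn_sym); apply: con_col => [|x hx]; first exact: ltW.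
  by apply: Zs; move: bw; rewrite /box /nrm /=; lia.
exact: (con_trans (con_sym nn_sym (rect _ bu)) (rect _ bu')).
Qed.

End PR.
End Dac.

(** * A finite-size criterion *)

(** The value [true] stands for black nearest-neighbour paths and [false] for white paths with
    diagonals, the two alternatives of [hex]. *)
Definition adjc (c : bool) : vertex -> vertex -> Prop := if c then nn else star.
Definition colc (c : bool) (S : vertex -> Prop) (v : vertex) : Prop := if c then S v else ~ S v.
Definition around (z : vertex) (n : int) (v : vertex) : bool := box n (sub v z).
Definition ball (z : vertex) (n : int) : seq vertex := map (shift z) (boxl n).

Lemma mem_ball z n v : (v \in ball z n) = around z n v.
Proof.
have e : shift z (sub v z) = v by apply: vtx_eq => /=; lia.
rewrite -{1}e mem_map ?mem_boxl //.
by move=> a b [h1 h2]; apply: vtx_eq; lia.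
Qed.

Lemma ball_uniq z n : uniq (ball z n).
Proof.
rewrite map_inj_uniq ?boxl_uniq // => a b [h1 h2]; apply: vtx_eq; lia.
Qed.

Lemma adjc_star c a b : adjc c a b -> star a b. Proof. by case: c => //; exact: nn_star. Qed.
Lemma adjc_sym c a b : adjc c a b -> adjc c b a.
Proof. by case: c; [exact: nn_sym|exact: star_sym]. Qed.

Lemma star_sub z a b : star a b -> star (sub a z) (sub b z).
Proof. by rewrite /star /=; lia. Qed.

Lemma star_around z a b : star a b ->
  nrm (sub a z) <= nrm (sub b z) + 1 /\ nrm (sub b z) <= nrm (sub a z) + 1.
Proof. by move/(star_sub z)/star_nrm. Qed.

Lemma nrm_sub_sym u v : nrm (sub u v) = nrm (sub v u).
Proof. by rewrite /nrm /=; lia. Qed.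

Lemma nrm_tri u v z : nrm (sub u z) <= nrm (sub u v) + nrm (sub v z).
Proof. by rewrite /nrm /=; lia. Qed.

Definition span (c : bool) (z : vertex) (n : int) : event := fun S => exists u v,
  [/\ around z n u, nrm (sub v z) = 3 * n &
      con (adjc c) (fun a => colc c S a /\ around z (3 * n) a) u v].
Definition leak (z : vertex) (n : int) (x : conf) : Prop := exists u v,
  [/\ around z (3 * n) u, nrm (sub v z) = 4 * n & con (oadj x) (fun a => a \in ball z (4 * n)) u v].
(** Local version of a crossing at scale n, decided by the bits of the ball of radius 4n. A leak
    counts as bad because an open cluster leaving this ball may change the colours inside the ball
    of radius 3n. *)
Definition bad (c : bool) (z : vertex) (n : int) (x : conf) : Prop :=
  span c z n (blackG kv (fun a => a \in ball z (4 * n)) x) \/ leak z n x.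

Lemma bad_dep c z n : dep (fun i => i \in bits_of (ball z (4 * n))) (bad c z n).
Proof.
move=> x y xy; rewrite /bad (@blackG_depP _ (span c z n) _ _ xy); congr (_ \/ _).
apply/propext; split=> -[u [v [h1 h2 h3]]]; exists u, v; split=> //;
  apply: con_dep h3 => i /gbit_bits ib; by rewrite xy.
Qed.

Lemma leak_pass z n (G : vertex -> Prop) x u v : 0 <= n -> around z (3 * n) u -> 4 * n <= nrm (sub v z) ->
  con (oadj x) G u v -> leak z n x.
Proof.
move=> n0 hu hv c; have l a b : oadj x a b -> nrm (sub a z) <= nrm (sub b z) + 1 /\ nrm (sub b z) <= nrm (sub a z) + 1.
  by move/oadj_star/star_around; exact.
have h34 : 3 * n <= 4 * n by lia.
have [u' [v' [e1 e2 _ c']]] := con_trunc l h34 c hu hv.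
exists u', v'; split=> //; first by rewrite /around /box e1.
by apply: con_sub c' => a [_ /andP[_ h]]; rewrite mem_ball.
Qed.

Lemma leak_reach z n x : 0 <= n -> leak z n x -> exists2 u, u \in ball z (3 * n) & reach u n x.
Proof.
move=> n0 [u [v [h1 h2 h3]]]; exists u; first by rewrite mem_ball.
exists v; split; last exact: con_sub h3.
by have := nrm_tri v u z; move: h1; rewrite /around /box; lia.
Qed.

Lemma no_leak z n (G : vertex -> Prop) x v : 0 <= n -> ~ leak z n x ->
  (forall a, around z (4 * n) a -> G a) -> around z (3 * n) v ->
  (blackG kv G x v <-> blackG kv (fun a => a \in ball z (4 * n)) x v).
Proof.
move=> n0 nl zG av; apply: blackG_local => [a|u c]; first by rewrite mem_ball; exact: zG.
rewrite mem_ball /around /box leNgt; apply/negP => h; apply: nl.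
exact: (leak_pass n0 av (ltW h) c).
Qed.

Lemma pass_bad c z n (G : vertex -> Prop) x u v : 0 <= n -> around z n u -> 3 * n <= nrm (sub v z) ->
  (forall a, around z (4 * n) a -> G a) -> con (adjc c) (colc c (blackG kv G x)) u v -> bad c z n x.
Proof.
move=> n0 hu hv zG cc; have [l|nl] := pselect (leak z n x); [by right|left].
have lip a b : adjc c a b -> nrm (sub a z) <= nrm (sub b z) + 1 /\ nrm (sub b z) <= nrm (sub a z) + 1.
  by move/adjc_star/star_around; exact.
have h13 : n <= 3 * n by lia.
have [u' [v' [e1 e2 _ c']]] := con_trunc lip h13 cc hu hv.
exists u', v'; split=> //; first by rewrite /around /box e1.
apply: con_sub c' => a [ca /andP[_ h]]; split=> //.
have := no_leak n0 nl zG h; by case: (c) ca => /= ca [h1 h2]; [exact: h1|move=> /h2].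
Qed.

Lemma bad_span c z n x : 0 <= n -> bad c z n x -> span c z n (blackG kv (fun=> True) x) \/ leak z n x.
Proof.
move=> n0 [[u [v [h1 h2 h3]]]|]; last by right.
have [l|nl] := pselect (leak z n x); [by right|left].
exists u, v; split=> //; apply: con_sub h3 => a [ca aa]; split=> //.
have := @no_leak z n (fun=> True) x a n0 nl (fun _ _ => I) aa.
by case: (c) ca => /= ca [h4 h5]; [exact: h5|move=> /h4].
Qed.

(* Opaque, so that the number of its elements is never computed. *)
Lemma gbox_sig : {l : seq vertex | forall k, box 49 k -> k \in l}.
Proof. by exists (boxl 49) => k; rewrite mem_boxl. Qed.
Definition gbox := sval gbox_sig.

Definition grid (z : vertex) (n : int) : seq vertex :=
  [seq (z.1 + n * k.1, z.2 + n * k.2) | k <- gbox].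

Lemma grid_near z (n : int) u : 0 < n -> nrm (sub u z) <= 48 * n ->
  exists2 y, y \in grid z n & around y n u.
Proof.
move=> n0 hu; pose f (a : int) := (a %/ n)%Z.
have hf a : n * f a <= a /\ a <= n * f a + n.
  rewrite /f; have := divz_eq a n; have := modz_ge0 a (lt0r_neq0 n0); have := ltz_pmod a n0.
  move: (a %/ n)%Z (a %% n)%Z => q m; nia.
have hb a : `|a| <= 48 * n -> `|f a| <= 49.
  by move=> h; have [h1 h2] := hf a; move: (f a) h1 h2 => q h1 h2; nia.
pose k : vertex := (f (u.1 - z.1), f (u.2 - z.2)).
exists (z.1 + n * k.1, z.2 + n * k.2).
  apply/mapP; exists k => //; apply: (svalP gbox_sig); rewrite /box /nrm /k /=.
  have h1 : `|u.1 - z.1| <= 48 * n by move: hu; rewrite /nrm /=; lia.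
  have h2 : `|u.2 - z.2| <= 48 * n by move: hu; rewrite /nrm /=; lia.
  by have := hb _ h1; have := hb _ h2; lia.
have := hf (u.1 - z.1); have := hf (u.2 - z.2); rewrite /around /box /nrm /k /=.
move: (f _) (f _) => q q'; move: (n * q) (n * q') => a a'; lia.
Qed.

Lemma around_sub (z y : vertex) (a b m : int) v : nrm (sub y z) <= m -> a + m <= b ->
  around y a v -> around z b v.
Proof. by move=> h1 h2; rewrite /around /box; have := nrm_tri v y z; lia. Qed.

(** At scale 12n both a crossing and a leak provide a path with ends at least 12n apart, within 48n
    of z. Grid points of mesh n near the two ends are more than 8n apart, so their balls of radius
    4n are disjoint, and the path crosses the small annuli around both. *)
Lemma bad_split c z (n : int) x : 0 < n -> bad c z (12 * n) x ->
  exists2 y1, y1 \in grid z n & exists2 y2, y2 \in [seq y <- grid z n | 8 * n < nrm (sub y y1)] &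
    bad c y1 n x /\ bad c y2 n x.
Proof.
move=> n0 B; have n0' := ltW n0.
suff [u [v [hu hv huv K]]] : exists u v, [/\ nrm (sub u z) <= 48 * n, nrm (sub v z) <= 48 * n,
    12 * n <= nrm (sub v u) & forall y, around y n u \/ around y n v -> bad c y n x].
  have [y1 g1 a1] := grid_near n0 hu; have [y2 g2 a2] := grid_near n0 hv.
  exists y1 => //; exists y2; last by split; apply: K; [left|right].
  rewrite mem_filter g2 andbT; move: a1 a2; rewrite /around /box.
  have := nrm_tri v y2 u; have := nrm_tri y2 y1 u; rewrite (nrm_sub_sym y1 u); clear -huv n0; lia.
case: B => [[u [v [h1 h2 h3]]]|[u [v [h1 h2 h3]]]]; exists u, v; move: (h1); rewrite /around /box => h1'.
  have huv : 12 * n <= nrm (sub v u) by have := nrm_tri v u z; clear -h1' h2 n0; lia.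
  split=> //; [clear -h1' n0; lia|clear -h2 n0; lia|move=> y hy].
  have cc := con_sub (fun a (h : _ /\ _) => h.1) h3.
  have zG : forall a, around y (4 * n) a -> a \in ball z (4 * (12 * n)).
    move=> a; rewrite mem_ball; apply: (@around_sub _ _ _ _ (37 * n)); last by clear -n0; lia.
    case: hy; rewrite /around /box.
      by have := nrm_tri y u z; rewrite (nrm_sub_sym y u); clear -h1' n0; lia.
    by have := nrm_tri y v z; rewrite (nrm_sub_sym y v); clear -h2 n0; lia.
  case: hy => hy.
    apply: (pass_bad n0' hy _ zG cc); move: hy; rewrite /around /box.
    by have := nrm_tri v y u; rewrite (nrm_sub_sym y u); clear -huv n0; lia.
  apply: (pass_bad n0' hy _ zG (con_sym (@adjc_sym c) cc)); move: hy; rewrite /around /box.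
  by have := nrm_tri v y u; rewrite (nrm_sub_sym y u); clear -huv n0; lia.
have huv : 12 * n <= nrm (sub v u) by have := nrm_tri v u z; clear -h1' h2 n0; lia.
split=> //; [clear -h1' n0; lia|clear -h2 n0; lia|move=> y [] hy; right].
  apply: (leak_pass n0' _ _ h3); move: hy; rewrite /around /box; first by clear -n0; lia.
  by have := nrm_tri v y u; rewrite (nrm_sub_sym y u); clear -huv n0; lia.
apply: (leak_pass n0' _ _ (con_sym (@oadj_sym x) h3)); move: hy; rewrite /around /box; first by clear -n0; lia.
by have := nrm_tri v y u; rewrite (nrm_sub_sym y u); clear -huv n0; lia.
Qed.

Lemma nrm_origin : nrm origin <= 0.
Proof. by rewrite /nrm /= normr0 maxxx. Qed.

Lemma sub_origin z : sub z origin = z.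
Proof. by apply: vtx_eq; rewrite /= subr0. Qed.

Lemma nn_nrm a b : nn a b -> nrm a <= nrm b + 1 /\ nrm b <= nrm a + 1.
Proof. by move/nn_star/star_nrm. Qed.

Definition rad (n : int) : event := fun S => exists v, n <= nrm v /\ con nn S origin v.

Lemma rad_on n : 0 <= n -> on_set (fun z => box n z) (rad n).
Proof.
move=> n0 S S' e [v [nv c]].
have o0 : nrm origin <= n by rewrite /nrm /=; lia.
have lip a b : nn a b -> nrm a <= nrm b + 1 /\ nrm b <= nrm a + 1 by move/nn_star/star_nrm.
have [v' [c' e']] : exists v', con nn (fun z => S z /\ nrm z <= n) origin v' /\ nrm v' = n.
  have o1 : nrm origin <= 0 by rewrite /nrm /=; lia.
  have [u' [v' [e1 e2 _ c']]] := con_trunc lip n0 c o1 nv.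
  have eu : u' = origin by apply: vtx_eq; move: e1; rewrite /nrm /=; lia.
  rewrite eu in c'; exists v'; split=> //; by apply: con_sub c' => z [? /andP[]].
exists v'; rewrite e'; split=> //; apply: con_sub c' => z [Sz nz]; exact: (e z nz).1.
Qed.

Lemma rad_loc n : 0 <= n -> loc (rad n).
Proof. by move=> n0; exists n; exact: rad_on. Qed.

Lemma span_on c z n : on_set (fun v => v \in ball z (3 * n)) (span c z n).
Proof.
move=> S S' e [u [v [h1 h2 h3]]]; exists u, v; split=> //; apply: con_sub h3 => a [ca aa]; split=> //.
have := e a; rewrite mem_ball => /(_ aa)[e1 e2]; by case: (c) ca => /= ca; [exact: e1|move/e2].
Qed.

Lemma span_loc c z n : loc (span c z n).
Proof.
exists (3 * n + nrm z); apply: on_set_sub (@span_on c z n) => v; rewrite mem_ball /around /box.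
by have := nrm_sub v z; lia.
Qed.

Lemma span_shift c z n S : span c z n S -> span c origin n (fun v => S (shift z v)).
Proof.
case=> u [v [h1 h2 h3]]; have e1 a : sub a origin = a by apply: vtx_eq => /=; lia.
exists (sub u z), (sub v z); rewrite /around !e1; split=> //.
have h k a b : adjc k a b -> adjc k (sub a z) (sub b z) by case: k => /=; rewrite /nn /star /=; lia.
apply: (@con_map _ _ (fun a => sub a z)); first exact: h.
 apply: con_sub h3 => a [ca aa]; split; last by rewrite e1.
suff e2 : shift z (sub a z) = a by case: (c) ca => /=; rewrite e2.
by apply: vtx_eq => /=; lia.
Qed.

Definition scale (n : int) (j : nat) : int := (12 ^ j)%N%:Z * n.

Lemma scaleS n j : scale n j.+1 = 12 * scale n j.
Proof. by rewrite /scale expnS; lia. Qed.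

Lemma scale_gt0 n j : 0 < n -> 0 < scale n j.
Proof. by move=> n0; rewrite /scale mulr_gt0 // ltz_nat expn_gt0. Qed.

Definition turn (j : nat) (z : vertex) : vertex := if odd j then swap z else z.
(** Lengthwise crossings of rectangles of growing size, alternately horizontal and vertical;
    consecutive ones must meet, so together they form an unbounded path. *)
Definition climb (n : int) (j : nat) : event := fun S =>
  hcross nn (fun z => S (turn j z)) 0 (4 * scale n j.+1) 0 (4 * scale n j).

Lemma turnS j z : turn j.+1 z = turn j (swap z).
Proof. by rewrite /turn /=; case: (odd j) => //=; rewrite swapK. Qed.

Lemma turn_nn j a b : nn a b -> nn (turn j a) (turn j b).
Proof. by rewrite /turn; case: odd => //; exact: swap_nn. Qed.

Lemma turn_star j a b : star a b -> star (turn j a) (turn j b).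
Proof. by rewrite /turn; case: odd => //; exact: swap_star. Qed.

Lemma turn_nrm j a b : nrm (sub (turn j a) (turn j b)) = nrm (sub a b).
Proof. by rewrite /turn; case: odd => //; rewrite /nrm /=; lia. Qed.

Lemma turn_nrm0 j a : nrm (turn j a) = nrm a.
Proof. by rewrite /turn; case: odd => //; rewrite /nrm /=; lia. Qed.

Lemma climb_loc n j : loc (climb n j).
Proof.
have [m hm] := hcross_loc 0 (4 * scale n j.+1) 0 (4 * scale n j).
exists m => S S' e; apply: hm => z bz; apply: e; by rewrite /box turn_nrm0.
Qed.

Lemma climb_fail n j (S : vertex -> Prop) : 0 < n -> ~ climb n j S ->
  exists u v, [/\ nrm u <= 48 * scale n j, 4 * scale n j <= nrm (sub v u) & con star (fun z => ~ S z) u v].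
Proof.
move=> n0 nc; have s0 := scale_gt0 j n0; have s1 := scaleS n j.
have [//|[u [v [h1 h2 c]]]] := @hex (fun z => S (turn j z)) 0 (4 * scale n j.+1) 0 (4 * scale n j) ltac:(lia) ltac:(lia).
exists (turn j u), (turn j v); split.
- by rewrite turn_nrm0; have [_] := con_l c; rewrite /in_rect /nrm; lia.
- by rewrite turn_nrm /nrm /=; lia.
apply: con_map; first exact: turn_star.
by apply: con_sub c => z [].
Qed.

Lemma climb_chain n J (S : vertex -> Prop) : 0 < n -> (forall j, (j <= J)%N -> climb n j S) ->
  exists u v, [/\ nrm u <= 4 * n, 4 * scale n J.+1 <= nrm v & con nn S u v].
Proof.
move=> n0 h.
suff [u [a [b [hu ha hb c1 c2]]]] : exists u a b, [/\ nrm u <= 4 * n, a.1 = 0, b.1 = 4 * scale n J.+1,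
    con nn S u (turn J a) &
    con nn (fun z => S (turn J z) /\ in_rect 0 (4 * scale n J.+1) 0 (4 * scale n J) z) a b].
  exists u, (turn J b); split=> //; first by rewrite turn_nrm0 /nrm hb; lia.
  apply: (con_trans c1); apply: con_map; first exact: turn_nn.
  by apply: con_sub c2 => z [].
elim: J h => [|J IH] h.
  have [a [b [ha hb c]]] := h 0%N isT; exists a, a, b; split=> //.
    have [_] := con_l c; rewrite /in_rect /nrm ha /scale expn0 mul1r; lia.
  by apply: con_refl; have [] := con_l c.
have [u [a [b [hu ha hb c1 c2]]]] := IH (fun j jJ => h j (leqW jJ)).
have [a' [b' [ha' hb' c']]] := h J.+1 (leqnn _).
have s1 := scaleS n J.+1; have s0 := scale_gt0 J.+1 n0; have s2 := scaleS n J; have s3 := scale_gt0 J n0.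
exists u, a', b'; split=> //.
have c3 := con_swap swap_nn c'.
have [||s [k1 k2]] := @hv_meet _ _ _ _ _ _ c2 c3.
- by move=> t [_]; rewrite ha hb /in_rect /=; lia.
- by move=> t [_]; rewrite /= ha' hb' /in_rect; clear -s1 s0 s2 s3; lia.
- rewrite turnS; apply: (con_trans c1); apply: (@con_trans _ _ _ (turn J s)).
    by apply: con_map; [exact: turn_nn|apply: con_sub k1 => z []].
  apply: (con_sym nn_sym); apply: con_map; first exact: turn_nn.
  by apply: con_sub k2 => z [h1 _]; move: h1; rewrite turnS swapK.
Qed.

Section Criterion.
Context {R : realType} {d : measure_display} {Omega : measurableType d}.
Variables (P : probability Omega R) (W : rindex -> Omega -> R) (hW : iid_uniform P W).
Variable p : R.
Hypothesis hp : 0 <= p <= 1.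

(** Number of ordered pairs of grid points, the price of the union bound in [bad_scale]. *)
Definition K0 : R := (size (gbox))%:R ^+ 2.

Lemma size_grid z n : size (grid z n) = size (gbox). Proof. exact: size_map. Qed.

Lemma K0_ge1 : 1 <= (size (gbox))%:R :> R.
Proof.
rewrite ler1n; have : origin \in gbox by apply: (svalP gbox_sig).
by case: gbox.
Qed.

Section FixR.
Variable r : R.
Hypothesis hr : 0 <= r <= 1.
Notation bx w := (bits W (thr p r) w).
Notation pr := (prc P (blk W p r)).
Definition pbad c z n : R := Pr P [set w | bad c z n (bx w)].

Lemma meas_bad c z n : measurable [set w | bad c z n (bx w)].
Proof.
by apply: (@meas_loc _ _ _ _ _ hW (thr p r) (bad c z n) (bits_of (ball z (4 * n)))); exact: bad_dep.
Qed.

(** Union bound over the two grid points given by [bad_split]; their bad events depend on disjoint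
    sets of bits, which yields the square. *)
Lemma bad_scale c n (e : R) : 0 < n -> (forall z, pbad c z n <= e) ->
  forall z, pbad c z (12 * n) <= K0 * e ^+ 2.
Proof.
move=> n0 h z; pose Q2 y1 y2 w := bad c y1 n (bx w) /\ bad c y2 n (bx w).
pose l y1 := [seq y <- grid z n | 8 * n < nrm (sub y y1)].
have e0 : 0 <= e by apply: le_trans (h origin); exact: Pr_ge0.
have m2 y1 : measurable [set w | exists2 y2, y2 \in l y1 & Q2 y1 y2 w] /\
   Pr P [set w | exists2 y2, y2 \in l y1 & Q2 y1 y2 w] <= \sum_(y2 <- l y1) Pr P [set w | Q2 y1 y2 w].
  by apply: Pr_ex_seq => y2 _; apply: meas_and; exact: meas_bad.
have [m1 b1] := Pr_ex_seq P (l := grid z n) (fun y1 _ => (m2 y1).1).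
apply: (@le_trans _ _ (Pr P [set w | exists2 y1, y1 \in grid z n & exists2 y2, y2 \in l y1 & Q2 y1 y2 w])).
  by apply: Pr_mono => //; [exact: meas_bad|move=> w /(bad_split n0)].
apply: le_trans b1 _.
have ind y1 y2 : y2 \in l y1 -> Pr P [set w | Q2 y1 y2 w] <= e ^+ 2.
  rewrite mem_filter => /andP[far _].
  rewrite (@Pr_indep _ _ _ _ _ hW (thr p r) (bad c y1 n) (bad c y2 n)
    (bits_of (ball y1 (4 * n))) (bits_of (ball y2 (4 * n)))) //.
  - by rewrite expr2; apply: ler_pM; try exact: Pr_ge0; exact: h.
  - exact: probs_thr.
  - by apply: bits_of_uniq; exact: ball_uniq.
  - by apply: bits_of_uniq; exact: ball_uniq.
  - have K v : v \in ball y1 (4 * n) -> v \in ball y2 (4 * n) -> False.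
      rewrite !mem_ball /around /box => h1 h2.
      by have := nrm_tri y2 v y1; rewrite (nrm_sub_sym y2 v); clear -far h1 h2; lia.
    by move=> i /bits_ofP hi; apply/negP => /bits_ofP; case: i hi => [f|v] /K.
  - exact: bad_dep.
  - exact: bad_dep.
have s2 y1 : Pr P [set w | exists2 y2, y2 \in l y1 & Q2 y1 y2 w] <= (size (gbox))%:R * e ^+ 2.
  apply: le_trans (m2 y1).2 _.
  apply: (@le_trans _ _ (\sum_(y2 <- l y1) e ^+ 2)).
    by rewrite !big_seq; apply: ler_sum => y2; exact: ind.
  rewrite big_const_seq count_predT iter_addr_0 -[_ *+ size _]mulr_natl.
  apply: ler_wpM2r; first exact: exprn_ge0.
  by rewrite ler_nat -(size_grid z n) size_filter count_size.
apply: (@le_trans _ _ (\sum_(y1 <- grid z n) (size (gbox))%:R * e ^+ 2)).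
  by apply: ler_sum => y1 _; exact: s2.
by rewrite big_const_seq count_predT iter_addr_0 -[_ *+ size _]mulr_natl size_grid mulrA -expr2.
Qed.

(** [bad_scale] squares the product of [K0] with the bound at each step; a product of at most 1/4
    thus decays, and the geometric rate is enough for the sums that follow. *)
Lemma bad_iter c n : 0 < n -> (forall z, K0 * pbad c z n <= 4^-1) ->
  forall j z, K0 * pbad c z (scale n j) <= 4^-1 ^+ j.+1.
Proof.
move=> n0 h; have k1 : 1 <= K0 by rewrite exprn_ege1 // K0_ge1.
have k0 : 0 < K0 by exact: lt_le_trans k1.
elim=> [|j IH] z; first by rewrite expr1 /scale expn0 mul1r.
have IH' y : pbad c y (scale n j) <= 4^-1 ^+ j.+1 / K0 by rewrite ler_pdivlMr // mulrC.
rewrite scaleS; have := bad_scale (scale_gt0 j n0) IH' z; rewrite -(ler_pM2l k0) => /le_trans; apply.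
rewrite mulrA -expr2 -exprMn [K0 * _]mulrC divfK ?gt_eqF // -exprM.
apply: ler_wiXn2l; [lra|lra|lia].
Qed.

Lemma black_small n : 0 < n -> (forall z, K0 * pbad true z n <= 4^-1) ->
  forall e : R, 0 < e -> exists N : nat, pr (rad N%:Z) <= e.
Proof.
move=> n0 h e e0; have [j hj] := @pow_small R (3 / 4) e ltac:(lra) e0.
have [N hN] : exists N : nat, N%:Z = 3 * scale n j.
  by exists `|(3 * scale n j)%R|%N; have := scale_gt0 j n0; lia.
exists N; apply: le_trans hj; rewrite (_ : 1 - 3 / 4 = 4^-1 :> R); last by lra.
have N0 : 0 <= N%:Z by [].
apply: (@le_trans _ _ (pbad true origin (scale n j))).
  apply: Pr_mono; [exact: (@meas_event _ _ _ _ _ hW p r _ (rad_loc N0))|exact: meas_bad|move=> w [v [nv c]]].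
  have e1 z : sub z origin = z by apply: vtx_eq => /=; lia.
  apply: (@pass_bad true origin (scale n j) (fun=> True) (bx w) origin v) => //.
  - exact: ltW (scale_gt0 j n0).
  - by rewrite /around /box e1; have := scale_gt0 j n0; rewrite /nrm /=; lia.
  - by rewrite e1 -hN.
have := bad_iter n0 h j origin; have b0 : 0 <= pbad true origin (scale n j) by exact: Pr_ge0.
have k1 : 1 <= K0 by rewrite exprn_ege1 // K0_ge1.
move=> h1; apply: le_trans (ler_peMl b0 k1) _; apply: le_trans h1 _.
by apply: ler_wiXn2l; [lra|lra|lia].
Qed.

(** A failing [climb] yields a bad grid point by [hex], and the failure probabilities sum to at most
    1/2. Otherwise some vertex of the box 4n starts a long black path, and by translation invariance
    each of these vertices has the same chance. *)
Lemma white_small n : 0 < n -> (forall z, K0 * pbad false z n <= 4^-1) ->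
  exists2 c : R, 0 < c & forall N : nat, c <= pr (rad N%:Z).
Proof.
move=> n0 h; pose B := boxl (4 * n); pose sB : R := (size B)%:R.
have sB0 : 0 < sB.
  rewrite ltr0n; have : origin \in B by rewrite mem_boxl /box /nrm /=; lia.
  by case: (B).
exists (2^-1 / sB); first by rewrite divr_gt0.
move=> N; pose J := N; rewrite ler_pdivrMr //.
have k1 : 1 <= (size (gbox))%:R :> R := K0_ge1.
have mf j : measurable [set w | ~ climb n j (blk W p r w)].
  by apply: meas_not; exact: (@meas_event _ _ _ _ _ hW p r _ (climb_loc n j)).
have fail j : Pr P [set w | ~ climb n j (blk W p r w)] <= 4^-1 ^+ j.+1.
  pose Q y w := bad false y (scale n j) (bx w).
  have [mQ bQ] := Pr_ex_seq P (l := grid origin (scale n j)) (Q := Q) (fun y _ => meas_bad _ _ _).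
  apply: (@le_trans _ _ (Pr P [set w | exists2 y, y \in grid origin (scale n j) & Q y w])).
    apply: Pr_mono => // w nc; have s0 := scale_gt0 j n0.
    have [u [v [hu huv c]]] := climb_fail n0 nc.
    have e1 z : sub z origin = z by apply: vtx_eq => /=; lia.
    have [y gy ay] := @grid_near origin (scale n j) u s0 ltac:(by rewrite e1).
    exists y => //; apply: (@pass_bad false y (scale n j) (fun=> True) (bx w) u v) => //; first exact: ltW.
    move: ay; rewrite /around /box; have := nrm_tri v y u; rewrite (nrm_sub_sym y u).
    by clear -huv s0; lia.
  apply: le_trans bQ _; apply: (@le_trans _ _ (\sum_(y <- grid origin (scale n j)) 4^-1 ^+ j.+1 / K0)).
    apply: ler_sum => y _; rewrite ler_pdivlMr; last by rewrite exprn_gt0 // (lt_le_trans _ k1).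
    by rewrite mulrC; exact: bad_iter.
  rewrite big_const_seq count_predT iter_addr_0 -[_ *+ size _]mulr_natl size_grid /K0.
  move: k1; move: ((size (gbox))%:R : R) => K k1; have K1 : 0 < K by exact: lt_le_trans k1.
  rewrite mulrCA ger_pMr; last by rewrite exprn_gt0.
  by rewrite ler_pdivrMr ?exprn_gt0 // mul1r expr2 ler_peMl // ltW.
have gs m : \sum_(j <- iota 0 m) (4^-1 : R) ^+ j.+1 <= 2^-1.
  have -> : \sum_(j <- iota 0 m) (4^-1 : R) ^+ j.+1 = (1 - 4^-1 ^+ m) / 3.
    elim: m => [|m IH]; first by rewrite big_nil expr0 subrr mul0r.
    by rewrite -addn1 iotaD add0n big_cat /= big_seq1 IH addn1 exprS; field.
  by have : 0 <= (4^-1 : R) ^+ m by [apply: exprn_ge0; lra]; lra.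
have [mF bF] := Pr_ex_seq P (l := iota 0 J.+1) (Q := fun j w => ~ climb n j (blk W p r w)) (fun j _ => mf j).
pose E u w := exists v, 4 * scale n J.+1 <= nrm v /\ con nn (blk W p r w) u v.
have Eu u w : u \in B -> E u w -> rad N%:Z (fun z => blk W p r w (shift u z)).
  rewrite mem_boxl /box => bu [v [hv c]]; exists (sub v u); split.
    have := nrm_sub v u; have : N.+1%:Z <= (12 ^ J.+1)%N%:Z :> int.
      by rewrite lez_nat; apply: leq_trans (ltn_expl J.+1 (isT : 1 < 12)%N) => //; rewrite ltnS ltnW.
    move: hv; rewrite /scale; move: (12 ^ J.+1)%N => M; clear -bu n0; nia.
  have e1 : forall z, shift u (sub z u) = z by move=> z; apply: vtx_eq => /=; lia.
  rewrite (_ : origin = sub u u); last by apply: vtx_eq => /=; lia.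
  apply: (@con_map _ (fun z => blk W p r w (shift u z)) (fun z => sub z u)).
    by move=> a b; rewrite /nn /=; lia.
  by apply: con_sub c => z; rewrite e1.
have lr : loc (rad N%:Z) by apply: rad_loc.
have lru u : loc (fun S => rad N%:Z (fun z => S (shift u z))).
  have [m hm] := lr; exists (m + nrm u) => S S' e; apply: hm => z bz; apply: e.
  by move: bz; rewrite /box /nrm /=; lia.
have [mE bE] := Pr_ex_seq P (l := B) (Q := fun u w => rad N%:Z (fun z => blk W p r w (shift u z)))
  (fun u _ => @meas_event _ _ _ _ _ hW p r _ (lru u)).
have : 1 <= Pr P [set w | exists2 j, j \in iota 0 J.+1 & ~ climb n j (blk W p r w)] +
   Pr P [set w | exists2 u, u \in B & rad N%:Z (fun z => blk W p r w (shift u z))].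
  apply: le_trans (Pr_sub2 P mF mE); rewrite -(Pr_T P); apply: Pr_mono => //; first exact: measurableU.
  move=> w _; have [ok|nok] := pselect (forall j, (j <= J)%N -> climb n j (blk W p r w)); [right|left].
    have [u [v [hu hv c]]] := climb_chain n0 ok; exists u; first by rewrite mem_boxl.
    by apply: Eu; [rewrite mem_boxl|exists v].
  have /existsNP[j /not_implyP[jJ nj]] := nok; exists j => //.
  by rewrite mem_iota add0n ltnS.
have h1 : Pr P [set w | exists2 j, j \in iota 0 J.+1 & ~ climb n j (blk W p r w)] <= 2^-1.
  by apply: le_trans (gs J.+1); apply: le_trans bF _; apply: ler_sum => j _; exact: fail.
have h2 : Pr P [set w | exists2 u, u \in B & rad N%:Z (fun z => blk W p r w (shift u z))] <= pr (rad N%:Z) * sB.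
  apply: le_trans bE _; rewrite (eq_bigr (fun=> pr (rad N%:Z))); last first.
    by move=> u _; exact: (dac_shift hW hp hr u lr).
  by rewrite big_const_seq count_predT iter_addr_0 mulr_natr.
by move=> h3; lra.
Qed.

(** A leak starts at one of at most 36 (n + 1)^2 sites of the ball of radius 3n and reaches distance
    n from there. *)
Lemma pbad_le c z (n : nat) : pbad c z n%:Z <= pr (span c origin n%:Z) + 36 * (n.+1%:R ^+ 2 * theta P W p n%:Z).
Proof.
pose Q u w := reach u n%:Z (bx w); pose l := ball z (3 * n%:Z).
have pq : probs (thr p r) by exact: probs_thr.
have [mQ bQ] := Pr_ex_seq P (l := l) (Q := Q) (fun u _ => meas_reach hW (thr p r) u (isT : 0 <= n%:Z)).
have ms : measurable [set w | span c origin n%:Z (fun v => blk W p r w (shift z v))].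
  apply: (@meas_event _ _ _ _ _ hW p r (fun S => span c origin n%:Z (fun v => S (shift z v)))).
  have [m hm] := span_loc c origin n%:Z; exists (m + nrm z) => S S' e; apply: hm => v bv; apply: e.
  by move: bv; rewrite /box /nrm /=; lia.
apply: (@le_trans _ _ (Pr P [set w | span c origin n%:Z (fun v => blk W p r w (shift z v))] +
   Pr P [set w | exists2 u, u \in l & Q u w])).
  apply: le_trans (Pr_sub2 P ms mQ); apply: Pr_mono; [exact: meas_bad|exact: measurableU|move=> w].
  move/(bad_span (isT : 0 <= n%:Z)) => [h|h]; [left; exact: span_shift|right; exact: leak_reach].
rewrite -(dac_shift hW hp hr z (span_loc c origin n%:Z)); rewrite lerD2l.
apply: le_trans bQ _; rewrite (eq_bigr (fun=> theta P W p n%:Z)); last first.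
  by move=> u _; exact: (Pr_reach hW pq).
have t0 : 0 <= theta P W p n%:Z by exact: Pr_ge0.
rewrite big_const_seq count_predT iter_addr_0 -[_ *+ size _]mulr_natl mulrA; apply: ler_wpM2r => //.
apply: (@le_trans _ _ ((6 * n.+1) ^ 2)%N%:R); last by rewrite natrX natrM exprMn; apply: ler_wpM2r => //; rewrite -natrX ler_nat.
rewrite ler_nat size_map size_filter; apply: leq_trans (count_size _ _) _.
by rewrite size_allpairs /irange !size_map !size_iota; nia.
Qed.

End FixR.

(** The number of bits involved depends on n but not on z, so [Ex_lip] gives one h for all z; this
    makes the criterion an open condition on r. *)
Lemma pbad_cont n (e : R) : 0 < e -> exists2 h : R, 0 < h & forall r r', 0 <= r <= 1 -> 0 <= r' <= 1 ->
  `|r - r'| <= h -> forall c z, pbad r' c z n <= pbad r c z n + e.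
Proof.
move=> e0; pose s : R := (size (bits_of (boxl (4 * n)))).+1%:R; have s0 : 0 < s by rewrite ltr0n.
exists (e / s); first by rewrite divr_gt0.
move=> r r' hr hr' rr c z; pose l := bits_of (ball z (4 * n)).
have ul : uniq l by apply: bits_of_uniq; exact: ball_uniq.
have d0 := @bad_dep c z n.
rewrite /pbad (@Pr_Ex _ _ _ _ _ hW _ (probs_thr hp hr') (bad c z n) l x0) //.
rewrite (@Pr_Ex _ _ _ _ _ hW _ (probs_thr hp hr) (bad c z n) l x0) //.
apply: le_trans (@Ex_lip _ _ (thr p r') (thr p r) l _ x0 (e / s) (probs_thr hp hr') (probs_thr hp hr) _ _) _.
- by move=> y; rewrite ind_ge0 ind_le1.
- move=> [f|v] _ /=; first by rewrite subrr normr0 divr_ge0 ?ltW.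
  by rewrite distrC.
rewrite lerD2l mulrCA ger_pMr // ler_pdivrMr // mul1r ler_nat.
by rewrite /l /bits_of !size_cat !size_map.
Qed.

End Criterion.

(** * Percolation probability and mean cluster size *)

(** As in Cauchy condensation, the block from n to 2n contributes at least n a(2n) >= c. *)
Lemma sums_unbounded (R : realType) (a : nat -> R) (c : R) (n0 : nat) : 0 < c ->
  (forall n m, (n <= m)%N -> a m <= a n) -> (forall n, (n0 <= n)%N -> c <= n%:R * a (2 * n)%N) ->
  forall M : R, exists N : nat, M <= \sum_(0 <= k < N) a k.
Proof.
move=> c0 da h M; pose n1 := n0.+1; pose S N := \sum_(0 <= k < N) a k.
have a0 k : 0 <= a k.
  apply: (@le_trans _ _ (a (2 * (n1 + k))%N)); last by apply: da; lia.
  have := h (n1 + k)%N ltac:(lia); have : 0 < ((n1 + k)%:R : R) by rewrite ltr0n.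
  by move=> h1 h2; rewrite -(pmulr_rge0 _ h1) (le_trans (ltW c0)).
have dblS n : (n0 <= n)%N -> S n + c <= S (2 * n)%N.
  move=> nn; rewrite /S (@big_cat_nat _ _ _ n 0 (2 * n)) //=; last by lia.
  rewrite lerD2l; apply: le_trans (h n nn) _.
  apply: (@le_trans _ _ (\sum_(n <= k < 2 * n) a (2 * n)%N)).
    by rewrite big_const_nat iter_addr_0 (_ : (2 * n - n)%N = n) ?mulr_natl //; lia.
  rewrite !big_nat; apply: ler_sum => k /andP[_ k2]; apply: da; exact: ltnW.
have Sj j : j%:R * c <= S (2 ^ j * n1)%N.
  elim: j => [|j IH]; first by rewrite mul0r; apply: sumr_ge0.
  apply: (@le_trans _ _ (S (2 ^ j * n1)%N + c)); first by rewrite -natr1 mulrDl mul1r lerD2r.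
  by rewrite expnS -mulnA; apply: dblS; have := expn_gt0 2 j; rewrite /n1; nia.
have [M0|M0] := leP M 0; first by exists 0%N; rewrite big_nil.
pose j := Num.bound (M / c); exists (2 ^ j * n1)%N; apply: le_trans (Sj j).
rewrite -ler_pdivrMr //; apply/ltW/archi_boundP; exact: divr_ge0 (ltW M0) (ltW c0).
Qed.

Section Mean.
Context {R : realType} {d : measure_display} {Omega : measurableType d}.
Variables (P : probability Omega R) (W : rindex -> Omega -> R) (hW : iid_uniform P W).
Variables (p r : R).
Notation col := (blk W p r).
Notation pr := (prc P col).

Lemma cluster0E w x : black_cluster0 W p r w x <-> con nn (col w) origin x.
Proof.
split=> [[b0 c]|[b0 c]].
  have {}b0 : col w origin by apply/blkE.
  elim: c => [|a b _ IH [/nn_adjP ab [_ /blkE bb]]]; first exact: con_refl.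
  exact: (con_step IH ab bb).
split; first exact/blkE.
suff [] : path_conn (black_adj W p r w) origin x /\ col w x by [].
elim: c => [|a b _ [IH ca] [ab cb]]; first by split=> //; exact: path_refl.
split=> //; apply: path_step IH _; split; first exact/nn_adjP.
by split; exact/blkE.
Qed.

Lemma infinite_rad w : ~ finite_set (black_cluster0 W p r w) <-> forall n : nat, rad n%:Z (col w).
Proof.
split=> [inf n|h fin].
  apply: contrapT => nr; apply: inf; apply: (@sub_finite_set _ _ [set` boxl n%:Z]); last exact: finite_seq.
  move=> x /cluster0E c; rewrite /= mem_boxl /box leNgt; apply/negP => nx; apply: nr.
  by exists x; split=> //; exact: ltW.
have [s hs] := (finite_seqP _).1 fin.
have [N hN] : exists N : nat, forall x, x \in s -> nrm x < N%:Z.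
  elim: (s) => [|a l [N IH]]; first by exists 0%N.
  exists (maxn N `|nrm a|.+1) => x; rewrite in_cons => /orP[/eqP->|/IH]; lia.
have [x [nx /cluster0E c]] := h N; have xs : x \in s by rewrite hs in c.
by have := hN x xs; lia.
Qed.

Lemma ThetaE : Theta W P p r = P (\bigcap_n [set w | rad n%:Z (col w)]).
Proof.
congr (P _); apply/seteqP; split=> w; first by move/infinite_rad => h n _; exact: h.
by move=> h; apply/infinite_rad => n; exact: h.
Qed.

Lemma meas_rad (n : nat) : measurable [set w | rad n%:Z (col w)].
Proof. by apply: (meas_event hW); exact: rad_loc. Qed.

Lemma rad_mono (n m : int) S : n <= m -> rad m S -> rad n S.
Proof. by move=> nm [v [h c]]; exists v; split=> //; exact: le_trans h. Qed.

Lemma rad_decr (n m : nat) : (n <= m)%N -> pr (rad m%:Z) <= pr (rad n%:Z).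
Proof.
move=> nm; apply: Pr_mono; try exact: meas_rad.
by move=> w; apply: rad_mono; rewrite lez_nat.
Qed.

Lemma Theta_le (n : nat) : (Theta W P p r <= (pr (rad n%:Z))%:E)%E.
Proof.
rewrite ThetaE -PrE; last exact: meas_rad.
apply: le_measure; rewrite ?inE; [|exact: meas_rad|by move=> w; exact].
by apply: bigcap_measurable => // k _; exact: meas_rad.
Qed.

Lemma Theta_eq0 : (forall e : R, 0 < e -> exists N : nat, pr (rad N%:Z) <= e) -> Theta W P p r = 0%E.
Proof.
move=> h; apply/eqP; rewrite eq_le; apply/andP; split; last exact: measure_ge0.
apply/lee_addgt0Pr => e e0; rewrite add0e; have [N hN] := h e e0.
by apply: le_trans (Theta_le N) _; rewrite lee_fin.
Qed.

Lemma Theta_ge (c : R) : (forall N : nat, c <= pr (rad N%:Z)) -> (c%:E <= Theta W P p r)%E.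
Proof.
move=> h; rewrite ThetaE PrE; last by apply: bigcap_measurable => // k _; exact: meas_rad.
rewrite lee_fin; apply: Pr_decr_inf => //; first exact: meas_rad.
by move=> n w; apply: rad_mono; rewrite lez_nat.
Qed.

(** A cluster of radius at least k has a vertex of norm exactly k, and these vertices differ for
    different k. *)
Lemma card0_ge w N : (\sum_(k <- iota 0 N) (\1_[set w | rad k%:Z (col w)] w : R)%:E <= Defs.card0 W p r w)%E.
Proof.
pose l := [seq k <- iota 0 N | `[< rad k%:Z (col w) >]].
have [v hv] : {v : nat -> vertex & forall k, k \in l -> nrm (v k) = k%:Z /\ con nn (col w) origin (v k)}.
  apply: (@choice _ _ (fun k v => k \in l -> nrm v = k%:Z /\ con nn (col w) origin v)) => k.
  have [kl|nk] := boolP (k \in l); last by exists origin.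
  move: kl; rewrite mem_filter => /andP[/asboolP[x [nx c]] _].
  have [u' [v' [e1 e2 c1 c']]] := con_trunc nn_nrm (isT : 0 <= k%:Z) c nrm_origin nx.
  by exists v' => _; split=> //; apply: (con_trans c1); apply: con_sub c' => z [].
have ul : uniq (map v l).
  rewrite map_inj_in_uniq ?filter_uniq ?iota_uniq // => a b al bl e.
  by have [h1 _] := hv a al; have [h2 _] := hv b bl; move: h1; rewrite e h2 => -[].
apply: esum_ge; exists [set` map v l].
  split; first exact: finite_seq.
  by move=> x /= /mapP[k kl ->]; apply/cluster0E; have [] := hv k kl.
rewrite -fsbig_seq // big_map.
rewrite /l big_filter [leRHS]big_mkcond /=; apply: lee_sum => k _.
rewrite indicE; case: asboolP => h; first by case: (_ \in _); rewrite ?lexx // lee_fin ler01.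
by rewrite memNset.
Qed.

Lemma mean_ge N : ((\sum_(0 <= k < N) pr (rad k%:Z))%:E <= \int[P]_w Defs.card0 W p r w)%E.
Proof.
have c0 w : (0 <= Defs.card0 W p r w)%E by apply: esum_ge0.
pose g w := (\sum_(k <- iota 0 N) (\1_[set w | rad k%:Z (col w)] w : R)%:E)%E.
have g0 w : (0 <= g w)%E by apply: sume_ge0 => k _; rewrite lee_fin.
have -> : ((\sum_(0 <= k < N) pr (rad k%:Z))%:E = \int[P]_w g w)%E.
  rewrite ge0_integral_sum //; last first.
    by move=> k; apply/measurable_EFinP; apply: measurable_indic; exact: meas_rad.
  rewrite -sumEFin /index_iota subn0; apply: eq_bigr => k _.
  by rewrite integral_indic // ?setIT -?PrE //; exact: meas_rad.
(* The integrals are compared as suprema over simple functions below the integrand, a route that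
   does not go through measurability of [card0]. *)
rewrite !ge0_integralTE //; apply: le_ereal_sup => _ [h hh <-]; exists h => //.
by move=> w; apply: le_trans (hh w) _; exact: card0_ge.
Qed.

Lemma mean_infinite (c : R) (n0 : nat) : 0 < c ->
  (forall n, (n0 <= n)%N -> c <= n%:R * pr (rad (2 * n)%N%:Z)) -> (\int[P]_w Defs.card0 W p r w)%E = +oo%E.
Proof.
move=> c0 h; apply/eqyP => M M0.
have [N hN] := @sums_unbounded R (fun k => pr (rad k%:Z)) c n0 c0 (fun n m nm => rad_decr nm) h M.
by apply: le_trans (mean_ge N); rewrite lee_fin.
Qed.

End Mean.

(** * The critical colouring probability below one half *)

Section Subcritical.
Context {R : realType} {d : measure_display} {Omega : measurableType d}.
Variables (P : probability Omega R) (W : rindex -> Omega -> R) (hW : iid_uniform P W).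
Variable p : R.
Hypothesis hp2 : 0 <= p < 2^-1.

Lemma hp1 : 0 <= p <= 1. Proof. by case/andP: hp2 => -> h /=; lra. Qed.
Let hp := hp1.
Notation pr r := (prc P (blk W p r)).
Notation Th r := (Theta W P p r).

Lemma blk_mono r r' w v : r <= r' -> blk W p r w v -> blk W p r' w v.
Proof.
move=> rr; rewrite !blkE => -[rep [h1 h2]]; exists rep; split=> //; exact: lt_le_trans rr.
Qed.

Lemma Theta_mono r r' : r <= r' -> (Th r <= Th r')%E.
Proof.
move=> rr; rewrite !ThetaE; apply: le_measure; rewrite ?inE;
  try by apply: bigcap_measurable => // k _; exact: (meas_rad hW).
move=> w h n _; have [v [nv c]] := h n I; exists v; split=> //.
by apply: con_sub c => z; exact: blk_mono.
Qed.

Lemma Theta_ge0 r : (0 <= Th r)%E. Proof. exact: measure_ge0. Qed.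

Lemma Theta_at0 : Th 0 = 0%E.
Proof.
apply/eqP; rewrite eq_le Theta_ge0 andbT; apply: le_trans (Theta_le hW p 0 0) _.
have h01 : 0 <= (0 : R) <= 1 by rewrite lexx ler01.
rewrite lee_fin -[leRHS](Pr_blk hW hp h01 origin); apply: Pr_mono; [exact: (meas_rad hW)|exact: (meas_blk hW)|].
by move=> w [v [_ /con_l]].
Qed.

Lemma Theta_at1 : (0 < Th 1)%E.
Proof.
apply: (@lt_le_trans _ _ 1%E); [exact: lte01|apply: (Theta_ge hW) => N].
have h01 : 0 <= (1 : R) <= 1 by rewrite lexx ler01.
have := all_black_ge hW hp h01 (boxl N%:Z); rewrite expr1n => /le_trans; apply.
apply: Pr_mono; [by apply: (meas_event hW); exact: all_black_loc|exact: (meas_rad hW)|move=> w h].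
exists (N%:Z, 0); split; first by rewrite /nrm /=; lia.
by apply: con_row => // x hx; apply: h; rewrite mem_boxl /box /nrm /=; lia.
Qed.

Lemma pbad_small c (r e : R) : 0 <= r <= 1 -> 0 < e ->
  exists N : nat, forall n : nat, (N <= n)%N -> prc P (blk W p r) (span c origin n%:Z) <= e ->
  forall z, pbad P W p r c z n%:Z <= 2 * e.
Proof.
move=> hr e0; have e36 : 0 < e / 36 by rewrite divr_gt0.
have [N hN] := theta_subcritical hW hp2 e36; exists N => n Nn hs z.
apply: le_trans (pbad_le hW hp hr c z n) _; have := hN n Nn; rewrite ler_pdivlMr //.
by move: hs; move: (prc _ _ _) (_ * theta _ _ _ _) => a b; lra.
Qed.

Lemma K0_gt0 : 0 < K0 :> R.
Proof. by rewrite exprn_gt0 // (lt_le_trans _ K0_ge1). Qed.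

Lemma pbad_open c (r : R) (n : int) : 0 <= r <= 1 -> (forall z, pbad P W p r c z n <= 2 * (16 * K0)^-1) ->
  exists2 h : R, 0 < h & forall r', 0 <= r' <= 1 -> `|r - r'| <= h -> forall z, K0 * pbad P W p r' c z n <= 4^-1.
Proof.
move=> hr hb; have k0 := K0_gt0; have e0 : 0 < 2 * (16 * K0)^-1 :> R by rewrite mulr_gt0 // invr_gt0 mulr_gt0.
have [h h0 H] := pbad_cont hW hp n e0; exists h => // r' hr' rr z.
have := H r r' hr hr' rr c z; have := hb z => h1 h2.
have h3 : pbad P W p r' c z n <= 4 * (16 * K0)^-1 by lra.
have := ler_wpM2l (ltW k0) h3; move/le_trans; apply.
rewrite le_eqVlt; apply/orP; left; apply/eqP; field; exact: lt0r_neq0.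
Qed.

(** Percolation makes black circuits likely, and these block white crossings; the white criterion
    then holds at r with room to spare, hence slightly below r, where it forces black to
    percolate. *)
Lemma Theta_open_left r : 0 < r <= 1 -> (0 < Th r)%E ->
  exists r', [/\ 0 <= r', r' < r & (0 < Th r')%E].
Proof.
case/andP=> r0 r1 T0; have hr : 0 <= r <= 1 by rewrite r1 ltW.
have p2 : p < 2^-1 by case/andP: hp2.
have L := dac_law hW hp hr p2; have k0 := K0_gt0.
(* Otherwise [no_perc], started from the box of radius 0, makes long black paths from the origin as
   unlikely as desired, against Theta > 0. *)
have perc : percolates (pr r).
  apply: contrapT => np; have Tf : (Th r \is a fin_num)%E.
    rewrite ThetaE; apply: P_fin; apply: bigcap_measurable => // k _; exact: (meas_rad hW).
  move: T0; rewrite -(fineK Tf) lte_fin => t0; have t2 : 0 < fine (Th r) / 2 by rewrite divr_gt0.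
  have [N [N0 hN]] := no_perc L np 0 t2.
  have := Theta_le hW p r `|N|; rewrite -(fineK Tf) lee_fin gez0_abs // => h1.
  have aloc : loc (arm (fun z => box 0 z) (fun z => box N z) (fun v => nrm v = N)).
    by apply: (@arm_loc _ _ _ N) => z; exact.
  have h2 : pr r (rad N) <= pr r (arm (fun z => box 0 z) (fun z => box N z) (fun v => nrm v = N)).
    apply: Pr_mono; [by apply: (meas_event hW); exact: rad_loc|exact: (meas_event hW _ _ aloc)|].
    move=> w [v [nv c]].
        have [u' [v' [e1 e2 _ c']]] := con_trunc nn_nrm N0 c nrm_origin nv.
    exists u', v'; split=> //; first by rewrite /box e1.
    by apply: con_sub c' => z [h /andP[_ hz]].
  by move: h1 h2 hN t0; move: (pr r _) (pr r _) (fine _) => a b t; lra.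
(* A crossing probability of at most e becomes a bad probability of at most 2e with leaks and 4e
   after moving r, and 4 e [K0] = 1/4. *)
pose e : R := (16 * K0)^-1; have e0 : 0 < e by rewrite invr_gt0 mulr_gt0.
have [N hN] := pbad_small false hr e0.
have [n nN [cl ci cp]] := circuits_high L perc (fun m m0 => dac_glue hW hp hr r0 m0) N.+1%:Z e0.
have n0 : 0 < n by apply: lt_le_trans nN.
have en : n = `|n|%N%:Z by rewrite gez0_abs // ltW.
have sp : pr r (span false origin n) <= e.
  have -> : e = 1 - (1 - e) by lra.
  apply: (@le_trans _ _ (1 - pr r (circ n))); last by rewrite lerD2l lerN2.
  rewrite -(law_not L cl); apply: (law_mono L); [exact: span_loc|exact: loc_not|].
  move=> S [u [v [h1 h2 h3]]] cS; have e1 := sub_origin.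
  rewrite /around !e1 in h1 h2.
  have hv : 3 * n <= nrm v by rewrite h2.
  have [s [Ss Ts]] := circ_blocks (ltW n0) cS (con_sub (fun a (h : _ /\ _) => h.1) h3) h1 hv.
  by [].
have hb z : pbad P W p r false z n <= 2 * (16 * K0)^-1.
  rewrite en; apply: hN; last by rewrite -en.
  by move: nN; rewrite en; clear; lia.
have [h h0 H] := pbad_open hr hb; pose r' := r - Num.min h r.
have m0 : 0 < Num.min h r by rewrite lt_min h0.
have [m1 m2] : Num.min h r <= h /\ Num.min h r <= r by rewrite !ge_min !lexx orbT.
have hr' : 0 <= r' <= 1 by rewrite /r'; apply/andP; split; lra.
exists r'; split; [by case/andP: hr'|rewrite /r'; lra|].
have rr : `|r - r'| <= h by rewrite /r' opprB addrC subrK ger0_norm // ltW.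
have [c c0 hc] := white_small hW hp hr' n0 (H r' hr' rr).
by apply: lt_le_trans (Theta_ge hW hc); rewrite lte_fin.
Qed.

Definition sphere (n : int) : seq vertex := [seq (n, j) | j <- irange n] ++ [seq (- n, j) | j <- irange n] ++
  [seq (j, n) | j <- irange n] ++ [seq (j, - n) | j <- irange n].

Lemma mem_sphere (n : int) u : 0 <= n -> nrm u = n -> u \in sphere n.
Proof.
move=> n0 nu; have ir (j : int) : - n <= j -> j <= n -> j \in irange n.
  by move=> h1 h2; apply/mapP; exists `|(j + n)%R|%N; [rewrite mem_iota; lia|lia].
rewrite /sphere !mem_cat; move: nu; case: u => a b; rewrite /nrm /= => nu.
have [e|na] := eqVneq a n; first by apply/orP; left; rewrite e; apply: map_f; apply: ir; lia.
have [e|na'] := eqVneq a (- n); first by apply/orP; right; apply/orP; left; rewrite e; apply: map_f; apply: ir; lia.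
have [e|nb] := eqVneq b n.
  by apply/orP; right; apply/orP; right; apply/orP; left; rewrite e; apply: (map_f (fun j => (j, n))); apply: ir; lia.
apply/orP; right; apply/orP; right; apply/orP; right; rewrite (_ : b = - n); last by lia.
by apply: (map_f (fun j => (j, - n))); apply: ir; lia.
Qed.

(** The crossing passes through one of the 8n + 4 <= 12n listed points of the sphere of radius n,
    from which it reaches distance 2n. *)
Lemma span_black_le (r : R) (n : nat) : 0 <= r <= 1 -> (0 < n)%N ->
  pr r (span true origin n%:Z) <= 12 * (n%:R * pr r (rad (2 * n)%N%:Z)).
Proof.
move=> hr n0; have lr : loc (rad (2 * n)%N%:Z) by apply: rad_loc.
have lru u : loc (fun S => rad (2 * n)%N%:Z (fun z => S (shift u z))).
  have [m hm] := lr; exists (m + nrm u) => S S' e; apply: hm => z bz; apply: e.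
  by move: bz; rewrite /box /nrm /=; lia.
have [mE bE] := Pr_ex_seq P (l := sphere n%:Z) (Q := fun u w => rad (2 * n)%N%:Z (fun z => blk W p r w (shift u z)))
  (fun u _ => meas_event hW p r (lru u)).
apply: (@le_trans _ _ (Pr P [set w | exists2 u, u \in sphere n%:Z & rad (2 * n)%N%:Z (fun z => blk W p r w (shift u z))])).
  apply: Pr_mono => //; first by apply: (meas_event hW); exact: span_loc.
  move=> w [u [v [h1 h2 h3]]]; have e1 := sub_origin.
  rewrite /around !e1 in h1 h2.
  have n3 : n%:Z <= 3 * n%:Z by lia.
  have hv : 3 * n%:Z <= nrm v by rewrite h2.
  have [u' [v' [k1 k2 _ c]]] := con_trunc nn_nrm n3 h3 h1 hv.
  exists u'; first by apply: mem_sphere.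
  exists (sub v' u'); split; first by have := nrm_sub v' u'; lia.
  have e2 : forall z, shift u' (sub z u') = z by move=> z; apply: vtx_eq => /=; lia.
  rewrite (_ : origin = sub u' u'); last by apply: vtx_eq => /=; lia.
  apply: (@con_map _ (fun z => blk W p r w (shift u' z)) (fun z => sub z u')).
    by move=> a b; rewrite /nn /=; lia.
  by apply: con_sub c => z [[h _] _]; rewrite e2.
apply: le_trans bE _; rewrite (eq_bigr (fun=> pr r (rad (2 * n)%N%:Z))); last first.
  by move=> u _; exact: (dac_shift hW hp hr u lr).
rewrite big_const_seq count_predT iter_addr_0 -[_ *+ size _]mulr_natl mulrA; apply: ler_wpM2r; first exact: Pr_ge0.
rewrite -natrM ler_nat /sphere !size_cat !size_map !size_iota; lia.
Qed.

(** With a finite mean, n P(rad (2n)) cannot stay bounded away from 0. So black crossings are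
    unlikely at some large scale, and the black criterion persists slightly above r. *)
Lemma Theta_open_right r : 0 <= r < 1 -> (\int[P]_w Defs.card0 W p r w)%E != +oo%E ->
  exists r', [/\ r < r', r' <= 1 & Th r' = 0%E].
Proof.
case/andP=> r0 r1 fin; have hr : 0 <= r <= 1 by rewrite r0 ltW.
have k0 := K0_gt0; pose e : R := (16 * K0)^-1; have e0 : 0 < e by rewrite invr_gt0 mulr_gt0.
have [N hN] := pbad_small true hr e0; have e12 : 0 < e / 12 by rewrite divr_gt0.
have [n [nN hn]] : exists n : nat, (N < n)%N /\ n%:R * pr r (rad (2 * n)%N%:Z) <= e / 12.
  apply: contrapT => H; case/eqP: fin; apply: (mean_infinite hW (n0 := N.+1) e12) => n nN.
  by rewrite leNgt; apply/negP => h; apply: H; exists n; split=> //; exact: ltW.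
have n0 : (0 < n)%N by exact: leq_ltn_trans nN.
have sp : pr r (span true origin n%:Z) <= e.
  by apply: le_trans (span_black_le hr n0) _; rewrite mulrC -ler_pdivlMr.
have [h h0 H] := pbad_open hr (hN n (ltnW nN) sp); pose m := Num.min h (1 - r).
have m0 : 0 < m by rewrite lt_min h0 subr_gt0.
have [m1 m2] : m <= h /\ m <= 1 - r by rewrite !ge_min !lexx orbT.
have hr' : 0 <= r + m <= 1 by apply/andP; split; lra.
exists (r + m); split; [lra|lra|].
have rr : `|r - (r + m)| <= h by rewrite opprD addrA subrr add0r normrN ger0_norm // ltW.
by apply: (Theta_eq0 hW); apply: (black_small hW hp hr' (n := n%:Z)) => //; exact: H.
Qed.

Lemma subcritical_critical : critical W P p (r_c W P p).
Proof.
pose E := [set r : R | 0 <= r <= 1 /\ Th r = 0%E]; pose rc := sup E.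
have E0 : E 0 by split; [rewrite lexx ler01|exact: Theta_at0].
have Eub : ubound E 1 by move=> r [/andP[]].
have hs : has_sup E by split; [exists 0|exists 1].
have rc0 : 0 <= rc by exact: (sup_upper_bound hs E0).
have rc1 : rc <= 1 by apply: ge_sup => //; exists 0.
have T0 : Th rc = 0%E.
  apply/eqP; rewrite eq_le Theta_ge0 andbT leNgt; apply/negP => T.
  have rcp : 0 < rc.
    rewrite lt_neqAle rc0 andbT; apply/eqP => e; move: T; rewrite -e Theta_at0 ltxx //.
  have [|r' [r'0 r'r T']] := Theta_open_left _ T; first by rewrite rcp.
  have : rc <= r'.
    apply: ge_sup; first by exists 0.
    move=> r [_ Tr]; rewrite leNgt; apply/negP => /ltW/Theta_mono; rewrite Tr => h.
    by have := lt_le_trans T' h; rewrite ltxx.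
  by rewrite leNgt r'r.
split=> //; apply/eqP/negPn/negP => fin.
(* There is room above the critical value because at r = 1 the whole lattice is black. *)
have rcl : rc < 1.
  rewrite lt_neqAle rc1 andbT; apply/eqP => e; have := Theta_at1; rewrite -e T0 ltxx //.
have [|r' [r'r r'1 T']] := Theta_open_right _ fin; first by rewrite rc0.
have : r' <= rc by apply: (sup_upper_bound hs); split=> //; rewrite r'1 (le_trans rc0 (ltW r'r)).
by rewrite leNgt r'r.
Qed.

End Subcritical.

(** * The critical bond parameter *)

Lemma con_rowU (S : vertex -> Prop) (a b y : int) :
  (forall x, Num.min a b <= x <= Num.max a b -> S (x, y)) -> con nn S (a, y) (b, y).
Proof.
move=> h; have [ab|ab] := leP a b; last apply: (con_sym nn_sym); apply: con_row => [|x hx];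
  by [exact: ltW|apply: h; lia|].
Qed.

Lemma con_colU (S : vertex -> Prop) (a b x : int) :
  (forall y, Num.min a b <= y <= Num.max a b -> S (x, y)) -> con nn S (x, a) (x, b).
Proof.
move=> h; have [ab|ab] := leP a b; last apply: (con_sym nn_sym); apply: con_col => [|y hy];
  by [exact: ltW|apply: h; lia|].
Qed.

Lemma out_con (N : int) z : 0 <= N -> N <= nrm z -> con nn (fun v => N <= nrm v) z (N, 0).
Proof.
case: z => a b N0; rewrite /nrm /= => h.
have [h1|h1] := leP N a.
  apply: (@con_trans _ _ _ (a, 0)).
    by apply: con_colU => y _; rewrite /nrm /=; clear -h1; lia.
  by apply: con_rowU => x hx; rewrite /nrm /=; clear -h1 hx; lia.
have [h2|h2] := leP N `|b|.
  apply: (@con_trans _ _ _ (N, b)).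
    by apply: con_rowU => x _; rewrite /nrm /=; clear -h2; lia.
  by apply: con_colU => y _; rewrite /nrm /=; clear; lia.
have h3 : a <= - N by clear -h h1 h2 N0; lia.
apply: (@con_trans _ _ _ (a, N)).
  by apply: con_colU => y _; rewrite /nrm /=; clear -h3; lia.
apply: (@con_trans _ _ _ (N, N)).
  by apply: con_rowU => x _; rewrite /nrm /=; clear; lia.
by apply: con_colU => y _; rewrite /nrm /=; clear; lia.
Qed.

Definition lifted (Q : vertex -> Prop) (z : vertex) : Prop :=
  (exists2 u, Q u & z = dbl u) \/ (exists e u v, [/\ Q u, edge_joins e u v & z = site e]).

Lemma lift_path (Q : vertex -> Prop) u v : con nn Q u v -> con nn (lifted Q) (dbl u) (dbl v).
Proof.
move=> c; have Qu := con_l c; move: v c; apply: con_ind; first by apply: con_refl; left; exists u.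
move=> v w uv c /nn_adjP[e ej] Qw; apply: (@con_step _ _ _ (site e)).
- apply: (con_step c); [exact: dbl_site ej|right; exists e, v, w; split=> //; exact: (con_r uv)].
- by apply: nn_sym; apply: dbl_site (edge_joins_sym ej).
- by left; exists w.
Qed.

Lemma lifted_open (Q : vertex -> Prop) x z : lifted Q z -> rho x z ->
  exists2 u, Q u & con nn (fun z => rho x z) (dbl u) z.
Proof.
case=> [[u Qu ->] h|[e [u [v [Qu ej ->]]]] h]; exists u => //; first exact: con_refl.
apply: (@con_step _ _ _ (dbl u)) => //; last exact: dbl_site ej.
by apply: con_refl; rewrite rho_dbl.
Qed.

Lemma open_near x z : rho x z ->
  exists2 v, con nn (fun z => rho x z) (dbl v) z & star (dbl v) z.
Proof.
case: rhoP => [u ->|//|e ->] h.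
  by exists u; [apply: con_refl; rewrite rho_dbl|rewrite /star; lia].
have ej : edge_joins e (edge_src e) (edge_dst e) by left.
exists (edge_src e); last by apply: nn_star; exact: dbl_site ej.
apply: (@con_step _ _ _ (dbl (edge_src e))); [by apply: con_refl; rewrite rho_dbl|exact: dbl_site ej|by rewrite rho_site].
Qed.

Lemma dbl_inj u v : dbl u = dbl v -> u = v.
Proof. by case=> h1 h2; apply: vtx_eq; lia. Qed.

Lemma open_lower x u v : con nn (fun z => rho x z) (dbl u) (dbl v) -> con (oadj x) (fun=> True) u v.
Proof.
move/lower_open=> [v1 [c [/dbl_inj->//|[e [v' [_ _]]]]]].
by case: e => [[a b] k]; rewrite /dbl /site; case: k => -[]; lia.
Qed.

Definition white_arm (m N : int) (x : conf) : Prop :=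
  arm (fun z => box m z) (fun z => box N z) (fun v => nrm v = N) (fun z => ~ rho x (shift (1, 1) z)).

(* The outer boundary of a box together with the dual clusters attached to it is
   connected in the refined lattice, so it lies in a single open cluster. *)
Lemma open_ring (x : conf) (m N : int) : 0 <= m -> 2 * m + 2 <= N -> ~ white_arm (2 * m + 2) N x ->
  exists v, [/\ m <= nrm v, nrm v <= N + 2 & forall (Q : vertex -> Prop) u, con nn Q origin u ->
     N + 2 <= nrm u -> exists2 a, Q a & con (oadj x) (fun=> True) v a].
Proof.
(* Norms double in the refined lattice. T is the box with the white sites attached to it, diagonals
   allowed, and the absence of a dual arm keeps it below norm N + 1. *)
move=> m0 mN nw; pose M := 2 * m; pose T := con star (fun z => box M z \/ ~ rho x z) origin.
have oM : box M origin by rewrite /box /M; have := nrm_origin; lia.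
have To : T origin by apply: con_refl; left.
have TN z : T z -> nrm z < N + 1.
  move=> Tz; rewrite ltNge; apply/negP => nz; apply: nw.
  have nKz : ~ box M z by rewrite /box /M; clear -nz mN; lia.
  have [a [b [[Ka _] nKb ab c]]] := @last_exit _ _ (fun z => box M z) _ _ Tz oM nKz.
  have c1 : con nn (fun z => ~ rho x z) b z.
    by apply: white_star_nn; apply: con_sub c => y [[h|//] nh].
  have nb : nrm b <= M + 1 by have := star_nrm ab; move: Ka; rewrite /box; clear; lia.
  pose f (y : vertex) : vertex := (y.1 - 1, y.2 - 1).
  have fK y : shift (1, 1) (f y) = y by apply: vtx_eq => /=; clear; lia.
  have c2 : con nn (fun y => ~ rho x (shift (1, 1) y)) (f b) (f z).
    apply: con_map; first by move=> y y'; rewrite /nn /=; clear; lia.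
    by apply: con_sub c1 => y; rewrite fK.
  have h1 : nrm (f b) <= 2 * m + 2 by move: nb; rewrite /M /nrm /=; clear; lia.
  have h2 : N <= nrm (f z) by move: nz; rewrite /nrm /=; clear; lia.
  have [u' [v' [e1 e2 _ c3]]] := con_trunc nn_nrm mN c2 h1 h2.
  by exists u', v'; split=> //; [rewrite /box e1|apply: con_sub c3 => y [h /andP[_ hy]]].
pose D := con nn (fun z => ~ T z) (N + 1, 0).
have N0 : 0 <= N + 1 by clear -mN m0; lia.
have nT z : N + 1 <= nrm z -> ~ T z by move=> h /TN; rewrite ltNge h.
have outD z : N + 1 <= nrm z -> D z.
  move=> h; apply: (con_sym nn_sym); apply: con_sub (out_con N0 h) => y; exact: nT.
have rim t b : T t -> D b -> star t b -> rho x b /\ M < nrm b /\ nrm b <= N + 1.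
  move=> Tt Db tb; have nTb := con_r Db; split; [|split].
  - by apply: contrapT => nb; apply: nTb; apply: (con_step Tt tb); right.
  - by rewrite ltNge; apply/negP => bb; apply: nTb; apply: (con_step Tt tb); left.
  - by have := TN t Tt; have := star_nrm tb; clear; lia.
have exit (Q : vertex -> Prop) u : con nn Q origin u -> N + 1 <= nrm u ->
   exists t b, [/\ T t, D b, nn t b & Q b].
  move=> c nu; have [t [b [[Tt _] _ tb c']]] := last_exit c To (nT u nu).
  exists t, b; split=> //; last by have [] := con_l c'.
  apply: (con_trans (outD u nu)); apply: (con_sym nn_sym); by apply: con_sub c' => y [].
have rowc : con nn (fun=> True) origin (N + 1, 0) by apply: con_rowU.
have nrow : N + 1 <= nrm (N + 1, 0) by rewrite /nrm /=; clear; lia.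
have [t0 [d0 [Tt0 Dd0 td0 _]]] := exit _ _ rowc nrow.
have [r0 [M0 N1]] := rim _ _ Tt0 Dd0 (nn_star td0).
have [v vd0 sv] := open_near r0; exists v.
have nv : M <= nrm (dbl v) <= N + 2 by have := star_nrm sv; clear -M0 N1; lia.
split.
- by move: nv; rewrite /M /nrm /=; clear; lia.
- by move: nv; rewrite /nrm /=; clear; lia.
move=> Q u c nu; have nu2 : N + 1 <= nrm (dbl u) by move: nu; rewrite /nrm /=; clear; lia.
have [t1 [d1 [Tt1 Dd1 td1 L1]]] := exit _ _ (lift_path c) nu2.
have [r1 _] := rim _ _ Tt1 Dd1 (nn_star td1).
have [a Qa ca] := lifted_open L1 r1; exists a => //; apply: open_lower.
apply: (con_trans vd0); apply: (@con_trans _ _ _ d1); last exact: (con_sym nn_sym ca).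
(* The sites of D along T are open and form one nearest-neighbour connected set, so the exit point
   of any path lies in the open cluster of d0. *)
have := @boundary_nn D _ T t0 d0 t1 d1 _ _ _ Tt0 Dd0 td0 Tt1 Dd1 td1.
move=> B; apply: con_sub (B _ _ _ _).
- by move=> y [Dy [t [Tt ty]]]; have [] := rim _ _ Tt Dy ty.
- by move=> y y'; exact: con_comp nn_sym.
- by move=> t t'; exact: con_comp star_sym.
- by move=> y z Dy yz nz; exact: (con_step Dy yz nz).
- by move=> z Tz Dz; exact: (con_r Dz Tz).
Qed.

Section Rings.
Context {R : realType} {d : measure_display} {Omega : measurableType d}.
Variables (P : probability Omega R) (W : rindex -> Omega -> R) (hW : iid_uniform P W).
Notation b2 w := (bits W (@thr2 R) w).

Definition edge_event (E : conf -> Prop) :=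
  (forall x y : conf, (forall e, x (inl e) = y (inl e)) -> E x -> E y) /\
  exists2 s, uniq s & dep (fun i => i \in s) E.

Lemma edge_event_and E F : edge_event E -> edge_event F -> edge_event (fun x => E x /\ F x).
Proof.
move=> [e1 [s us dE]] [e2 [t ut dF]]; split=> [x y xy [h1 h2]|]; first by split; [exact: e1 h1|exact: e2 h2].
exists (undup (s ++ t)); first exact: undup_uniq.
move=> x y xy; rewrite (dE x y) ?(dF x y) // => i ii; apply: xy; by rewrite mem_undup mem_cat ii ?orbT.
Qed.

Lemma edge_event_not E : edge_event E -> edge_event (fun x => ~ E x).
Proof.
move=> [e1 [s us dE]]; split; first by move=> x y xy h /(e1 y x) h'; apply: h; apply: h' => e.
by exists s => // x y xy; rewrite (dE x y xy).
Qed.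

Lemma edge_event_meas E (thr : rindex -> R) : edge_event E -> measurable [set w | E (bits W thr w)].
Proof. by case=> _ [s _ dE]; exact: (@meas_loc _ _ _ _ _ hW thr E s). Qed.

Lemma white_arm_edge m N : edge_event (white_arm m N).
Proof.
split.
  move=> x y xy; rewrite /white_arm (_ : (fun z => ~ rho x _) = (fun z => ~ rho y (shift (1, 1) z))) //.
  by apply/funext => z; rewrite (@rho_dep (fun=> True) x y).
exists (bits_of (boxl (N + 1))); first by apply: bits_of_uniq; exact: boxl_uniq.
pose A : event := fun S => arm (fun z => box m z) (fun z => box N z) (fun v => nrm v = N) (fun z => ~ S (shift (1, 1) z)).
apply: (@rho_loc_dep A (N + 1)) => S S' e; apply: arm_on => z bz.
have [e1 e2] := e (shift (1, 1) z) ltac:(by move: bz; rewrite /box /nrm /=; lia).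
by split=> h1 h2; apply: h1; [exact: e2|exact: e1].
Qed.

Lemma white_arm_small (m : int) (e : R) : 0 < e -> exists N : int, m <= N /\
  Pr P [set w | white_arm m N (b2 w)] <= e.
Proof.
move=> e0; have [N [mN hN]] := bond_arm_small hW m e0; exists N; split=> //.
rewrite -(bond_dual hW) // in hN; exact: (@arm_loc _ _ _ N).
Qed.

Lemma far_reach_small (N : int) (e : R) : 0 < e -> exists2 n : int, 0 < n &
  edge_event (fun x => exists2 u, u \in boxl N & reach u n x) /\
  Pr P [set w | exists2 u, u \in boxl N & reach u n (b2 w)] <= e.
Proof.
move=> e0; pose k : R := (size (boxl N)).+1%:R; have k0 : 0 < k by rewrite ltr0n.
have ek : 0 < e / k by rewrite divr_gt0.
have [n n0 hn] := theta_half_small hW ek; have n1 : 0 <= n + 1 by lia.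
exists (n + 1); first by lia.
have h2 : 0 <= (2^-1 : R) <= 1 by apply/andP; split; lra.
split; first split.
- by move=> x y xy [u uN h]; exists u => //; exact: reach_ext h.
- exists (undup (flatten [seq bits_of (boxl (n + 1 + nrm u)) | u <- boxl N])); first exact: undup_uniq.
  have K x y : (forall i, i \in undup (flatten [seq bits_of (boxl (n + 1 + nrm u)) | u <- boxl N]) -> x i = y i) ->
     (exists2 u, u \in boxl N & reach u (n + 1) x) -> exists2 u, u \in boxl N & reach u (n + 1) y.
    move=> xy [u uN h]; exists u => //; rewrite -(@reach_dep u (n + 1) n1 x y) // => i ib; apply: xy.
    by rewrite mem_undup; apply/flattenP; exists (bits_of (boxl (n + 1 + nrm u))) => //; apply: map_f.
  by move=> x y xy; apply/propext; split; apply: K => // i /xy.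
have [_ b] := Pr_ex_seq P (l := boxl N) (Q := fun u w => reach u (n + 1) (b2 w))
  (fun u _ => meas_reach hW (@thr2 R) u n1).
apply: le_trans b _; rewrite (eq_bigr (fun=> theta P W 2^-1 (n + 1))); last first.
  by move=> u _; exact: (Pr_reach hW (@probs2 R)).
have t1 : theta P W 2^-1 (n + 1) <= e / k by apply: le_trans hn; apply: (theta_decr hW) => //; lia.
have t0 : 0 <= theta P W 2^-1 (n + 1) by exact: Pr_ge0.
rewrite big_const_seq count_predT iter_addr_0 -(mulr_natr (theta P W 2^-1 (n + 1))).
move: t1; rewrite ler_pdivlMr // => /(le_trans _); apply; apply: ler_wpM2l => //; by rewrite ler_nat.
Qed.

(** The last clause concerns all lattice paths and not only open ones, since a black path may pass
    from one open cluster to another. *)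
Definition ringed (N : int) (k : nat) (x : conf) : Prop := exists vs : seq vertex,
  [/\ size vs = k, uniq vs, forall v, v \in vs -> box N v,
   forall u v, u \in vs -> v \in vs -> con (oadj x) (fun=> True) u v -> u = v &
   forall (Q : vertex -> Prop) u, con nn Q origin u -> N <= nrm u ->
     forall v, v \in vs -> exists2 a, Q a & con (oadj x) (fun=> True) v a].

(** Induction outwards: no open cluster of the box N reaches distance n, so the next ring belongs to
    a new cluster; and no dual arm runs from 2m + 2 to N', so [open_ring] provides that ring. Each
    stage costs 2e. *)
Lemma rings k (e : R) : 0 < e -> exists (N : int) (E : conf -> Prop),
  [/\ 0 <= N, edge_event E, Pr P [set w | ~ E (b2 w)] <= (2 * k)%:R * e &
      forall x, E x -> ringed N k x].
Proof.
move=> e0; elim: k => [|k [N [E [N0 eE PE hE]]]].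
  exists 0, (fun=> True); split=> //.
  - by split=> //; exists [::].
  - rewrite muln0 mul0r (_ : [set w | _] = set0) ?/Pr ?measure0 //.
    by apply/seteqP; split=> // w /=.
  - by move=> x _; exists [::]; split.
have [n n0 [eF PF]] := far_reach_small N e0.
pose m := N + n; have [N' [mN' PD]] := white_arm_small (2 * m + 2) e0.
have m0 : 0 <= m by rewrite /m; lia.
pose F x := ~ exists2 u, u \in boxl N & reach u n x.
pose D x := ~ white_arm (2 * m + 2) N' x.
have eD := edge_event_not (white_arm_edge (2 * m + 2) N'); have eF' := edge_event_not eF.
exists (N' + 2), (fun x => E x /\ (F x /\ D x)); split.
- by clear -mN' m0; lia.
- by apply: edge_event_and => //; exact: edge_event_and.
- have mE := edge_event_meas (@thr2 R) (edge_event_not eE).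
  have mF := edge_event_meas (@thr2 R) eF.
  have mD := edge_event_meas (@thr2 R) (white_arm_edge (2 * m + 2) N').
  apply: (@le_trans _ _ (Pr P [set w | ~ E (b2 w)] + (Pr P [set w | exists2 u, u \in boxl N & reach u n (b2 w)] +
     Pr P [set w | white_arm (2 * m + 2) N' (b2 w)]))).
    apply: le_trans (_ : Pr P ([set w | ~ E (b2 w)] `|` ([set w | exists2 u, u \in boxl N & reach u n (b2 w)] `|`
       [set w | white_arm (2 * m + 2) N' (b2 w)])) <= _).
      apply: Pr_mono.
      + by apply: (edge_event_meas (E := fun x => ~ (E x /\ (F x /\ D x)))); apply: edge_event_not;
          apply: edge_event_and => //; exact: edge_event_and.
      + by apply: measurableU => //; exact: measurableU.
      move=> w nE; apply: contrapT => h; apply: nE; split; [|split].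
      * by apply: contrapT => nE; apply: h; left.
      * by move=> nF; apply: h; right; left.
      * by move=> nD; apply: h; right; right.
    have mFD : measurable ([set w | exists2 u, u \in boxl N & reach u n (b2 w)] `|`
       [set w | white_arm (2 * m + 2) N' (b2 w)]) by exact: measurableU.
    by apply: le_trans (Pr_sub2 P mE mFD) _; rewrite lerD2l; exact: (Pr_sub2 P mF mD).
  rewrite (_ : (2 * k.+1)%:R = (2 * k)%:R + 2 :> R); last by rewrite mulnS natrD addrC.
  by move: PE PF PD; move: (Pr _ _) (Pr _ _) (Pr _ _) => a b c; lra.
move=> x [Ex [Fx Dx]]; have [vs [s1 s2 s3 s4 s5]] := hE x Ex.
have [v [v1 v2 v3]] := open_ring m0 mN' Dx.
have far u : u \in vs -> ~ con (oadj x) (fun=> True) u v.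
  move=> uv c; apply: Fx; exists u; first by rewrite mem_boxl; exact: s3.
  exact: (reach_box (s3 _ uv) v1 c).
exists (v :: vs); split.
- by rewrite /= s1.
- rewrite /= s2 andbT; apply/negP => /s3; rewrite /box; clear -v1 n0 => ?; rewrite /m in v1; lia.
- move=> u; rewrite in_cons => /orP[/eqP->//|/s3]; rewrite /box; clear -mN' n0 N0; rewrite /m; lia.
- move=> a b; rewrite !in_cons => /orP[/eqP->|av] /orP[/eqP->|bv] // c.
  + by case: (far b bv); exact: (con_sym (@oadj_sym x) c).
  + by case: (far a av).
  + exact: s4.
- move=> Q u c nu a; rewrite in_cons => /orP[/eqP->|]; first exact: v3 c nu.
  apply: s5 c _ a; move: nu; clear -mN' n0 N0; rewrite /m; lia.
Qed.

Variable r : R.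
Hypothesis hr : 0 <= r <= 1.
Notation pr := (prc P (blk W 2^-1 r)).

Lemma p2_01 : 0 <= (2^-1 : R) <= 1. Proof. by apply/andP; split; lra. Qed.

Lemma edge_event_thr E : edge_event E ->
  forall w, E (b2 w) <-> E (bits W (thr 2^-1 r) w).
Proof. by move=> [e1 _] w; split; apply: e1. Qed.

Lemma rad_le_rings k (e : R) : 0 < e -> exists N : nat, pr (rad N%:Z) <= ((2 * k)%:R + 1) * e + r ^+ k.
Proof.
move=> e0; have [N [E [N0 eE PE hE]]] := rings k e0; exists `|N|%N; rewrite gez0_abs //.
have pq : probs (thr 2^-1 r) := probs_thr p2_01 hr; have [e1 [s us dE]] := eE.
have [L hL] := unstable_small hW 2^-1 r N e0.
have [M hM] : exists M : nat, forall i, i \in s -> (if i is inl f then box M%:Z (edge_src f) else true).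
  clear -s; elim: s => [|i l [M IH]]; first by exists 0%N.
  case: i => [f|u]; last by exists M => i; rewrite in_cons => /orP[/eqP->//|/IH].
  exists (maxn M `|nrm (edge_src f)|) => i; rewrite in_cons => /orP[/eqP->|/IH].
    by rewrite /box; lia.
  by case: i => // f'; rewrite /box; lia.
pose L' := maxn `|N|%N (maxn L M); pose gl := boxl L'%:Z; have ugl : uniq gl by exact: boxl_uniq.
have Ng z : box N z -> z \in gl by rewrite mem_boxl /box /L'; clear -N0; lia.
(* The ring vertices come from a choice function on configurations. Applying it to the configuration
   cut to a finite region makes them depend on finitely many edge bits, so that [black_many] can
   colour them independently of the choice. *)
pose cut (x : conf) : conf := fun i => if i is inl f then (i \in bits_of gl) && x i else false.
have cut_le x i : cut x i -> x i by case: i => //= f /andP[].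
have cutE x y : (forall i, i \in bits_of gl -> x i = y i) -> cut x = cut y.
  by move=> xy; apply/funext => -[f|//] /=; case: (boolP (_ \in _)) => // h; rewrite xy.
have Ecut x : E x -> E (cut x).
  move=> Ex; pose z : conf := fun i => if i is inl _ then cut x i else x i.
  apply: (e1 z) => //; rewrite -(dE x) // => -[f|//] fs; rewrite /z /= (_ : inl f \in bits_of gl) //.
  have := hM _ fs => b; rewrite /bits_of !mem_cat; case: f b {fs} => u [] b; apply/orP; [left|right; apply/orP; left];
    by apply: map_f; rewrite mem_boxl; move: b; rewrite /box /edge_src /L' /=; clear; lia.
have [vs0 hvs] : {vs : conf -> seq vertex & forall x, E x -> [/\ size (vs x) = k, uniq (vs x),
   forall v, v \in vs x -> box N v,
   forall u v, u \in vs x -> v \in vs x -> con (oadj x) (fun=> True) u v -> u = v &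
   forall (Q : vertex -> Prop) u, con nn Q origin u -> N <= nrm u ->
     forall v, v \in vs x -> exists2 a, Q a & con (oadj x) (fun=> True) v a]}.
  apply: (@choice _ _ (fun x vs => E x -> [/\ size vs = k, uniq vs, forall v, v \in vs -> box N v,
   forall u v, u \in vs -> v \in vs -> con (oadj x) (fun=> True) u v -> u = v &
   forall (Q : vertex -> Prop) u, con nn Q origin u -> N <= nrm u ->
     forall v, v \in vs -> exists2 a, Q a & con (oadj x) (fun=> True) v a])) => x.
  by have [/hE[vs h]|nE] := pselect (E x); [exists vs|exists [::]].
pose vs x := vs0 (cut x); pose gin := fun z => z \in gl.
pose A (x : conf) := E x /\ forall v, v \in vs x -> blackG kv gin x v.
have dE' : dep (fun i => i \in bits_of gl) E.
  have K x y : (forall i, i \in bits_of gl -> x i = y i) -> E x -> E y.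
    move=> xy /Ecut; rewrite (cutE _ _ xy); move: y {xy} => y Ey.
    pose z : conf := fun i => if i is inl _ then cut y i else y i.
    have Ez : E z by apply: e1 Ey => f.
    rewrite (dE y z) // => -[f|//] fs; rewrite /z /= (_ : inl f \in bits_of gl) //.
    have := hM _ fs => b; rewrite /bits_of !mem_cat; case: f b {fs} => u [] b; apply/orP; [left|right; apply/orP; left];
      by apply: map_f; rewrite mem_boxl; move: b; rewrite /box /edge_src /L' /=; clear; lia.
  by move=> x y xy; apply/propext; split; apply: K => // i /xy.
have dA : dep (fun i => i \in bits_of gl) A.
  move=> x y xy; rewrite /A (dE' _ _ xy) /vs (cutE _ _ xy); congr (_ /\ _).
  exact: (@blackG_depP gl (fun S => forall v, v \in vs0 (cut y) -> S v) _ _ xy).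
pose bx w := bits W (thr 2^-1 r) w.
have mA : measurable [set w | A (bx w)] by apply: (@meas_loc _ _ _ _ _ hW (thr 2^-1 r) A (bits_of gl)).
have PA : Pr P [set w | A (bx w)] <= r ^+ k.
  rewrite (@Pr_Ex _ _ _ _ _ hW _ pq A (bits_of gl) x0) //; last exact: bits_of_uniq.
  rewrite (@Ex_ext _ _ _ _ _ (fun y => ind (E y) * ind (forall v, v \in vs y -> blackG kv gin y v))); last first.
    by move=> y; rewrite /A ind_and.
  rewrite (@black_many R (thr 2^-1 r) r gl (fun=> erefl) ugl k) //.
  - case/andP: hr => r0 _; apply: ler_piMr; first exact: exprn_ge0.
    by apply: Ex_le1 => // y; exact: ind_le1.
  - move=> y z yz; split; first by apply: ind_iff; split; apply: e1.
    rewrite /vs (_ : cut y = cut z) //; apply/funext => -[f|//] /=; by rewrite yz.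
  - move=> y Ey; have {}Ey : E y by apply: contrapT => nE; move: Ey; rewrite indF // eqxx.
    have [h1 h2 h3 h4 _] := hvs _ (Ecut _ Ey); split=> //; first by move=> v /h3/Ng.
    move=> u v uv vv c; apply: h4 => //; apply: (con_sub (S := gin)) => //.
    apply: con_dep_e c => f f1 f2; rewrite /cut /= (_ : inl f \in bits_of gl) //.
    exact: gbit_bits.
have mE : measurable [set w | ~ E (b2 w)] := edge_event_meas (@thr2 R) (edge_event_not eE).
have mU := meas_unstable hW 2^-1 r N L%:Z.
have mUA : measurable (unstable W 2^-1 r N L%:Z `|` [set w | A (bx w)]) by exact: measurableU.
have PU := hL L (leqnn L).
apply: (@le_trans _ _ (Pr P ([set w | ~ E (b2 w)] `|` (unstable W 2^-1 r N L%:Z `|` [set w | A (bx w)])))); last first.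
  apply: le_trans (Pr_sub2 P mE mUA) _; have := Pr_sub2 P mU mA.
  by move: PE PU PA; move: (Pr _ _) (Pr _ _) (Pr _ _) (Pr _ _) => a b c f; lra.
apply: Pr_mono; [exact: (meas_event hW _ _ (rad_loc N0))|exact: measurableU|].
move=> w [u [nu c]]; have [Ew|nE] := pselect (E (b2 w)); last by left.
have [Uw|nU] := pselect (unstable W 2^-1 r N L%:Z w); first by right; left.
right; right; have Ex : E (bx w) by apply/(edge_event_thr eE).
have [_ _ h3 _ h5] := hvs _ (Ecut _ Ex); split=> // v vv.
have Lg z : box L%:Z z -> gin z by rewrite /gin mem_boxl /box /L'; clear; lia.
apply/(stable_blk nU Lg); first exact: h3.
have [a Qa va] := h5 _ _ c nu v vv.
apply: (blackG_con _ Qa); apply: (con_sym (@oadj_sym _)).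
by apply: con_adj va => y y' [f [fj xf]]; exists f; split=> //; exact: cut_le.
Qed.

(** A black origin makes its whole open cluster black, and its colour is independent of the edges by
    [black_edges]. *)
Lemma rad_reach p (k : nat) : 0 <= p <= 1 -> r * theta P W p k%:Z <= prc P (blk W p r) (rad k%:Z).
Proof.
move=> hp; have pq : probs (thr p r) := probs_thr hp hr.
have k0 : 0 <= k%:Z by [].
rewrite -(Pr_reach hW pq (fun=> erefl) origin k0).
rewrite -(@black_edges _ _ _ _ _ hW p r hp hr (reach origin k%:Z) (bits_of (boxl (k%:Z + nrm origin))) origin).
- apply: Pr_mono; [by apply: meas_and; [exact: (meas_reach hW)|exact: (meas_blk hW)]|
    exact: (meas_event hW _ _ (rad_loc k0))|move=> w [[v [nv c]] b0]].
  exists v; split; first by move: nv; rewrite sub_origin.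
  move: v c {nv}; apply: con_ind; first exact: con_refl.
  move=> v u c0 c [f [fj xf]] _; apply: (con_step c (edge_joins_nn fj)).
  apply: (blackG_con _ (con_r c)); apply: (@con_step _ _ _ v) => //; first exact: con_refl.
  by exists f.
- by move=> x y xy; exact: reach_ext.
- exact: reach_dep.
- by apply: bits_of_uniq; exact: boxl_uniq.
Qed.

Lemma Theta_half : r < 1 -> Theta W P 2^-1 r = 0%E.
Proof.
move=> r1; case/andP: hr => r0 _; apply: (Theta_eq0 hW) => e e0; have e2 : 0 < e / 2 by rewrite divr_gt0.
have [k hk] := @pow_small R (1 - r) (e / 2) ltac:(apply/andP; split; lra) e2.
rewrite (_ : 1 - (1 - r) = r) in hk; last by lra.
pose c : R := (2 * k)%:R + 1; have c0 : 0 < c by rewrite /c ltr_wpDl // ler0n.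
have [N hN] := rad_le_rings k (divr_gt0 e2 c0); exists N; apply: le_trans hN _.
by rewrite -/c mulrC divfK ?gt_eqF //; lra.
Qed.

Lemma mean_half : 0 < r -> (\int[P]_w Defs.card0 W 2^-1 r w)%E = +oo%E.
Proof.
(* The constant comes from n [theta](2n) >= n / (4n + 2) >= 1/6 for n >= 1. *)
move=> r0; apply: (mean_infinite hW (c := r / 6) (n0 := 1)); first by rewrite divr_gt0.
move=> n n1; have h1 := rad_reach (2 * n) p2_01; have h2 := theta_half_lower hW (2 * n).
have n1' : 1 <= n%:R :> R by rewrite ler1n.
have e4 : (2 * (2 * n).+1 = 4 * n + 2)%N by lia.
have h3 : (2 * (2 * n).+1)%:R = 4 * n%:R + 2 :> R by rewrite e4 natrD natrM.
rewrite h3 in h2; move: h1 h2; move: (theta _ _ _ _) (prc _ _ _) => t q h1 h2.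
have t0 : 0 <= t by rewrite leNgt; apply/negP => t0; nra.
have h4 : 6^-1 <= n%:R * t by nra.
by rewrite mulrC; have := ler_wpM2l (ltW r0) h4; nra.
Qed.

End Rings.

Theorem mainTheorem3 (R : realType) (d : measure_display) (Omega : measurableType d)
  (P : probability Omega R) (W : rindex -> Omega -> R) :
  iid_uniform P W ->
  (forall p : R, 0 <= p < 1 / 2 -> critical W P p (r_c W P p)) /\
  (forall r : R, 0 < r < 1 -> critical W P (1 / 2) r) /\
  (forall p : R, 1 / 2 < p <= 1 -> forall r : R, 0 < r <= 1 -> (0 < Theta W P p r)%E).
Proof.
move=> hW; rewrite !div1r; split; [|split].
- by move=> p hp; exact: subcritical_critical.
- move=> r /andP[r0 r1]; have hr : 0 <= r <= 1 by rewrite !ltW.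
  by split; [exact: Theta_half|exact: mean_half].
move=> p hp r /andP[r0 r1]; have hr : 0 <= r <= 1 by rewrite r1 ltW.
have [c c0 hc] := theta_supercritical hW hp.
have p01 : 0 <= p <= 1 by case/andP: hp => h1 ->; rewrite andbT; lra.
apply: (@lt_le_trans _ _ (r * c)%:E); first by rewrite lte_fin mulr_gt0.
apply: (Theta_ge hW) => N; apply: le_trans (rad_reach hW hr N p01).
by rewrite ler_pM2l //; exact: hc.
Qed.
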